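(* For $n=1,2,\dots$ and $0\le\tau<2$ the following hold: (i) $\alpha_n(0)=n\,\xi'(0)/\xi(0)<0$; (ii) there exists a sequence $1/2=a_1>a_2>a_3>\cdots$ such that $\alpha_n(a_n)=0$ and $\alpha_n(\tau)<0$ for $\tau<a_n$; (iii) between any two real zeros of $\alpha_n(\tau)$ there exists at least one real zero of $\alpha_{n+1}(\tau)$; (iv) for every positive integer $N$ there exists a positive integer $n_0$ such that for all $n>n_0$ the function $\alpha_n(\tau)$ has at least $N$ zeros in the interval $(0,2)$.
   Context: $\zeta$ is the Riemann zeta function and $\xi(s)=s(s-1)\pi^{-s/2}\Gamma(s/2)\zeta(s)$, an entire function satisfying $\xi(s)=\xi(1-s)$, which is real and positive on the real axis. For real $\tau\ge 0$ and $n=0,1,2,\dots$ define $$\alpha_{n+1}(\tau)=\frac{1}{n!}\,\frac{d^{n+1}}{ds^{n+1}}\Big[s^{n}\log \xi(s)\Big]\Big|_{s=\tau}.$$ *)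

(* Defs.v *)
(* Stdlib reals with Coquelicot. *)
From Stdlib Require Export Reals Factorial List.
From Stdlib Require Import ClassicalEpsilon.
From Coquelicot Require Export Coquelicot.

Open Scope R_scope.

Definition Cexp (z : C) : C :=
  (exp (Re z) * cos (Im z), exp (Re z) * sin (Im z)).

(* [x ^ s] for a positive real base [x] and a complex exponent [s]. *)
Definition Rpow (x : R) (s : C) : C := Cexp (s * RtoC (ln x))%C.

(* Dirichlet series and Euler integral; they are the Riemann zeta function for
   [1 < Re s] and the Gamma function for [0 < Re s], and are only used there. *)
Definition zeta (s : C) : C :=
  (Series (fun k => Re (Rpow (INR (S k)) (- s)%C)),
   Series (fun k => Im (Rpow (INR (S k)) (- s)%C))).

Definition Gamma (s : C) : C :=
  RInt_gen (V := C_R_CompleteNormedModule)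
    (fun t => (Rpow t (s - RtoC 1) * RtoC (exp (- t)))%C)
    (at_right 0) (Rbar_locally p_infty).

Definition entire (f : C -> C) : Prop :=
  forall z : C, ex_derive (K := C_AbsRing) (V := C_NormedModule) f z.

(* An entire function is determined by its values on [1 < Re s], so at most one
   function satisfies this predicate. Outside that half-plane (in particular at
   the removable singularities 0, 1, -2, -4, ... of the product) its values are
   those of the analytic continuation. *)
Definition is_xi (f : C -> C) : Prop :=
  entire f /\
  forall s : C, 1 < Re s ->
    f s = (s * (s - RtoC 1) * Rpow PI (- (s / RtoC 2))
             * Gamma (s / RtoC 2) * zeta s)%C.

Definition xi : C -> C := epsilon (inhabits (fun _ : C => RtoC 0)) is_xi.

(* [xi] is real on the real axis; this is its restriction as a real function. *)
Definition xiR (x : R) : R := Re (xi (RtoC x)).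

(* Only meaningful for [1 <= n]. As [xi] is positive on the real axis, [ln] is
   the real branch of its logarithm, and the derivatives at a real point may be
   taken along the real axis. *)
Definition alpha (n : nat) (tau : R) : R :=
  / INR (fact (n - 1)) *
  Derive_n (fun s => s ^ (n - 1) * ln (xiR s)) n tau.

(* Main.v *)
(* Write xi (x + 1/2) = sum e_n x^n. The e_n vanish for odd n and are nonnegative, being
   differences of moments of the theta kernel. The recurrence
   n alpha_(n+1) = s alpha_n' + (n + 1) alpha_n says that s^(n+1) alpha_n has the derivative
   n s^n alpha_(n+1), and it vanishes at 0, so Rolle's theorem gives (ii) and (iii).
   If the number of zeros of alpha_n in (0, 1] were bounded, alpha_n tau would have a constant
   sign for some tau in (0, 1) and all large n. The numbers tau alpha_(n+1) tau are the Taylor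
   coefficients of d/dz log xi (tau / (1 - z)), so by Pringsheim's argument this series would
   converge in the unit disc, and with the symmetry s -> 1 - s, xi would have no zeros at all.
   Then the integral of log |xi (1/2 + r e^(i y))| (1 + cos (2 y)) over the circle would grow
   like pi (e_2 / e_0) r^2, whereas log xi (1/2 + r) = O(r log r). *)

Require Import Defs.
From Stdlib Require Import Reals List.
From Stdlib Require Import ZArith Znumtheory Lra Lia Wf_nat.
From Stdlib Require Import FunctionalExtensionality ClassicalEpsilon Classical.
From Coquelicot Require Import Coquelicot.
Open Scope R_scope.

(* Coquelicot's canonical structures leave the carrier of an equation in a form that [ring] does not recognize. *)
Ltac eqR := match goal with |- @eq _ ?x ?y => change (@eq R x y) end.

(** Since [xi] is selected by [epsilon] from [is_xi], nothing is known about it until an entire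
    function with the prescribed values on [1 < Re s] is constructed and shown to be the only one.
    The construction is Riemann's (theta functional equation, Mellin transform, even kernel); it
    yields an everywhere convergent power series with real coefficients, which is studied from then
    on. Complex integration is limited to Goursat's theorem on rectangles and the mean value
    property. This shapes the end of the proof: bounds for Taylor coefficients come from absolute
    convergence, not from Cauchy's formula, and zero-freeness is refuted without product expansions.
    The weight 1 + cos (2 y) is nonnegative, so an upper bound for log |xi| suffices, and it
    extracts the quadratic coefficient of log xi, nonzero because e_2 > 0. Growth of order r^(3/2)
    is already small enough. Zeros are counted in (0, 1], although (0, 2) is asked for: tau / (1 -
    z) maps the unit disc onto Re s > tau / 2, which contains Re s >= 1/2 when tau < 1. *)

(** * Real series: comparison, tails and dominated convergence *)

Lemma is_lim_seq_sum (g : nat -> nat -> R) (G : nat -> R) (K : nat) :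
  (forall k, is_lim_seq (fun N => g N k) (G k)) ->
  is_lim_seq (fun N => sum_f_R0 (g N) K) (sum_f_R0 G K).
Proof.
intros H; induction K as [|K IH]; simpl; [apply H|].
apply is_lim_seq_plus'; auto.
Qed.

Lemma ex_series_dom (a b : nat -> R) :
  (forall n, Rabs (a n) <= b n) -> ex_series b -> ex_series a.
Proof.
intros H Hb; apply (ex_series_le a b); auto.
Qed.

Lemma Series_abs_le (a b : nat -> R) :
  (forall n, Rabs (a n) <= b n) -> ex_series b -> Rabs (Series a) <= Series b.
Proof.
intros H Hb.
assert (Ha : ex_series (fun n => Rabs (a n))).
{ apply (ex_series_dom _ b); auto. intros n; rewrite Rabs_Rabsolu; auto. }
apply Rle_trans with (Series (fun n => Rabs (a n))).
- now apply Series_Rabs.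
- apply Series_le; auto. intros n; split; auto. apply Rabs_pos.
Qed.

Lemma Series_nonneg (a : nat -> R) :
  (forall n, 0 <= a n) -> ex_series a -> 0 <= Series a.
Proof.
intros H Ha. apply Rle_trans with (Rabs (Series (fun _ => 0))).
apply Rabs_pos. apply Series_abs_le; auto. intros n; rewrite Rabs_R0; auto.
Qed.

Lemma Series_tail_small (b : nat -> R) (eps : R) :
  ex_series b -> 0 < eps -> exists K, Rabs (Series (fun k => b (S K + k)%nat)) < eps.
Proof.
intros Hb He.
assert (Hs : is_lim_seq (sum_n b) (Series b)) by exact (Series_correct _ Hb).
apply is_lim_seq_spec in Hs. destruct (Hs (mkposreal eps He)) as [K HK].
exists K. specialize (HK K (Nat.le_refl K)); simpl in HK.
rewrite (Series_incr_n b (S K)) in HK; [|lia|auto].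
rewrite sum_n_Reals in HK. simpl pred in HK.
rewrite <- Rabs_Ropp. eapply Rle_lt_trans; [|apply HK].
apply Req_le. f_equal. ring.
Qed.

Lemma is_series_finite (a : nat -> R) N :
  (forall n, (N < n)%nat -> a n = 0) -> is_series a (sum_f_R0 a N).
Proof.
intros H.
assert (L : is_lim_seq (sum_n a) (sum_f_R0 a N)); [|exact L].
apply is_lim_seq_ext_loc with (fun _ => sum_f_R0 a N); [|apply is_lim_seq_const].
exists N. intros n Hn. rewrite sum_n_Reals. induction Hn as [|n Hn IH]; auto.
rewrite tech5, <- IH, H by lia. ring.
Qed.

Lemma Series_finite (a : nat -> R) N : (forall n, (N < n)%nat -> a n = 0) -> Series a = sum_f_R0 a N.
Proof. intros H. apply is_series_unique. now apply is_series_finite. Qed.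

(** Dominated convergence for series. The limit [G] inherits the bound [b], so beyond a common [K]
    both series have tails below the tail of [b], and the finite heads converge termwise. The
    domination is required only eventually, which is how it is available for the theta sums. *)
Theorem tannery (g : nat -> nat -> R) (G b : nat -> R) :
  (forall k, is_lim_seq (fun N => g N k) (G k)) ->
  ex_series b ->
  eventually (fun N => forall k, Rabs (g N k) <= b k) ->
  is_lim_seq (fun N => Series (g N)) (Series G).
Proof.
intros Hg Hb [N0 HN0].
assert (HG : forall k, Rabs (G k) <= b k).
{ intros k.
  assert (HA := is_lim_seq_abs _ _ (Hg k)). simpl in HA.
  refine (is_lim_seq_le_loc _ _ (Rabs (G k)) (b k) _ HA (is_lim_seq_const _)).
  exists N0; intros N HN; auto. }
assert (ExG : ex_series G) by (apply (ex_series_dom _ b); auto).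
assert (Exg : forall N, (N0 <= N)%nat -> ex_series (g N)).
{ intros N HN. apply (ex_series_dom _ b); auto. }
apply is_lim_seq_spec. intros eps.
assert (He3 : 0 < eps / 3) by (destruct eps; simpl; lra).
destruct (Series_tail_small b _ Hb He3) as [K HK].
assert (HS := is_lim_seq_sum g G K Hg).
apply is_lim_seq_spec in HS. destruct (HS (mkposreal _ He3)) as [N1 HN1].
exists (max N0 N1). intros N HN.
assert (HNa : (N0 <= N)%nat) by lia.
assert (HNb : (N1 <= N)%nat) by lia.
specialize (HN1 N HNb). simpl in HN1.
rewrite (Series_incr_n (g N) (S K)); [|lia|auto].
rewrite (Series_incr_n G (S K)); [|lia|auto].
simpl pred.
assert (Hbt : ex_series (fun k => b (S K + k)%nat)) by now apply ex_series_incr_n.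
assert (T1 : Rabs (Series (fun k => g N (S K + k)%nat)) <= Series (fun k => b (S K + k)%nat)).
{ apply Series_abs_le; auto. }
assert (T2 : Rabs (Series (fun k => G (S K + k)%nat)) <= Series (fun k => b (S K + k)%nat)).
{ apply Series_abs_le; auto. }
revert HN1 HK T1 T2.
generalize (Series (fun k => b (S K + k)%nat)) (Series (fun k => g N (S K + k)%nat))
  (Series (fun k => G (S K + k)%nat)) (sum_f_R0 (g N) K) (sum_f_R0 G K).
intros x y z u v. unfold Rabs; repeat destruct Rcase_abs; lra.
Qed.

Lemma ex_series_scalR (c : R) (a : nat -> R) :
  ex_series a -> ex_series (fun n => c * a n).
Proof. intros H; exact (ex_series_scal_l c a H). Qed.

(** * Complex series *)

(** Componentwise summation makes [zeta s] convertible to a [CSeries]. *)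
Definition CSeries (f : nat -> C) : C :=
  (Series (fun n => Re (f n)), Series (fun n => Im (f n))).

Definition cabs (f : nat -> C) := ex_series (fun n => Cmod (f n)).

Lemma im_le_Cmod (c : C) : Rabs (Im c) <= Cmod c.
Proof.
eapply Rle_trans; [|apply Rmax_Cmod]. apply Rmax_r.
Qed.

Lemma Cmod_le_abs (c : C) : Cmod c <= Rabs (Re c) + Rabs (Im c).
Proof.
assert (E : c = (RtoC (Re c) + Ci * RtoC (Im c))%C)
 by (destruct c; unfold Cplus, Cmult, RtoC, Ci, Re, Im; simpl; f_equal; ring).
rewrite E at 1. eapply Rle_trans; [apply Cmod_triangle|].
rewrite Cmod_mult, Cmod_Ci, !Cmod_R. lra.
Qed.

Lemma cabs_re f : cabs f -> ex_series (fun n => Re (f n)).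
Proof. intros H; apply (ex_series_dom _ _ (fun n => re_le_Cmod (f n)) H). Qed.

Lemma cabs_im f : cabs f -> ex_series (fun n => Im (f n)).
Proof. intros H; apply (ex_series_dom _ _ (fun n => im_le_Cmod (f n)) H). Qed.

Lemma cabs_dom f (b : nat -> R) : (forall n, Cmod (f n) <= b n) -> ex_series b -> cabs f.
Proof.
intros H Hb; apply (ex_series_dom _ b); auto. intros n.
rewrite Rabs_pos_eq; [auto|apply Cmod_ge_0].
Qed.

Lemma cabs_ext f g : (forall n, f n = g n) -> cabs f -> cabs g.
Proof.
intros H; apply ex_series_ext; intros n; now rewrite H.
Qed.

Lemma CSeries_ext f g : (forall n, f n = g n) -> CSeries f = CSeries g.
Proof.
intros H; unfold CSeries; f_equal; apply Series_ext; intros n; now rewrite H.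
Qed.

Lemma cabs_plus f g : cabs f -> cabs g -> cabs (fun n => f n + g n)%C.
Proof.
intros Hf Hg. apply (cabs_dom _ (fun n => Cmod (f n) + Cmod (g n))).
- intros n; apply Cmod_triangle.
- exact (ex_series_plus _ _ Hf Hg).
Qed.

Lemma cabs_scal c f : cabs f -> cabs (fun n => c * f n)%C.
Proof.
intros Hf. apply (cabs_dom _ (fun n => Cmod c * Cmod (f n))).
- intros n; rewrite Cmod_mult; lra.
- now apply ex_series_scalR.
Qed.

Lemma CSeries_plus f g : cabs f -> cabs g ->
  CSeries (fun n => f n + g n)%C = (CSeries f + CSeries g)%C.
Proof.
intros Hf Hg. unfold CSeries, Cplus; simpl. f_equal.
- rewrite <- Series_plus; auto using cabs_re.
- rewrite <- Series_plus; auto using cabs_im.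
Qed.

Lemma CSeries_scal c f : cabs f ->
  CSeries (fun n => c * f n)%C = (c * CSeries f)%C.
Proof.
intros Hf. unfold CSeries, Cmult; simpl.
pose proof (cabs_re f Hf) as H1. pose proof (cabs_im f Hf) as H2.
assert (E : forall x a, ex_series a -> ex_series (fun n => x * a n)).
{ intros x a Ha. now apply ex_series_scalR. }
f_equal.
- rewrite <- !Series_scal_l, <- Series_minus; auto.
- rewrite <- !Series_scal_l, <- Series_plus; auto.
Qed.

Lemma CSeries_minus f g : cabs f -> cabs g ->
  CSeries (fun n => f n - g n)%C = (CSeries f - CSeries g)%C.
Proof.
intros Hf Hg.
rewrite (CSeries_ext _ (fun n => f n + (-(1)) * g n)%C) by (intros; ring).
rewrite CSeries_plus; auto using cabs_scal. rewrite CSeries_scal; auto. ring.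
Qed.

Lemma cabs_minus f g : cabs f -> cabs g -> cabs (fun n => f n - g n)%C.
Proof.
intros Hf Hg. apply (cabs_ext (fun n => f n + (-(1)) * g n)%C); [intros; ring|].
auto using cabs_plus, cabs_scal.
Qed.

(** The modulus is removed by a rotation: with z the sum, |z|^2 is the real part of the sum of
    [Cconj z * f n], a real series dominated termwise by |z| |f n|. *)
Lemma Cmod_CSeries f : cabs f -> Cmod (CSeries f) <= Series (fun n => Cmod (f n)).
Proof.
intros Hf. set (z := CSeries f).
destruct (Req_dec (Cmod z) 0) as [E|E].
{ rewrite E. apply Series_nonneg; auto. intros; apply Cmod_ge_0. }
assert (Hz : 0 < Cmod z) by (pose proof (Cmod_ge_0 z); lra).
assert (H : (Cconj z * z)%C = CSeries (fun n => Cconj z * f n)%C)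
  by (symmetry; now apply CSeries_scal).
assert (H2 : Cmod z * Cmod z <= Cmod z * Series (fun n => Cmod (f n))).
{ rewrite <- Series_scal_l.
  replace (Cmod z * Cmod z) with (Series (fun n => Re (Cconj z * f n)%C)).
  2:{ change (Series (fun n => Re (Cconj z * f n)%C)) with (fst (CSeries (fun n => Cconj z * f n)%C)).
      rewrite <- H. rewrite Cmult_comm, <- Cmod2_conj. simpl. ring. }
  eapply Rle_trans; [apply Rle_abs|]. apply Series_abs_le.
  - intros n. eapply Rle_trans; [apply re_le_Cmod|]. rewrite Cmod_mult, Cmod_conj. lra.
  - now apply ex_series_scalR. }
apply Rmult_le_reg_l with (Cmod z); auto.
Qed.

Lemma Cmod_CSeries_le f b : (forall n, Cmod (f n) <= b n) -> ex_series b ->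
  Cmod (CSeries f) <= Series b.
Proof.
intros H Hb. eapply Rle_trans; [apply Cmod_CSeries; now apply (cabs_dom f b)|].
apply Series_le; auto. intros n; split; auto. apply Cmod_ge_0.
Qed.

Definition Csum (f : nat -> C) (N : nat) : C :=
  (sum_f_R0 (fun n => Re (f n)) N, sum_f_R0 (fun n => Im (f n)) N).

Lemma Csum_S f N : Csum f (S N) = (Csum f N + f (S N))%C.
Proof. unfold Csum, Cplus; simpl. reflexivity. Qed.

Lemma Csum_0 f : Csum f 0 = f O.
Proof. unfold Csum; simpl. now destruct (f O). Qed.

Lemma Csum_ext f g N : (forall n, (n <= N)%nat -> f n = g n) -> Csum f N = Csum g N.
Proof.
intros H; unfold Csum; f_equal; apply sum_eq; intros n Hn; now rewrite H.
Qed.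

Lemma Csum_scal c f N : Csum (fun n => c * f n)%C N = (c * Csum f N)%C.
Proof.
induction N as [|N IH]; [now rewrite !Csum_0|]. rewrite !Csum_S, IH. ring.
Qed.

Lemma Cmod_Csum f N : Cmod (Csum f N) <= sum_f_R0 (fun n => Cmod (f n)) N.
Proof.
induction N as [|N IH]; [rewrite Csum_0; simpl; lra|]. rewrite Csum_S. simpl.
eapply Rle_trans; [apply Cmod_triangle|]. lra.
Qed.

(** Real and imaginary parts are combinations of four absolutely convergent real Cauchy products. *)
Lemma CSeries_mult f g : cabs f -> cabs g ->
  cabs (fun n => Csum (fun k => f k * g (n - k)%nat)%C n) /\
  CSeries (fun n => Csum (fun k => f k * g (n - k)%nat)%C n) = (CSeries f * CSeries g)%C.
Proof.
intros Hf Hg.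
assert (AR : forall f, cabs f -> ex_series (fun n => Rabs (Re (f n)))).
{ intros h Hh. apply (ex_series_dom _ (fun n => Cmod (h n))); auto.
  intros n; rewrite Rabs_Rabsolu; apply re_le_Cmod. }
assert (AI : forall f, cabs f -> ex_series (fun n => Rabs (Im (f n)))).
{ intros h Hh. apply (ex_series_dom _ (fun n => Cmod (h n))); auto.
  intros n; rewrite Rabs_Rabsolu; apply im_le_Cmod. }
split.
- eapply cabs_dom; [intros n; apply Cmod_Csum|].
  assert (AC : forall f, cabs f -> ex_series (fun n => Rabs (Cmod (f n)))).
  { intros h Hh. apply (ex_series_dom _ (fun n => Cmod (h n))); auto.
    intros n; rewrite !Rabs_Rabsolu, Rabs_pos_eq; [lra|apply Cmod_ge_0]. }
  exists (Series (fun n => Cmod (f n)) * Series (fun n => Cmod (g n))).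
  eapply is_series_ext; [|apply (is_series_mult _ _ _ _ (Series_correct _ Hf) (Series_correct _ Hg)); now apply AC].
  intros n; simpl. apply sum_eq; intros k _. now rewrite Cmod_mult.
- pose proof (is_series_mult _ _ _ _ (Series_correct _ (cabs_re f Hf)) (Series_correct _ (cabs_re g Hg)) (AR _ Hf) (AR _ Hg)) as RR.
  pose proof (is_series_mult _ _ _ _ (Series_correct _ (cabs_im f Hf)) (Series_correct _ (cabs_im g Hg)) (AI _ Hf) (AI _ Hg)) as II.
  pose proof (is_series_mult _ _ _ _ (Series_correct _ (cabs_re f Hf)) (Series_correct _ (cabs_im g Hg)) (AR _ Hf) (AI _ Hg)) as RI.
  pose proof (is_series_mult _ _ _ _ (Series_correct _ (cabs_im f Hf)) (Series_correct _ (cabs_re g Hg)) (AI _ Hf) (AR _ Hg)) as IR.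
  unfold CSeries, Cmult at 3; simpl. f_equal.
  + apply is_series_unique. eapply is_series_ext; [|apply (is_series_minus _ _ _ _ RR II)].
    intros n; simpl. unfold minus, plus, opp; simpl. rewrite <- Rminus_def, <- minus_sum. reflexivity.
  + apply is_series_unique. eapply is_series_ext; [|apply (is_series_plus _ _ _ _ RI IR)].
    intros n; simpl. unfold plus; simpl. rewrite <- plus_sum. reflexivity.
Qed.

(** * Complex power series with real coefficients *)

Definition absconv (a : nat -> R) (r : R) := ex_series (fun n => Rabs (a n) * r ^ n).
Definition CP (a : nat -> R) (z : C) : C := CSeries (fun n => RtoC (a n) * z ^ n)%C.

Lemma absconv_le a r r' : 0 <= r' <= r -> absconv a r -> absconv a r'.
Proof.
intros Hr H. apply (ex_series_dom _ (fun n => Rabs (a n) * r ^ n)); auto.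
intros n. rewrite Rabs_pos_eq.
- apply Rmult_le_compat_l; [apply Rabs_pos|]. now apply pow_incr.
- apply Rmult_le_pos; [apply Rabs_pos|]. apply pow_le; lra.
Qed.

Lemma Cmod_term (a : R) z n : Cmod (RtoC a * z ^ n)%C = Rabs a * Cmod z ^ n.
Proof. now rewrite Cmod_mult, Cmod_R, Cmod_pow. Qed.

Lemma cabs_CP a z r : absconv a r -> Cmod z <= r -> cabs (fun n => RtoC (a n) * z ^ n)%C.
Proof.
intros H Hz. eapply ex_series_ext; [intros n; symmetry; apply Cmod_term|].
apply (absconv_le a r); auto. split; [apply Cmod_ge_0|auto].
Qed.

Lemma CP_real a x : CP a (RtoC x) = RtoC (PSeries a x).
Proof.
change (RtoC (PSeries a x)) with (PSeries a x, 0). unfold CP, CSeries. f_equal.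
- apply Series_ext; intros n. rewrite <- RtoC_pow, <- RtoC_mult. reflexivity.
- rewrite (Series_ext _ (fun n => 0 * 0)).
  + rewrite Series_scal_l. ring.
  + intros n. rewrite <- RtoC_pow, <- RtoC_mult. simpl. ring.
Qed.

Lemma CP_mult a b z r : absconv a r -> absconv b r -> Cmod z <= r ->
  CP (PS_mult a b) z = (CP a z * CP b z)%C.
Proof.
intros Ha Hb Hz. unfold CP.
destruct (CSeries_mult _ _ (cabs_CP a z r Ha Hz) (cabs_CP b z r Hb Hz)) as [_ <-].
apply CSeries_ext; intros n.
rewrite (Csum_ext _ (fun k => z ^ n * RtoC (a k * b (n - k)%nat))%C).
- rewrite Csum_scal, Cmult_comm. f_equal.
  unfold Csum, PS_mult, RtoC. simpl. f_equal.
  rewrite sum_cte. ring.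
- intros k Hk. rewrite RtoC_mult. replace (z ^ n)%C with (z ^ k * z ^ (n - k))%C.
  + ring.
  + rewrite <- Cpow_add_r. f_equal. lia.
Qed.

Lemma absconv_mult a b r : 0 <= r -> absconv a r -> absconv b r -> absconv (PS_mult a b) r.
Proof.
intros Hr Ha Hb.
assert (Hz : Cmod (RtoC r) <= r) by (rewrite Cmod_R, Rabs_pos_eq; lra).
destruct (CSeries_mult _ _ (cabs_CP a _ r Ha Hz) (cabs_CP b _ r Hb Hz)) as [H _].
eapply ex_series_ext; [|exact H]. intros n; simpl.
rewrite (Csum_ext _ (fun k => RtoC r ^ n * RtoC (a k * b (n - k)%nat))%C).
- rewrite Csum_scal, Cmod_mult, Cmod_pow, Cmod_R, (Rabs_pos_eq r Hr), Rmult_comm. f_equal.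
  replace (Csum (fun k => RtoC (a k * b (n - k)%nat)) n) with (RtoC (PS_mult a b n)).
  + now rewrite Cmod_R.
  + unfold Csum, PS_mult, RtoC; simpl. f_equal.
    rewrite sum_cte; ring.
- intros k Hk. rewrite RtoC_mult. replace (RtoC r ^ n)%C with (RtoC r ^ k * RtoC r ^ (n - k))%C.
  + ring.
  + rewrite <- Cpow_add_r. f_equal. lia.
Qed.

(** * Complex differentiability *)

(** The derivative stays visible and the remainder is compared with [eps * Cmod h], which avoids
    quotients. [cdiff_ex_derive] gives the equivalence with the differentiability used in
    [entire]. *)
Definition cdiff (f : C -> C) (z l : C) : Prop :=
  forall eps, 0 < eps -> exists d, 0 < d /\ forall h, Cmod h < d ->
    Cmod (f (z + h) - f z - l * h)%C <= eps * Cmod h.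

Definition ccont (f : C -> C) (z : C) : Prop :=
  forall eps, 0 < eps -> exists d, 0 < d /\ forall h, Cmod h < d ->
    Cmod (f (z + h) - f z)%C < eps.

Lemma cdiff_ccont f z l : cdiff f z l -> ccont f z.
Proof.
intros H eps He. destruct (H 1 Rlt_0_1) as [d [Hd H1]].
pose proof (Cmod_ge_0 l) as Hl.
exists (Rmin d (eps / (Cmod l + 2))). split.
{ apply Rmin_pos; auto. apply Rdiv_lt_0_compat; lra. }
intros h Hh. assert (Hh1 := Rlt_le_trans _ _ _ Hh (Rmin_l _ _)).
assert (Hh2 := Rlt_le_trans _ _ _ Hh (Rmin_r _ _)).
specialize (H1 h Hh1).
replace (f (z + h) - f z)%C with ((f (z + h) - f z - l * h) + l * h)%C by ring.
eapply Rle_lt_trans; [apply Cmod_triangle|]. rewrite Cmod_mult.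
apply Rle_lt_trans with ((Cmod l + 1) * Cmod h); [lra|].
apply Rle_lt_trans with ((Cmod l + 1) * (eps / (Cmod l + 2))).
- apply Rmult_le_compat_l; lra.
- apply Rmult_lt_reg_r with (Cmod l + 2); [lra|].
  replace ((Cmod l + 1) * (eps / (Cmod l + 2)) * (Cmod l + 2)) with ((Cmod l + 1) * eps)
   by (field; lra). nra.
Qed.

Lemma cdiff_ext f g z l : (forall z, f z = g z) -> cdiff f z l -> cdiff g z l.
Proof.
intros E H eps He. destruct (H eps He) as [d [Hd Hh]]. exists d; split; auto.
intros h; rewrite <- !E; auto.
Qed.

Lemma cdiff_const c z : cdiff (fun _ => c) z 0.
Proof.
intros eps He. exists 1; split; [lra|]. intros h _.
replace (c - c - 0 * h)%C with (RtoC 0) by ring. rewrite Cmod_0.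
apply Rmult_le_pos; [lra|apply Cmod_ge_0].
Qed.

Lemma cdiff_id z : cdiff (fun z => z) z 1.
Proof.
intros eps He. exists 1; split; [lra|]. intros h _.
replace (z + h - z - 1 * h)%C with (RtoC 0) by ring. rewrite Cmod_0.
apply Rmult_le_pos; [lra|apply Cmod_ge_0].
Qed.

Lemma cdiff_plus f g z l m : cdiff f z l -> cdiff g z m ->
  cdiff (fun z => f z + g z)%C z (l + m)%C.
Proof.
intros Hf Hg eps He.
destruct (Hf (eps / 2)) as [d1 [Hd1 H1]]; [lra|].
destruct (Hg (eps / 2)) as [d2 [Hd2 H2]]; [lra|].
exists (Rmin d1 d2); split; [now apply Rmin_pos|]. intros h Hh.
specialize (H1 h (Rlt_le_trans _ _ _ Hh (Rmin_l _ _))).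
specialize (H2 h (Rlt_le_trans _ _ _ Hh (Rmin_r _ _))).
replace (f (z + h) + g (z + h) - (f z + g z) - (l + m) * h)%C with
 ((f (z + h) - f z - l * h) + (g (z + h) - g z - m * h))%C by ring.
eapply Rle_trans; [apply Cmod_triangle|]. lra.
Qed.

Lemma cdiff_comp f g z l m : cdiff g z m -> cdiff f (g z) l ->
  cdiff (fun z => f (g z)) z (l * m)%C.
Proof.
intros Hg Hf eps He.
pose proof (Cmod_ge_0 l) as Hl. pose proof (Cmod_ge_0 m) as Hm.
assert (Hc := cdiff_ccont _ _ _ Hg).
destruct (Hf (eps / (2 * (Cmod m + 1)))) as [d1 [Hd1 H1]].
{ apply Rdiv_lt_0_compat; lra. }
destruct (Hc d1 Hd1) as [d2 [Hd2 H2]].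
destruct (Hg (Rmin 1 (eps / (2 * (Cmod l + 1))))) as [d3 [Hd3 H3]].
{ apply Rmin_pos; [lra|]. apply Rdiv_lt_0_compat; lra. }
exists (Rmin d2 d3); split; [now apply Rmin_pos|]. intros h Hh.
specialize (H2 h (Rlt_le_trans _ _ _ Hh (Rmin_l _ _))).
specialize (H3 h (Rlt_le_trans _ _ _ Hh (Rmin_r _ _))).
set (k := (g (z + h) - g z)%C) in *.
specialize (H1 k H2).
replace (g z + k)%C with (g (z + h))%C in H1 by (unfold k; ring).
assert (Hk : Cmod k <= (Cmod m + 1) * Cmod h).
{ replace k with ((k - m * h) + m * h)%C by ring.
  eapply Rle_trans; [apply Cmod_triangle|]. rewrite Cmod_mult.
  assert (Cmod (k - m * h) <= 1 * Cmod h).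
  { eapply Rle_trans; [apply H3|]. apply Rmult_le_compat_r; [apply Cmod_ge_0|apply Rmin_l]. }
  lra. }
replace (f (g (z + h)) - f (g z) - l * m * h)%C with
  ((f (g (z + h)) - f (g z) - l * k) + l * (k - m * h))%C by ring.
eapply Rle_trans; [apply Cmod_triangle|]. rewrite (Cmod_mult l).
assert (A1 : eps / (2 * (Cmod m + 1)) * Cmod k <= eps / 2 * Cmod h).
{ apply Rle_trans with (eps / (2 * (Cmod m + 1)) * ((Cmod m + 1) * Cmod h)).
  - apply Rmult_le_compat_l; auto. apply Rlt_le, Rdiv_lt_0_compat; lra.
  - apply Req_le; field; lra. }
assert (A2 : Cmod l * Cmod (k - m * h) <= eps / 2 * Cmod h).
{ apply Rle_trans with ((Cmod l + 1) * (eps / (2 * (Cmod l + 1)) * Cmod h)).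
  - apply Rmult_le_compat; try apply Cmod_ge_0; [lra|].
    eapply Rle_trans; [apply H3|]. apply Rmult_le_compat_r; [apply Cmod_ge_0|apply Rmin_r].
  - apply Req_le; field; lra. }
lra.
Qed.

Lemma cdiff_sqr z : cdiff (fun z => z * z)%C z (z + z)%C.
Proof.
intros eps He. exists eps; split; auto. intros h Hh.
replace ((z + h) * (z + h) - z * z - (z + z) * h)%C with (h * h)%C by ring.
rewrite Cmod_mult. apply Rmult_le_compat_r; [apply Cmod_ge_0|lra].
Qed.

Lemma cdiff_scal c f z l : cdiff f z l -> cdiff (fun z => c * f z)%C z (c * l)%C.
Proof.
intros H. apply (cdiff_comp (fun w => c * w)%C f z c l H).
intros eps He. exists 1; split; [lra|]. intros h _.
replace (c * (f z + h) - c * f z - c * h)%C with (RtoC 0) by ring. rewrite Cmod_0.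
apply Rmult_le_pos; [lra|apply Cmod_ge_0].
Qed.

(** Polarization: a product is a quarter of the difference of the squares of sum and difference, so
    the rules for sums, multiples, composition and the square suffice. *)
Lemma cdiff_mult f g z l m : cdiff f z l -> cdiff g z m ->
  cdiff (fun z => f z * g z)%C z (l * g z + f z * m)%C.
Proof.
intros Hf Hg.
assert (Hs := cdiff_comp _ _ _ _ _ (cdiff_plus _ _ _ _ _ Hf Hg) (cdiff_sqr _)).
assert (Hd := cdiff_comp _ _ _ _ _ (cdiff_plus _ _ _ _ _ Hf (cdiff_scal (-(1)) _ _ _ Hg)) (cdiff_sqr _)).
set (c := (/ ((1 + 1) * (1 + 1)))%C).
assert (H := cdiff_plus _ _ _ _ _ (cdiff_scal c _ _ _ Hs) (cdiff_scal (- c) _ _ _ Hd)).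
simpl in H.
assert (H2 : (1 + 1)%C <> RtoC 0) by (rewrite <- RtoC_plus; intros E; apply RtoC_inj in E; lra).
replace (l * g z + f z * m)%C with
 (c * ((f z + g z + (f z + g z)) * (l + m)) +
  - c * ((f z + - (1) * g z + (f z + - (1) * g z)) * (l + - (1) * m)))%C
 by (unfold c; field; auto).
eapply cdiff_ext; [|exact H]. intros w; simpl. unfold c; field; auto.
Qed.

Lemma cdiff_inv (z : C) : z <> RtoC 0 -> cdiff (fun z => / z)%C z (- / (z * z))%C.
Proof.
intros Hz eps He. assert (Hp : 0 < Cmod z) by (apply (proj1 (Cmod_gt_0 z)); exact Hz).
set (d := Rmin (Cmod z / 2) (eps * Cmod z ^ 3 / 2)).
assert (Hp3 : 0 < Cmod z ^ 3) by now apply pow_lt.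
exists d; split.
{ apply Rmin_pos; [lra|]. apply Rdiv_lt_0_compat; [|lra]. now apply Rmult_lt_0_compat. }
intros h Hh.
assert (Hh1 : Cmod h < Cmod z / 2) by exact (Rlt_le_trans _ _ _ Hh (Rmin_l _ _)).
assert (Hh2 : Cmod h < eps * Cmod z ^ 3 / 2) by exact (Rlt_le_trans _ _ _ Hh (Rmin_r _ _)).
assert (Hzh : Cmod z / 2 <= Cmod (z + h)).
{ assert (Cmod z <= Cmod (z + h) + Cmod h).
  { replace z with ((z + h) + - h)%C at 1 by ring.
    eapply Rle_trans; [apply Cmod_triangle|]. rewrite Cmod_opp. lra. }
  lra. }
assert (Hn : (z + h)%C <> RtoC 0) by (apply (proj2 (Cmod_gt_0 (z + h))); lra).
replace (/ (z + h) - / z - - / (z * z) * h)%C with (h * h * / (z * z * (z + h)))%C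
 by (field; auto).
rewrite !Cmod_mult, Cmod_inv by (repeat apply Cmult_neq_0; auto).
rewrite !Cmod_mult.
replace (eps * Cmod h) with (Cmod h * eps) by ring. rewrite Rmult_assoc.
apply Rmult_le_compat_l; [apply Cmod_ge_0|].
assert (Hq : 0 < Cmod z * Cmod z * Cmod (z + h)) by (repeat apply Rmult_lt_0_compat; lra).
apply Rmult_le_reg_r with (Cmod z * Cmod z * Cmod (z + h)); auto.
rewrite Rmult_assoc, Rinv_l, Rmult_1_r by lra.
apply Rle_trans with (eps * (Cmod z * Cmod z * (Cmod z / 2))).
- simpl in Hh2. lra.
- apply Rmult_le_compat_l; [lra|]. apply Rmult_le_compat_l; [nra|auto].
Qed.

Lemma cdiff_div f g z l m : g z <> RtoC 0 -> cdiff f z l -> cdiff g z m ->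
  cdiff (fun z => f z / g z)%C z ((l * g z - f z * m) / (g z * g z))%C.
Proof.
intros Hz Hf Hg.
assert (H := cdiff_mult _ _ _ _ _ Hf (cdiff_comp _ _ _ _ _ Hg (cdiff_inv _ Hz))).
simpl in H.
replace ((l * g z - f z * m) / (g z * g z))%C with (l * / g z + f z * (- / (g z * g z) * m))%C
 by (field; auto).
exact H.
Qed.

Lemma cdiff_ex_derive (f : C -> C) (z : C) :
  ex_derive (K := C_AbsRing) (V := C_NormedModule) f z <-> exists l, cdiff f z l.
Proof.
split.
- intros [l [_ H]]. exists l. intros eps He.
  specialize (H z (fun P HP => HP) (mkposreal eps He)).
  destruct H as [d Hd]. exists d; split; [apply cond_pos|].
  intros h Hh. specialize (Hd (z + h)%C).
  assert (B : @ball (AbsRing_UniformSpace C_AbsRing) z d (z + h)%C).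
  { change (Cmod (z + h - z) < d). now replace (z + h - z)%C with h by ring. }
  specialize (Hd B). change (Cmod (f (z + h) - f z - (z + h - z) * l)%C <= eps * Cmod (z + h - z)%C) in Hd.
  replace (z + h - z)%C with h in Hd by ring.
  replace (f (z + h) - f z - l * h)%C with (f (z + h) - f z - h * l)%C by ring. exact Hd.
- intros [l H]. exists l. split.
  + apply is_linear_scal_l.
  + intros x Hx eps.
    assert (E : z = x) by (apply (is_filter_lim_locally_unique (V:=AbsRing_NormedModule C_AbsRing)); exact Hx).
    subst x. destruct (H eps (cond_pos eps)) as [d [Hd Hh]].
    exists (mkposreal d Hd). intros y Hy.
    change (Cmod (y - z) < d) in Hy.
    change (Cmod (f y - f z - (y - z) * l)%C <= eps * Cmod (y - z)%C).
    specialize (Hh _ Hy).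
    assert (E1 : forall u v : C, (v + (u - v))%C = u) by (intros; ring).
    rewrite E1 in Hh. now rewrite (Cmult_comm (y - z) l).
Qed.

Lemma pow_diff_bound z h t n : 0 < t -> Cmod h <= t ->
  Cmod ((z + h) ^ n - z ^ n)%C <= Cmod h / t * (Cmod z + t) ^ n.
Proof.
intros Ht Hh.
assert (H0 : 0 <= Cmod h / t) by (apply Rdiv_le_0_compat; [apply Cmod_ge_0|auto]).
pose proof (Cmod_ge_0 z) as Hz. pose proof (Cmod_ge_0 h) as Hh0.
induction n as [|n IH].
- simpl. replace (1 - 1)%C with (RtoC 0) by ring. rewrite Cmod_0. lra.
- replace ((z + h) ^ S n - z ^ S n)%C with (z * ((z + h) ^ n - z ^ n) + h * (z + h) ^ n)%C
   by (simpl; ring).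
  eapply Rle_trans; [apply Cmod_triangle|]. rewrite !Cmod_mult, Cmod_pow.
  assert (A : Cmod (z + h) ^ n <= (Cmod z + t) ^ n).
  { apply pow_incr. split; [apply Cmod_ge_0|]. eapply Rle_trans; [apply Cmod_triangle|]. lra. }
  assert (B : Cmod h = Cmod h / t * t) by (field; lra).
  simpl. set (q := (Cmod z + t) ^ n) in *.
  apply Rle_trans with (Cmod z * (Cmod h / t * q) + Cmod h * q).
  + apply Rplus_le_compat; apply Rmult_le_compat_l; auto.
  + rewrite B at 2. lra.
Qed.

(** The factor [(Cmod z + t) ^ n] carries no polynomial in [n], so the bound can be summed against
    coefficients that converge absolutely at radius [Cmod z + t]. This is how power series are
    differentiated term by term. *)
Lemma pow_diff2_bound z h t n : 0 < t -> Cmod h <= t ->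
  Cmod ((z + h) ^ n - z ^ n - RtoC (INR n) * z ^ pred n * h)%C
   <= (Cmod h / t) ^ 2 * (Cmod z + t) ^ n.
Proof.
intros Ht Hh.
assert (H0 : 0 <= Cmod h / t) by (apply Rdiv_le_0_compat; [apply Cmod_ge_0|auto]).
pose proof (Cmod_ge_0 z) as Hz. pose proof (Cmod_ge_0 h) as Hh0.
induction n as [|n IH].
- simpl. replace (1 - 1 - 0 * 1 * h)%C with (RtoC 0) by ring. rewrite Cmod_0. nra.
- replace ((z + h) ^ S n - z ^ S n - RtoC (INR (S n)) * z ^ pred (S n) * h)%C with
   (z * ((z + h) ^ n - z ^ n - RtoC (INR n) * z ^ pred n * h) + h * ((z + h) ^ n - z ^ n))%C.
  2:{ rewrite S_INR, RtoC_plus. simpl pred. destruct n; simpl; ring. }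
  eapply Rle_trans; [apply Cmod_triangle|]. rewrite !Cmod_mult.
  assert (A := pow_diff_bound z h t n Ht Hh).
  assert (B : Cmod h = Cmod h / t * t) by (field; lra).
  simpl ((Cmod z + t) ^ S n). set (q := (Cmod z + t) ^ n) in *.
  apply Rle_trans with (Cmod z * ((Cmod h / t) ^ 2 * q) + Cmod h * (Cmod h / t * q)).
  + apply Rplus_le_compat; apply Rmult_le_compat_l; auto.
  + rewrite B at 2. nra.
Qed.

(** The loss of radius pays for the factor [n]: [(m + 1) r^m (R - r) <= R^(m+1)]. *)
Lemma absconv_derive a r R : 0 <= r < R -> absconv a R -> absconv (PS_derive a) r.
Proof.
intros Hr H.
assert (H1 : ex_series (fun n => / (R - r) * (Rabs (a (S n)) * R ^ (S n)))).
{ apply ex_series_scalR. now apply (ex_series_incr_1 (fun n => Rabs (a n) * R ^ n)). }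
refine (ex_series_dom _ _ _ H1). intros n.
assert (Hp : 0 <= r ^ n) by (apply pow_le; lra).
rewrite Rabs_pos_eq by (apply Rmult_le_pos; [apply Rabs_pos|auto]).
unfold PS_derive. rewrite Rabs_mult, (Rabs_pos_eq (INR _)) by apply pos_INR.
assert (K : forall m, INR (S m) * r ^ m * (R - r) <= R ^ S m).
{ induction m as [|m IH]; [simpl; lra|].
  rewrite S_INR.
  assert (r ^ S m <= R ^ S m) by (apply pow_incr; lra).
  change (R ^ S (S m)) with (R * R ^ S m). change (r ^ S m) with (r * r ^ m) in *.
  assert (0 <= r ^ m) by (apply pow_le; lra).
  nra. }
specialize (K n). pose proof (Rabs_pos (a (S n))).
apply Rmult_le_reg_l with (R - r); [lra|].
replace ((R - r) * (/ (R - r) * (Rabs (a (S n)) * R ^ S n))) with (Rabs (a (S n)) * R ^ S n)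
  by (field; lra).
replace ((R - r) * (INR (S n) * Rabs (a (S n)) * r ^ n)) with
 (Rabs (a (S n)) * (INR (S n) * r ^ n * (R - r))) by ring.
now apply Rmult_le_compat_l.
Qed.

Lemma cdiff_CP a z R : absconv a R -> Cmod z < R -> cdiff (CP a) z (CP (PS_derive a) z).
Proof.
intros Ha Hz. pose proof (Cmod_ge_0 z) as Hz0.
set (t := R - Cmod z). assert (Ht : 0 < t) by (unfold t; lra).
set (M := Series (fun n => Rabs (a n) * R ^ n)).
assert (HM : 0 <= M).
{ apply Series_nonneg; auto. intros n; apply Rmult_le_pos; [apply Rabs_pos|apply pow_le; lra]. }
assert (Hd : absconv (PS_derive a) (Cmod z)) by (apply (absconv_derive a (Cmod z) R); auto; lra).
assert (Cd := cabs_CP _ z _ Hd (Rle_refl _)).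
set (u := fun n => (RtoC (a n) * (RtoC (INR n) * z ^ pred n))%C).
assert (Cu : cabs u).
{ unfold cabs. apply ex_series_incr_1. eapply ex_series_ext; [|exact Cd].
  intros n; simpl; f_equal. unfold u, PS_derive. rewrite RtoC_mult. simpl pred. ring. }
assert (Eu : CSeries u = CP (PS_derive a) z).
{ unfold CP, CSeries. f_equal; rewrite Series_incr_1.
  - replace (Re (u 0%nat)) with 0. 2:{ unfold u; simpl. ring. }
    rewrite Rplus_0_l. apply Series_ext. intros n; f_equal. unfold u, PS_derive.
    rewrite RtoC_mult. simpl pred. ring.
  - now apply cabs_re.
  - replace (Im (u 0%nat)) with 0. 2:{ unfold u; simpl. ring. }
    rewrite Rplus_0_l. apply Series_ext. intros n; f_equal. unfold u, PS_derive.
    rewrite RtoC_mult. simpl pred. ring.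
  - now apply cabs_im. }
intros eps He. exists (Rmin t (eps * t ^ 2 / (M + 1))). split.
{ apply Rmin_pos; auto. apply Rdiv_lt_0_compat; [|lra]. apply Rmult_lt_0_compat; auto. nra. }
intros h Hh.
assert (Hh1 : Cmod h < t) by exact (Rlt_le_trans _ _ _ Hh (Rmin_l _ _)).
assert (Hh2 : Cmod h < eps * t ^ 2 / (M + 1)) by exact (Rlt_le_trans _ _ _ Hh (Rmin_r _ _)).
assert (C1 : cabs (fun n => RtoC (a n) * (z + h) ^ n)%C).
{ apply (cabs_CP a _ R Ha). eapply Rle_trans; [apply Cmod_triangle|]. unfold t in Hh1; lra. }
assert (C2 : cabs (fun n => RtoC (a n) * z ^ n)%C) by (apply (cabs_CP a _ R Ha); lra).
rewrite <- Eu. unfold CP.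
rewrite (Cmult_comm (CSeries u) h), <- CSeries_scal by auto.
rewrite <- CSeries_minus by auto.
rewrite <- CSeries_minus by auto using cabs_scal, cabs_minus.
assert (B : Cmod (CSeries (fun n => RtoC (a n) * (z + h) ^ n - RtoC (a n) * z ^ n - h * u n)%C)
  <= Series (fun n => (Cmod h / t) ^ 2 * (Rabs (a n) * R ^ n))).
{ apply Cmod_CSeries_le; [|now apply ex_series_scalR].
  intros n. unfold u.
  replace (RtoC (a n) * (z + h) ^ n - RtoC (a n) * z ^ n - h * (RtoC (a n) * (RtoC (INR n) * z ^ pred n)))%C
   with (RtoC (a n) * ((z + h) ^ n - z ^ n - RtoC (INR n) * z ^ pred n * h))%C by ring.
  rewrite Cmod_mult, Cmod_R.
  assert (P := pow_diff2_bound z h t n Ht (Rlt_le _ _ Hh1)).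
  replace (Cmod z + t) with R in P by (unfold t; ring).
  pose proof (Rabs_pos (a n)). nra. }
rewrite Series_scal_l in B. fold M in B. eapply Rle_trans; [apply B|].
pose proof (Cmod_ge_0 h) as Hh0.
apply Rmult_le_reg_r with (t ^ 2); [nra|].
replace ((Cmod h / t) ^ 2 * M * t ^ 2) with (Cmod h * (Cmod h * M)) by (field; lra).
replace (eps * Cmod h * t ^ 2) with (Cmod h * (eps * t ^ 2)) by ring.
apply Rmult_le_compat_l; auto.
apply Rle_trans with (eps * t ^ 2 / (M + 1) * (M + 1)).
- apply Rmult_le_compat; lra.
- apply Req_le; field; lra.
Qed.

(** * Integrals of complex-valued functions *)

Definition rc (g : R -> C) : Prop :=
  forall t, continuous (fun t => Re (g t)) t /\ continuous (fun t => Im (g t)) t.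

Definition CI (g : R -> C) (a b : R) : C :=
  (RInt (fun t => Re (g t)) a b, RInt (fun t => Im (g t)) a b).

Lemma rc_re g a b : rc g -> ex_RInt (fun t => Re (g t)) a b.
Proof. intros H; apply (ex_RInt_continuous (V := R_CompleteNormedModule)); intros; apply H. Qed.

Lemma rc_im g a b : rc g -> ex_RInt (fun t => Im (g t)) a b.
Proof. intros H; apply (ex_RInt_continuous (V := R_CompleteNormedModule)); intros; apply H. Qed.

Lemma rc_plus f g : rc f -> rc g -> rc (fun t => f t + g t)%C.
Proof.
intros Hf Hg t; destruct (Hf t), (Hg t); simpl.
split; now apply (continuous_plus (V := R_NormedModule)).
Qed.

Lemma rc_mult f g : rc f -> rc g -> rc (fun t => f t * g t)%C.
Proof.
intros Hf Hg t; destruct (Hf t), (Hg t); simpl. split.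
- apply (continuous_minus (V := R_NormedModule)); now apply (continuous_mult (K := R_AbsRing)).
- apply (continuous_plus (V := R_NormedModule)); now apply (continuous_mult (K := R_AbsRing)).
Qed.

Lemma rc_const c : rc (fun _ => c).
Proof. intros t; split; apply continuous_const. Qed.

Lemma rc_ext f g : (forall t, f t = g t) -> rc f -> rc g.
Proof.
intros E H t; split; [eapply continuous_ext; [|apply (proj1 (H t))]|
 eapply continuous_ext; [|apply (proj2 (H t))]]; intros; simpl; now rewrite E.
Qed.

Lemma CI_ext f g a b : (forall t, Rmin a b < t < Rmax a b -> f t = g t) -> CI f a b = CI g a b.
Proof.
intros E; unfold CI; f_equal; apply RInt_ext; intros; now rewrite E.
Qed.

Lemma CI_plus f g a b : rc f -> rc g ->
  CI (fun t => f t + g t)%C a b = (CI f a b + CI g a b)%C.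
Proof.
intros Hf Hg; unfold CI, Cplus; simpl; f_equal.
- apply (RInt_plus (V := R_CompleteNormedModule)); now apply rc_re.
- apply (RInt_plus (V := R_CompleteNormedModule)); now apply rc_im.
Qed.

Lemma CI_scal c f a b : rc f -> CI (fun t => c * f t)%C a b = (c * CI f a b)%C.
Proof.
intros Hf. unfold CI, Cmult; simpl.
pose proof (rc_re f a b Hf) as Hr. pose proof (rc_im f a b Hf) as Hi.
assert (S : forall x g, ex_RInt g a b -> ex_RInt (fun t => x * g t) a b)
 by (intros x g H; exact (ex_RInt_scal (V := R_NormedModule) g a b x H)).
assert (S' : forall x g, ex_RInt g a b -> RInt (fun t => x * g t) a b = x * RInt g a b)
 by (intros x g H; exact (RInt_scal (V := R_CompleteNormedModule) g a b x H)).
f_equal.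
- rewrite <- !S' by auto.
  apply (RInt_minus (V := R_CompleteNormedModule) (fun t => fst c * fst (f t)) (fun t => snd c * snd (f t))); apply S; auto.
- rewrite <- !S' by auto.
  apply (RInt_plus (V := R_CompleteNormedModule) (fun t => fst c * snd (f t)) (fun t => snd c * fst (f t))); apply S; auto.
Qed.

Lemma CI_Chasles f a b c : rc f -> (CI f a b + CI f b c)%C = CI f a c.
Proof.
intros H. unfold CI, Cplus; simpl; f_equal.
- apply (RInt_Chasles (V := R_CompleteNormedModule)); now apply rc_re.
- apply (RInt_Chasles (V := R_CompleteNormedModule)); now apply rc_im.
Qed.

Lemma RInt_constR (c a b : R) : RInt (fun _ => c) a b = (b - a) * c.
Proof. exact (RInt_const (V := R_CompleteNormedModule) a b c). Qed.

Lemma RInt_le_const (g : R -> R) a b M : a <= b -> ex_RInt g a b ->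
  (forall t, a <= t <= b -> g t <= M) -> RInt g a b <= M * (b - a).
Proof.
intros Hab Hg H.
replace (M * (b - a)) with (RInt (fun _ => M) a b).
- apply RInt_le; auto. apply ex_RInt_const. intros; apply H; lra.
- rewrite RInt_constR; apply Rmult_comm.
Qed.

(** The rotation by [Cconj z] used for series again reduces the estimate to a real integral. *)
Lemma Cmod_CI f a b M : a <= b -> rc f -> (forall t, a <= t <= b -> Cmod (f t) <= M) ->
  Cmod (CI f a b) <= M * (b - a).
Proof.
intros Hab Hf HM. set (z := CI f a b).
assert (HM0 : 0 <= M).
{ eapply Rle_trans; [apply Cmod_ge_0|]. apply (HM a); lra. }
destruct (Req_dec (Cmod z) 0) as [E|E].
{ rewrite E. apply Rmult_le_pos; lra. }
assert (Hz : 0 < Cmod z) by (pose proof (Cmod_ge_0 z); lra).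
assert (H : (Cconj z * z)%C = CI (fun t => Cconj z * f t)%C a b)
  by (symmetry; now apply CI_scal).
assert (H2 : Cmod z * Cmod z <= Cmod z * (M * (b - a))).
{ replace (Cmod z * Cmod z) with (RInt (fun t => Re (Cconj z * f t)%C) a b).
  2:{ change (RInt (fun t => Re (Cconj z * f t)%C) a b) with (fst (CI (fun t => Cconj z * f t)%C a b)).
      rewrite <- H. rewrite Cmult_comm, <- Cmod2_conj. simpl. ring. }
  rewrite <- Rmult_assoc. apply RInt_le_const; auto.
  - apply (rc_re (fun t => Cconj z * f t)%C). apply rc_mult; auto using rc_const.
  - intros t Ht. eapply Rle_trans; [apply Rle_abs|].
    eapply Rle_trans; [apply re_le_Cmod|]. rewrite Cmod_mult, Cmod_conj.
    apply Rmult_le_compat_l; [apply Cmod_ge_0|]. auto. }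
apply Rmult_le_reg_l with (Cmod z); auto.
Qed.

Lemma ccont_rc f (g : R -> C) : (forall t, ccont f (g t)) -> rc g -> rc (fun t => f (g t)).
Proof.
intros Hf Hg t.
assert (K : forall eps, 0 < eps -> locally t (fun s => Cmod (f (g s) - f (g t))%C < eps)).
{ intros eps He. destruct (Hf t eps He) as [d [Hd H]].
  destruct (Hg t) as [H1 H2].
  assert (Hd2 : 0 < d / 2) by lra.
  specialize (H1 _ (locally_ball (Re (g t)) (mkposreal _ Hd2))).
  specialize (H2 _ (locally_ball (Im (g t)) (mkposreal _ Hd2))).
  unfold filtermap in H1, H2.
  apply (filter_imp _ _ ) with (2 := filter_and _ _ H1 H2).
  intros s [B1 B2]. change (Rabs (Re (g s) - Re (g t)) < d / 2) in B1.
  change (Rabs (Im (g s) - Im (g t)) < d / 2) in B2.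
  specialize (H (g s - g t)%C).
  replace (g t + (g s - g t))%C with (g s) in H by ring. apply H.
  eapply Rle_lt_trans; [apply Cmod_le_abs|].
  change (Rabs (Re (g s) - Re (g t)) + Rabs (Im (g s) - Im (g t)) < d). lra. }
split; apply (filterlim_locally (F := locally t)); intros eps;
 apply (filter_imp _ _ ) with (2 := K eps (cond_pos eps)); intros s Hs.
- eapply Rle_lt_trans; [|apply Hs]. apply (re_le_Cmod (f (g s) - f (g t))%C).
- eapply Rle_lt_trans; [|apply Hs]. apply (im_le_Cmod (f (g s) - f (g t))%C).
Qed.

Lemma rc_pair (u v : R -> R) : (forall t, continuous u t) -> (forall t, continuous v t) ->
  rc (fun t => (u t, v t)).
Proof. intros Hu Hv t; simpl; split; auto. Qed.

(** * Goursat's theorem on rectangles *)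

(** The integral of f(z) dz, counterclockwise, along the boundary of the rectangle with lower left
    corner [(a, b)], width [w] and height [h]. *)
Definition rect (f : C -> C) (a b w h : R) : C :=
  (CI (fun t => f (t, b)) a (a + w)%R + Ci * CI (fun t => f ((a + w)%R, t)) b (b + h)%R
   - CI (fun t => f (t, (b + h)%R)) a (a + w)%R - Ci * CI (fun t => f (a, t)) b (b + h)%R)%C.

Lemma rc_hor f b : (forall z, ccont f z) -> rc (fun t => f (t, b)).
Proof.
intros H; apply (ccont_rc f); auto. apply rc_pair; intros; [apply continuous_id|apply continuous_const].
Qed.

Lemma rc_ver f a : (forall z, ccont f z) -> rc (fun t => f (a, t)).
Proof.
intros H; apply (ccont_rc f); auto. apply rc_pair; intros; [apply continuous_const|apply continuous_id].
Qed.

Lemma ccont_plus f g z : ccont f z -> ccont g z -> ccont (fun z => f z + g z)%C z.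
Proof.
intros Hf Hg eps He. destruct (Hf (eps / 2)) as [d1 [Hd1 H1]]; [lra|].
destruct (Hg (eps / 2)) as [d2 [Hd2 H2]]; [lra|].
exists (Rmin d1 d2); split; [now apply Rmin_pos|]. intros h Hh.
specialize (H1 h (Rlt_le_trans _ _ _ Hh (Rmin_l _ _))).
specialize (H2 h (Rlt_le_trans _ _ _ Hh (Rmin_r _ _))).
replace (f (z + h) + g (z + h) - (f z + g z))%C with
 ((f (z + h) - f z) + (g (z + h) - g z))%C by ring.
eapply Rle_lt_trans; [apply Cmod_triangle|]. lra.
Qed.

Lemma rect_plus f g a b w h : (forall z, ccont f z) -> (forall z, ccont g z) ->
  rect (fun z => f z + g z)%C a b w h = (rect f a b w h + rect g a b w h)%C.
Proof.
intros Hf Hg. unfold rect. rewrite !CI_plus by auto using rc_hor, rc_ver. ring.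
Qed.

Lemma rect_scal c f a b w h : (forall z, ccont f z) ->
  rect (fun z => c * f z)%C a b w h = (c * rect f a b w h)%C.
Proof.
intros Hf. unfold rect. rewrite !CI_scal by auto using rc_hor, rc_ver. ring.
Qed.

Lemma CI_const c a b : CI (fun _ => c) a b = (RtoC (b - a) * c)%C.
Proof.
unfold CI. rewrite !RInt_constR. unfold RtoC, Cmult, Re, Im; simpl. f_equal; eqR; ring.
Qed.

Lemma RInt_id a b : RInt (fun t => t) a b = (b * b - a * a) / 2.
Proof.
apply is_RInt_unique.
replace ((b * b - a * a) / 2) with (minus (b * b / 2) (a * a / 2))
  by (unfold minus, plus, opp; simpl; field).
apply (is_RInt_derive (V := R_CompleteNormedModule) (fun t => t * t / 2)).
- intros x _. auto_derive; auto. field.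
- intros; apply continuous_id.
Qed.

Lemma rect_const c a b w h : rect (fun _ => c) a b w h = 0%C.
Proof. unfold rect. rewrite !CI_const. replace (a + w - a) with w by ring. replace (b + h - b) with h by ring. ring. Qed.

Lemma rect_id a b w h : rect (fun z => z) a b w h = 0%C.
Proof.
unfold rect, CI; simpl. rewrite !RInt_constR, !RInt_id.
apply injective_projections; simpl; eqR; field.
Qed.

Lemma ccont_const c z : ccont (fun _ => c) z.
Proof. eapply cdiff_ccont, cdiff_const. Qed.

Lemma ccont_id z : ccont (fun z => z) z.
Proof. eapply cdiff_ccont, cdiff_id. Qed.

Lemma ccont_scal c f z : ccont f z -> ccont (fun z => c * f z)%C z.
Proof.
intros H eps He. pose proof (Cmod_ge_0 c) as Hc.
destruct (H (eps / (Cmod c + 1))) as [d [Hd H1]].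
{ apply Rdiv_lt_0_compat; lra. }
exists d; split; auto. intros k Hk. specialize (H1 k Hk).
replace (c * f (z + k) - c * f z)%C with (c * (f (z + k) - f z))%C by ring.
rewrite Cmod_mult.
apply Rle_lt_trans with (Cmod c * (eps / (Cmod c + 1))).
- apply Rmult_le_compat_l; lra.
- apply Rmult_lt_reg_r with (Cmod c + 1); [lra|].
  replace (Cmod c * (eps / (Cmod c + 1)) * (Cmod c + 1)) with (Cmod c * eps) by (field; lra). nra.
Qed.

Lemma rect_bound f a b w h M : 0 <= w -> 0 <= h -> (forall z, ccont f z) ->
  (forall x y, a <= x <= a + w -> b <= y <= b + h -> Cmod (f (x, y)) <= M) ->
  Cmod (rect f a b w h) <= M * (2 * (w + h)).
Proof.
intros Hw Hh Hf HM. unfold rect, Cminus.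
eapply Rle_trans; [apply Cmod_triangle|]. rewrite Cmod_opp, Cmod_mult, Cmod_Ci.
eapply Rle_trans; [apply Rplus_le_compat_r, Cmod_triangle|]. rewrite Cmod_opp.
eapply Rle_trans; [apply Rplus_le_compat_r, Rplus_le_compat_r, Cmod_triangle|].
rewrite Cmod_mult, Cmod_Ci.
assert (B1 := Cmod_CI (fun t => f (t, b)) a (a + w) M).
assert (B2 := Cmod_CI (fun t => f (a + w, t)) b (b + h) M).
assert (B3 := Cmod_CI (fun t => f (t, b + h)) a (a + w) M).
assert (B4 := Cmod_CI (fun t => f (a, t)) b (b + h) M).
assert (Cmod (CI (fun t => f (t, b)) a (a + w)) <= M * (a + w - a))
 by (apply B1; [lra|auto using rc_hor|intros; apply HM; lra]).
assert (Cmod (CI (fun t => f (a + w, t)) b (b + h)) <= M * (b + h - b))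
 by (apply B2; [lra|auto using rc_ver|intros; apply HM; lra]).
assert (Cmod (CI (fun t => f (t, b + h)) a (a + w)) <= M * (a + w - a))
 by (apply B3; [lra|auto using rc_hor|intros; apply HM; lra]).
assert (Cmod (CI (fun t => f (a, t)) b (b + h)) <= M * (b + h - b))
 by (apply B4; [lra|auto using rc_ver|intros; apply HM; lra]).
lra.
Qed.

Lemma rect_split f a b w h : (forall z, ccont f z) ->
  rect f a b w h = (rect f a b (w / 2) (h / 2) + rect f (a + w / 2) b (w / 2) (h / 2)
    + rect f a (b + h / 2) (w / 2) (h / 2) + rect f (a + w / 2) (b + h / 2) (w / 2) (h / 2))%C.
Proof.
intros Hf. unfold rect.
replace (a + w / 2 + w / 2) with (a + w) by field.
replace (b + h / 2 + h / 2) with (b + h) by field.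
rewrite <- (CI_Chasles (fun t => f (t, b)) a (a + w / 2) (a + w)) by auto using rc_hor.
rewrite <- (CI_Chasles (fun t => f (t, b + h)) a (a + w / 2) (a + w)) by auto using rc_hor.
rewrite <- (CI_Chasles (fun t => f (a + w, t)) b (b + h / 2) (b + h)) by auto using rc_ver.
rewrite <- (CI_Chasles (fun t => f (a, t)) b (b + h / 2) (b + h)) by auto using rc_ver.
ring.
Qed.

Section Goursat.

Variable f : C -> C.
Hypothesis Hf : forall z, exists l, cdiff f z l.

Lemma entire_ccont : forall z, ccont f z.
Proof. intros z; destruct (Hf z) as [l Hl]; eapply cdiff_ccont; eauto. Qed.

(** An affine function integrates to zero around a rectangle, so [f] may be replaced by its
    first-order remainder at [p]. That is at most [eps * (w + h)] on a boundary of length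
    [2 * (w + h)]. *)
Lemma rect_local (p l : C) eps a b w h : 0 <= w -> 0 <= h -> 0 <= eps ->
  (forall x y, a <= x <= a + w -> b <= y <= b + h ->
     Cmod (f (x, y) - f p - l * ((x, y) - p)) <= eps * Cmod ((x, y) - p)%C) ->
  a <= fst p <= a + w -> b <= snd p <= b + h ->
  Cmod (rect f a b w h) <= 2 * eps * (w + h) ^ 2.
Proof.
intros Hw Hh He H Hp1 Hp2.
set (g := fun z => (f z + (- l * z + (l * p - f p)))%C).
assert (C1 : forall z, ccont (fun z => - l * z + (l * p - f p))%C z).
{ intros z; apply ccont_plus; [apply (ccont_scal (- l)%C (fun z => z)), ccont_id|apply ccont_const]. }
assert (E : rect g a b w h = rect f a b w h).
{ unfold g. rewrite rect_plus by (auto using entire_ccont).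
  rewrite (rect_plus (fun z => - l * z)%C (fun _ => l * p - f p)%C).
  - rewrite (rect_scal (- l)%C (fun z => z)) by apply ccont_id. rewrite rect_id, rect_const. ring.
  - intros z; apply (ccont_scal (- l)%C (fun z => z)), ccont_id.
  - intros z; apply ccont_const. }
rewrite <- E.
eapply Rle_trans; [apply (rect_bound _ _ _ _ _ (eps * (w + h)))|]; auto.
- intros z. unfold g. apply ccont_plus; auto using entire_ccont.
- intros x y Hx Hy. unfold g.
  replace (f (x, y) + (- l * (x, y) + (l * p - f p)))%C with (f (x, y) - f p - l * ((x, y) - p))%C by ring.
  eapply Rle_trans; [apply H; auto|]. apply Rmult_le_compat_l; auto.
  eapply Rle_trans; [apply Cmod_le_abs|]. destruct p as [p1 p2]; simpl in *.
  apply Rplus_le_compat; apply Rabs_le; lra.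
- simpl. lra.
Qed.

Variables a0 b0 W H0 : R.
Hypothesis HW : 0 <= W.
Hypothesis HH : 0 <= H0.

Let wd (k : nat) := W / 2 ^ k.
Let ht (k : nat) := H0 / 2 ^ k.

(** One bisection step: the integral around the rectangle is the sum of those around its four
    quarters, so one quarter keeps at least a fourth of it in modulus. *)
Let good (k : nat) (s s' : R * R) : Prop :=
  (fst s' = fst s \/ fst s' = fst s + wd (S k)) /\
  (snd s' = snd s \/ snd s' = snd s + ht (S k)) /\
  Cmod (rect f (fst s) (snd s) (wd k) (ht k)) <=
   4 * Cmod (rect f (fst s') (snd s') (wd (S k)) (ht (S k))).

Let good_ex k s : exists s', good k s s'.
Proof.
destruct s as [a b]. unfold good. simpl fst; simpl snd.
assert (E := rect_split f a b (wd k) (ht k) entire_ccont).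
assert (Ew : wd k / 2 = wd (S k)) by (unfold wd; simpl; field; apply pow_nonzero; lra).
assert (Eh : ht k / 2 = ht (S k)) by (unfold ht; simpl; field; apply pow_nonzero; lra).
rewrite Ew, Eh in E. set (w := wd (S k)) in *. set (h := ht (S k)) in *.
set (r1 := rect f a b w h) in *. set (r2 := rect f (a + w) b w h) in *.
set (r3 := rect f a (b + h) w h) in *. set (r4 := rect f (a + w) (b + h) w h) in *.
assert (T : Cmod (rect f a b (wd k) (ht k)) <= Cmod r1 + Cmod r2 + Cmod r3 + Cmod r4).
{ rewrite E. pose proof (Cmod_triangle (r1 + r2 + r3) r4). pose proof (Cmod_triangle (r1 + r2) r3).
  pose proof (Cmod_triangle r1 r2). lra. }
destruct (Rle_dec (Cmod (rect f a b (wd k) (ht k))) (4 * Cmod r1)); [exists (a, b); auto|].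
destruct (Rle_dec (Cmod (rect f a b (wd k) (ht k))) (4 * Cmod r2)); [exists (a + w, b); auto|].
destruct (Rle_dec (Cmod (rect f a b (wd k) (ht k))) (4 * Cmod r3)); [exists (a, b + h); auto|].
exists (a + w, b + h); repeat split; auto. simpl. fold r4. lra.
Qed.

Let corner : nat -> R * R :=
  fix c k := match k with O => (a0, b0) | S k => epsilon (inhabits (0, 0)) (good k (c k)) end.

Let corner_good k : good k (corner k) (corner (S k)).
Proof. simpl. apply epsilon_spec, good_ex. Qed.

Let wd_pos k : 0 <= wd k.
Proof. apply Rdiv_le_0_compat; auto. apply pow_lt; lra. Qed.
Let ht_pos k : 0 <= ht k.
Proof. apply Rdiv_le_0_compat; auto. apply pow_lt; lra. Qed.

Let wd_S k : wd k = 2 * wd (S k).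
Proof. unfold wd; simpl; field; apply pow_nonzero; lra. Qed.
Let ht_S k : ht k = 2 * ht (S k).
Proof. unfold ht; simpl; field; apply pow_nonzero; lra. Qed.

Lemma nested_limit (u d : nat -> R) :
  (forall k, u k <= u (S k)) -> (forall k, u (S k) + d (S k) <= u k + d k) -> (forall k, 0 <= d k) ->
  exists p, forall k, u k <= p <= u k + d k.
Proof.
intros Hu Hd Hp.
assert (M1 : forall j k, (j <= k)%nat -> u j <= u k).
{ intros j k; induction 1; [lra|]. specialize (Hu m); lra. }
assert (M2 : forall j k, (j <= k)%nat -> u k + d k <= u j + d j).
{ intros j k; induction 1; [lra|]. specialize (Hd m); lra. }
assert (B : forall j k, u j <= u k + d k).
{ intros j k. specialize (M1 j (max j k)). specialize (M2 k (max j k)).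
  specialize (Hp (max j k)).
  assert (u j <= u (max j k)) by (apply M1; lia).
  assert (u (max j k) + d (max j k) <= u k + d k) by (apply M2; lia). lra. }
destruct (completeness (fun x => exists k, x = u k)) as [p [Hp1 Hp2]].
- exists (u O + d O). intros x [k ->]. apply B.
- now exists (u O), O.
- exists p. intros k; split.
  + apply Hp1. now exists k.
  + apply Hp2. intros x [j ->]. apply B.
Qed.

(** After [k] bisections the integral has lost at most a factor [4 ^ k], while near the common point
    [p] of the nested rectangles differentiability bounds it by [2 * eps] times the square of the
    sum of the sides, which shrinks by exactly [4 ^ k]. *)
Theorem goursat : rect f a0 b0 W H0 = 0%C.
Proof.
apply Cmod_eq_0.
assert (Hcase : forall k, fst (corner k) <= fst (corner (S k)) /\
   fst (corner (S k)) + wd (S k) <= fst (corner k) + wd k /\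
   snd (corner k) <= snd (corner (S k)) /\
   snd (corner (S k)) + ht (S k) <= snd (corner k) + ht k).
{ intros k. destruct (corner_good k) as [[G1|G1] [[G2|G2] _]]; rewrite G1, G2, (wd_S k), (ht_S k);
  pose proof (wd_pos (S k)); pose proof (ht_pos (S k)); lra. }
destruct (nested_limit (fun k => fst (corner k)) wd) as [p1 Hp1];
 [intros k; apply Hcase|intros k; apply Hcase|auto|].
destruct (nested_limit (fun k => snd (corner k)) ht) as [p2 Hp2];
 [intros k; apply Hcase|intros k; apply Hcase|auto|].
set (p := (p1, p2) : C).
assert (Hgrow : forall k, Cmod (rect f a0 b0 W H0) <=
   4 ^ k * Cmod (rect f (fst (corner k)) (snd (corner k)) (wd k) (ht k))).
{ induction k as [|k IH].
  - simpl. unfold wd, ht; simpl. unfold Rdiv. rewrite Rinv_1, !Rmult_1_r. lra.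
  - eapply Rle_trans; [apply IH|]. destruct (corner_good k) as [_ [_ G]].
    replace (4 ^ S k) with (4 ^ k * 4) by (simpl; ring). rewrite Rmult_assoc.
    apply Rmult_le_compat_l; [apply pow_le; lra|]. exact G. }
destruct (Hf p) as [l Hl].
apply Rle_antisym; [|apply Cmod_ge_0].
apply Rnot_lt_le. intros Hpos.
(* Chosen so that the final bound [2 * eps * (W + H0) ^ 2] stays below the modulus of the integral;
   the [+ 1] covers a degenerate rectangle. *)
set (eps := Cmod (rect f a0 b0 W H0) / (2 * (W + H0) ^ 2 + 1) / 2).
assert (Hsq : 0 <= (W + H0) ^ 2) by (apply pow2_ge_0).
assert (Heps : 0 < eps) by (apply Rdiv_lt_0_compat; [apply Rdiv_lt_0_compat|]; lra).
destruct (Hl eps Heps) as [d [Hd Hl']].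
assert (Hk : exists k, wd k + ht k < d).
{ destruct (Rlt_dec 0 (W + H0)) as [P|P].
  - assert (L : is_lim_seq (fun k => (W + H0) * (/ 2) ^ k) ((W + H0) * 0)).
    { apply is_lim_seq_mult'; [apply is_lim_seq_const|]. apply is_lim_seq_geom. rewrite Rabs_pos_eq; lra. }
    rewrite Rmult_0_r in L. apply is_lim_seq_spec in L. destruct (L (mkposreal d Hd)) as [k Hk].
    exists k. specialize (Hk k (Nat.le_refl k)). simpl in Hk. rewrite Rminus_0_r in Hk.
    rewrite pow_inv in Hk. eapply Rle_lt_trans; [|apply Hk]. eapply Rle_trans; [|apply Rle_abs].
    unfold wd, ht. apply Req_le. field. apply pow_nonzero; lra.
  - exists O. unfold wd, ht; simpl. lra. }
destruct Hk as [k Hk]. specialize (Hgrow k).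
assert (Hloc : Cmod (rect f (fst (corner k)) (snd (corner k)) (wd k) (ht k)) <= 2 * eps * (wd k + ht k) ^ 2).
{ apply (rect_local p l); auto; try lra.
  - intros x y Hx Hy. specialize (Hp1 k). specialize (Hp2 k).
    specialize (Hl' ((x, y) - p)%C).
    assert (E1 : forall u v : C, (v + (u - v))%C = u) by (intros; ring).
    rewrite E1 in Hl'.
    apply Hl'. eapply Rle_lt_trans; [apply Cmod_le_abs|]. simpl.
    eapply Rle_lt_trans; [|apply Hk]. apply Rplus_le_compat; apply Rabs_le; lra. }
assert (E4 : 4 ^ k * (2 * eps * (wd k + ht k) ^ 2) = 2 * eps * (W + H0) ^ 2).
{ assert (E2 : 2 ^ k <> 0) by (apply pow_nonzero; lra).
  replace (4 ^ k) with (2 ^ k * 2 ^ k) by (rewrite <- Rpow_mult_distr; f_equal; lra).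
  unfold wd, ht. field; auto. }
assert (Hfin : Cmod (rect f a0 b0 W H0) <= 2 * eps * (W + H0) ^ 2).
{ rewrite <- E4. eapply Rle_trans; [apply Hgrow|]. apply Rmult_le_compat_l; auto. apply pow_le; lra. }
assert (Ee : Cmod (rect f a0 b0 W H0) = 2 * eps * (2 * (W + H0) ^ 2 + 1)) by (unfold eps; field; lra).
assert (0 <= eps * (W + H0) ^ 2) by (apply Rmult_le_pos; lra).
lra.
Qed.

End Goursat.

(** * The exponential and the mean value property *)

Definition cis (y : R) : C := (cos y, sin y).

Lemma Cexp_polar x y : Cexp (x, y) = (RtoC (exp x) * cis y)%C.
Proof. unfold Cexp, cis, RtoC, Cmult; simpl. f_equal; ring. Qed.

Lemma Cmod_cis y : Cmod (cis y) = 1.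
Proof.
unfold Cmod, cis; simpl. transitivity (sqrt 1); [f_equal|apply sqrt_1].
pose proof (sin2_cos2 y) as H. unfold Rsqr in H. lra.
Qed.

Lemma Cmod_Cexp z : Cmod (Cexp z) = exp (Re z).
Proof.
destruct z as [x y]. rewrite Cexp_polar, Cmod_mult, Cmod_cis, Cmod_R, Rabs_pos_eq; simpl; [ring|].
apply Rlt_le, exp_pos.
Qed.

Lemma Cexp_plus z w : Cexp (z + w) = (Cexp z * Cexp w)%C.
Proof.
destruct z as [x y], w as [u v]. unfold Cexp, Cmult; simpl.
rewrite exp_plus, cos_plus, sin_plus. f_equal; ring.
Qed.

Lemma Cexp_0 : Cexp 0 = 1%C.
Proof. unfold Cexp, RtoC; simpl. rewrite exp_0, cos_0, sin_0. f_equal; ring. Qed.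

Lemma derivable_pt_lim_bound f x l : derivable_pt_lim f x l -> forall eps, 0 < eps ->
  exists d, 0 < d /\ forall h, Rabs h < d -> Rabs (f (x + h) - f x - l * h) <= eps * Rabs h.
Proof.
intros H eps He. destruct (H eps He) as [d Hd]. exists d; split; [apply cond_pos|].
intros h Hh. destruct (Req_dec h 0) as [->|Hn].
- rewrite Rplus_0_r, Rabs_R0. replace (f x - f x - l * 0) with 0 by ring. rewrite Rabs_R0; lra.
- specialize (Hd h Hn Hh).
  replace (f (x + h) - f x - l * h) with (((f (x + h) - f x) / h - l) * h) by (field; auto).
  rewrite Rabs_mult. apply Rmult_le_compat_r; [apply Rabs_pos|lra].
Qed.

Lemma cdiff_Cexp_0 : cdiff Cexp 0 1.
Proof.
intros eps He.
destruct (derivable_pt_lim_bound exp 0 1) with (eps := eps / 8) as [d1 [Hd1 H1]]; [|lra|].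
{ rewrite <- exp_0. apply derivable_pt_lim_exp. }
destruct (derivable_pt_lim_bound sin 0 1) with (eps := eps / 16) as [d2 [Hd2 H2]]; [|lra|].
{ rewrite <- cos_0. apply derivable_pt_lim_sin. }
destruct (derivable_pt_lim_bound cos 0 0) with (eps := eps / 16) as [d3 [Hd3 H3]]; [|lra|].
{ replace 0 with (- sin 0) at 2 by (rewrite sin_0; ring). apply derivable_pt_lim_cos. }
destruct (derivable_pt_lim_bound exp 0 1) with (eps := 1) as [d4 [Hd4 H4]]; [|lra|].
{ rewrite <- exp_0. apply derivable_pt_lim_exp. }
exists (Rmin (Rmin (Rmin d1 d2) (Rmin d3 d4)) (Rmin (1/2) (eps / 8))). split.
{ repeat apply Rmin_pos; lra. }
intros h Hh.
assert (L : Cmod h < d1 /\ Cmod h < d2 /\ Cmod h < d3 /\ Cmod h < d4 /\ Cmod h < 1/2 /\ Cmod h < eps / 8).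
{ revert Hh. unfold Rmin. repeat destruct Rle_dec; lra. }
destruct L as [L1 [L2 [L3 [L4 [L5 L6]]]]].
assert (Ha := re_le_Cmod h). assert (Hb := im_le_Cmod h).
rewrite Cplus_0_l, Cexp_0. destruct h as [a b]. simpl in Ha, Hb. set (m := Cmod (a, b)) in *.
specialize (H1 a). specialize (H2 b). specialize (H3 b). specialize (H4 a).
rewrite !Rplus_0_l, exp_0 in H1, H4. rewrite Rplus_0_l, sin_0 in H2. rewrite Rplus_0_l, cos_0 in H3.
assert (G1 := H1 ltac:(lra)). assert (G2 := H2 ltac:(lra)). assert (G3 := H3 ltac:(lra)).
assert (G4 := H4 ltac:(lra)).
eapply Rle_trans; [apply Cmod_le_abs|]. unfold Cexp; simpl.
replace (exp a * cos b + - (1) + - (1 * a - 0 * b)) with ((exp a - 1 - 1 * a) + exp a * (cos b - 1 - 0 * b)) by ring.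
replace (exp a * sin b + - 0 + - (1 * b + 0 * a)) with ((exp a - 1) * b + exp a * (sin b - 0 - 1 * b)) by ring.
assert (E1 : Rabs (exp a - 1) <= 2 * m).
{ replace (exp a - 1) with ((exp a - 1 - 1 * a) + a) by ring. eapply Rle_trans; [apply Rabs_triang|]. lra. }
assert (E2 : 0 <= exp a <= 2).
{ split; [apply Rlt_le, exp_pos|]. revert E1. unfold Rabs; destruct Rcase_abs; lra. }
assert (Hm : 0 <= m) by (pose proof (Rabs_pos a); lra).
assert (F1 : Rabs (exp a - 1 - 1 * a + exp a * (cos b - 1 - 0 * b)) <= eps / 8 * m + 2 * (eps / 16 * m)).
{ eapply Rle_trans; [apply Rabs_triang|]. apply Rplus_le_compat.
  - eapply Rle_trans; [apply G1|]. apply Rmult_le_compat_l; lra.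
  - rewrite Rabs_mult, (Rabs_pos_eq (exp a)) by lra. apply Rmult_le_compat; try apply Rabs_pos; try lra.
    eapply Rle_trans; [apply G3|]. apply Rmult_le_compat_l; lra. }
assert (F2 : Rabs ((exp a - 1) * b + exp a * (sin b - 0 - 1 * b)) <= 2 * (eps / 8) * m + 2 * (eps / 16 * m)).
{ eapply Rle_trans; [apply Rabs_triang|]. rewrite !Rabs_mult, (Rabs_pos_eq (exp a)) by lra. apply Rplus_le_compat.
  - apply Rle_trans with (2 * m * m); [|nra]. apply Rmult_le_compat; try apply Rabs_pos; lra.
  - apply Rmult_le_compat; try apply Rabs_pos; try lra.
    eapply Rle_trans; [apply G2|]. apply Rmult_le_compat_l; lra. }
assert (0 <= eps * m) by (apply Rmult_le_pos; lra).
lra.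
Qed.

Lemma cdiff_Cexp z : cdiff Cexp z (Cexp z).
Proof.
intros eps He. assert (Hp : 0 < Cmod (Cexp z)) by (rewrite Cmod_Cexp; apply exp_pos).
destruct (cdiff_Cexp_0 (eps / Cmod (Cexp z))) as [d [Hd H]].
{ now apply Rdiv_lt_0_compat. }
exists d; split; auto. intros h Hh. specialize (H h Hh).
rewrite Cplus_0_l, Cexp_0 in H. rewrite Cexp_plus.
replace (Cexp z * Cexp h - Cexp z - Cexp z * h)%C with (Cexp z * (Cexp h - 1 - 1 * h))%C by ring.
rewrite Cmod_mult.
apply Rle_trans with (Cmod (Cexp z) * (eps / Cmod (Cexp z) * Cmod h)).
- apply Rmult_le_compat_l; lra.
- apply Req_le; field; lra.
Qed.

Definition holo (f : C -> C) : Prop := forall z, exists l, cdiff f z l.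

Lemma holo_ccont f : holo f -> forall z, ccont f z.
Proof. intros H z; destruct (H z) as [l Hl]; eapply cdiff_ccont; eauto. Qed.

Lemma holo_const c : holo (fun _ => c).
Proof. intros z; eexists; apply cdiff_const. Qed.

Lemma holo_id : holo (fun z => z).
Proof. intros z; eexists; apply cdiff_id. Qed.

Lemma holo_plus f g : holo f -> holo g -> holo (fun z => f z + g z)%C.
Proof. intros Hf Hg z; destruct (Hf z), (Hg z); eexists; apply cdiff_plus; eauto. Qed.

Lemma holo_mult f g : holo f -> holo g -> holo (fun z => f z * g z)%C.
Proof. intros Hf Hg z; destruct (Hf z), (Hg z); eexists; apply cdiff_mult; eauto. Qed.

Lemma holo_comp f g : holo f -> holo g -> holo (fun z => f (g z)).
Proof. intros Hf Hg z; destruct (Hf (g z)), (Hg z); eexists; apply (cdiff_comp f g); eauto. Qed.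

Lemma holo_affine c d f : holo f -> holo (fun z => f (c + d * z)%C).
Proof.
intros H. apply (holo_comp f); auto. apply holo_plus; [apply holo_const|].
apply holo_mult; [apply holo_const|apply holo_id].
Qed.

Lemma rc_cis r : rc (fun y => RtoC r * cis y)%C.
Proof.
apply rc_mult; [apply rc_const|]. apply rc_pair; intros t.
- apply continuity_pt_filterlim, continuity_cos.
- apply continuity_pt_filterlim, continuity_sin.
Qed.

(** Goursat's theorem is applied to [g] composed with [Cexp], on the rectangle with opposite corners
    [(ln r1, 0)] and [(ln r2, 2 * PI)]. Its vertical sides are the two circles, and the horizontal
    ones cancel because [Cexp] has period [2 * PI] in the imaginary direction. *)
Lemma mean_value_const g r1 r2 : holo g -> 0 < r1 <= r2 ->
  CI (fun y => g (RtoC r1 * cis y)%C) 0 (2 * PI) = CI (fun y => g (RtoC r2 * cis y)%C) 0 (2 * PI).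
Proof.
intros Hg [H1 H2].
assert (Hr : forall r, 0 < r -> forall y, (RtoC r * cis y)%C = Cexp (ln r, y))
  by (intros; now rewrite Cexp_polar, exp_ln).
assert (HG : holo (fun w => g (Cexp w))).
{ apply (holo_comp g); auto. intros z; eexists; apply cdiff_Cexp. }
assert (E := goursat _ HG (ln r1) 0 (ln r2 - ln r1) (2 * PI)).
assert (Hln : ln r1 <= ln r2) by (apply ln_le; auto).
pose proof PI_RGT_0 as Hpi.
specialize (E ltac:(lra) ltac:(lra)). unfold rect in E.
rewrite (CI_ext (fun t => g (Cexp (t, (0 + 2 * PI)%R))) (fun t => g (Cexp (t, 0)))) in E.
2:{ intros t _. f_equal. unfold Cexp; simpl. now rewrite Rplus_0_l, cos_2PI, sin_2PI, cos_0, sin_0. }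
replace (ln r1 + (ln r2 - ln r1)) with (ln r2) in E by ring. rewrite !Rplus_0_l in E.
rewrite (CI_ext (fun y => g (RtoC r1 * cis y)%C) (fun t => g (Cexp (ln r1, t)))) by (intros; f_equal; apply Hr; lra).
rewrite (CI_ext (fun y => g (RtoC r2 * cis y)%C) (fun t => g (Cexp (ln r2, t)))) by (intros; f_equal; apply Hr; lra).
set (A := CI (fun t => g (Cexp (ln r1, t))) 0 (2 * PI)) in *.
set (B := CI (fun t => g (Cexp (ln r2, t))) 0 (2 * PI)) in *.
assert (E2 : (Ci * (B - A))%C = 0%C) by (rewrite <- E; ring).
assert (E3 : (B - A)%C = 0%C).
{ replace (B - A)%C with (- Ci * (Ci * (B - A)))%C.
  - rewrite E2; ring.
  - transitivity (- (Ci * Ci) * (B - A))%C; [ring|].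
    replace (Ci * Ci)%C with (- (1))%C; [ring|].
    unfold Ci, Cmult, Copp, RtoC; simpl; f_equal; ring. }
replace B with ((B - A) + A)%C by ring. rewrite E3. ring.
Qed.

(** The mean does not depend on the radius, so it can be evaluated on a circle so small that
    continuity at the centre decides. *)
Theorem mean_value g r : holo g -> 0 < r ->
  CI (fun y => g (RtoC r * cis y)%C) 0 (2 * PI) = (RtoC (2 * PI) * g 0)%C.
Proof.
intros Hg Hr. pose proof PI_RGT_0 as Hpi.
set (A := CI _ _ _).
assert (E : (A - RtoC (2 * PI) * g 0)%C = 0%C).
{ apply Cmod_eq_0. apply Rle_antisym; [|apply Cmod_ge_0]. apply Rnot_lt_le; intros Hpos.
  set (D := Cmod (A - RtoC (2 * PI) * g 0)%C) in *.
  destruct (holo_ccont g Hg 0%C (D / (4 * PI))) as [d [Hd Hc]].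
  { apply Rdiv_lt_0_compat; lra. }
  set (r1 := Rmin (d / 2) r).
  assert (Hr1 : 0 < r1) by (apply Rmin_pos; lra).
  assert (Hr1d : r1 < d) by (eapply Rle_lt_trans; [apply Rmin_l|lra]).
  assert (EA : A = CI (fun y => g (RtoC r1 * cis y)%C) 0 (2 * PI)).
  { symmetry; apply mean_value_const; auto. split; auto. apply Rmin_r. }
  assert (Hrc : rc (fun y => g (RtoC r1 * cis y)%C)).
  { apply (ccont_rc g); [intros; now apply holo_ccont|apply rc_cis]. }
  assert (ED : (A - RtoC (2 * PI) * g 0)%C = CI (fun y => g (RtoC r1 * cis y) + - g 0)%C 0 (2 * PI)).
  { rewrite CI_plus, CI_const, <- EA by auto using rc_const. rewrite Rminus_0_r. ring. }
  assert (B : D <= D / (4 * PI) * (2 * PI - 0)).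
  { unfold D at 1. rewrite ED. apply Cmod_CI; [lra|apply rc_plus; auto using rc_const|].
    intros t _. specialize (Hc (RtoC r1 * cis t)%C). rewrite Cplus_0_l in Hc.
    apply Rlt_le, Hc. rewrite Cmod_mult, Cmod_cis, Cmod_R, Rabs_pos_eq; lra. }
  replace (D / (4 * PI) * (2 * PI - 0)) with (D / 2) in B by (field; lra). lra. }
replace A with ((A - RtoC (2 * PI) * g 0) + RtoC (2 * PI) * g 0)%C by ring.
rewrite E. ring.
Qed.

(** * Uniqueness of the continuation *)

(* Any point of a large circle around [x] has one of its four rotations by multiples
   of a right angle in the half-plane where [h] vanishes, so the product of the four
   rotated copies of [h] vanishes on the circle, hence at its centre. *)
Theorem holo_zero_half_plane h c : holo h -> (forall z, c < Re z -> h z = 0%C) ->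
  forall z, h z = 0%C.
Proof.
intros Hh H0 z.
set (P := fun w => (h (z + 1 * w) * h (z + Ci * w) * (h (z + (- (1)) * w) * h (z + (- Ci) * w)))%C).
assert (HP : holo P) by (unfold P; repeat apply holo_mult; now apply holo_affine).
(* One of the four rotations of a point of the unit circle has real part above 1/2, so with this
   radius the corresponding rotated point lies beyond the abscissa [c]. *)
set (r := 2 * (Rabs (c - Re z) + 1)).
assert (Hr : 0 < r) by (unfold r; pose proof (Rabs_pos (c - Re z)); lra).
assert (Hz : forall y, P (RtoC r * cis y)%C = 0%C).
{ intros y. unfold P.
  assert (K : forall t, 1 / 2 < t -> c < Re z + r * t).
  { intros t Ht. unfold r. pose proof (Rle_abs (c - Re z)). pose proof (Rabs_pos (c - Re z)).
    nra. }
  assert (S := sin2_cos2 y). unfold Rsqr in S.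
  assert (O : 1 / 2 < cos y \/ 1 / 2 < - cos y \/ 1 / 2 < sin y \/ 1 / 2 < - sin y).
  { destruct (Rlt_dec (1/2) (cos y)); auto. destruct (Rlt_dec (1/2) (- cos y)); auto.
    destruct (Rlt_dec (1/2) (sin y)); auto. destruct (Rlt_dec (1/2) (- sin y)); auto.
    exfalso. assert (cos y * cos y <= 1/4) by nra. assert (sin y * sin y <= 1/4) by nra. lra. }
  destruct O as [O|[O|[O|O]]].
  - rewrite (H0 (z + 1 * (RtoC r * cis y))%C); [ring|].
    specialize (K _ O). unfold cis; simpl. unfold Re in *. simpl. lra.
  - rewrite (H0 (z + - (1) * (RtoC r * cis y))%C); [ring|].
    specialize (K _ O). unfold cis; simpl. unfold Re in *. simpl. lra.
  - rewrite (H0 (z + - Ci * (RtoC r * cis y))%C); [ring|].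
    specialize (K _ O). unfold cis; simpl. unfold Re in *. simpl. lra.
  - rewrite (H0 (z + Ci * (RtoC r * cis y))%C); [ring|].
    specialize (K _ O). unfold cis; simpl. unfold Re in *. simpl. lra. }
assert (M := mean_value P r HP Hr).
rewrite (CI_ext _ (fun _ => 0%C)) in M by (intros; apply Hz). rewrite CI_const in M.
assert (E : P 0%C = 0%C).
{ pose proof PI_RGT_0. destruct (Ceq_dec (P 0%C) 0%C) as [|N]; auto. exfalso.
  apply (Cmult_neq_0 (RtoC (2 * PI)) (P 0%C)); auto.
  - intros E; apply RtoC_inj in E; lra.
  - rewrite <- M. ring. }
unfold P in E. rewrite !Cmult_0_r, Cplus_0_r in E.
destruct (Ceq_dec (h z) 0%C) as [|N]; auto. exfalso.
revert E. repeat apply Cmult_neq_0; auto.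
Qed.

(** * The functional equation of the theta function *)

(* Polya's proof: [walk m k] is the binomial coefficient of [2 m] over [m + k]. Summing it over
   a residue class modulo [s] counts walks on a cycle of length [s], which can also be computed
   from the eigenvalues [(2 cos (pi l / s)) ^ 2] of the cycle. With [m] of order [s ^ 2], both
   sides converge to theta series as [s] tends to infinity. *)
Fixpoint walk (m k : nat) : R :=
  match m with
  | O => match k with O => 1 | S _ => 0 end
  | S m' => match k with
            | O => 2 * walk m' 0 + 2 * walk m' 1
            | S k' => walk m' k' + 2 * walk m' (S k') + walk m' (S (S k'))
            end
  end.

(** The ratio of neighbouring binomial coefficients. All asymptotic information about [walk] is
    drawn from it. *)
Lemma walk_ratio m : forall k, (INR m + INR k + 1) * walk m (S k) = (INR m - INR k) * walk m k.
Proof.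
induction m as [|m IH]; intros k.
- destruct k; simpl; ring.
- destruct k as [|k].
  + pose proof (IH 0%nat) as H0. pose proof (IH 1%nat) as H1.
    rewrite S_INR. cbn -[INR] in *. simpl INR in *.
    set (a := walk m 0) in *; set (b := walk m 1) in *; set (c := walk m 2) in *.
    assert (E : (INR m + 1 + 0 + 1) * (a + 2 * b + c) - (INR m + 1 - 0) * (2 * a + 2 * b)
      = - ((INR m - 0) * a - (INR m + 0 + 1) * b) + ((INR m + 1 + 1) * c - (INR m - 1) * b)
      ) by ring.
    rewrite H0, H1 in E. lra.
  + pose proof (IH k) as H0. pose proof (IH (S k)) as H1. pose proof (IH (S (S k))) as H2.
    rewrite !S_INR in *. simpl walk.
    set (a := walk m k) in *; set (b := walk m (S k)) in *; set (c := walk m (S (S k))) in *;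
    set (d := walk m (S (S (S k)))) in *.
    assert (E : (INR m + 1 + (INR k + 1) + 1) * (b + 2 * c + d) - (INR m + 1 - (INR k + 1)) * (a + 2 * b + c)
      = ((INR m + INR k + 1) * b - (INR m - INR k) * a)
      + 2 * ((INR m + (INR k + 1) + 1) * c - (INR m - (INR k + 1)) * b)
      + ((INR m + (INR k + 1 + 1) + 1) * d - (INR m - (INR k + 1 + 1)) * c)) by ring.
    rewrite H0, H1, H2 in E. lra.
Qed.

Lemma walk_pos m : forall k, 0 <= walk m k.
Proof.
induction m as [|m IH]; intros [|k]; simpl; try lra.
- pose proof (IH 0%nat); pose proof (IH 1%nat); lra.
- pose proof (IH k); pose proof (IH (S k)); pose proof (IH (S (S k))); lra.
Qed.

Lemma walk_0_pos m : 0 < walk m 0.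
Proof. induction m as [|m IH]; simpl; [lra|]. pose proof (walk_pos m 1); lra. Qed.

Lemma walk_vanish m : forall k, (m < k)%nat -> walk m k = 0.
Proof.
induction m as [|m IH]; intros [|k] H; simpl; try lia; try lra.
rewrite !IH by lia. lra.
Qed.

Definition zwalk (m : nat) (j : Z) : R := walk m (Z.abs_nat j).

Lemma zwalk_S m j : zwalk (S m) j = zwalk m (j - 1) + 2 * zwalk m j + zwalk m (j + 1).
Proof.
unfold zwalk. destruct (Z.abs_nat j) as [|k] eqn:E.
- replace (Z.abs_nat (j - 1)) with 1%nat by lia.
  replace (Z.abs_nat (j + 1)) with 1%nat by lia. simpl. lra.
- simpl. destruct (Z_lt_le_dec j 0).
  + replace (Z.abs_nat (j - 1)) with (S (S k)) by lia.
    replace (Z.abs_nat (j + 1)) with k by lia. lra.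
  + replace (Z.abs_nat (j - 1)) with k by lia.
    replace (Z.abs_nat (j + 1)) with (S (S k)) by lia. lra.
Qed.

(** The sum over the residue class of [r] modulo [s], cut off at [N + 1] periods on either side; the
    cut is invisible as long as the walk cannot reach it. *)
Definition period_sum (s : Z) (N m : nat) (r : Z) : R :=
  zwalk m r + sum_f_R0 (fun i => zwalk m (r + s * Z.of_nat (S i)) + zwalk m (r - s * Z.of_nat (S i))) N.

Lemma period_sum_S s N m r : period_sum s N (S m) r =
  period_sum s N m (r - 1) + 2 * period_sum s N m r + period_sum s N m (r + 1).
Proof.
unfold period_sum. rewrite zwalk_S.
induction N as [|N IH].
- simpl sum_f_R0. rewrite !zwalk_S.
  replace (r - 1 + s * 1)%Z with (r + s * 1 - 1)%Z by ring.
  replace (r + 1 + s * 1)%Z with (r + s * 1 + 1)%Z by ring.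
  replace (r - 1 - s * 1)%Z with (r - s * 1 - 1)%Z by ring.
  replace (r + 1 - s * 1)%Z with (r - s * 1 + 1)%Z by ring. ring.
- rewrite !tech5. rewrite !zwalk_S. set (t := (s * Z.of_nat (S (S N)))%Z).
  replace (r - 1 + t)%Z with (r + t - 1)%Z by ring.
  replace (r + 1 + t)%Z with (r + t + 1)%Z by ring.
  replace (r - 1 - t)%Z with (r - t - 1)%Z by ring.
  replace (r + 1 - t)%Z with (r - t + 1)%Z by ring. lra.
Qed.

Lemma zwalk_0_neq j : j <> 0%Z -> zwalk 0 j = 0.
Proof. intros H. unfold zwalk. apply walk_vanish. lia. Qed.

Lemma period_sum_0_dvd s N q : (0 < s)%Z ->
  period_sum s N 0 (s * q) = if Z_le_dec (Z.abs q) (Z.of_nat (S N)) then 1 else 0.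
Proof.
intros Hs. unfold period_sum.
assert (K : forall a b, (a * s = b * s -> a = b)%Z) by (intros; nia).
assert (Z1 : forall a, (a <> 0)%Z -> zwalk 0 (s * a) = 0) by (intros a Ha; apply zwalk_0_neq; nia).
assert (Z2 : zwalk 0 0 = 1) by reflexivity.
induction N as [|N IH].
- simpl sum_f_R0.
  replace (s * q + s * 1)%Z with (s * (q + 1))%Z by ring.
  replace (s * q - s * 1)%Z with (s * (q - 1))%Z by ring.
  destruct (Z.eq_dec q 0) as [->|N0]; [|destruct (Z.eq_dec q 1) as [->|N1]; [|destruct (Z.eq_dec q (-1)) as [->|N2]]].
  + rewrite Z.mul_0_r, Z2, !Z1 by lia. destruct Z_le_dec; [lra|lia].
  + rewrite Z.mul_0_r, Z2, !Z1 by lia. destruct Z_le_dec; [lra|lia].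
  + rewrite Z.mul_0_r, Z2, !Z1 by lia. destruct Z_le_dec; [lra|lia].
  + rewrite !Z1 by lia. destruct Z_le_dec; [lia|lra].
- rewrite tech5, <- Rplus_assoc, IH.
  replace (s * q + s * Z.of_nat (S (S N)))%Z with (s * (q + Z.of_nat (S (S N))))%Z by ring.
  replace (s * q - s * Z.of_nat (S (S N)))%Z with (s * (q - Z.of_nat (S (S N))))%Z by ring.
  destruct (Z.eq_dec q (Z.of_nat (S (S N)))) as [->|N1];
   [|destruct (Z.eq_dec q (- Z.of_nat (S (S N)))) as [->|N2]].
  + rewrite Z.sub_diag, Z.mul_0_r, Z2, Z1 by lia. repeat destruct Z_le_dec; try lia; lra.
  + rewrite Z.add_opp_diag_l, Z.mul_0_r, Z2, Z1 by lia. repeat destruct Z_le_dec; try lia; lra.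
  + rewrite !Z1 by lia. repeat destruct Z_le_dec; try lia; lra.
Qed.

Lemma period_sum_0_ndvd s N r : ~ (s | r)%Z -> period_sum s N 0 r = 0.
Proof.
intros H. unfold period_sum.
rewrite zwalk_0_neq by (intros ->; apply H, Z.divide_0_r).
rewrite (sum_eq _ (fun _ => 0)).
- rewrite sum_cte; ring.
- intros i _. rewrite !zwalk_0_neq; [ring| |]; intros E; apply H.
  + exists (Z.of_nat (S i)); lia.
  + exists (- Z.of_nat (S i))%Z; lia.
Qed.

(** The same count from the spectrum of the cycle of odd length [2 j + 3]. The constant vector has
    eigenvalue 4, and the eigenvalues for [l] and [2 j + 3 - l] coincide, which leaves [j + 1] terms
    counted twice. *)
Definition cos_sum (j m : nat) (r : Z) : R :=
  / (2 * INR j + 3) * (4 ^ m + 2 * sum_f_R0 (fun l =>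
     (4 * cos (PI * INR (S l) / (2 * INR j + 3)) ^ 2) ^ m *
       cos (2 * (PI * INR (S l) / (2 * INR j + 3)) * IZR r)) j).

(** The addition formulas expand [4 cos^2 a cos (2 a b)] into the same three-term step that
    [zwalk_S] performs. *)
Lemma cos_sum_S j m r : cos_sum j (S m) r =
  cos_sum j m (r - 1) + 2 * cos_sum j m r + cos_sum j m (r + 1).
Proof.
unfold cos_sum. set (s := 2 * INR j + 3).
rewrite minus_IZR, plus_IZR.
assert (T : forall a b, 4 * cos a ^ 2 * cos (2 * a * b) =
   cos (2 * a * (b - 1)) + 2 * cos (2 * a * b) + cos (2 * a * (b + 1))).
{ intros a b. replace (2 * a * (b - 1)) with (2 * a * b - 2 * a) by ring.
  replace (2 * a * (b + 1)) with (2 * a * b + 2 * a) by ring.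
  rewrite cos_minus, cos_plus, (cos_2a_cos a). ring. }
match goal with |- / s * (4 ^ S m + 2 * ?A) = / s * (_ + 2 * ?B) + 2 * (/ s * (_ + 2 * ?D)) + / s * (_ + 2 * ?F) =>
 assert (E : A = B + 2 * D + F) end.
{ assert (T' : forall x, (4 * cos x ^ 2) ^ S m * cos (2 * x * IZR r) =
    (4 * cos x ^ 2) ^ m * cos (2 * x * (IZR r - 1)) + 2 * ((4 * cos x ^ 2) ^ m * cos (2 * x * IZR r))
    + (4 * cos x ^ 2) ^ m * cos (2 * x * (IZR r + 1))).
  { intros x. rewrite <- tech_pow_Rmult.
    transitivity ((4 * cos x ^ 2) ^ m * (4 * cos x ^ 2 * cos (2 * x * IZR r))); [ring|].
    rewrite T. ring. }
  clearbody s. generalize j. intros n; induction n as [|n IH].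
  - cbn [sum_f_R0]. rewrite T'. ring.
  - rewrite !tech5, IH, T'. ring. }
rewrite E. simpl. ring.
Qed.

Lemma dirichlet_kernel a n :
  (1 + 2 * sum_f_R0 (fun l => cos (INR (S l) * a)) n) * sin (a / 2) = sin ((INR n + 1 + / 2) * a).
Proof.
assert (T : forall x, 2 * cos (x * a) * sin (a / 2) = sin ((x + / 2) * a) - sin ((x - / 2) * a)).
{ intros x. replace ((x + / 2) * a) with (x * a + a / 2) by field.
  replace ((x - / 2) * a) with (x * a - a / 2) by field. rewrite sin_plus, sin_minus. ring. }
induction n as [|n IH].
- simpl. rewrite Rmult_plus_distr_r. rewrite T.
  replace ((1 - / 2) * a) with (a / 2) by field. replace ((0 + 1 + / 2) * a) with ((1 + / 2) * a) by ring. ring.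
- rewrite tech5, Rmult_plus_distr_l, <- Rplus_assoc, Rmult_plus_distr_r, IH, T.
  rewrite !S_INR. replace (INR n + 1 + 1 - / 2) with (INR n + 1 + / 2) by field. ring.
Qed.

(** Orthogonality of characters. With length [s], the Dirichlet kernel identity has right-hand side
    [sin (r PI) = 0], so either the bracket with the cosine sum vanishes or [sin (PI r / s) = 0],
    that is, [s] divides [r]. *)
Lemma cos_sum_0 j r : cos_sum j 0 r = if Zdivide_dec (2 * Z.of_nat j + 3) r then 1 else 0.
Proof.
unfold cos_sum. simpl pow.
assert (Hs : 0 < 2 * INR j + 3) by (pose proof (pos_INR j); lra).
assert (Es : IZR (2 * Z.of_nat j + 3) = 2 * INR j + 3) by (rewrite plus_IZR, mult_IZR, <- INR_IZR_INZ; ring).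
set (s := 2 * INR j + 3) in *.
rewrite (sum_eq _ (fun l => cos (INR (S l) * (2 * PI * IZR r / s)))).
2:{ intros l _. rewrite Rmult_1_l. f_equal. field. lra. }
destruct Zdivide_dec as [[q Hq]|Hn].
- rewrite (sum_eq _ (fun _ => 1)).
  + rewrite sum_cte, S_INR. unfold s. field. fold s; lra.
  + intros l _. rewrite Hq, mult_IZR, Es.
    replace (INR (S l) * (2 * PI * (IZR q * s) / s)) with (IZR (Z.of_nat (S l) * q) * (2 * PI)).
    2:{ rewrite mult_IZR, <- INR_IZR_INZ. field. lra. }
    generalize (Z.of_nat (S l) * q)%Z. intros z.
    replace (IZR z * (2 * PI)) with (2 * (IZR z * PI)) by ring. rewrite cos_2a_sin.
    replace (sin (IZR z * PI)) with 0; [ring|]. symmetry; apply sin_eq_0_1. now exists z.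
- pose proof (dirichlet_kernel (2 * PI * IZR r / s) j) as D.
  replace ((INR j + 1 + / 2) * (2 * PI * IZR r / s)) with (IZR r * PI) in D by (unfold s; field; fold s; lra).
  replace (sin (IZR r * PI)) with 0 in D by (symmetry; apply sin_eq_0_1; now exists r).
  apply Rmult_integral in D. destruct D as [D|D].
  + rewrite D. ring.
  + exfalso. apply Hn. apply sin_eq_0_0 in D. destruct D as [k Hk]. exists k.
    apply eq_IZR. rewrite mult_IZR, Es. pose proof PI_RGT_0.
    apply Rmult_eq_reg_r with PI; [|lra].
    replace (IZR k * s * PI) with (IZR k * PI * s) by ring. rewrite <- Hk. field. lra.
Qed.

(** Both sides obey the same recurrence in [m] and agree at [m = 0]. The inequality passes to the
    three neighbours with one step less, so the truncated range is never left. *)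
Lemma period_sum_cos_sum j N m : forall r, (Z.abs r + Z.of_nat m <= (2 * Z.of_nat j + 3) * Z.of_nat (S N))%Z ->
  period_sum (2 * Z.of_nat j + 3) N m r = cos_sum j m r.
Proof.
induction m as [|m IH]; intros r Hr.
- rewrite cos_sum_0. destruct Zdivide_dec as [[q Hq]|Hn].
  + subst r. rewrite (Z.mul_comm q), period_sum_0_dvd by lia.
    destruct Z_le_dec as [|n]; [reflexivity|]. exfalso. apply n. rewrite Z.abs_mul in Hr. nia.
  + now apply period_sum_0_ndvd.
- rewrite period_sum_S, cos_sum_S, !IH by lia. reflexivity.
Qed.

Definition walk_quot (j m i : nat) : R := walk m ((2 * j + 3) * S i) / walk m 0.
Definition cos_pow (j m l : nat) : R :=
  if le_dec l j then (cos (PI * INR (S l) / (2 * INR j + 3)) ^ 2) ^ m else 0.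

(** A discrete Poisson summation formula, taken at residue 0. Dividing by the central coefficient
    gives both sides the shape of [theta]. *)
Lemma poisson_discrete j m :
  (2 * INR j + 3) * (walk m 0 / 4 ^ m) * (1 + 2 * Series (walk_quot j m)) =
  1 + 2 * Series (cos_pow j m).
Proof.
pose proof (walk_0_pos m) as H0. assert (H4 : 0 < 4 ^ m) by (apply pow_lt; lra).
assert (Hs : 0 < 2 * INR j + 3) by (pose proof (pos_INR j); lra).
rewrite (Series_finite _ m).
2:{ intros n Hn. unfold walk_quot. rewrite walk_vanish by nia. unfold Rdiv; ring. }
rewrite (Series_finite _ j).
2:{ intros n Hn. unfold cos_pow. destruct le_dec; [lia|auto]. }
pose proof (period_sum_cos_sum j m m 0 ltac:(simpl Z.abs; nia)) as E.
unfold period_sum, cos_sum in E.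
rewrite (sum_eq _ (fun i => walk_quot j m i * (2 * walk m 0))) in E.
2:{ intros i _. unfold walk_quot, zwalk.
  replace (Z.abs_nat (0 + (2 * Z.of_nat j + 3) * Z.of_nat (S i))) with ((2 * j + 3) * S i)%nat by nia.
  replace (Z.abs_nat (0 - (2 * Z.of_nat j + 3) * Z.of_nat (S i))) with ((2 * j + 3) * S i)%nat by nia.
  field. lra. }
rewrite (sum_eq (fun l => _ * cos (_ * 0)) (fun l => cos_pow j m l * 4 ^ m)) in E.
2:{ intros l Hl. unfold cos_pow. destruct le_dec; [|lia]. rewrite Rmult_0_r, cos_0, Rpow_mult_distr. ring. }
rewrite <- !scal_sum in E. change (zwalk m 0) with (walk m 0) in E.
set (A := sum_f_R0 (walk_quot j m) m) in *. set (B := sum_f_R0 (cos_pow j m) j) in *.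
apply Rmult_eq_reg_r with (4 ^ m / (2 * INR j + 3)).
2:{ apply Rgt_not_eq. now apply Rdiv_lt_0_compat. }
transitivity (walk m 0 + 2 * walk m 0 * A); [field; lra|].
change (walk m (Z.abs_nat 0)) with (walk m 0) in E. unfold zwalk in E. simpl Z.abs_nat in E.
rewrite E. field. lra.
Qed.

(** Consecutive values have ratio [1 - (2 i + 1) / (m + i + 1)], at most the exponential of
    [- (2 i + 1) / (m + K)] for [i < K], and the first [k] odd numbers add up to [k ^ 2]. *)
Lemma walk_quot_upper m : forall k, (k <= m)%nat ->
  walk m k <= walk m 0 * exp (- (INR k ^ 2 / (INR m + INR k))).
Proof.
pose proof (walk_0_pos m) as H0.
assert (G : forall K k, (k <= K)%nat -> (K <= m)%nat -> (0 < m)%nat ->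
   walk m k <= walk m 0 * exp (- (INR k ^ 2 / (INR m + INR K)))).
{ intros K. induction k as [|k IH]; intros Hk HK Hm.
  - simpl. replace (- (0 * (0 * 1) / (INR m + INR K))) with 0 by (unfold Rdiv; ring). rewrite exp_0; lra.
  - specialize (IH ltac:(lia) HK Hm).
    pose proof (walk_ratio m k) as Hr. pose proof (walk_pos m k).
    assert (Hkm : INR k + 1 <= INR m) by (rewrite <- S_INR; apply le_INR; lia).
    assert (HkK : INR k + 1 <= INR K) by (rewrite <- S_INR; apply le_INR; lia).
    pose proof (pos_INR k).
    assert (E : walk m (S k) = (1 - (2 * INR k + 1) / (INR m + INR k + 1)) * walk m k).
    { apply Rmult_eq_reg_l with (INR m + INR k + 1); [|lra]. rewrite Hr. field. lra. }
    assert (D : (2 * INR k + 1) / (INR m + INR K) <= (2 * INR k + 1) / (INR m + INR k + 1)).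
    { apply Rmult_le_compat_l; [lra|]. apply Rinv_le_contravar; lra. }
    assert (X : 1 - (2 * INR k + 1) / (INR m + INR k + 1) <= exp (- ((2 * INR k + 1) / (INR m + INR K)))).
    { eapply Rle_trans; [|apply exp_ineq1_le]. lra. }
    rewrite E, S_INR.
    replace (- ((INR k + 1) ^ 2 / (INR m + INR K))) with
      (- ((2 * INR k + 1) / (INR m + INR K)) + - (INR k ^ 2 / (INR m + INR K))) by (field; lra).
    rewrite exp_plus.
    apply Rle_trans with (exp (- ((2 * INR k + 1) / (INR m + INR K))) * walk m k).
    + apply Rmult_le_compat_r; lra.
    + replace (walk m 0 * (exp (- ((2 * INR k + 1) / (INR m + INR K))) * exp (- (INR k ^ 2 / (INR m + INR K)))))
       with (exp (- ((2 * INR k + 1) / (INR m + INR K))) * (walk m 0 * exp (- (INR k ^ 2 / (INR m + INR K))))) by ring.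
      apply Rmult_le_compat_l; auto. apply Rlt_le, exp_pos. }
intros k Hk. destruct k as [|k].
- simpl. replace (- (0 * (0 * 1) / (INR m + 0))) with 0 by (unfold Rdiv; ring). rewrite exp_0; lra.
- apply G; lia.
Qed.

(** The inverse ratios [1 + (2 i + 1) / (m - i)] are bounded by exponentials in the same way. *)
Lemma walk_quot_lower m : forall K, (K < m)%nat ->
  walk m 0 * exp (- (INR K ^ 2 / (INR m - INR K))) <= walk m K.
Proof.
pose proof (walk_0_pos m) as H0.
assert (G : forall K k, (k <= K)%nat -> (K < m)%nat ->
   walk m 0 * exp (- (INR k ^ 2 / (INR m - INR K))) <= walk m k).
{ intros K. induction k as [|k IH]; intros Hk HK.
  - simpl. replace (- (0 * (0 * 1) / (INR m - INR K))) with 0 by (unfold Rdiv; ring). rewrite exp_0; lra.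
  - specialize (IH ltac:(lia) HK).
    pose proof (walk_ratio m k) as Hr. pose proof (walk_pos m k).
    assert (Hkm : INR K + 1 <= INR m) by (rewrite <- S_INR; apply le_INR; lia).
    assert (HkK : INR k + 1 <= INR K) by (rewrite <- S_INR; apply le_INR; lia).
    pose proof (pos_INR k).
    set (x := (2 * INR k + 1) / (INR m - INR K)).
    assert (E : walk m k = (1 + (2 * INR k + 1) / (INR m - INR k)) * walk m (S k)).
    { apply Rmult_eq_reg_l with (INR m - INR k); [|lra]. rewrite <- Hr. field. lra. }
    assert (D : (2 * INR k + 1) / (INR m - INR k) <= x).
    { apply Rmult_le_compat_l; [lra|]. apply Rinv_le_contravar; lra. }
    assert (X : 1 + (2 * INR k + 1) / (INR m - INR k) <= exp x).
    { eapply Rle_trans; [|apply exp_ineq1_le]. lra. }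
    rewrite S_INR.
    replace (- ((INR k + 1) ^ 2 / (INR m - INR K))) with
      (- x + - (INR k ^ 2 / (INR m - INR K))) by (unfold x; field; lra).
    rewrite exp_plus, exp_Ropp. pose proof (exp_pos x).
    apply Rmult_le_reg_l with (exp x); auto.
    apply Rle_trans with (walk m k).
    + eapply Rle_trans; [|apply IH]. apply Req_le. field. lra.
    + rewrite E. apply Rmult_le_compat_r; auto. apply walk_pos. }
intros K HK. apply G; lia.
Qed.

Lemma is_lim_seq_exp (u : nat -> R) l : is_lim_seq u (Finite l) -> is_lim_seq (fun n => exp (u n)) (exp l).
Proof.
intros H. apply (is_lim_seq_continuous exp u l); auto.
apply derivable_continuous_pt, derivable_pt_exp.
Qed.

Lemma is_lim_seq_inv0 (u : nat -> R) : is_lim_seq u p_infty -> is_lim_seq (fun n => / u n) 0.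
Proof. intros H. apply (is_lim_seq_inv u p_infty); auto. discriminate. Qed.

Definition theta (y : R) : R := 1 + 2 * Series (fun n => exp (- (PI * INR (S n) ^ 2 * y))).

Lemma ex_series_exp_lin (c : R) : 0 < c -> ex_series (fun n => exp (- (c * INR (S n)))).
Proof.
intros Hc.
apply (ex_series_ext (fun n => exp (- c) * exp (- c) ^ n)).
- intros n. eqR.  change (exp (- c) * exp (- c) ^ n) with (exp (- c) ^ S n).
  rewrite <- Rpower_pow by apply exp_pos. unfold Rpower. rewrite ln_exp. f_equal. ring.
- apply ex_series_scalR, ex_series_geom. rewrite Rabs_pos_eq by apply Rlt_le, exp_pos.
  rewrite <- exp_0. apply exp_increasing. lra.
Qed.

Section ThetaLimit.

Variable c : R.
Hypothesis Hc : 0 < c.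

Let s (j : nat) : R := 2 * INR j + 3.
(** The scaling [m = floor (c s^2)], in which both sides of the discrete formula converge to theta
    series. *)
Let mm (j : nat) : nat := proj1_sig (nfloor_ex (c * s j ^ 2) (Rmult_le_pos _ _ (Rlt_le _ _ Hc) (pow2_ge_0 _))).

Lemma theta_s_pos j : 3 <= s j.
Proof. unfold s; pose proof (pos_INR j); lra. Qed.

Lemma theta_mm j : INR (mm j) <= c * s j ^ 2 < INR (mm j) + 1.
Proof. unfold mm. destruct nfloor_ex as [n Hn]; simpl in *; auto. Qed.

Lemma theta_s_lim : is_lim_seq s p_infty.
Proof.
unfold s. apply is_lim_seq_plus with (l1 := p_infty) (l2 := 3).
- replace p_infty with (Rbar_mult 2 p_infty).
  + apply is_lim_seq_scal_l, is_lim_seq_INR.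
  + simpl. destruct Rle_dec; [|lra]. destruct Rle_lt_or_eq_dec; [auto|lra].
- apply is_lim_seq_const.
- reflexivity.
Qed.

Lemma theta_inv_s_lim : is_lim_seq (fun j => / s j) 0.
Proof. apply is_lim_seq_inv0, theta_s_lim. Qed.

Lemma theta_ratio_lim : is_lim_seq (fun j => INR (mm j) / s j ^ 2) c.
Proof.
apply is_lim_seq_le_le with (u := fun j => c - / s j * / s j) (w := fun _ => c).
- intros j. pose proof (theta_mm j). pose proof (theta_s_pos j).
  assert (0 < s j ^ 2) by nra. split.
  + apply Rmult_le_reg_r with (s j ^ 2); auto.
    replace ((c - / s j * / s j) * s j ^ 2) with (c * s j ^ 2 - 1) by (field; lra).
    replace (INR (mm j) / s j ^ 2 * s j ^ 2) with (INR (mm j)) by (field; lra). lra.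
  + apply Rmult_le_reg_r with (s j ^ 2); auto.
    replace (INR (mm j) / s j ^ 2 * s j ^ 2) with (INR (mm j)) by (field; lra). lra.
- replace (Finite c) with (Finite (c - 0 * 0)) by (f_equal; ring).
  apply is_lim_seq_minus'; [apply is_lim_seq_const|].
  apply is_lim_seq_mult'; apply theta_inv_s_lim.
- apply is_lim_seq_const.
Qed.

Lemma theta_mm_lim : is_lim_seq (fun j => INR (mm j)) p_infty.
Proof.
apply is_lim_seq_le_p_loc with (fun j => c * s j - 1).
- exists O. intros j _. pose proof (theta_mm j). pose proof (theta_s_pos j).
  assert (c * s j <= c * s j ^ 2) by (apply Rmult_le_compat_l; nra). lra.
- apply is_lim_seq_minus with (l1 := p_infty) (l2 := 1).
  + replace p_infty with (Rbar_mult c p_infty).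
    * apply is_lim_seq_scal_l, theta_s_lim.
    * simpl. destruct Rle_dec; [|lra]. destruct Rle_lt_or_eq_dec; [auto|lra].
  + apply is_lim_seq_const.
  + reflexivity.
Qed.

Lemma cos_pow_lim l : is_lim_seq (fun j => cos_pow j (mm j) l) (exp (- (PI * INR (S l) ^ 2 * (PI * c)))).
Proof.
pose proof PI_RGT_0 as Hpi.
assert (Hl : 0 < INR (S l)) by (rewrite S_INR; pose proof (pos_INR l); lra).
set (x := fun j => PI * INR (S l) / s j).
assert (Hx0 : is_lim_seq x 0).
{ unfold x. replace (Finite 0) with (Finite (PI * INR (S l) * 0)) by (f_equal; ring).
  apply is_lim_seq_mult'; [apply is_lim_seq_const|apply theta_inv_s_lim]. }
assert (Hxp : forall j, 0 < x j).
{ intros j. pose proof (theta_s_pos j). apply Rdiv_lt_0_compat; [nra|lra]. }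
set (y := fun j => sin (x j) ^ 2).
assert (Hsinc : is_lim_seq (fun j => sin (x j) / x j) 1).
{ apply (is_lim_comp_seq (fun t => sin t / t) x 0 1).
  - apply is_lim_sinc_0.
  - exists O. intros n _ E. specialize (Hxp n). injection E; lra.
  - auto. }
assert (Hy0 : is_lim_seq y 0).
{ apply is_lim_seq_ext with (fun j => (sin (x j) / x j * x j) * (sin (x j) / x j * x j)).
  - intros j. specialize (Hxp j). unfold y. field. lra.
  - replace (Finite 0) with (Finite ((1 * 0) * (1 * 0))) by (f_equal; ring).
    repeat apply is_lim_seq_mult'; auto. }
assert (Hmy : is_lim_seq (fun j => INR (mm j) * y j) (PI * INR (S l) ^ 2 * (PI * c))).
{ apply is_lim_seq_ext with (fun j => (PI * INR (S l)) ^ 2 * (INR (mm j) / s j ^ 2) * ((sin (x j) / x j) * (sin (x j) / x j))).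
  - intros j. pose proof (theta_s_pos j). unfold y, x. field. lra.
  - replace (Finite (PI * INR (S l) ^ 2 * (PI * c))) with (Finite ((PI * INR (S l)) ^ 2 * c * (1 * 1))) by (f_equal; ring).
    repeat apply is_lim_seq_mult'; auto using is_lim_seq_const, theta_ratio_lim. }
assert (Hy1 : eventually (fun j => y j < 1 / 2)).
{ apply is_lim_seq_spec in Hy0. destruct (Hy0 (mkposreal (1/2) ltac:(lra))) as [N HN].
  exists N; intros n Hn. specialize (HN n Hn). simpl in HN. revert HN. rewrite Rminus_0_r.
  intros HN. pose proof (Rle_abs (y n)). lra. }
destruct Hy1 as [N HN].
(* With [y = sin^2 x] the base [cos^2 x = 1 - y] lies between [exp (- y / (1 - y))] and [exp (- y)],
   while [m * y] converges and [y] tends to 0. *)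
assert (Hb : eventually (fun j => exp (- (INR (mm j) * y j) * / (1 - y j)) <= cos_pow j (mm j) l <= exp (- (INR (mm j) * y j)))).
{ exists (max l N). intros j Hj. specialize (HN j ltac:(lia)).
  unfold cos_pow. destruct le_dec; [|lia]. fold (s j). fold (x j).
  assert (Ey : cos (x j) ^ 2 = 1 - y j).
  { unfold y. pose proof (sin2_cos2 (x j)) as S2. unfold Rsqr in S2. simpl. lra. }
  rewrite Ey. assert (Hy : 0 <= y j) by apply pow2_ge_0.
  assert (Hexp : forall t n, exp t ^ n = exp (INR n * t)).
  { intros t n0. rewrite <- Rpower_pow by apply exp_pos. unfold Rpower. now rewrite ln_exp. }
  split.
  - replace (- (INR (mm j) * y j) * / (1 - y j)) with (INR (mm j) * (- (y j / (1 - y j)))) by (field; lra).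
    rewrite <- Hexp. apply pow_incr. split; [apply Rlt_le, exp_pos|].
    rewrite exp_Ropp. rewrite <- (Rinv_inv (1 - y j)). apply Rinv_le_contravar.
    + apply Rinv_0_lt_compat; lra.
    + eapply Rle_trans; [|apply exp_ineq1_le]. apply Req_le. field. lra.
  - replace (- (INR (mm j) * y j)) with (INR (mm j) * (- y j)) by ring.
    rewrite <- Hexp. apply pow_incr. split; [lra|]. eapply Rle_trans; [|apply exp_ineq1_le]. lra. }
apply is_lim_seq_le_le_loc with (1 := Hb).
- apply is_lim_seq_exp.
  replace (- (PI * INR (S l) ^ 2 * (PI * c))) with (- (PI * INR (S l) ^ 2 * (PI * c)) * / (1 - 0)) by (field).
  apply is_lim_seq_mult'.
  + apply (is_lim_seq_opp _ (Finite _)) in Hmy. exact Hmy.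
  + apply (is_lim_seq_inv (fun j => 1 - y j) (1 - 0)).
    * apply is_lim_seq_minus'; [apply is_lim_seq_const|auto].
    * intros E; injection E; lra.
- apply is_lim_seq_exp. apply (is_lim_seq_opp _ (Finite _)) in Hmy. exact Hmy.
Qed.

Lemma sin_ge_third x : 0 <= x <= PI / 2 -> x / 3 <= sin x.
Proof.
intros Hx. pose proof PI_4. destruct (sin_bound x 0) as [B _]; try lra.
unfold sin_approx, sin_term in B. simpl in B.
assert (x * (1 - x * x / 6) <= sin x).
{ eapply Rle_trans; [|apply B]. apply Req_le. field. }
assert (x * x <= 4) by nra. nra.
Qed.

(** As [l <= j] keeps the angle below [PI / 2], [sin x >= x / 3] gives an exponent quadratic in
    [l + 1], which is weakened to a linear one. The constant 18 is [2 * 3 ^ 2]: the 2 comes from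
    [m >= c s^2 / 2]. *)
Lemma cos_pow_dom : eventually (fun j => forall l, Rabs (cos_pow j (mm j) l) <= exp (- (c / 18 * INR (S l)))).
Proof.
pose proof theta_ratio_lim as HL. apply is_lim_seq_spec in HL.
destruct (HL (mkposreal (c / 2) ltac:(lra))) as [N HN]. exists N. intros j Hj l.
specialize (HN j Hj). change (Rabs (INR (mm j) / s j ^ 2 - c) < c / 2) in HN. apply Rabs_def2 in HN.
unfold cos_pow. destruct le_dec as [Hl|Hl].
2:{ rewrite Rabs_R0. apply Rlt_le, exp_pos. }
fold (s j). pose proof (theta_s_pos j). set (x := PI * INR (S l) / s j).
rewrite Rabs_pos_eq by (apply pow_le, pow2_ge_0).
assert (Hexp : forall t n, exp t ^ n = exp (INR n * t)).
{ intros t n0. rewrite <- Rpower_pow by apply exp_pos. unfold Rpower. now rewrite ln_exp. }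
assert (Hl1 : 1 <= INR (S l)) by (rewrite S_INR; pose proof (pos_INR l); lra).
assert (Hlj : INR (S l) <= s j / 2).
{ unfold s. rewrite S_INR. apply le_INR in Hl. lra. }
pose proof PI2_1 as P1. pose proof PI_RGT_0.
assert (Hx : 0 <= x <= PI / 2).
{ unfold x. split.
  - apply Rdiv_le_0_compat; nra.
  - apply Rmult_le_reg_r with (s j); [lra|]. replace (PI * INR (S l) / s j * s j) with (PI * INR (S l)) by (field; lra). nra. }
assert (Hsin := sin_ge_third x Hx).
apply Rle_trans with (exp (- (sin x ^ 2)) ^ mm j).
{ apply pow_incr. split; [apply pow2_ge_0|]. eapply Rle_trans; [|apply exp_ineq1_le].
  pose proof (sin2_cos2 x) as S2. unfold Rsqr in S2. simpl. lra. }
rewrite Hexp.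
assert (Q : c / 18 * INR (S l) <= INR (mm j) * sin x ^ 2).
{ assert (Q1 : (x / 3) ^ 2 <= sin x ^ 2) by (apply pow_incr; lra).
  assert (Q2 : c / 2 * s j ^ 2 <= INR (mm j)).
  { apply Rmult_le_reg_r with (/ s j ^ 2); [apply Rinv_0_lt_compat; nra|].
    replace (c / 2 * s j ^ 2 * / s j ^ 2) with (c / 2) by (field; lra). change (INR (mm j) * / s j ^ 2) with (INR (mm j) / s j ^ 2). lra. }
  apply Rle_trans with (c / 2 * s j ^ 2 * (x / 3) ^ 2).
  - replace (c / 2 * s j ^ 2 * (x / 3) ^ 2) with (c / 18 * (PI ^ 2 * INR (S l) ^ 2)) by (unfold x; field; lra).
    apply Rmult_le_compat_l; [lra|].
    assert (1 <= PI ^ 2) by nra. assert (INR (S l) <= INR (S l) ^ 2) by nra.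
    assert (0 <= INR (S l) ^ 2) by nra. nra.
  - apply Rmult_le_compat; auto; try nra. }
destruct (Rle_lt_or_eq_dec _ _ Q) as [Q'|Q'].
- apply Rlt_le, exp_increasing. lra.
- apply Req_le. f_equal. lra.
Qed.

Lemma walk_quot_lim i : is_lim_seq (fun j => walk_quot j (mm j) i) (exp (- (PI * INR (S i) ^ 2 * / (PI * c)))).
Proof.
pose proof PI_RGT_0 as Hpi.
set (K := fun j => ((2 * j + 3) * S i)%nat).
assert (EK : forall j, INR (K j) = s j * INR (S i)).
{ intros j. unfold K, s. rewrite mult_INR, plus_INR, mult_INR. simpl (INR 2). simpl (INR 3). ring. }
assert (Hi : 0 < INR (S i)) by (rewrite S_INR; pose proof (pos_INR i); lra).
assert (HKm : is_lim_seq (fun j => INR (K j) / s j ^ 2) 0).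
{ apply is_lim_seq_ext with (fun j => INR (S i) * / s j).
  - intros j. rewrite EK. pose proof (theta_s_pos j). field. lra.
  - replace (Finite 0) with (Finite (INR (S i) * 0)) by (f_equal; ring).
    apply is_lim_seq_mult'; [apply is_lim_seq_const|apply theta_inv_s_lim]. }
assert (Hev : eventually (fun j => INR (K j) < INR (mm j))).
{ assert (H := is_lim_seq_minus' _ _ _ _ theta_ratio_lim HKm).
  apply is_lim_seq_spec in H. destruct (H (mkposreal (c / 2) ltac:(lra))) as [N HN].
  exists N. intros j Hj. specialize (HN j Hj).
  change (Rabs (INR (mm j) / s j ^ 2 - INR (K j) / s j ^ 2 - (c - 0)) < c / 2) in HN. apply Rabs_def2 in HN.
  pose proof (theta_s_pos j). assert (0 < s j ^ 2) by nra.
  assert (P : 0 < (INR (mm j) / s j ^ 2 - INR (K j) / s j ^ 2) * s j ^ 2) by (apply Rmult_lt_0_compat; lra).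
  replace ((INR (mm j) / s j ^ 2 - INR (K j) / s j ^ 2) * s j ^ 2) with (INR (mm j) - INR (K j)) in P by (field; lra).
  lra. }
assert (Hb : eventually (fun j => exp (- (INR (S i) ^ 2 * / (INR (mm j) / s j ^ 2 - INR (K j) / s j ^ 2)))
   <= walk_quot j (mm j) i <= exp (- (INR (S i) ^ 2 * / (INR (mm j) / s j ^ 2 + INR (K j) / s j ^ 2))))).
{ destruct Hev as [N HN]. exists N. intros j Hj. specialize (HN j Hj).
  pose proof (theta_s_pos j) as Hs. pose proof (walk_0_pos (mm j)) as Hw. pose proof (pos_INR (K j)).
  assert (0 < INR (K j)) by (rewrite EK; nra).
  assert (U := walk_quot_upper (mm j) (K j)). assert (L := walk_quot_lower (mm j) (K j)).
  specialize (U ltac:(apply INR_le; lra)). specialize (L ltac:(apply INR_lt; lra)).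
  unfold walk_quot. fold (K j).
  replace (INR (S i) ^ 2 * / (INR (mm j) / s j ^ 2 - INR (K j) / s j ^ 2)) with (INR (K j) ^ 2 / (INR (mm j) - INR (K j))).
  2:{ rewrite EK in *. field. repeat split; lra. }
  replace (INR (S i) ^ 2 * / (INR (mm j) / s j ^ 2 + INR (K j) / s j ^ 2)) with (INR (K j) ^ 2 / (INR (mm j) + INR (K j))).
  2:{ rewrite EK in *. field. repeat split; lra. }
  split.
  - apply Rmult_le_reg_r with (walk (mm j) 0); auto.
    replace (walk (mm j) (K j) / walk (mm j) 0 * walk (mm j) 0) with (walk (mm j) (K j)) by (field; lra). lra.
  - apply Rmult_le_reg_r with (walk (mm j) 0); auto.
    replace (walk (mm j) (K j) / walk (mm j) 0 * walk (mm j) 0) with (walk (mm j) (K j)) by (field; lra). lra. }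
assert (El : forall u : nat -> R, is_lim_seq u (Finite c) ->
   is_lim_seq (fun j => exp (- (INR (S i) ^ 2 * / u j))) (exp (- (PI * INR (S i) ^ 2 * / (PI * c))))).
{ intros u Hu. apply is_lim_seq_exp.
  replace (- (PI * INR (S i) ^ 2 * / (PI * c))) with (- (INR (S i) ^ 2 * / c)) by (field; lra).
  assert (H : is_lim_seq (fun j => INR (S i) ^ 2 * / u j) (INR (S i) ^ 2 * / c)).
  { apply is_lim_seq_mult'; [apply is_lim_seq_const|].
    apply (is_lim_seq_inv u c); auto. intros E; injection E; lra. }
  apply (is_lim_seq_opp _ (Finite _)) in H. exact H. }
apply is_lim_seq_le_le_loc with (1 := Hb); apply El.
- replace c with (c - 0) by ring. apply is_lim_seq_minus'; auto using theta_ratio_lim.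
- replace c with (c + 0) by ring. apply is_lim_seq_plus'; auto using theta_ratio_lim.
Qed.

(** With [K = s (i + 1)], the exponent in [walk_quot_upper] is at least
    [K^2 / (2 c s^2) = (i + 1)^2 / (2 c)], because [K <= m <= c s^2] whenever the term is
    nonzero. *)
Lemma walk_quot_dom : eventually (fun j => forall i, Rabs (walk_quot j (mm j) i) <= exp (- (/ (4 * c) * INR (S i)))).
Proof.
pose proof theta_mm_lim as HL. apply is_lim_seq_spec in HL. destruct (HL 0) as [N HN].
exists N. intros j Hj i. specialize (HN j Hj). simpl in HN.
pose proof (walk_0_pos (mm j)) as Hw. unfold walk_quot. set (K := ((2 * j + 3) * S i)%nat).
assert (EK : INR K = s j * INR (S i)).
{ unfold K, s. rewrite mult_INR, plus_INR, mult_INR. simpl (INR 2). simpl (INR 3). ring. }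
pose proof (theta_s_pos j) as Hs. pose proof (theta_mm j) as Hm.
assert (Hl1 : 1 <= INR (S i)) by (rewrite S_INR; pose proof (pos_INR i); lra).
destruct (le_lt_dec K (mm j)) as [H|H].
2:{ rewrite walk_vanish by auto. unfold Rdiv; rewrite Rmult_0_l, Rabs_R0. apply Rlt_le, exp_pos. }
assert (U := walk_quot_upper (mm j) K H). apply le_INR in H.
rewrite Rabs_pos_eq by (apply Rdiv_le_0_compat; [apply walk_pos|auto]).
apply Rle_trans with (exp (- (INR K ^ 2 / (INR (mm j) + INR K)))).
- apply Rmult_le_reg_r with (walk (mm j) 0); auto.
  replace (walk (mm j) K / walk (mm j) 0 * walk (mm j) 0) with (walk (mm j) K) by (field; lra). lra.
- assert (Q : / (4 * c) * INR (S i) <= INR K ^ 2 / (INR (mm j) + INR K)).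
  { apply Rle_trans with (INR K ^ 2 / (2 * (c * s j ^ 2))).
    - replace (INR K ^ 2 / (2 * (c * s j ^ 2))) with (/ (4 * c) * (2 * INR (S i) ^ 2)) by (rewrite EK; field; lra).
      apply Rmult_le_compat_l; [|nra]. apply Rlt_le, Rinv_0_lt_compat; lra.
    - apply Rmult_le_compat_l; [apply pow2_ge_0|]. apply Rinv_le_contravar; [|lra].
      pose proof (pos_INR K); lra. }
  destruct (Rle_lt_or_eq_dec _ _ Q) as [Q'|Q'].
  + apply Rlt_le, exp_increasing. lra.
  + apply Req_le. f_equal. lra.
Qed.

(** Both series converge by Tannery's theorem; the discrete formula identifies their quotient with
    the rescaled central coefficient. *)
Lemma theta_limit : is_lim_seq (fun j => s j * (walk (mm j) 0 / 4 ^ mm j)) (theta (PI * c) / theta (/ (PI * c))).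
Proof.
pose proof PI_RGT_0 as Hpi.
assert (L1 : is_lim_seq (fun j => 1 + 2 * Series (cos_pow j (mm j))) (theta (PI * c))).
{ unfold theta. apply is_lim_seq_plus'; [apply is_lim_seq_const|].
  apply is_lim_seq_mult'; [apply is_lim_seq_const|].
  eapply (tannery (fun j => cos_pow j (mm j))); [apply cos_pow_lim| |apply cos_pow_dom].
  apply ex_series_exp_lin. lra. }
assert (L2 : is_lim_seq (fun j => 1 + 2 * Series (walk_quot j (mm j))) (theta (/ (PI * c)))).
{ unfold theta. apply is_lim_seq_plus'; [apply is_lim_seq_const|].
  apply is_lim_seq_mult'; [apply is_lim_seq_const|].
  eapply (tannery (fun j => walk_quot j (mm j))); [apply walk_quot_lim| |apply walk_quot_dom].
  apply ex_series_exp_lin. apply Rinv_0_lt_compat; lra. }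
assert (P2 : forall j, 1 <= 1 + 2 * Series (walk_quot j (mm j))).
{ intros j. rewrite (Series_finite _ (mm j)).
  - assert (0 <= sum_f_R0 (walk_quot j (mm j)) (mm j)); [|lra].
    apply cond_pos_sum. intros n. apply Rdiv_le_0_compat; [apply walk_pos|apply walk_0_pos].
  - intros n Hn. unfold walk_quot. rewrite walk_vanish by nia. unfold Rdiv; ring. }
assert (P3 : 1 <= theta (/ (PI * c))).
{ exact (is_lim_seq_le (fun _ => 1) _ (Finite 1) (Finite _) P2 (is_lim_seq_const 1) L2). }
apply is_lim_seq_ext with (fun j => (1 + 2 * Series (cos_pow j (mm j))) / (1 + 2 * Series (walk_quot j (mm j)))).
- intros j. specialize (P2 j). rewrite <- poisson_discrete. unfold s. field. split; [apply pow_nonzero; lra|lra].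
- apply is_lim_seq_div'; auto. lra.
Qed.

(** The square of the rescaled central coefficient is [m * (walk m 0 / 4 ^ m) ^ 2] divided by
    [m / s^2], so the theta quotient becomes known up to the constant [U]. *)
Lemma theta_quotient_sqr (U : R) :
  is_lim_seq (fun m => INR m * (walk m 0 / 4 ^ m) ^ 2) U ->
  (theta (PI * c) / theta (/ (PI * c))) ^ 2 = U / c.
Proof.
intros HU.
assert (Hmm : filterlim mm eventually eventually).
{ intros P [N HN]. pose proof theta_mm_lim as H. apply is_lim_seq_spec in H.
  destruct (H (INR N)) as [N' HN']. exists N'. intros j Hj. apply HN.
  apply INR_le. left. now apply HN'. }
assert (H1 : is_lim_seq (fun j => INR (mm j) * (walk (mm j) 0 / 4 ^ mm j) ^ 2) U).
{ now apply (is_lim_seq_subseq (fun m => INR m * (walk m 0 / 4 ^ m) ^ 2) U mm). }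
assert (H2 : is_lim_seq (fun j => (s j * (walk (mm j) 0 / 4 ^ mm j)) * (s j * (walk (mm j) 0 / 4 ^ mm j)))
   ((theta (PI * c) / theta (/ (PI * c))) * (theta (PI * c) / theta (/ (PI * c))))).
{ apply is_lim_seq_mult'; apply theta_limit. }
assert (H3 : is_lim_seq (fun j => (s j * (walk (mm j) 0 / 4 ^ mm j)) * (s j * (walk (mm j) 0 / 4 ^ mm j))) (U / c)).
{ apply is_lim_seq_ext_loc with (fun j => INR (mm j) * (walk (mm j) 0 / 4 ^ mm j) ^ 2 * / (INR (mm j) / s j ^ 2)).
  - pose proof theta_mm_lim as H. apply is_lim_seq_spec in H. destruct (H 0) as [N HN].
    exists N. intros j Hj. specialize (HN j Hj). pose proof (theta_s_pos j). field.
    repeat split; try lra. apply pow_nonzero; lra.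
  - apply is_lim_seq_mult'; auto. apply (is_lim_seq_inv _ c); [apply theta_ratio_lim|].
    intros E; injection E; lra. }
apply is_lim_seq_unique in H2. apply is_lim_seq_unique in H3. rewrite H2 in H3.
injection H3; intros E. simpl. rewrite Rmult_1_r. exact E.
Qed.

End ThetaLimit.

(** With [q m] the central probability, [m * q^2] increases while [(m + 1/2) * q^2] decreases. The
    value of the limit is read off later from the theta function itself. *)
Lemma central_walk_limit : exists U : R, is_lim_seq (fun m => INR m * (walk m 0 / 4 ^ m) ^ 2) U.
Proof.
set (q := fun m => walk m 0 / 4 ^ m).
assert (Hq : forall m, q (S m) = q m * (2 * INR m + 1) / (2 * INR m + 2)).
{ intros m. unfold q. pose proof (walk_ratio m 0) as H. simpl (INR 0) in H. simpl walk at 1.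
  pose proof (pos_INR m).
  assert (E : walk m 1 = INR m / (INR m + 1) * walk m 0).
  { apply Rmult_eq_reg_l with (INR m + 1); [|lra].
    replace (INR m + 1) with (INR m + 0 + 1) at 1 by ring. rewrite H. field. lra. }
  rewrite E. simpl pow. field. split; [apply pow_nonzero|]; lra. }
assert (Hq0 : forall m, 0 < q m) by (intros m; apply Rdiv_lt_0_compat; [apply walk_0_pos|apply pow_lt; lra]).
assert (Hv : forall m, (INR m + 1 / 2) * q m ^ 2 <= 1 / 2).
{ induction m as [|m IH]; [unfold q; simpl; lra|].
  eapply Rle_trans; [|apply IH]. rewrite Hq, S_INR. pose proof (pos_INR m). specialize (Hq0 m).
  replace ((INR m + 1 + 1 / 2) * (q m * (2 * INR m + 1) / (2 * INR m + 2)) ^ 2) with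
   (q m ^ 2 * ((INR m + 1 + 1 / 2) * ((2 * INR m + 1) / (2 * INR m + 2)) ^ 2)) by (field; lra).
  rewrite (Rmult_comm (INR m + 1 / 2)). apply Rmult_le_compat_l; [apply pow2_ge_0|].
  apply Rmult_le_reg_r with ((2 * INR m + 2) ^ 2); [nra|].
  replace ((INR m + 1 + 1 / 2) * ((2 * INR m + 1) / (2 * INR m + 2)) ^ 2 * (2 * INR m + 2) ^ 2)
    with ((INR m + 1 + 1 / 2) * (2 * INR m + 1) ^ 2) by (field; lra). nra. }
destruct (ex_finite_lim_seq_incr (fun m => INR m * q m ^ 2) (1 / 2)) as [U HU].
- intros m. rewrite Hq, S_INR. pose proof (pos_INR m). specialize (Hq0 m).
  replace ((INR m + 1) * (q m * (2 * INR m + 1) / (2 * INR m + 2)) ^ 2) with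
   (q m ^ 2 * ((INR m + 1) * ((2 * INR m + 1) / (2 * INR m + 2)) ^ 2)) by (field; lra).
  rewrite (Rmult_comm (INR m)). apply Rmult_le_compat_l; [apply pow2_ge_0|].
  apply Rmult_le_reg_r with ((2 * INR m + 2) ^ 2); [nra|].
  replace ((INR m + 1) * ((2 * INR m + 1) / (2 * INR m + 2)) ^ 2 * (2 * INR m + 2) ^ 2)
    with ((INR m + 1) * (2 * INR m + 1) ^ 2) by (field; lra). nra.
- intros m. eapply Rle_trans; [|apply (Hv m)]. pose proof (pow2_ge_0 (q m)). nra.
- now exists U.
Qed.

Lemma theta_pos y : 0 < y -> 1 <= theta y.
Proof.
intros Hy. unfold theta. pose proof PI_RGT_0.
assert (0 <= Series (fun n => exp (- (PI * INR (S n) ^ 2 * y)))); [|lra].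
apply Series_nonneg; [intros; apply Rlt_le, exp_pos|].
apply (ex_series_dom _ (fun n => exp (- (PI * y * INR (S n))))).
- intros n. rewrite Rabs_pos_eq by apply Rlt_le, exp_pos.
  assert (INR (S n) <= INR (S n) ^ 2) by (rewrite S_INR; pose proof (pos_INR n); nra).
  assert (Q : PI * y * INR (S n) <= PI * INR (S n) ^ 2 * y) by (assert (0 < PI * y) by nra; nra).
  destruct (Rle_lt_or_eq_dec _ _ Q) as [Q'|Q'].
  + apply Rlt_le, exp_increasing. lra.
  + apply Req_le. f_equal. lra.
- apply ex_series_exp_lin. nra.
Qed.

(** By positivity it suffices to compare squares, and the constant is fixed by [y = 1], where the
    theta quotient equals 1. *)
Theorem theta_functional_equation y : 0 < y -> theta (/ y) = sqrt y * theta y.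
Proof.
intros Hy. pose proof PI_RGT_0 as Hpi. destruct central_walk_limit as [U HU].
assert (K : forall z, 0 < z -> (theta z / theta (/ z)) ^ 2 = U * PI / z).
{ intros z Hz. pose proof (theta_quotient_sqr (z / PI) ltac:(now apply Rdiv_lt_0_compat) U HU) as E.
  replace (PI * (z / PI)) with z in E by (field; lra). rewrite E. field. lra. }
assert (HU1 : U * PI = 1).
{ pose proof (K 1 Rlt_0_1) as E. rewrite Rinv_1 in E. pose proof (theta_pos 1 Rlt_0_1).
  replace (theta 1 / theta 1) with 1 in E by (field; lra). lra. }
specialize (K y Hy). rewrite HU1 in K.
pose proof (theta_pos y Hy) as T1. pose proof (theta_pos (/ y) ltac:(now apply Rinv_0_lt_compat)) as T2.
pose proof (sqrt_lt_R0 y Hy) as Hs.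
assert (E : theta (/ y) ^ 2 = (sqrt y * theta y) ^ 2).
{ replace ((sqrt y * theta y) ^ 2) with (sqrt y * sqrt y * theta y ^ 2) by ring.
  rewrite sqrt_def by lra.
  replace (y * theta y ^ 2) with (y * (theta y / theta (/ y)) ^ 2 * theta (/ y) ^ 2) by (field; lra).
  rewrite K. field. lra. }
apply Rsqr_inj; [lra|nra|]. unfold Rsqr. simpl in E. lra.
Qed.

(** * Integrals over the line of exponentially decaying functions *)

Lemma exp_le x y : x <= y -> exp x <= exp y.
Proof.
intros H. destruct (Rle_lt_or_eq_dec _ _ H) as [H'| ->]; [|lra].
now apply Rlt_le, exp_increasing.
Qed.

Lemma is_derive_ray f z w l t : cdiff f (z + RtoC t * w)%C l ->
  is_derive (fun t => Re (f (z + RtoC t * w)%C)) t (Re (l * w)%C) /\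
  is_derive (fun t => Im (f (z + RtoC t * w)%C)) t (Im (l * w)%C).
Proof.
intros H.
assert (K : forall eps, 0 < eps -> exists d, 0 < d /\ forall h, Rabs h < d ->
  Cmod (f (z + RtoC (t + h) * w) - f (z + RtoC t * w) - RtoC h * (l * w))%C <= eps * Rabs h).
{ intros eps He. pose proof (Cmod_ge_0 w) as Hw.
  destruct (H (eps / (Cmod w + 1))) as [d [Hd Hh]]; [apply Rdiv_lt_0_compat; lra|].
  exists (d / (Cmod w + 1)). split; [apply Rdiv_lt_0_compat; lra|]. intros h Hhd.
  assert (E : Cmod (RtoC h * w) = Rabs h * Cmod w) by (now rewrite Cmod_mult, Cmod_R).
  pose proof (Rabs_pos h).
  specialize (Hh (RtoC h * w)%C). rewrite E in Hh.
  replace (z + RtoC t * w + RtoC h * w)%C with (z + RtoC (t + h) * w)%C in Hh by (rewrite RtoC_plus; ring).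
  replace (l * (RtoC h * w))%C with (RtoC h * (l * w))%C in Hh by ring.
  eapply Rle_trans; [apply Hh|].
  - apply Rle_lt_trans with (Rabs h * (Cmod w + 1)); [nra|].
    replace d with (d / (Cmod w + 1) * (Cmod w + 1)) by (field; lra).
    apply Rmult_lt_compat_r; lra.
  - apply Rle_trans with (eps / (Cmod w + 1) * (Rabs h * (Cmod w + 1))).
    + apply Rmult_le_compat_l; [apply Rlt_le, Rdiv_lt_0_compat; lra|]. nra.
    + apply Req_le; field; lra. }
split; apply is_derive_Reals; intros eps He; destruct (K (eps / 2)) as [d [Hd Hk]]; try lra;
 exists (mkposreal d Hd); intros h Hn Hh; specialize (Hk h Hh);
 assert (0 < Rabs h) by now apply Rabs_pos_lt.
- assert (B := Rle_trans _ _ _ (re_le_Cmod _) Hk).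
  set (A := f (z + RtoC (t + h) * w)%C) in *. set (A0 := f (z + RtoC t * w)%C) in *.
  replace ((Re A - Re A0) / h - Re (l * w)%C) with (Re (A - A0 - RtoC h * (l * w))%C / h).
  + unfold Rdiv. rewrite Rabs_mult, Rabs_inv. apply Rle_lt_trans with (eps / 2); [|lra].
    apply Rmult_le_reg_r with (Rabs h); auto. rewrite Rmult_assoc, Rinv_l by lra. lra.
  + unfold Re; simpl. field; auto.
- assert (B := Rle_trans _ _ _ (im_le_Cmod _) Hk).
  set (A := f (z + RtoC (t + h) * w)%C) in *. set (A0 := f (z + RtoC t * w)%C) in *.
  replace ((Im A - Im A0) / h - Im (l * w)%C) with (Im (A - A0 - RtoC h * (l * w))%C / h).
  + unfold Rdiv. rewrite Rabs_mult, Rabs_inv. apply Rle_lt_trans with (eps / 2); [|lra].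
    apply Rmult_le_reg_r with (Rabs h); auto. rewrite Rmult_assoc, Rinv_l by lra. lra.
  + unfold Im; simpl. field; auto.
Qed.

Lemma CI_derive F g a b : rc g ->
  (forall t, is_derive (fun t => Re (F t)) t (Re (g t)) /\ is_derive (fun t => Im (F t)) t (Im (g t))) ->
  CI g a b = (F b - F a)%C.
Proof.
intros Hg HF. unfold CI. apply injective_projections; simpl.
- apply is_RInt_unique. apply (is_RInt_derive (V := R_CompleteNormedModule) (fun t => Re (F t)) (fun t => Re (g t))).
  + intros t _; apply HF.
  + intros t _; apply Hg.
- apply is_RInt_unique. apply (is_RInt_derive (V := R_CompleteNormedModule) (fun t => Im (F t)) (fun t => Im (g t))).
  + intros t _; apply HF.
  + intros t _; apply Hg.
Qed.

Lemma rc_line f z w : holo f -> rc (fun t => f (z + RtoC t * w)%C).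
Proof.
intros H t. destruct (H (z + RtoC t * w)%C) as [l Hl].
destruct (is_derive_ray f z w l t Hl) as [H1 H2].
split; [refine (ex_derive_continuous (fun t => Re (f (z + RtoC t * w)%C)) t _)|
 refine (ex_derive_continuous (fun t => Im (f (z + RtoC t * w)%C)) t _)]; eexists; eauto.
Qed.

Lemma holo_Cexp : holo Cexp.
Proof. intros z; eexists; apply cdiff_Cexp. Qed.

Lemma rc_Cexp_lin c : rc (fun t => Cexp (c * RtoC t)%C).
Proof.
apply (rc_ext (fun t => Cexp (0 + RtoC t * c)%C)); [intros t; f_equal; ring|].
apply rc_line, holo_Cexp.
Qed.

Lemma CI_Cexp (c : C) (a b : R) : c <> RtoC 0 ->
  CI (fun t => Cexp (c * RtoC t)%C) a b = ((Cexp (c * RtoC b) - Cexp (c * RtoC a)) / c)%C.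
Proof.
intros Hc.
rewrite (CI_derive (fun t => / c * Cexp (0 + RtoC t * c))%C).
- replace (0 + RtoC b * c)%C with (c * RtoC b)%C by ring.
  replace (0 + RtoC a * c)%C with (c * RtoC a)%C by ring. field; auto.
- apply rc_Cexp_lin.
- intros t.
  destruct (is_derive_ray (fun z => / c * Cexp z)%C 0 c (/ c * Cexp (0 + RtoC t * c))%C t) as [H1 H2].
  { apply cdiff_scal, cdiff_Cexp. }
  replace (/ c * Cexp (0 + RtoC t * c) * c)%C with (Cexp (c * RtoC t)) in H1, H2.
  2:{ replace (0 + RtoC t * c)%C with (c * RtoC t)%C by ring. field; auto. }
  split; assumption.
Qed.

Lemma Cmod_CI_dom f (h : R -> R) a b : a <= b -> rc f -> (forall t, continuous h t) ->
  (forall t, a <= t <= b -> Cmod (f t) <= h t) -> Cmod (CI f a b) <= RInt h a b.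
Proof.
intros Hab Hf Hh HM. set (z := CI f a b).
assert (Eh : ex_RInt h a b) by (apply (ex_RInt_continuous (V := R_CompleteNormedModule)); auto).
assert (HM0 : 0 <= RInt h a b).
{ apply RInt_ge_0; auto. intros t Ht. eapply Rle_trans; [apply Cmod_ge_0|]. apply HM; lra. }
destruct (Req_dec (Cmod z) 0) as [E|E]; [lra|].
assert (Hz : 0 < Cmod z) by (pose proof (Cmod_ge_0 z); lra).
assert (H : (Cconj z * z)%C = CI (fun t => Cconj z * f t)%C a b)
  by (symmetry; now apply CI_scal).
assert (H2 : Cmod z * Cmod z <= Cmod z * RInt h a b).
{ replace (Cmod z * Cmod z) with (RInt (fun t => Re (Cconj z * f t)%C) a b).
  2:{ change (RInt (fun t => Re (Cconj z * f t)%C) a b) with (fst (CI (fun t => Cconj z * f t)%C a b)).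
      rewrite <- H. rewrite Cmult_comm, <- Cmod2_conj. simpl. ring. }
  replace (Cmod z * RInt h a b) with (RInt (fun t => Cmod z * h t) a b)
   by exact (RInt_scal (V := R_CompleteNormedModule) h a b (Cmod z) Eh).
  apply RInt_le; auto.
  - apply (rc_re (fun t => Cconj z * f t)%C). apply rc_mult; auto using rc_const.
  - exact (ex_RInt_scal (V := R_NormedModule) h a b (Cmod z) Eh).
  - intros t Ht. eapply Rle_trans; [apply Rle_abs|].
    eapply Rle_trans; [apply re_le_Cmod|]. rewrite Cmod_mult, Cmod_conj.
    apply Rmult_le_compat_l; [apply Cmod_ge_0|]. apply HM; lra. }
apply Rmult_le_reg_l with (Cmod z); auto.
Qed.

Lemma RInt_exp_lin k a b : k <> 0 -> RInt (fun t => exp (k * t)) a b = (exp (k * b) - exp (k * a)) / k.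
Proof.
intros Hk. apply is_RInt_unique.
replace ((exp (k * b) - exp (k * a)) / k) with (minus (exp (k * b) / k) (exp (k * a) / k))
  by (unfold minus, plus, opp; simpl; field; auto).
apply (is_RInt_derive (V := R_CompleteNormedModule) (fun t => exp (k * t) / k)).
- intros x _. auto_derive; auto. field; auto.
- intros x _. apply (ex_derive_continuous (fun t => exp (k * t))). auto_derive; auto.
Qed.

(** The two ends of the interval move independently, which makes the limit stable under shifts of
    the variable. *)
Definition isJ (g : R -> C) (l : C) : Prop :=
  forall eps, 0 < eps -> exists M, 0 <= M /\ forall a b, a <= - M -> M <= b ->
    Cmod (CI g a b - l)%C < eps.

Definition decays (g : R -> C) (K d : R) : Prop := forall t, Cmod (g t) <= K * exp (- d * Rabs t).
Definition tame (g : R -> C) : Prop := rc g /\ exists K d, 0 < d /\ decays g K d.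
(** The improper integral over the line as a total function; for [tame] integrands [J_spec] gives it
    its meaning. *)
Definition J (g : R -> C) : C := epsilon (inhabits (RtoC 0)) (isJ g).

Lemma isJ_unique g l l' : isJ g l -> isJ g l' -> l = l'.
Proof.
intros H H'.
assert (E : (l - l')%C = 0%C).
{ apply Cmod_eq_0, Rle_antisym; [|apply Cmod_ge_0]. apply Rnot_lt_le; intros Hp.
  destruct (H _ (Rmult_lt_0_compat _ (/2) Hp ltac:(lra))) as [M [HM0 HM]].
  destruct (H' _ (Rmult_lt_0_compat _ (/2) Hp ltac:(lra))) as [M' [HM0' HM']].
  pose proof (Rmax_l M M'); pose proof (Rmax_r M M').
  specialize (HM (- Rmax M M') (Rmax M M') ltac:(lra) ltac:(lra)).
  specialize (HM' (- Rmax M M') (Rmax M M') ltac:(lra) ltac:(lra)).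
  set (z := CI g _ _) in *.
  assert (T : Cmod (l - l') <= Cmod (z - l') + Cmod (z - l)).
  { replace (l - l')%C with ((z - l') + - (z - l))%C by ring.
    eapply Rle_trans; [apply Cmod_triangle|]. rewrite Cmod_opp. lra. }
  lra. }
replace l with ((l - l') + l')%C by ring. rewrite E; ring.
Qed.

Lemma decays_nonneg g K d : decays g K d -> 0 <= K.
Proof.
intros H. specialize (H 0). rewrite Rabs_R0, Rmult_0_r, exp_0, Rmult_1_r in H.
eapply Rle_trans; [apply Cmod_ge_0|apply H].
Qed.

Lemma tail_right g K d a b : rc g -> 0 < d -> decays g K d -> 0 <= a <= b ->
  Cmod (CI g a b) <= K / d * exp (- d * a).
Proof.
intros Hg Hd HK Hab. pose proof (decays_nonneg g K d HK) as HK0.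
assert (B : Cmod (CI g a b) <= RInt (fun t => K * exp (- d * t)) a b).
{ apply Cmod_CI_dom; auto; try lra.
  - intros t. apply (ex_derive_continuous (fun t => K * exp (- d * t))). auto_derive; auto.
  - intros t Ht. specialize (HK t). rewrite Rabs_pos_eq in HK by lra. exact HK. }
assert (E : RInt (fun t => K * exp (- d * t)) a b = K * ((exp (- d * b) - exp (- d * a)) / - d)).
{ rewrite <- RInt_exp_lin by lra.
  apply (RInt_scal (V := R_CompleteNormedModule)). apply (ex_RInt_continuous (V := R_CompleteNormedModule)).
  intros t _. apply (ex_derive_continuous (fun t => exp (- d * t))). auto_derive; auto. }
rewrite E in B. eapply Rle_trans; [apply B|].
replace (K * ((exp (- d * b) - exp (- d * a)) / - d)) with (K / d * exp (- d * a) - K / d * exp (- d * b)) by (field; lra).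
assert (0 <= K / d * exp (- d * b)); [|lra].
apply Rmult_le_pos; [now apply Rdiv_le_0_compat|apply Rlt_le, exp_pos].
Qed.

Lemma rc_opp_arg g : rc g -> rc (fun t => g (- t)).
Proof.
intros H t. destruct (H (- t)) as [H1 H2].
split; [apply (continuous_comp Ropp (fun t => Re (g t)))|apply (continuous_comp Ropp (fun t => Im (g t)))]; auto;
 apply (ex_derive_continuous Ropp); auto_derive; auto.
Qed.

Lemma RInt_opp_arg (f : R -> R) a b : (forall t, continuous f t) -> RInt (fun t => f (- t)) a b = RInt f (- b) (- a).
Proof.
intros H.
assert (Ex : forall u v, ex_RInt f u v) by (intros; apply (ex_RInt_continuous (V := R_CompleteNormedModule)); auto).
assert (E := RInt_comp_lin (V := R_CompleteNormedModule) f (-1) 0 a b (Ex _ _)).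
replace (-1 * a + 0) with (- a) in E by ring. replace (-1 * b + 0) with (- b) in E by ring.
rewrite <- (opp_RInt_swap f (- a) (- b)) by apply Ex. rewrite <- E.
rewrite (RInt_ext (V := R_CompleteNormedModule) (fun t => f (- t)) (fun t => f (-1 * t + 0))).
2:{ intros t _. f_equal. ring. }
rewrite (RInt_scal (V := R_CompleteNormedModule) (fun t => f (-1 * t + 0))).
- assert (A : forall x : R, x = - (-1 * x)) by (intros; ring). apply A.
- apply (ex_RInt_continuous (V := R_CompleteNormedModule)). intros z _.
  apply (continuous_comp (fun t => -1 * t + 0) f); auto.
  apply (ex_derive_continuous (fun t => -1 * t + 0)); auto_derive; auto.
Qed.

Lemma CI_opp_arg g a b : rc g -> CI (fun t => g (- t)) a b = CI g (- b) (- a).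
Proof.
intros H. unfold CI. f_equal.
- apply (RInt_opp_arg (fun t => Re (g t))). apply H.
- apply (RInt_opp_arg (fun t => Im (g t))). apply H.
Qed.

Lemma decays_opp_arg g K d : decays g K d -> decays (fun t => g (- t)) K d.
Proof. intros H t. rewrite <- Rabs_Ropp. apply H. Qed.

Lemma tail_left g K d a b : rc g -> 0 < d -> decays g K d -> a <= b <= 0 ->
  Cmod (CI g a b) <= K / d * exp (d * b).
Proof.
intros Hg Hd HK Hab.
replace (CI g a b) with (CI (fun t => g (- t)) (- b) (- a)).
- replace (d * b) with (- d * - b) by ring.
  apply tail_right; auto using rc_opp_arg, decays_opp_arg. lra.
- rewrite CI_opp_arg, !Ropp_involutive by auto. reflexivity.
Qed.

Lemma tame_split g K d n a b : rc g -> 0 < d -> decays g K d -> 0 <= n -> a <= - n -> n <= b ->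
  Cmod (CI g a b - CI g (- n) n)%C <= 2 * (K / d) * exp (- d * n).
Proof.
intros Hg Hd HK Hn Ha Hb.
rewrite <- (CI_Chasles g a (- n) b), <- (CI_Chasles g (- n) n b) by auto.
replace (CI g a (- n) + (CI g (- n) n + CI g n b) - CI g (- n) n)%C with (CI g a (- n) + CI g n b)%C by ring.
eapply Rle_trans; [apply Cmod_triangle|].
assert (T1 := tail_left g K d a (- n) Hg Hd HK ltac:(lra)).
assert (T2 := tail_right g K d n b Hg Hd HK ltac:(lra)).
replace (d * - n) with (- d * n) in T1 by ring. lra.
Qed.

Lemma exp_decay_small d eps K : 0 < d -> 0 < eps -> exists n : nat, forall m, INR n <= m -> K * exp (- d * m) < eps.
Proof.
intros Hd He.
assert (Hk : 0 < Rabs K + 1) by (pose proof (Rabs_pos K); lra).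
destruct (nfloor_ex (Rmax 0 (ln ((Rabs K + 1) / eps) / d)) (Rmax_l _ _)) as [n [_ Hn]].
exists (S n). intros m Hm. rewrite S_INR in Hm.
assert (L : ln ((Rabs K + 1) / eps) < d * m).
{ pose proof (Rmax_r 0 (ln ((Rabs K + 1) / eps) / d)).
  assert (Hx : ln ((Rabs K + 1) / eps) / d < m) by lra.
  apply Rmult_lt_compat_r with (r := d) in Hx; auto.
  replace (ln ((Rabs K + 1) / eps) / d * d) with (ln ((Rabs K + 1) / eps)) in Hx by (field; lra). lra. }
apply exp_increasing in L. rewrite exp_ln in L by now apply Rdiv_lt_0_compat.
assert (Hp := exp_pos (d * m)).
apply Rle_lt_trans with (Rabs K * exp (- d * m)).
{ apply Rmult_le_compat_r; [apply Rlt_le, exp_pos|apply Rle_abs]. }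
replace (- d * m) with (- (d * m)) by ring. rewrite exp_Ropp.
apply Rmult_lt_reg_r with (exp (d * m)); auto.
rewrite Rmult_assoc, Rinv_l, Rmult_1_r by lra.
apply Rmult_lt_compat_r with (r := eps) in L; auto.
replace ((Rabs K + 1) / eps * eps) with (Rabs K + 1) in L by (field; lra). lra.
Qed.

Lemma J_spec g : tame g -> isJ g (J g).
Proof.
intros [Hg [K [d [Hd HK]]]]. unfold J. apply epsilon_spec.
set (S := fun n : nat => CI g (- INR n) (INR n)).
assert (HS : forall eps, 0 < eps -> exists n0 : nat, forall a b, a <= - INR n0 -> INR n0 <= b ->
   Cmod (CI g a b - S n0)%C < eps).
{ intros eps He. destruct (exp_decay_small d eps (2 * (K / d)) Hd He) as [n Hn].
  exists n. intros a b Ha Hb. eapply Rle_lt_trans; [apply (tame_split g K d); auto; apply pos_INR|].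
  apply Hn; lra. }
assert (HC : forall eps, 0 < eps -> exists n0 : nat, forall n, (n0 <= n)%nat -> Cmod (S n - S n0)%C < eps).
{ intros eps He. destruct (HS eps He) as [n0 Hn]. exists n0. intros n Hnn. apply le_INR in Hnn.
  apply Hn; lra. }
assert (CR : Cauchy_crit (fun n => Re (S n))).
{ intros eps He. destruct (HC (eps / 2)) as [n0 Hn]; [lra|]. exists n0. intros n m Hn1 Hm1.
  assert (A := Rle_lt_trans _ _ _ (re_le_Cmod _) (Hn n Hn1)).
  assert (B := Rle_lt_trans _ _ _ (re_le_Cmod _) (Hn m Hm1)).
  change (Rabs (Re (S n) - Re (S n0)) < eps / 2) in A. change (Rabs (Re (S m) - Re (S n0)) < eps / 2) in B.
  unfold Rdist. revert A B. unfold Rabs; repeat destruct Rcase_abs; lra. }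
assert (CI' : Cauchy_crit (fun n => Im (S n))).
{ intros eps He. destruct (HC (eps / 2)) as [n0 Hn]; [lra|]. exists n0. intros n m Hn1 Hm1.
  assert (A := Rle_lt_trans _ _ _ (im_le_Cmod _) (Hn n Hn1)).
  assert (B := Rle_lt_trans _ _ _ (im_le_Cmod _) (Hn m Hm1)).
  change (Rabs (Im (S n) - Im (S n0)) < eps / 2) in A. change (Rabs (Im (S m) - Im (S n0)) < eps / 2) in B.
  unfold Rdist. revert A B. unfold Rabs; repeat destruct Rcase_abs; lra. }
destruct (Rcomplete.R_complete _ CR) as [lr Hlr]. destruct (Rcomplete.R_complete _ CI') as [li Hli].
exists (lr, li). intros eps He.
destruct (HC (eps / 4)) as [n0 Hn0]; [lra|].
destruct (exp_decay_small d (eps / 4) (2 * (K / d)) Hd ltac:(lra)) as [n1 Hn1].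
destruct (Hlr (eps / 4)) as [n2 Hn2]; [lra|]. destruct (Hli (eps / 4)) as [n3 Hn3]; [lra|].
set (n := (n1 + n2 + n3)%nat).
exists (INR n). split; [apply pos_INR|]. intros a b Ha Hb.
assert (T : Cmod (CI g a b - S n)%C < eps / 4).
{ eapply Rle_lt_trans; [apply (tame_split g K d); auto; apply pos_INR|]. apply Hn1. apply le_INR; unfold n; lia. }
specialize (Hn2 n ltac:(unfold n; lia)). specialize (Hn3 n ltac:(unfold n; lia)). unfold Rdist in Hn2, Hn3.
assert (T2 : Cmod (S n - (lr, li))%C < eps / 2).
{ eapply Rle_lt_trans; [apply Cmod_le_abs|].
  change (Rabs (Re (S n) - lr) + Rabs (Im (S n) - li) < eps / 2). lra. }
replace (CI g a b - (lr, li))%C with ((CI g a b - S n) + (S n - (lr, li)))%C by ring.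
eapply Rle_lt_trans; [apply Cmod_triangle|]. lra.
Qed.

Lemma J_unique g l : isJ g l -> J g = l.
Proof.
intros H. apply (isJ_unique g); auto. unfold J. apply epsilon_spec. now exists l.
Qed.

Lemma J_bound g K d : rc g -> 0 < d -> decays g K d -> Cmod (J g) <= 2 * K / d.
Proof.
intros Hg Hd HK. assert (HJ : isJ g (J g)) by (apply J_spec; split; eauto).
pose proof (decays_nonneg g K d HK) as HK0.
apply Rnot_lt_le. intros Hp.
destruct (HJ (Cmod (J g) - 2 * K / d)) as [M [HM0 HM]]; [lra|].
specialize (HM (- M) M ltac:(lra) ltac:(lra)).
rewrite <- (CI_Chasles g (- M) 0 M) in HM by auto.
assert (T1 := tail_left g K d (- M) 0 Hg Hd HK ltac:(lra)).
assert (T2 := tail_right g K d 0 M Hg Hd HK ltac:(lra)).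
rewrite Rmult_0_r, exp_0 in T1, T2.
assert (Cmod (J g) <= Cmod (CI g (- M) 0 + CI g 0 M - J g) + Cmod (CI g (- M) 0 + CI g 0 M)).
{ replace (J g) with (- (CI g (- M) 0 + CI g 0 M - J g) + (CI g (- M) 0 + CI g 0 M))%C at 1 by ring.
  eapply Rle_trans; [apply Cmod_triangle|]. rewrite Cmod_opp. lra. }
pose proof (Cmod_triangle (CI g (- M) 0) (CI g 0 M)).
replace (2 * K / d) with (K / d * 1 + K / d * 1) in HM by (field; lra). lra.
Qed.

Lemma tame_plus f g : tame f -> tame g -> tame (fun t => f t + g t)%C.
Proof.
intros [Hf [K [d [Hd HK]]]] [Hg [K' [d' [Hd' HK']]]]. split; [now apply rc_plus|].
exists (K + K'), (Rmin d d'). split; [now apply Rmin_pos|]. intros t.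
pose proof (decays_nonneg f K d HK). pose proof (decays_nonneg g K' d' HK').
eapply Rle_trans; [apply Cmod_triangle|]. specialize (HK t); specialize (HK' t).
pose proof (Rmin_l d d'); pose proof (Rmin_r d d'). pose proof (Rabs_pos t).
assert (exp (- d * Rabs t) <= exp (- Rmin d d' * Rabs t)) by (apply exp_le; nra).
assert (exp (- d' * Rabs t) <= exp (- Rmin d d' * Rabs t)) by (apply exp_le; nra). nra.
Qed.

Lemma tame_scal c f : tame f -> tame (fun t => c * f t)%C.
Proof.
intros [Hf [K [d [Hd HK]]]]. split; [apply rc_mult; auto using rc_const|].
exists (Cmod c * K), d. split; auto. intros t. rewrite Cmod_mult, Rmult_assoc.
apply Rmult_le_compat_l; [apply Cmod_ge_0|]. apply HK.
Qed.

Lemma J_plus f g : tame f -> tame g -> J (fun t => f t + g t)%C = (J f + J g)%C.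
Proof.
intros Hf Hg. apply J_unique. intros eps He.
destruct (J_spec f Hf (eps / 2)) as [M [HM0 HM]]; [lra|].
destruct (J_spec g Hg (eps / 2)) as [M' [HM0' HM']]; [lra|].
pose proof (Rmax_l M M'); pose proof (Rmax_r M M').
exists (Rmax M M'). split; [lra|]. intros a b Ha Hb.
rewrite CI_plus by (apply Hf || apply Hg).
specialize (HM a b ltac:(lra) ltac:(lra)). specialize (HM' a b ltac:(lra) ltac:(lra)).
replace (CI f a b + CI g a b - (J f + J g))%C with ((CI f a b - J f) + (CI g a b - J g))%C by ring.
eapply Rle_lt_trans; [apply Cmod_triangle|]. lra.
Qed.

Lemma J_scal c f : tame f -> J (fun t => c * f t)%C = (c * J f)%C.
Proof.
intros Hf. apply J_unique. intros eps He. pose proof (Cmod_ge_0 c).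
destruct (J_spec f Hf (eps / (Cmod c + 1))) as [M [HM0 HM]]; [apply Rdiv_lt_0_compat; lra|].
exists M. split; auto. intros a b Ha Hb. rewrite CI_scal by apply Hf.
specialize (HM a b Ha Hb).
replace (c * CI f a b - c * J f)%C with (c * (CI f a b - J f))%C by ring. rewrite Cmod_mult.
apply Rle_lt_trans with (Cmod c * (eps / (Cmod c + 1))); [apply Rmult_le_compat_l; lra|].
apply Rmult_lt_reg_r with (Cmod c + 1); [lra|].
replace (Cmod c * (eps / (Cmod c + 1)) * (Cmod c + 1)) with (Cmod c * eps) by (field; lra). nra.
Qed.

Lemma J_ext f g : (forall t, f t = g t) -> J f = J g.
Proof. intros H. f_equal. now apply functional_extensionality. Qed.

Lemma tame_ext f g : (forall t, f t = g t) -> tame f -> tame g.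
Proof. intros H. now rewrite (functional_extensionality f g H). Qed.

Lemma J_shift g c : tame g -> J (fun t => g (t + c)) = J g.
Proof.
intros Hg. apply J_unique. intros eps He.
destruct (J_spec g Hg eps He) as [M [HM0 HM]]. exists (M + Rabs c).
pose proof (Rabs_pos c). split; [lra|]. intros a b Ha Hb.
assert (E : CI (fun t => g (t + c)) a b = CI g (a + c) (b + c)).
{ destruct Hg as [Hg _].
  assert (X : forall f : R -> R, (forall t, continuous f t) -> RInt (fun t => f (t + c)) a b = RInt f (a + c) (b + c)).
  { intros f Hf. pose proof (RInt_comp_lin (V := R_CompleteNormedModule) f 1 c a b) as L.
    rewrite !Rmult_1_l in L. rewrite <- L.
    - apply RInt_ext. intros t _. change (f (t + c) = 1 * f (1 * t + c)). now rewrite !Rmult_1_l.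
    - apply (ex_RInt_continuous (V := R_CompleteNormedModule)); auto. }
  unfold CI. f_equal; [apply (X (fun t => Re (g t)))|apply (X (fun t => Im (g t)))]; apply Hg. }
rewrite E. apply HM; revert Ha Hb; unfold Rabs; destruct Rcase_abs; lra.
Qed.

Lemma J_opp_arg g : tame g -> J (fun t => g (- t)) = J g.
Proof.
intros Hg. apply J_unique. intros eps He.
destruct (J_spec g Hg eps He) as [M [HM0 HM]]. exists M. split; auto. intros a b Ha Hb.
rewrite CI_opp_arg by apply Hg. apply HM; lra.
Qed.

Lemma J_dist f g K d : tame f -> tame g -> 0 < d -> decays (fun t => f t - g t)%C K d ->
  Cmod (J f - J g) <= 2 * K / d.
Proof.
intros Hf Hg Hd H.
assert (E : (J f - J g)%C = J (fun t => f t + - (1) * g t)%C).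
{ rewrite J_plus, J_scal by auto using tame_scal. ring. }
rewrite E. apply J_bound; auto.
- apply rc_plus; [apply Hf|]. apply rc_mult; [apply rc_const|apply Hg].
- intros t. replace (f t + - (1) * g t)%C with (f t - g t)%C by ring. apply H.
Qed.

(** * The kernel of the Mellin transform *)

(* By the functional equation [om] is even up to an elementary term; [Om] is the even function
   that agrees with it for [0 <= v]. *)
Definition gterm (n : nat) (v : R) : R := exp (- (PI * INR (S n) ^ 2 * exp (2 * v))).
Definition Psi (v : R) : R := Series (fun n => gterm n v).
Definition om (v : R) : R := exp (v / 2) * Psi v.
Definition Om (v : R) : R := om (Rabs v).
(* [wt P n = (n + 1) ^ (- P)], and [kap p] is the maximum of [t ^ p * exp (- t)] for [0 < t]. *)
Definition wt (P : R) (n : nat) : R := exp (- P * ln (INR (S n))).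
Definition kap (p : R) : R := exp (p * ln p - p).

(** The theta functional equation at [y = exp (2 v)], where [theta y = 1 + 2 * Psi v], multiplied by
    [exp (- v / 2)]. *)
Lemma om_refl v : om v - om (- v) = (exp (- v / 2) - exp (v / 2)) / 2.
Proof.
assert (T := theta_functional_equation (exp (2 * v)) (exp_pos _)).
assert (E1 : sqrt (exp (2 * v)) = exp v).
{ replace (exp (2 * v)) with (Rsqr (exp v)) by (unfold Rsqr; rewrite <- exp_plus; f_equal; ring).
  apply sqrt_Rsqr, Rlt_le, exp_pos. }
rewrite <- exp_Ropp, E1 in T.
change (theta (exp (2 * v))) with (1 + 2 * Psi v) in T.
replace (- (2 * v)) with (2 * - v) in T by ring.
change (theta (exp (2 * - v))) with (1 + 2 * Psi (- v)) in T.
unfold om. replace (exp (- v / 2) * Psi (- v)) with (exp (- v / 2) * ((1 + 2 * Psi (- v)) - 1) / 2) by field.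
rewrite T. replace (exp v) with (exp (v / 2) * exp (v / 2)) by (rewrite <- exp_plus; f_equal; field).
assert (E2 : exp (- v / 2) * exp (v / 2) = 1) by (rewrite <- exp_plus, <- exp_0; f_equal; field).
replace (exp (- v / 2) * (exp (v / 2) * exp (v / 2) * (1 + 2 * Psi v) - 1) / 2) with
 ((exp (- v / 2) * exp (v / 2)) * exp (v / 2) * (1 + 2 * Psi v) / 2 - exp (- v / 2) / 2) by field.
rewrite E2. field.
Qed.

Lemma exp_neg_bound p t : 0 < p -> 0 < t -> exp (- t) <= kap p * exp (- p * ln t).
Proof.
intros Hp Ht. unfold kap. rewrite <- exp_plus. apply exp_le.
assert (H : 1 + ln (t / p) <= t / p).
{ rewrite <- (exp_ln (t / p)) at 2 by (now apply Rdiv_lt_0_compat). apply exp_ineq1_le. }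
rewrite ln_div in H by auto.
apply Rmult_le_compat_l with (r := p) in H; [|lra].
replace (p * (t / p)) with t in H by (field; lra). lra.
Qed.

Lemma ln_S_pos n : 0 <= ln (INR (S n)).
Proof.
rewrite <- ln_1. apply ln_le; [lra|]. rewrite S_INR. pose proof (pos_INR n). lra.
Qed.

Lemma gterm_pos n v : 0 < gterm n v.
Proof. apply exp_pos. Qed.

(** The free exponent [p] trades decay in [n] against growth in [v]: large [p] serves positive [v],
    small [p] serves negative [v]. *)
Lemma gterm_bound p n v : 0 < p -> gterm n v <= kap p * wt (2 * p) n * exp (- (2 * p) * v).
Proof.
intros Hp. assert (Hn : 0 < INR (S n)) by (apply lt_0_INR; lia).
assert (H2 : 0 < INR (S n) ^ 2) by (apply pow_lt; auto).
pose proof (exp_pos (2 * v)) as He.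
apply Rle_trans with (exp (- (INR (S n) ^ 2 * exp (2 * v)))).
- unfold gterm. apply exp_le. pose proof PI2_1.
  assert (0 < INR (S n) ^ 2 * exp (2 * v)) by (now apply Rmult_lt_0_compat). nra.
- eapply Rle_trans; [apply (exp_neg_bound p); auto; now apply Rmult_lt_0_compat|].
  rewrite ln_mult, ln_exp, ln_pow by auto. unfold wt. rewrite Rmult_assoc, <- exp_plus.
  apply Req_le. f_equal. f_equal. simpl (INR 2). ring.
Qed.

Lemma wt_pos P n : 0 < wt P n.
Proof. apply exp_pos. Qed.

(** The integral test by hand: differences of the values [wt (P - 1) n / (P - 1)] of the
    antiderivative dominate the terms and telescope. *)
Lemma ex_series_wt P : 1 < P -> ex_series (wt P).
Proof.
intros HP. apply ex_series_incr_1.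
set (a := P - 1). assert (Ha : 0 < a) by (unfold a; lra).
set (f := fun n => wt a n / a).
assert (H1 : forall n, wt P (S n) <= f n - f (S n)).
{ intros n. unfold f, wt. set (x := ln (INR (S n))). set (y := ln (INR (S (S n)))).
  assert (Hn : 0 < INR (S n)) by (apply lt_0_INR; lia).
  assert (Hn2 : 0 < INR (S (S n))) by (apply lt_0_INR; lia).
  assert (Hxy : / INR (S (S n)) <= y - x).
  { assert (E := exp_ineq1_le (x - y)).
    replace (exp (x - y)) with (INR (S n) / INR (S (S n))) in E.
    2:{ unfold x, y. rewrite <- ln_div, exp_ln by (auto; apply Rdiv_lt_0_compat; auto). reflexivity. }
    replace (INR (S n)) with (INR (S (S n)) - 1) in E by (rewrite (S_INR (S n)); ring).
    replace ((INR (S (S n)) - 1) / INR (S (S n))) with (1 - / INR (S (S n))) in E by (field; lra). lra. }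
  replace (exp (- P * y)) with (exp (- a * y) * / INR (S (S n))).
  2:{ rewrite <- (exp_ln (INR (S (S n)))) at 1 by auto. fold y. rewrite <- exp_Ropp, <- exp_plus. f_equal. unfold a; ring. }
  assert (E := exp_ineq1_le (a * (y - x))).
  replace (exp (- a * x)) with (exp (- a * y) * exp (a * (y - x))) by (rewrite <- exp_plus; f_equal; ring).
  pose proof (exp_pos (- a * y)) as He.
  apply Rmult_le_reg_l with a; auto.
  replace (a * (exp (- a * y) * exp (a * (y - x)) / a - exp (- a * y) / a)) with (exp (- a * y) * (exp (a * (y - x)) - 1)) by (field; lra).
  replace (a * (exp (- a * y) * / INR (S (S n)))) with (exp (- a * y) * (a * / INR (S (S n)))) by ring.
  apply Rmult_le_compat_l; [lra|]. nra. }
assert (H2 : forall N, sum_n (fun n => wt P (S n)) N <= f O - f (S N)).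
{ induction N as [|N IH]; [rewrite sum_O; apply H1|]. rewrite sum_Sn. unfold plus; simpl.
  specialize (H1 (S N)). simpl in *. lra. }
destruct (ex_finite_lim_seq_incr (sum_n (fun n => wt P (S n))) (f O)) as [l Hl].
- intros n. rewrite sum_Sn. unfold plus; simpl. pose proof (wt_pos P (S (S n))). lra.
- intros n. eapply Rle_trans; [apply H2|].
  assert (0 < f (S n)) by (apply Rdiv_lt_0_compat; auto; apply wt_pos). lra.
- exists l. exact Hl.
Qed.

Lemma gterm_summable v : ex_series (fun n => gterm n v).
Proof.
apply (ex_series_dom _ (fun n => kap 1 * exp (- (2 * 1) * v) * wt (2 * 1) n)).
- intros n. rewrite Rabs_pos_eq by apply Rlt_le, gterm_pos.
  eapply Rle_trans; [apply (gterm_bound 1); lra|]. apply Req_le; ring.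
- apply ex_series_scalR, ex_series_wt. lra.
Qed.

Lemma Psi_bound p v : 1 < 2 * p -> 0 <= Psi v <= kap p * Series (wt (2 * p)) * exp (- (2 * p) * v).
Proof.
intros Hp. split.
- apply Series_nonneg; [intros; apply Rlt_le, gterm_pos|apply gterm_summable].
- rewrite <- Series_scal_l, <- Series_scal_r. apply Series_le.
  + intros n; split; [apply Rlt_le, gterm_pos|apply gterm_bound; lra].
  + apply ex_series_scal_r, ex_series_scalR, ex_series_wt. lra.
Qed.

Lemma Series_continuous (u : nat -> R -> R) (b : nat -> R) (t d : R) : 0 < d ->
  (forall n, continuous (u n) t) -> ex_series b ->
  (forall n s, Rabs (s - t) < d -> Rabs (u n s) <= b n) ->
  continuous (fun s => Series (fun n => u n s)) t.
Proof.
intros Hd Hu Hb Hub. apply (filterlim_locally (F := locally t)). intros eps.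
destruct (Series_tail_small b (eps / 4) Hb ltac:(destruct eps; simpl; lra)) as [K HK].
assert (Hs : continuous (fun s => sum_f_R0 (fun n => u n s) K) t).
{ clear HK. induction K as [|K IH]; simpl; auto. now apply (continuous_plus (V := R_NormedModule)). }
assert (He4 : 0 < eps / 4) by (destruct eps; simpl; lra).
specialize (Hs _ (locally_ball _ (mkposreal _ He4))). unfold filtermap in Hs.
assert (Hball : locally t (fun s => Rabs (s - t) < d)) by (exists (mkposreal d Hd); intros s Hs'; exact Hs').
apply (filter_imp _ _ ) with (2 := filter_and _ _ Hs Hball).
intros s [B1 B2]. change (Rabs (Series (fun n => u n s) - Series (fun n => u n t)) < eps).
change (Rabs (sum_f_R0 (fun n => u n s) K - sum_f_R0 (fun n => u n t) K) < eps / 4) in B1.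
assert (Bt : Rabs (t - t) < d) by (rewrite Rminus_diag, Rabs_R0; auto).
assert (Es : ex_series (fun n => u n s)) by (apply (ex_series_dom _ b); auto).
assert (Et : ex_series (fun n => u n t)) by (apply (ex_series_dom _ b); auto).
rewrite (Series_incr_n (fun n => u n s) (S K)), (Series_incr_n (fun n => u n t) (S K)) by (auto; lia).
simpl pred.
assert (Hbt : ex_series (fun k => b (S K + k)%nat)) by now apply ex_series_incr_n.
assert (T1 : Rabs (Series (fun k => u (S K + k)%nat s)) <= Series (fun k => b (S K + k)%nat)).
{ apply Series_abs_le; auto. }
assert (T2 : Rabs (Series (fun k => u (S K + k)%nat t)) <= Series (fun k => b (S K + k)%nat)).
{ apply Series_abs_le; auto. }
revert B1 HK T1 T2.
generalize (Series (fun k => b (S K + k)%nat)) (Series (fun k => u (S K + k)%nat s))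
  (Series (fun k => u (S K + k)%nat t)) (sum_f_R0 (fun n => u n s) K) (sum_f_R0 (fun n => u n t) K).
intros x y z a c. unfold Rabs; repeat destruct Rcase_abs; lra.
Qed.

Lemma gterm_continuous n t : continuous (gterm n) t.
Proof. apply (ex_derive_continuous (gterm n)). unfold gterm. auto_derive; auto. Qed.

Lemma Psi_continuous t : continuous Psi t.
Proof.
apply (Series_continuous gterm (fun n => kap 1 * exp (- (2 * 1) * (t - 1)) * wt (2 * 1) n) t 1); [lra|intros n; apply gterm_continuous| |].
- apply ex_series_scalR, ex_series_wt. lra.
- intros n s Hs. rewrite Rabs_pos_eq by apply Rlt_le, gterm_pos.
  eapply Rle_trans; [apply (gterm_bound 1); lra|].
  apply Rabs_def2 in Hs.
  assert (exp (- (2 * 1) * s) <= exp (- (2 * 1) * (t - 1))) by (apply exp_le; lra).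
  assert (0 < kap 1 * wt (2 * 1) n) by (apply Rmult_lt_0_compat; apply exp_pos).
  apply Rle_trans with (kap 1 * wt (2 * 1) n * exp (- (2 * 1) * (t - 1))); [|apply Req_le; ring].
  apply Rmult_le_compat_l; lra.
Qed.

Lemma om_continuous t : continuous om t.
Proof.
apply (continuous_mult (K := R_AbsRing) (fun v => exp (v / 2)) Psi); [|apply Psi_continuous].
apply (ex_derive_continuous (fun v => exp (v / 2))). auto_derive; auto.
Qed.

Lemma Om_continuous t : continuous Om t.
Proof. apply (continuous_comp Rabs om); [apply continuous_Rabs|apply om_continuous]. Qed.

(** The constant for decay at rate [P]; the extra 1/2 absorbs the factor [exp (v / 2)] of [om]. As
    [P] is arbitrary, [Om] decays faster than every exponential, and the size of [Dc P] as a
    function of [P] later governs the growth of xi. *)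
Definition Dc (P : R) : R := kap ((P + / 2) / 2) * Series (wt (P + / 2)).

Lemma Om_bound P v : / 2 < P -> 0 <= Om v <= Dc P * exp (- P * Rabs v).
Proof.
intros HP. destruct (Psi_bound ((P + / 2) / 2) (Rabs v)) as [H1 H2]; [lra|].
pose proof (exp_pos (Rabs v / 2)). unfold Om, om. split; [nra|].
replace (2 * ((P + / 2) / 2)) with (P + / 2) in H2 by field.
replace (Dc P * exp (- P * Rabs v)) with (exp (Rabs v / 2) * (Dc P * exp (- (P + / 2) * Rabs v))).
- apply Rmult_le_compat_l; [lra|exact H2].
- replace (exp (- P * Rabs v)) with (exp (Rabs v / 2) * exp (- (P + / 2) * Rabs v)); [ring|].
  rewrite <- exp_plus. f_equal. field.
Qed.

Lemma Dc_pos P : / 2 < P -> 0 <= Dc P.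
Proof.
intros HP. destruct (Om_bound P 0 HP) as [H1 H2]. rewrite Rabs_R0, Rmult_0_r, exp_0 in H2. lra.
Qed.

Lemma rc_RtoC f : (forall t, continuous f t) -> rc (fun t => RtoC (f t)).
Proof. intros H t; split; [apply H|apply continuous_const]. Qed.

(** * The power series of the exponential and its remainder *)

Lemma pow_fact_le_exp x n : 0 <= x -> x ^ n / INR (fact n) <= exp x.
Proof.
intros Hx.
pose proof (is_exp_Reals x) as H.
assert (E : Series (fun n => / INR (fact n) * x ^ n) = exp x).
{ apply is_series_unique.
  eapply is_series_ext; [|exact H]. intros k; simpl. unfold scal; simpl; unfold mult; simpl.
  rewrite pow_n_pow. apply Rmult_comm. }
assert (Ex : ex_series (fun n => / INR (fact n) * x ^ n)).
{ exists (exp x). eapply is_series_ext; [|exact H]. intros k; simpl. unfold scal; simpl; unfold mult; simpl.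
  rewrite pow_n_pow. apply Rmult_comm. }
assert (Hp : forall k, 0 <= / INR (fact k) * x ^ k).
{ intros k. apply Rmult_le_pos; [apply Rlt_le, Rinv_0_lt_compat, INR_fact_lt_0|now apply pow_le]. }
rewrite <- E. rewrite (Series_incr_n _ (S n)) by (auto; lia). simpl pred.
assert (0 <= Series (fun k => / INR (fact (S n + k)) * x ^ (S n + k))).
{ apply Series_nonneg; auto. now apply (ex_series_incr_n (fun k => / INR (fact k) * x ^ k) (S n)). }
assert (x ^ n / INR (fact n) <= sum_f_R0 (fun k => / INR (fact k) * x ^ k) n); [|lra].
unfold Rdiv; rewrite Rmult_comm. destruct n as [|n]; [simpl; lra|]. rewrite tech5.
pose proof (cond_pos_sum (fun k => / INR (fact k) * x ^ k) n Hp). lra.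
Qed.

Lemma cdiff_zero_const f : (forall z, cdiff f z 0) -> forall z, f z = f 0%C.
Proof.
intros H z.
assert (D : forall t, is_derive (fun t => Re (f (0 + RtoC t * z)%C)) t zero /\ is_derive (fun t => Im (f (0 + RtoC t * z)%C)) t zero).
{ intros t. destruct (is_derive_ray f 0 z 0 t (H _)) as [H1 H2].
  replace (0 * z)%C with (RtoC 0) in H1, H2 by ring. split; assumption. }
replace (f z) with (f (0 + RtoC 1 * z)%C) by (f_equal; ring).
replace (f 0%C) with (f (0 + RtoC 0 * z)%C) by (f_equal; ring).
symmetry. apply injective_projections.
- apply (eq_is_derive (fun t => Re (f (0 + RtoC t * z)%C)) 0 1); [intros t _; apply D|lra].
- apply (eq_is_derive (fun t => Im (f (0 + RtoC t * z)%C)) 0 1); [intros t _; apply D|lra].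
Qed.

Definition ifact (n : nat) : R := / INR (fact n).

Lemma ifact_pos n : 0 < ifact n.
Proof. apply Rinv_0_lt_compat, INR_fact_lt_0. Qed.

Lemma absconv_ifact r : 0 <= r -> absconv ifact r.
Proof.
intros Hr. exists (exp r). eapply is_series_ext; [|exact (is_exp_Reals r)].
intros k; simpl. unfold scal; simpl; unfold mult; simpl. rewrite pow_n_pow, Rabs_pos_eq by apply Rlt_le, ifact_pos.
apply Rmult_comm.
Qed.

(** The function [Cexp (- w) * CP ifact w] has derivative zero, hence equals its value 1 at the
    origin. *)
Lemma Cexp_series z : Cexp z = CP ifact z.
Proof.
assert (D : PS_derive ifact = ifact).
{ apply functional_extensionality; intros n. unfold PS_derive, ifact. rewrite fact_simpl, mult_INR.
  field. split; [apply INR_fact_neq_0|apply not_0_INR; lia]. }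
assert (H : forall w, cdiff (fun w => Cexp (- (1) * w) * CP ifact w)%C w 0).
{ intros w. replace (RtoC 0) with (Cexp (- (1) * w) * (- (1) * 1) * CP ifact w + Cexp (- (1) * w) * CP ifact w)%C by ring.
  apply (cdiff_mult (fun w => Cexp (- (1) * w))%C (CP ifact)).
  - apply (cdiff_comp Cexp (fun w => - (1) * w)%C); [|apply cdiff_Cexp]. apply cdiff_scal, cdiff_id.
  - rewrite <- D at 2. apply (cdiff_CP ifact w (Cmod w + 1)); [|lra].
    apply absconv_ifact. pose proof (Cmod_ge_0 w); lra. }
pose proof (cdiff_zero_const _ H z) as E. simpl in E.
rewrite Cmult_0_r, Cexp_0, Cmult_1_l in E.
rewrite CP_real in E. rewrite PSeries_0 in E. unfold ifact at 2 in E. simpl in E. rewrite Rinv_1 in E.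
replace (CP ifact z) with (Cexp z * (Cexp (- (1) * z) * CP ifact z))%C.
- rewrite E. ring.
- rewrite Cmult_assoc, <- Cexp_plus. replace (z + - (1) * z)%C with (RtoC 0) by ring. rewrite Cexp_0. ring.
Qed.

Lemma CSeries_tail f N : cabs f -> (CSeries f - Csum f N)%C = CSeries (fun n => f (S N + n)%nat).
Proof.
intros H. unfold CSeries, Csum. apply injective_projections; simpl.
- rewrite (Series_incr_n (fun n => Re (f n)) (S N)) by (lia || now apply cabs_re). simpl. ring.
- rewrite (Series_incr_n (fun n => Im (f n)) (S N)) by (lia || now apply cabs_im). simpl. ring.
Qed.

Lemma Series_geom_tail N : Series (fun n => (/ 2) ^ (S N + n)) = (/ 2) ^ N.
Proof.
rewrite (Series_ext _ (fun n => (/ 2) ^ S N * (/ 2) ^ n)) by (intros; apply pow_add).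
rewrite Series_scal_l, Series_geom by (rewrite Rabs_pos_eq; lra). simpl. field.
Qed.

Lemma ex_series_geom_tail N : ex_series (fun n => (/ 2) ^ (S N + n)).
Proof.
apply (ex_series_ext (fun n => (/ 2) ^ S N * (/ 2) ^ n)); [intros; symmetry; apply pow_add|].
apply ex_series_scalR, ex_series_geom. rewrite Rabs_pos_eq; lra.
Qed.

(** The geometric factor makes remainders of the exponential series small; the price [exp (2 x)] is
    absorbed by the decay of [Om]. *)
Lemma pow_fact_half x n : 0 <= x -> ifact n * x ^ n <= (/ 2) ^ n * exp (2 * x).
Proof.
intros Hx. pose proof (pow_fact_le_exp (2 * x) n ltac:(lra)) as H.
rewrite Rpow_mult_distr in H. unfold Rdiv in H. fold (ifact n) in H.
assert (H2 : 0 < 2 ^ n) by (apply pow_lt; lra).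
apply Rmult_le_reg_l with (2 ^ n); auto. rewrite pow_inv, <- (Rmult_assoc (2 ^ n) (/ 2 ^ n)), Rinv_r by lra. lra.
Qed.

Lemma Cexp_remainder z X N : Cmod z <= X ->
  Cmod (Cexp z - Csum (fun n => RtoC (ifact n) * z ^ n) N)%C <= (/ 2) ^ N * exp (2 * X).
Proof.
intros HX. pose proof (Cmod_ge_0 z). rewrite Cexp_series. unfold CP.
assert (HC : cabs (fun n => RtoC (ifact n) * z ^ n)%C) by (apply (cabs_CP _ _ X); auto; apply absconv_ifact; lra).
rewrite CSeries_tail by auto.
rewrite <- (Series_geom_tail N), <- Series_scal_r. apply Cmod_CSeries_le.
- intros n. rewrite Cmod_term, Rabs_pos_eq by apply Rlt_le, ifact_pos.
  eapply Rle_trans; [|apply pow_fact_half; lra].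
  apply Rmult_le_compat_l; [apply Rlt_le, ifact_pos|]. apply pow_incr; lra.
- apply ex_series_scal_r, ex_series_geom_tail.
Qed.

(** * Moments of the kernel *)

Lemma J_real f : tame (fun t => RtoC (f t)) -> J (fun t => RtoC (f t)) = RtoC (Re (J (fun t => RtoC (f t)))).
Proof.
intros H. set (l := J _). pose proof (J_spec _ H) as HJ. fold l in HJ.
assert (E : Im l = 0).
{ destruct (Req_dec (Im l) 0) as [|N]; auto. exfalso.
  destruct (HJ (Rabs (Im l))) as [M [HM0 HM]]; [now apply Rabs_pos_lt|].
  specialize (HM (- M) M ltac:(lra) ltac:(lra)).
  assert (B := Rle_lt_trans _ _ _ (im_le_Cmod _) HM).
  unfold CI in B. simpl in B. rewrite RInt_constR, Rmult_0_r in B.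
  rewrite Rplus_0_l, Rabs_Ropp in B. unfold Im in B. lra. }
destruct l as [a b]. simpl in E. rewrite E. reflexivity.
Qed.

Lemma J_nonneg f : tame (fun t => RtoC (f t)) -> (forall t, 0 <= f t) -> 0 <= Re (J (fun t => RtoC (f t))).
Proof.
intros H Hf. set (l := J _). pose proof (J_spec _ H) as HJ. fold l in HJ.
apply Rnot_lt_le. intros N.
destruct (HJ (- Re l)) as [M [HM0 HM]]; [lra|].
specialize (HM (- M) M ltac:(lra) ltac:(lra)).
assert (B := Rle_lt_trans _ _ _ (re_le_Cmod _) HM).
change (Rabs (RInt (fun t => f t) (- M) M - Re l) < - Re l) in B. apply Rabs_def2 in B.
assert (0 <= RInt (fun t => f t) (- M) M); [|lra].
apply RInt_ge_0; [lra| |auto]. apply (rc_re (fun t => RtoC (f t))). apply H.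
Qed.

Lemma J_le f g : tame (fun t => RtoC (f t)) -> tame (fun t => RtoC (g t)) -> (forall t, f t <= g t) ->
  Re (J (fun t => RtoC (f t))) <= Re (J (fun t => RtoC (g t))).
Proof.
intros Hf Hg H.
assert (T : tame (fun t => RtoC (g t - f t))).
{ apply (tame_ext (fun t => RtoC (g t) + - (1) * RtoC (f t))%C).
  - intros t. rewrite RtoC_minus. ring.
  - auto using tame_plus, tame_scal. }
assert (P := J_nonneg _ T ltac:(intros t; specialize (H t); lra)).
rewrite (J_ext _ (fun t => RtoC (g t) + - (1) * RtoC (f t))%C) in P by (intros t; rewrite RtoC_minus; ring).
rewrite J_plus, J_scal in P by auto using tame_scal. simpl in P. unfold Re in *. lra.
Qed.

Lemma cont_pow n t : continuous (fun v : R => v ^ n) t.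
Proof. apply (ex_derive_continuous (fun v : R => v ^ n)). auto_derive; auto. Qed.

Lemma pow_fact_exp Q v n : 0 < Q -> Rabs (ifact n * v ^ n) <= exp (Q * Rabs v) / Q ^ n.
Proof.
intros HQ. rewrite Rabs_mult, (Rabs_pos_eq (ifact n)), <- RPow_abs by apply Rlt_le, ifact_pos.
pose proof (Rabs_pos v).
pose proof (pow_fact_le_exp (Q * Rabs v) n ltac:(nra)) as H0. rewrite Rpow_mult_distr in H0.
assert (HQn : 0 < Q ^ n) by (now apply pow_lt).
apply Rmult_le_reg_r with (Q ^ n); auto.
replace (exp (Q * Rabs v) / Q ^ n * Q ^ n) with (exp (Q * Rabs v)) by (field; lra).
unfold Rdiv in H0. fold (ifact n) in H0. lra.
Qed.

Lemma decays_moment Q n : 0 < Q -> decays (fun v => RtoC (Om v * (ifact n * v ^ n))) (Dc (Q + 1) / Q ^ n) 1.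
Proof.
intros HQ v. rewrite Cmod_R, Rabs_mult.
destruct (Om_bound (Q + 1) v) as [B1 B2]; [lra|]. rewrite (Rabs_pos_eq (Om v)) by lra.
assert (HQn : 0 < Q ^ n) by (now apply pow_lt).
apply Rle_trans with (Dc (Q + 1) * exp (- (Q + 1) * Rabs v) * (exp (Q * Rabs v) / Q ^ n)).
- apply Rmult_le_compat; auto using pow_fact_exp. apply Rabs_pos.
- replace (exp (- (1) * Rabs v)) with (exp (- (Q + 1) * Rabs v) * exp (Q * Rabs v)).
  + apply Req_le. field. lra.
  + rewrite <- exp_plus. f_equal. ring.
Qed.

Lemma tame_moment n : tame (fun v => RtoC (Om v * (ifact n * v ^ n))).
Proof.
split.
- apply rc_RtoC. intros t. apply (continuous_mult (K := R_AbsRing) Om); [apply Om_continuous|].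
  apply (continuous_mult (K := R_AbsRing) (fun _ => ifact n)); [apply continuous_const|apply cont_pow].
- exists (Dc (1 + 1) / 1 ^ n), 1. split; [lra|]. apply decays_moment. lra.
Qed.

(** Twice the normalized moment, the factor 2 being the one that the Mellin transform of theta
    produces in [mellin_zeta]. *)
Definition mu (n : nat) : R := 2 * Re (J (fun v => RtoC (Om v * (ifact n * v ^ n)))).

Lemma mu_bound Q n : 0 < Q -> Rabs (mu n) <= 4 * Dc (Q + 1) * (/ Q) ^ n.
Proof.
intros HQ. unfold mu. rewrite Rabs_mult, (Rabs_pos_eq 2) by lra.
assert (B := J_bound _ _ 1 (proj1 (tame_moment n)) Rlt_0_1 (decays_moment Q n HQ)).
assert (B2 := Rle_trans _ _ _ (re_le_Cmod _) B). rewrite pow_inv.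
replace (4 * Dc (Q + 1) * / Q ^ n) with (2 * (2 * (Dc (Q + 1) / Q ^ n) / 1)) by (field; apply pow_nonzero; lra).
lra.
Qed.

Lemma absconv_mu r : 0 <= r -> absconv mu r.
Proof.
intros Hr. set (Q := 2 * r + 1).
apply (ex_series_dom _ (fun n => 4 * Dc (Q + 1) * (/ 2) ^ n)).
- intros n. rewrite Rabs_pos_eq by (apply Rmult_le_pos; [apply Rabs_pos|now apply pow_le]).
  assert (HQ : 0 < Q) by (unfold Q; lra). pose proof (mu_bound Q n HQ) as B.
  assert (HD := Dc_pos (Q + 1) ltac:(lra)).
  apply Rle_trans with (4 * Dc (Q + 1) * (/ Q) ^ n * r ^ n).
  + apply Rmult_le_compat_r; [now apply pow_le|auto].
  + rewrite Rmult_assoc, <- Rpow_mult_distr. apply Rmult_le_compat_l; [lra|].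
    apply pow_incr. split; [apply Rmult_le_pos; [apply Rlt_le, Rinv_0_lt_compat; lra|lra]|].
    apply Rmult_le_reg_l with Q; auto. rewrite <- Rmult_assoc, Rinv_r by lra. unfold Q; lra.
- apply ex_series_scalR, ex_series_geom. rewrite Rabs_pos_eq; lra.
Qed.

Lemma rc_OmCexp x : rc (fun v => RtoC (Om v) * Cexp (x * RtoC v))%C.
Proof. apply rc_mult; [apply rc_RtoC, Om_continuous|apply rc_Cexp_lin]. Qed.

Lemma tame_OmCexp x : tame (fun v => RtoC (Om v) * Cexp (x * RtoC v))%C.
Proof.
split; [apply rc_OmCexp|]. pose proof (Cmod_ge_0 x).
exists (Dc (Cmod x + 1)), 1. split; [lra|]. intros v.
destruct (Om_bound (Cmod x + 1) v) as [B1 B2]; [lra|].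
rewrite Cmod_mult, Cmod_R, Rabs_pos_eq, Cmod_Cexp by lra.
apply Rle_trans with (Dc (Cmod x + 1) * exp (- (Cmod x + 1) * Rabs v) * exp (Cmod x * Rabs v)).
- apply Rmult_le_compat; auto; [apply Rlt_le, exp_pos|]. apply exp_le.
  eapply Rle_trans; [apply Rle_abs|]. eapply Rle_trans; [apply re_le_Cmod|]. rewrite Cmod_mult, Cmod_R. lra.
- rewrite Rmult_assoc, <- exp_plus. apply Req_le. f_equal. f_equal. ring.
Qed.

Lemma Csum_J (g : nat -> R -> C) N : (forall n, tame (g n)) ->
  tame (fun v => Csum (fun n => g n v) N) /\ J (fun v => Csum (fun n => g n v) N) = Csum (fun n => J (g n)) N.
Proof.
intros H. induction N as [|N [IH1 IH2]].
- split.
  + apply (tame_ext (g O)); auto. intros; now rewrite Csum_0.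
  + rewrite Csum_0. apply J_ext. intros; now rewrite Csum_0.
- split.
  + apply (tame_ext (fun v => Csum (fun n => g n v) N + g (S N) v)%C); [|auto using tame_plus].
    intros; now rewrite Csum_S.
  + rewrite Csum_S, <- IH2, <- J_plus by auto. apply J_ext. intros; now rewrite Csum_S.
Qed.

Lemma C_eq_of_small (a b : C) : (forall eps, 0 < eps -> Cmod (a - b)%C < eps) -> a = b.
Proof.
intros H. assert (E : (a - b)%C = 0%C).
{ apply Cmod_eq_0, Rle_antisym; [|apply Cmod_ge_0]. apply Rnot_lt_le; intros P. specialize (H _ P). lra. }
replace a with ((a - b) + b)%C by ring. rewrite E. ring.
Qed.

Lemma Csum_lim f eps : cabs f -> 0 < eps -> exists N0, forall N, (N0 <= N)%nat -> Cmod (CSeries f - Csum f N)%C < eps.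
Proof.
intros H He.
assert (Hr : is_lim_seq (sum_n (fun n => Re (f n))) (Series (fun n => Re (f n)))) by exact (Series_correct _ (cabs_re f H)).
assert (Hi : is_lim_seq (sum_n (fun n => Im (f n))) (Series (fun n => Im (f n)))) by exact (Series_correct _ (cabs_im f H)).
apply is_lim_seq_spec in Hr. apply is_lim_seq_spec in Hi.
assert (He2 : 0 < eps / 2) by lra.
destruct (Hr (mkposreal _ He2)) as [N1 H1]. destruct (Hi (mkposreal _ He2)) as [N2 H2].
exists (max N1 N2). intros N HN. specialize (H1 N ltac:(lia)). specialize (H2 N ltac:(lia)). simpl in H1, H2.
rewrite sum_n_Reals in H1, H2. rewrite Rabs_minus_sym in H1, H2.
eapply Rle_lt_trans; [apply Cmod_le_abs|]. unfold CSeries, Csum. simpl.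
unfold Rminus in *. lra.
Qed.

(** Summation and integration are exchanged through the remainder of the exponential series. The
    rate [P = 2 |x| + 1] leaves one unit of decay after paying [exp (2 |x| |v|)]. *)
Theorem mu_generating x : CP mu x = (2 * J (fun v => RtoC (Om v) * Cexp (x * RtoC v)))%C.
Proof.
apply C_eq_of_small. intros eps He.
pose proof (Cmod_ge_0 x) as Hx. set (P := 2 * Cmod x + 1).
assert (HD := Dc_pos P ltac:(unfold P; lra)).
assert (HC : cabs (fun n => RtoC (mu n) * x ^ n)%C) by (apply (cabs_CP mu x (Cmod x)); [apply absconv_mu|]; lra).
destruct (Csum_lim _ (eps / 2) HC ltac:(lra)) as [N0 HN0].
assert (L : is_lim_seq (fun N => 4 * Dc P * (/ 2) ^ N) (4 * Dc P * 0)).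
{ apply is_lim_seq_mult'; [apply is_lim_seq_const|]. apply is_lim_seq_geom. rewrite Rabs_pos_eq; lra. }
rewrite Rmult_0_r in L. apply is_lim_seq_spec in L. destruct (L (mkposreal (eps / 2) ltac:(lra))) as [N1 HN1].
set (N := max N0 N1). specialize (HN0 N ltac:(unfold N; lia)). specialize (HN1 N ltac:(unfold N; lia)).
simpl in HN1. rewrite Rminus_0_r in HN1.
set (g := fun n v => (x ^ n * RtoC (Om v * (ifact n * v ^ n)))%C).
assert (Hg : forall n, tame (g n)) by (intros n; apply tame_scal, tame_moment).
destruct (Csum_J g N Hg) as [T1 T2].
assert (E : Csum (fun n => RtoC (mu n) * x ^ n)%C N = (2 * J (fun v => Csum (fun n => g n v) N))%C).
{ rewrite T2, <- Csum_scal. apply Csum_ext. intros n _. unfold g. rewrite J_scal by apply tame_moment.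
  rewrite J_real by apply tame_moment. unfold mu. rewrite RtoC_mult. ring. }
assert (D : decays (fun v => RtoC (Om v) * Cexp (x * RtoC v) - Csum (fun n => g n v) N)%C ((/ 2) ^ N * Dc P) 1).
{ intros v. replace (Csum (fun n => g n v) N) with (RtoC (Om v) * Csum (fun n => RtoC (ifact n) * (x * RtoC v) ^ n) N)%C.
  2:{ rewrite <- Csum_scal. apply Csum_ext. intros n _. unfold g. rewrite !RtoC_mult, RtoC_pow, Cpow_mult_l. ring. }
  replace (RtoC (Om v) * Cexp (x * RtoC v) - RtoC (Om v) * Csum (fun n => RtoC (ifact n) * (x * RtoC v) ^ n) N)%C
    with (RtoC (Om v) * (Cexp (x * RtoC v) - Csum (fun n => RtoC (ifact n) * (x * RtoC v) ^ n) N))%C by ring.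
  destruct (Om_bound P v) as [B1 B2]; [unfold P; lra|].
  rewrite Cmod_mult, Cmod_R, Rabs_pos_eq by lra.
  assert (R1 := Cexp_remainder (x * RtoC v) (Cmod x * Rabs v) N). rewrite Cmod_mult, Cmod_R in R1. specialize (R1 (Rle_refl _)).
  apply Rle_trans with (Dc P * exp (- P * Rabs v) * ((/ 2) ^ N * exp (2 * (Cmod x * Rabs v)))).
  - apply Rmult_le_compat; auto. apply Cmod_ge_0.
  - replace (exp (- (1) * Rabs v)) with (exp (- P * Rabs v) * exp (2 * (Cmod x * Rabs v))).
    + apply Req_le; ring.
    + rewrite <- exp_plus. f_equal. unfold P; ring. }
assert (B := J_dist _ _ _ 1 (tame_OmCexp x) T1 Rlt_0_1 D).
set (A := J (fun v => RtoC (Om v) * Cexp (x * RtoC v))%C) in *.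
rewrite E in HN0. unfold CP.
set (Z := CSeries _) in *. set (W := J (fun v => Csum (fun n => g n v) N)) in *.
replace (Z - 2 * A)%C with ((Z - 2 * W) + - (2 * (A - W)))%C by ring.
eapply Rle_lt_trans; [apply Cmod_triangle|]. rewrite Cmod_opp, Cmod_mult, Cmod_R, (Rabs_pos_eq 2) by lra.
pose proof (Rle_abs (4 * Dc P * (/ 2) ^ N)). lra.
Qed.

Lemma pow_opp_odd v n : (- v) ^ (2 * n + 1) = - v ^ (2 * n + 1).
Proof. rewrite !pow_add, !pow_mult. replace ((- v) ^ 2) with (v ^ 2) by ring. ring. Qed.

Lemma pow_opp_even v n : (- v) ^ (2 * n) = v ^ (2 * n).
Proof. rewrite !pow_mult. replace ((- v) ^ 2) with (v ^ 2) by ring. ring. Qed.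

Lemma Om_even v : Om (- v) = Om v.
Proof. unfold Om. now rewrite Rabs_Ropp. Qed.

Lemma mu_odd n : mu (2 * n + 1) = 0.
Proof.
unfold mu. set (g := fun v => RtoC (Om v * (ifact (2 * n + 1) * v ^ (2 * n + 1)))).
assert (T : tame g) by apply tame_moment.
assert (E : J g = (- (1) * J g)%C).
{ rewrite <- J_scal by auto. rewrite <- (J_opp_arg g) at 1 by auto. apply J_ext. intros v. unfold g.
  rewrite Om_even, pow_opp_odd, <- RtoC_opp, <- RtoC_mult. f_equal. ring. }
assert (E2 : Re (J g) = Re (- (1) * J g)%C) by (f_equal; exact E).
unfold Re in *. simpl in E2. lra.
Qed.

Lemma mu_even_pos n : 0 <= mu (2 * n).
Proof.
unfold mu. apply Rmult_le_pos; [lra|]. apply J_nonneg; [apply tame_moment|].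
intros v. destruct (Om_bound 1 v) as [H _]; [lra|]. apply Rmult_le_pos; auto.
apply Rmult_le_pos; [apply Rlt_le, ifact_pos|]. rewrite pow_mult. apply pow_le, pow2_ge_0.
Qed.

(** Termwise: the logarithm of [exp (3 v / 2) * gterm n v] has slope [3/2 - 2 c exp (2 v)] with
    [c = PI (n + 1)^2 >= 1], which is negative for [0 <= v]. *)
Lemma om_exp_decr v w : 0 <= v <= w -> om w * exp w <= om v * exp v.
Proof.
intros H. unfold om, Psi.
assert (T : forall n, exp (3 / 2 * w) * gterm n w <= exp (3 / 2 * v) * gterm n v).
{ intros n. unfold gterm. rewrite <- !exp_plus. apply exp_le.
  set (c := PI * INR (S n) ^ 2).
  assert (Hc : 1 <= c).
  { assert (1 <= INR (S n)) by (rewrite S_INR; pose proof (pos_INR n); lra). pose proof PI2_1.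
    unfold c. assert (1 <= INR (S n) ^ 2) by nra. nra. }
  assert (He : 2 * (w - v) <= exp (2 * w) - exp (2 * v)).
  { replace (exp (2 * w)) with (exp (2 * v) * exp (2 * (w - v))) by (rewrite <- exp_plus; f_equal; ring).
    assert (1 <= exp (2 * v)) by (rewrite <- exp_0; apply exp_le; lra).
    pose proof (exp_ineq1_le (2 * (w - v))). nra. }
  nra. }
assert (Ex : forall x k, k * Series (fun n => gterm n x) = Series (fun n => k * gterm n x)) by (intros; now rewrite Series_scal_l).
assert (G : exp (3 / 2 * w) * Series (fun n => gterm n w) <= exp (3 / 2 * v) * Series (fun n => gterm n v)).
{ rewrite !Ex. apply Series_le; [|apply ex_series_scalR, gterm_summable].
  intros n; split; auto. apply Rmult_le_pos; apply Rlt_le, exp_pos. }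
replace (exp (w / 2) * Series (fun n => gterm n w) * exp w) with (exp (3 / 2 * w) * Series (fun n => gterm n w)).
2:{ replace (3 / 2 * w) with (w / 2 + w) by field. rewrite exp_plus. ring. }
replace (exp (v / 2) * Series (fun n => gterm n v) * exp v) with (exp (3 / 2 * v) * Series (fun n => gterm n v)).
2:{ replace (3 / 2 * v) with (v / 2 + v) by field. rewrite exp_plus. ring. }
exact G.
Qed.

Lemma Om_exp_decr v w : Rabs v <= Rabs w -> Om w * exp (Rabs w) <= Om v * exp (Rabs v).
Proof. intros H. apply om_exp_decr. split; auto. apply Rabs_pos. Qed.

(** The integrand of a difference of moments for the model kernel [exp (- |v|)], whose normalized
    even moments are all equal. *)
Definition kdiff (n : nat) (v : R) : R :=
  exp (- Rabs v) * (ifact (n + 2) * v ^ (n + 2) - ifact n * v ^ n).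

Lemma ifact_S n : ifact n = INR (S n) * ifact (S n).
Proof.
unfold ifact. rewrite fact_simpl, mult_INR. field.
split; [apply INR_fact_neq_0|apply not_0_INR; lia].
Qed.

Lemma kdiff_continuous n t : continuous (kdiff n) t.
Proof.
apply (continuous_mult (K := R_AbsRing) (fun v => exp (- Rabs v))).
- apply (continuous_comp Rabs (fun v => exp (- v))); [apply continuous_Rabs|].
  apply (ex_derive_continuous (fun v => exp (- v))). auto_derive; auto.
- apply (ex_derive_continuous (fun v => ifact (n + 2) * v ^ (n + 2) - ifact n * v ^ n)). auto_derive; auto.
Qed.

Lemma tame_kdiff n : tame (fun v => RtoC (kdiff n v)).
Proof.
split; [apply rc_RtoC, kdiff_continuous|].
exists (1 / (/ 2) ^ (n + 2) + 1 / (/ 2) ^ n), (/ 2). split; [lra|]. intros v.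
assert (A : forall m, exp (- Rabs v) * Rabs (ifact m * v ^ m) <= 1 / (/ 2) ^ m * exp (- / 2 * Rabs v)).
{ intros m. pose proof (pow_fact_exp (/ 2) v m ltac:(lra)) as H. pose proof (exp_pos (- Rabs v)).
  apply Rle_trans with (exp (- Rabs v) * (exp (/ 2 * Rabs v) / (/ 2) ^ m)); [apply Rmult_le_compat_l; lra|].
  apply Req_le. unfold Rdiv. rewrite <- Rmult_assoc, <- exp_plus, Rmult_1_l, Rmult_comm. f_equal. f_equal. field. }
rewrite Cmod_R. unfold kdiff. rewrite Rabs_mult, (Rabs_pos_eq (exp _)) by apply Rlt_le, exp_pos.
pose proof (A n). pose proof (A (n + 2)%nat). pose proof (exp_pos (- Rabs v)).
assert (Rabs (ifact (n + 2) * v ^ (n + 2) - ifact n * v ^ n) <= Rabs (ifact (n + 2) * v ^ (n + 2)) + Rabs (ifact n * v ^ n)).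
{ unfold Rminus. eapply Rle_trans; [apply Rabs_triang|]. rewrite Rabs_Ropp. lra. }
nra.
Qed.

(** On the positive half-line [G] is an antiderivative that vanishes at 0 and at infinity; the other
    half follows by evenness. *)
Lemma J_kdiff n : Re (J (fun v => RtoC (kdiff (2 * n) v))) = 0.
Proof.
set (m := (2 * n)%nat).
set (G := fun v => - (exp (- v) * (ifact (m + 1) * v ^ (m + 1) + ifact (m + 2) * v ^ (m + 2)))).
assert (I0 : forall b, 0 <= b -> RInt (kdiff m) 0 b = G b).
{ intros b Hb. apply is_RInt_unique.
  assert (G0 : G 0 = 0) by (unfold G; rewrite !pow_i by lia; ring).
  assert (GE : G b = G b - G 0) by (rewrite G0; ring). rewrite GE.
  apply (is_RInt_ext (fun v => exp (- v) * (ifact (m + 2) * v ^ (m + 2) - ifact m * v ^ m))).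
  { intros x Hx. rewrite Rmin_left, Rmax_right in Hx by auto. unfold kdiff. rewrite Rabs_pos_eq by lra. reflexivity. }
  apply (is_RInt_derive (V := R_CompleteNormedModule) G).
  - intros x _. unfold G. auto_derive; auto.
    replace (m + 1)%nat with (S m) by lia. replace (m + 2)%nat with (S (S m)) by lia. simpl pred.
    rewrite (ifact_S m), (ifact_S (S m)). simpl pow. ring.
  - intros x _. apply (ex_derive_continuous (fun v => exp (- v) * (ifact (m + 2) * v ^ (m + 2) - ifact m * v ^ m))).
    auto_derive; auto. }
assert (Ev : forall v, kdiff m (- v) = kdiff m v).
{ intros v. unfold kdiff. rewrite Rabs_Ropp. unfold m.
  replace (2 * n + 2)%nat with (2 * (n + 1))%nat by lia. rewrite !pow_opp_even. reflexivity. }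
assert (I1 : forall a, 0 <= a -> RInt (kdiff m) (- a) 0 = G a).
{ intros a Ha. rewrite <- I0 by auto. rewrite <- (RInt_ext (fun v => kdiff m (- v)) (kdiff m) 0 a) by (intros; apply Ev).
  rewrite RInt_opp_arg by apply kdiff_continuous. now rewrite Ropp_0. }
assert (GB : forall b, 0 <= b -> Rabs (G b) <= 2 * 2 ^ (m + 2) * exp (- / 2 * b)).
{ intros b Hb. unfold G. rewrite Rabs_Ropp, Rabs_mult, (Rabs_pos_eq (exp _)) by apply Rlt_le, exp_pos.
  assert (A : forall k, (k <= m + 2)%nat -> exp (- b) * Rabs (ifact k * b ^ k) <= 2 ^ (m + 2) * exp (- / 2 * b)).
  { intros k Hk. pose proof (pow_fact_exp (/ 2) b k ltac:(lra)) as H. pose proof (exp_pos (- b)).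
    rewrite (Rabs_pos_eq b) in H by auto.
    apply Rle_trans with (exp (- b) * (exp (/ 2 * b) / (/ 2) ^ k)); [apply Rmult_le_compat_l; lra|].
    unfold Rdiv. rewrite <- Rmult_assoc, <- exp_plus, pow_inv, Rinv_inv, Rmult_comm.
    replace (- b + / 2 * b) with (- / 2 * b) by field.
    apply Rmult_le_compat_r; [apply Rlt_le, exp_pos|]. apply Rle_pow; lra || lia. }
  pose proof (A (m + 1)%nat ltac:(lia)). pose proof (A (m + 2)%nat ltac:(lia)).
  pose proof (Rabs_triang (ifact (m + 1) * b ^ (m + 1)) (ifact (m + 2) * b ^ (m + 2))). pose proof (exp_pos (- b)).
  nra. }
pose proof (J_spec _ (tame_kdiff m)) as HJ. set (l := J _) in *.
destruct (Req_dec (Re l) 0) as [|N]; auto. exfalso.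
assert (HN : 0 < Rabs (Re l)) by now apply Rabs_pos_lt.
destruct (HJ (Rabs (Re l) / 2)) as [M [HM0 HM]]; [lra|].
destruct (exp_decay_small (/ 2) (Rabs (Re l) / 4) (2 * 2 ^ (m + 2)) ltac:(lra) ltac:(lra)) as [k Hk].
set (b := Rmax M (INR k)). pose proof (Rmax_l M (INR k)). pose proof (Rmax_r M (INR k)). fold b in H, H0.
specialize (HM (- b) b ltac:(lra) ltac:(lra)). specialize (Hk b H0).
assert (B := Rle_lt_trans _ _ _ (re_le_Cmod _) HM).
change (Rabs (RInt (kdiff m) (- b) b - Re l) < Rabs (Re l) / 2) in B.
specialize (GB b ltac:(lra)).
assert (EI : RInt (kdiff m) (- b) b = G b + G b).
{ rewrite <- (I1 b) at 1 by lra. rewrite <- (I0 b) by lra. symmetry.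
  apply (RInt_Chasles (V := R_CompleteNormedModule)); apply (ex_RInt_continuous (V := R_CompleteNormedModule));
  intros; apply kdiff_continuous. }
rewrite EI in B. revert B GB Hk. unfold Rabs at 1 3 4.
generalize (2 * 2 ^ (m + 2) * exp (- / 2 * b)). intros X. unfold Rabs. repeat destruct Rcase_abs; lra.
Qed.

(** [Om] is compared with [rho * exp (- |v|)], the multiple of the model kernel that agrees with it
    where the moment integrand changes sign. As [Om v * exp |v|] decreases in [|v|], the comparison
    has the right direction on both sides of that point, and the model integral is zero. *)
Lemma mu_step n : mu (2 * n + 2) <= mu (2 * n).
Proof.
set (m := (2 * n)%nat).
(* The positive zero of [v^(m+2) / (m+2)! - v^m / m!]. *)
set (w := sqrt (INR (m + 1) * INR (m + 2))).
assert (H1 : 0 < INR (m + 1)) by (apply lt_0_INR; lia).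
assert (H2 : 0 < INR (m + 2)) by (apply lt_0_INR; lia).
assert (Hw : 0 < w) by (apply sqrt_lt_R0; nra).
assert (Hw2 : w * w = INR (m + 1) * INR (m + 2)) by (apply sqrt_def; nra).
set (rho := Om w * exp (Rabs w)).
assert (P : forall v, Om v * (ifact (m + 2) * v ^ (m + 2) - ifact m * v ^ m) <= rho * kdiff m v).
{ intros v. unfold kdiff.
  replace (Om v * (ifact (m + 2) * v ^ (m + 2) - ifact m * v ^ m)) with
   (Om v * exp (Rabs v) * (exp (- Rabs v) * (ifact (m + 2) * v ^ (m + 2) - ifact m * v ^ m))).
  2:{ rewrite exp_Ropp. field. apply Rgt_not_eq, exp_pos. }
  assert (F : ifact (m + 2) * v ^ (m + 2) - ifact m * v ^ m = ifact (m + 2) * v ^ m * (v * v - w * w)).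
  { rewrite Hw2. replace (m + 1)%nat with (S m) by lia. replace (m + 2)%nat with (S (S m)) by lia.
    rewrite (ifact_S m), (ifact_S (S m)). simpl pow. ring. }
  assert (Fp : 0 <= ifact (m + 2) * v ^ m).
  { apply Rmult_le_pos; [apply Rlt_le, ifact_pos|]. unfold m. rewrite pow_mult. apply pow_le, pow2_ge_0. }
  pose proof (exp_pos (- Rabs v)). rewrite F.
  destruct (Rle_lt_dec (Rabs w) (Rabs v)) as [C|C].
  - pose proof (Om_exp_decr w v C) as D. fold rho in D.
    assert (w * w <= v * v).
    { pose proof (Rsqr_le_abs_1 w v C) as S. unfold Rsqr in S. lra. }
    apply Rmult_le_compat_r; auto. apply Rmult_le_pos; [lra|]. apply Rmult_le_pos; lra.
  - pose proof (Om_exp_decr v w (Rlt_le _ _ C)) as D. fold rho in D.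
    assert (v * v <= w * w).
    { pose proof (Rsqr_le_abs_1 v w (Rlt_le _ _ C)) as S. unfold Rsqr in S. lra. }
    assert (X : 0 <= exp (- Rabs v) * (ifact (m + 2) * v ^ m * (w * w - v * v))).
    { apply Rmult_le_pos; [lra|]. apply Rmult_le_pos; lra. }
    assert (Y : rho * (exp (- Rabs v) * (ifact (m + 2) * v ^ m * (w * w - v * v))) <=
      Om v * exp (Rabs v) * (exp (- Rabs v) * (ifact (m + 2) * v ^ m * (w * w - v * v)))) by (apply Rmult_le_compat_r; auto).
    lra. }
assert (T1 : tame (fun v => RtoC (Om v * (ifact (m + 2) * v ^ (m + 2) - ifact m * v ^ m)))).
{ apply (tame_ext (fun v => RtoC (Om v * (ifact (m + 2) * v ^ (m + 2))) + - (1) * RtoC (Om v * (ifact m * v ^ m)))%C).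
  - intros v. rewrite Rmult_minus_distr_l, RtoC_minus. ring.
  - auto using tame_plus, tame_scal, tame_moment. }
assert (T2 : tame (fun v => RtoC (rho * kdiff m v))).
{ apply (tame_ext (fun v => RtoC rho * RtoC (kdiff m v))%C); [intros; now rewrite RtoC_mult|].
  apply tame_scal, tame_kdiff. }
pose proof (J_le _ _ T1 T2 P) as L. cbv beta in L.
rewrite (J_ext (fun v => RtoC (rho * kdiff m v)) (fun v => RtoC rho * RtoC (kdiff m v))%C) in L by (intros; now rewrite RtoC_mult).
rewrite J_scal in L by apply tame_kdiff.
rewrite (J_ext _ (fun v => RtoC (Om v * (ifact (m + 2) * v ^ (m + 2))) + - (1) * RtoC (Om v * (ifact m * v ^ m)))%C) in L
 by (intros; rewrite Rmult_minus_distr_l, RtoC_minus; ring).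
rewrite J_plus, J_scal in L by auto using tame_moment, tame_scal.
pose proof (J_kdiff n) as K. fold m in K. unfold mu. fold m. unfold Re in *. simpl in L. rewrite K in L. lra.
Qed.

(** Needed for [ecoef 0 > 0], that is, for [xi (1/2) > 0]. From [Om v <= Om 0 * exp (- |v|)] and
    [Om 0 <= 1/2], the latter by a geometric series of ratio 1/3, even [mu 0 <= 2] results. *)
Lemma mu_0_lt : mu 0 < 4.
Proof.
assert (HD : decays (fun v => RtoC (Om v * (ifact 0 * v ^ 0))) (Om 0) 1).
{ intros v. unfold ifact; simpl. rewrite Rinv_1, !Rmult_1_r, Cmod_R.
  destruct (Om_bound 1 v) as [H _]; [lra|]. rewrite Rabs_pos_eq by auto.
  pose proof (Om_exp_decr 0 v) as D. rewrite Rabs_R0, exp_0, Rmult_1_r in D. specialize (D (Rabs_pos v)).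
  replace (- (1) * Rabs v) with (- Rabs v) by ring. rewrite exp_Ropp.
  pose proof (exp_pos (Rabs v)). apply Rmult_le_reg_r with (exp (Rabs v)); auto.
  rewrite Rmult_assoc, Rinv_l by lra. lra. }
assert (B := J_bound _ _ 1 (proj1 (tame_moment 0)) Rlt_0_1 HD).
assert (B2 := Rle_trans _ _ _ (re_le_Cmod _) B).
assert (H0 : Om 0 <= / 2).
{ unfold Om, om. rewrite Rabs_R0. unfold Rdiv. rewrite Rmult_0_l, exp_0, Rmult_1_l. unfold Psi.
  replace (/ 2) with (Series (fun n => / 3 * (/ 3) ^ n)).
  2:{ rewrite Series_scal_l, Series_geom; [field|rewrite Rabs_pos_eq; lra]. }
  apply Series_le.
  - intros n. split; [apply Rlt_le, gterm_pos|]. unfold gterm. rewrite Rmult_0_r, exp_0, Rmult_1_r.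
    pose proof PI2_1. assert (1 <= INR (S n)) by (rewrite S_INR; pose proof (pos_INR n); lra).
    apply Rle_trans with (exp (- (2 * INR (S n)))).
    + apply exp_le. assert (INR (S n) <= INR (S n) ^ 2) by nra. nra.
    + assert (E3 : exp (- (2)) <= / 3).
      { rewrite exp_Ropp. apply Rinv_le_contravar; [lra|]. pose proof (exp_ineq1_le 2). lra. }
      change (/ 3 * (/ 3) ^ n) with ((/ 3) ^ S n).
      replace (exp (- (2 * INR (S n)))) with (exp (- (2)) ^ S n).
      * apply pow_incr. split; [apply Rlt_le, exp_pos|auto].
      * rewrite <- Rpower_pow by apply exp_pos. unfold Rpower. rewrite ln_exp. f_equal. ring.
  - apply ex_series_scalR, ex_series_geom. rewrite Rabs_pos_eq; lra. }
unfold mu. assert (B3 := Rle_abs (Re (J (fun v => RtoC (Om v * (ifact 0 * v ^ 0)))))). lra.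
Qed.

(** Makes [ecoef 2] positive. On [[-1, 1]] the kernel is at least its first theta term, hence at
    least [exp (- (PI * exp 2))]. *)
Lemma mu_0_pos : 0 < mu 0.
Proof.
unfold mu. set (f := fun v => Om v * (ifact 0 * v ^ 0)).
assert (T : tame (fun v => RtoC (f v))) by apply tame_moment.
assert (Ef : forall v, f v = Om v) by (intros v; unfold f, ifact; simpl; field).
assert (H1 : forall v, 0 <= f v) by (intros v; rewrite Ef; destruct (Om_bound 1 v); lra).
set (c := exp (- (PI * exp 2))). assert (Hc : 0 < c) by apply exp_pos.
assert (H2 : forall v, -1 <= v <= 1 -> c <= f v).
{ intros v Hv. rewrite Ef. unfold Om, om. assert (Hv1 : 0 <= Rabs v <= 1) by (unfold Rabs; destruct Rcase_abs; lra).
  assert (P : c <= Psi (Rabs v)).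
  { unfold Psi. rewrite Series_incr_1 by apply gterm_summable.
    assert (0 <= Series (fun k => gterm (S k) (Rabs v))).
    { apply Series_nonneg; [intros; apply Rlt_le, gterm_pos|]. apply (ex_series_incr_1 (fun n => gterm n (Rabs v))), gterm_summable. }
    assert (c <= gterm 0 (Rabs v)); [|lra].
    unfold c, gterm. apply exp_le. simpl INR. pose proof PI_RGT_0.
    assert (exp (2 * Rabs v) <= exp 2) by (apply exp_le; lra). nra. }
  assert (1 <= exp (Rabs v / 2)) by (rewrite <- exp_0; apply exp_le; lra). nra. }
assert (Hcont : forall t, continuous f t) by (intros t; apply (continuous_ext Om); [intros; now rewrite Ef|apply Om_continuous]).
pose proof (J_spec _ T) as HJ. set (l := J _) in *.
assert (2 * c <= Re l); [|lra]. apply Rnot_lt_le. intros N.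
destruct (HJ (2 * c - Re l)) as [M [HM0 HM]]; [lra|].
set (b := Rmax M 1). pose proof (Rmax_l M 1). pose proof (Rmax_r M 1). fold b in H, H0.
specialize (HM (- b) b ltac:(lra) ltac:(lra)).
assert (B := Rle_lt_trans _ _ _ (re_le_Cmod _) HM).
change (Rabs (RInt f (- b) b - Re l) < 2 * c - Re l) in B. apply Rabs_def2 in B.
assert (Ex : forall u v, ex_RInt f u v) by (intros; apply (ex_RInt_continuous (V := R_CompleteNormedModule)); auto).
assert (E1 : RInt f (- b) b = RInt f (- b) (-1) + (RInt f (-1) 1 + RInt f 1 b)).
{ symmetry. transitivity (RInt f (- b) (-1) + RInt f (-1) b).
  - f_equal. apply (RInt_Chasles (V := R_CompleteNormedModule)); auto.
  - apply (RInt_Chasles (V := R_CompleteNormedModule)); auto. }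
assert (0 <= RInt f (- b) (-1)) by (apply RInt_ge_0; auto; lra).
assert (0 <= RInt f 1 b) by (apply RInt_ge_0; auto; lra).
assert (2 * c <= RInt f (-1) 1).
{ replace (2 * c) with (RInt (fun _ => c) (-1) 1) by (rewrite RInt_constR; f_equal; lra).
  apply RInt_le; auto; [lra|apply ex_RInt_const|]. intros v Hv. apply H2; lra. }
lra.
Qed.

(** * The power series of the xi function *)

(* [xi (x + 1/2) = 1 + (x^2 - 1/4) * CP mu x]. *)
Definition ecoef (n : nat) : R :=
  match n with
  | O => 1 - mu 0 / 4
  | S O => - mu 1 / 4
  | S (S k) => mu k - mu (S (S k)) / 4
  end.

Lemma even_odd_nat n : exists k, n = (2 * k)%nat \/ n = (2 * k + 1)%nat.
Proof. exists (n / 2)%nat. pose proof (Nat.div_mod_eq n 2). pose proof (Nat.mod_upper_bound n 2). lia. Qed.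

Lemma ecoef_odd k : ecoef (2 * k + 1) = 0.
Proof.
destruct k as [|k].
- simpl. pose proof (mu_odd 0) as H. simpl in H. rewrite H. field.
- replace (2 * S k + 1)%nat with (S (S (2 * k + 1))) by lia. cbn [ecoef].
  rewrite mu_odd. replace (S (S (2 * k + 1))) with (2 * (S k) + 1)%nat by lia. rewrite mu_odd. field.
Qed.

Lemma ecoef_nonneg n : 0 <= ecoef n.
Proof.
destruct (even_odd_nat n) as [k [->| ->]]; [|rewrite ecoef_odd; lra].
destruct k as [|k].
- simpl. pose proof mu_0_lt. lra.
- replace (2 * S k)%nat with (S (S (2 * k))) by lia. cbn [ecoef].
  pose proof (mu_step k) as H. replace (2 * k + 2)%nat with (S (S (2 * k))) in H by lia.
  pose proof (mu_even_pos k). lra.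
Qed.

Lemma ecoef_0_pos : 0 < ecoef 0.
Proof. simpl. pose proof mu_0_lt. lra. Qed.

Lemma ecoef_2_pos : 0 < ecoef 2.
Proof. simpl. pose proof mu_0_pos. pose proof (mu_step 0) as H1. simpl in H1. lra. Qed.

Lemma absconv_ecoef r : 0 <= r -> absconv ecoef r.
Proof.
intros Hr. pose proof (absconv_mu r Hr) as H. unfold absconv in *.
apply ex_series_incr_1, ex_series_incr_1.
assert (H2 : ex_series (fun n => Rabs (mu (S (S n))) * r ^ S (S n))).
{ exact (proj1 (ex_series_incr_n (fun n => Rabs (mu n) * r ^ n) 2) H). }
apply (ex_series_dom _ (fun n => r ^ 2 * (Rabs (mu n) * r ^ n) + / 4 * (Rabs (mu (S (S n))) * r ^ S (S n)))).
- intros n. rewrite Rabs_pos_eq by (apply Rmult_le_pos; [apply Rabs_pos|now apply pow_le]).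
  cbn [ecoef].
  assert (T : Rabs (mu n - mu (S (S n)) / 4) <= Rabs (mu n) + / 4 * Rabs (mu (S (S n)))).
  { unfold Rminus. eapply Rle_trans; [apply Rabs_triang|]. rewrite Rabs_Ropp. unfold Rdiv. rewrite Rabs_mult, (Rabs_pos_eq (/ 4)); lra. }
  assert (0 <= r ^ S (S n)) by now apply pow_le.
  replace (r ^ 2 * (Rabs (mu n) * r ^ n) + / 4 * (Rabs (mu (S (S n))) * r ^ S (S n))) with
   ((Rabs (mu n) + / 4 * Rabs (mu (S (S n)))) * r ^ S (S n)) by (simpl; ring).
  now apply Rmult_le_compat_r.
- apply (ex_series_plus (fun n => r ^ 2 * (Rabs (mu n) * r ^ n))); now apply ex_series_scalR.
Qed.

Lemma CSeries_incr_2 f : cabs f -> CSeries f = (f 0%nat + (f 1%nat + CSeries (fun n => f (S (S n)))))%C.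
Proof.
intros H. pose proof (CSeries_tail f 1 H) as E. rewrite Csum_S, Csum_0 in E. simpl plus in E.
change (fun n => f (S (S n))) with (fun n => f (2 + n)%nat) in *. rewrite <- E. ring.
Qed.

Lemma CP_ecoef x : CP ecoef x = (1 + (x * x - / 4) * CP mu x)%C.
Proof.
pose proof (Cmod_ge_0 x) as Hx.
assert (Hm : cabs (fun n => RtoC (mu n) * x ^ n)%C) by (apply (cabs_CP mu x (Cmod x)); [apply absconv_mu|]; lra).
assert (He : cabs (fun n => RtoC (ecoef n) * x ^ n)%C) by (apply (cabs_CP ecoef x (Cmod x)); [apply absconv_ecoef|]; lra).
assert (Hm2 : cabs (fun n => RtoC (mu (S (S n))) * x ^ (S (S n)))%C).
{ exact (proj1 (ex_series_incr_n (fun n => Cmod (RtoC (mu n) * x ^ n)%C) 2) Hm). }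
unfold CP. rewrite (CSeries_incr_2 _ He).
rewrite (CSeries_ext (fun n => RtoC (ecoef (S (S n))) * x ^ S (S n))%C
  (fun n => x * x * (RtoC (mu n) * x ^ n) + (- / 4) * (RtoC (mu (S (S n))) * x ^ S (S n)))%C).
2:{ intros n. cbn [ecoef]. unfold Rdiv. rewrite RtoC_minus, RtoC_mult, RtoC_inv by lra. simpl. ring. }
rewrite CSeries_plus, !CSeries_scal by auto using cabs_scal.
assert (E2 := CSeries_incr_2 _ Hm).
set (A := CSeries (fun n => RtoC (mu n) * x ^ n)%C) in *.
set (B := CSeries (fun n => RtoC (mu (S (S n))) * x ^ S (S n))%C) in *.
cbn [ecoef]. unfold Rdiv. rewrite RtoC_minus, !RtoC_mult, RtoC_opp, !RtoC_inv by lra. rewrite E2 at 2.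
simpl. rewrite E2. ring.
Qed.

(** * The Mellin transform of the theta function *)

(** Half the Euler integrand of [Gamma (s / 2)] after the substitution [t = exp (2 v)]. *)
Definition gam (s : C) (v : R) : C := (Cexp (s * RtoC v) * RtoC (exp (- exp (2 * v))))%C.

Lemma cont_exp_exp t : continuous (fun v => exp (- exp (2 * v))) t.
Proof. apply (ex_derive_continuous (fun v => exp (- exp (2 * v)))). auto_derive; auto. Qed.

Lemma Cmod_Cexp_lin s v : Cmod (Cexp (s * RtoC v)) = exp (Re s * v).
Proof. rewrite Cmod_Cexp. f_equal. unfold Re; simpl. ring. Qed.

Lemma tame_gam s : 0 < Re s -> tame (gam s).
Proof.
intros Hs. split.
- apply rc_mult; [apply rc_Cexp_lin|apply rc_RtoC, cont_exp_exp].
- exists (kap (Re s) + 1), (Re s). split; auto. intros v. unfold gam.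
  rewrite Cmod_mult, Cmod_Cexp_lin, Cmod_R, Rabs_pos_eq by apply Rlt_le, exp_pos.
  pose proof (exp_neg_bound (Re s) (exp (2 * v)) Hs (exp_pos _)) as B. rewrite ln_exp in B.
  assert (0 < kap (Re s)) by apply exp_pos. pose proof (exp_pos (Re s * v)).
  unfold Rabs; destruct Rcase_abs.
  + replace (- Re s * - v) with (Re s * v) by ring.
    assert (exp (- exp (2 * v)) <= 1) by (rewrite <- exp_0; apply exp_le; pose proof (exp_pos (2 * v)); lra). nra.
  + apply Rle_trans with (exp (Re s * v) * (kap (Re s) * exp (- Re s * (2 * v)))).
    * apply Rmult_le_compat_l; lra.
    * replace (exp (Re s * v) * (kap (Re s) * exp (- Re s * (2 * v)))) with (kap (Re s) * (exp (Re s * v) * exp (- Re s * (2 * v)))) by ring.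
      rewrite <- exp_plus. replace (Re s * v + - Re s * (2 * v)) with (- Re s * v) by ring.
      apply Rmult_le_compat_r; [apply Rlt_le, exp_pos|lra].
Qed.

Lemma gamma_change_var s a b : 0 < a -> 0 < b ->
  is_RInt (V := C_R_NormedModule) (fun t => (Rpow t (s / RtoC 2 - RtoC 1) * RtoC (exp (- t)))%C) a b
    (RtoC 2 * CI (gam s) (ln a / 2) (ln b / 2))%C.
Proof.
intros Ha Hb.
set (f := fun t => (Rpow t (s / RtoC 2 - RtoC 1) * RtoC (exp (- t)))%C).
set (g := fun v => exp (2 * v)).
assert (Ega : g (ln a / 2) = a) by (unfold g; replace (2 * (ln a / 2)) with (ln a) by field; now apply exp_ln).
assert (Egb : g (ln b / 2) = b) by (unfold g; replace (2 * (ln b / 2)) with (ln b) by field; now apply exp_ln).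
assert (Ef : forall v, (RtoC (2 * exp (2 * v)) * f (g v))%C = (RtoC 2 * gam s v)%C).
{ intros v. unfold f, g, gam, Rpow. rewrite ln_exp, RtoC_mult.
  replace (RtoC (exp (2 * v))) with (Cexp (RtoC (2 * v))).
  2:{ unfold Cexp, RtoC; simpl. rewrite cos_0, sin_0. f_equal; ring. }
  replace (RtoC 2 * Cexp (RtoC (2 * v)) * (Cexp ((s / RtoC 2 - RtoC 1) * RtoC (2 * v)) * RtoC (exp (- exp (2 * v)))))%C
   with (RtoC 2 * (Cexp (RtoC (2 * v)) * Cexp ((s / RtoC 2 - RtoC 1) * RtoC (2 * v))) * RtoC (exp (- exp (2 * v))))%C by ring.
  rewrite <- Cexp_plus. replace (RtoC (2 * v) + (s / RtoC 2 - RtoC 1) * RtoC (2 * v))%C with (s * RtoC v)%C; [ring|].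
  rewrite RtoC_mult. field. }
assert (Cf : forall t, 0 < t -> continuous (fun t => Re (f t)) t /\ continuous (fun t => Im (f t)) t).
{ intros t Ht. set (k := (s / RtoC 2 - RtoC 1)%C).
  pose proof (rc_mult _ (fun u => RtoC (exp (- exp u))) (rc_Cexp_lin k)) as Hc.
  assert (H2 : rc (fun u => RtoC (exp (- exp u)))).
  { apply rc_RtoC. intros u. apply (ex_derive_continuous (fun v => exp (- exp v))). auto_derive; auto. }
  specialize (Hc H2 (ln t)). destruct Hc as [Hc1 Hc2].
  assert (Cl : continuous ln t).
  { apply (ex_derive_continuous ln). exists (/ t). now apply is_derive_ln. }
  assert (El : locally t (fun u => 0 < u)).
  { exists (mkposreal t Ht). intros u Hu. change (Rabs (u - t) < t) in Hu. apply Rabs_def2 in Hu. lra. }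
  split.
  - apply (continuous_ext_loc _ (fun u => Re (Cexp (k * RtoC (ln u)) * RtoC (exp (- exp (ln u))))%C) t).
    + apply (filter_imp _ _) with (2 := El). intros u Hu. unfold f, Rpow. rewrite exp_ln by auto. reflexivity.
    + apply (continuous_comp ln (fun u => Re (Cexp (k * RtoC u) * RtoC (exp (- exp u)))%C)); auto.
  - apply (continuous_ext_loc _ (fun u => Im (Cexp (k * RtoC (ln u)) * RtoC (exp (- exp (ln u))))%C) t).
    + apply (filter_imp _ _) with (2 := El). intros u Hu. unfold f, Rpow. rewrite exp_ln by auto. reflexivity.
    + apply (continuous_comp ln (fun u => Im (Cexp (k * RtoC u) * RtoC (exp (- exp u)))%C)); auto. }
assert (Dg : forall x, is_derive g x (2 * exp (2 * x)) /\ continuous (fun x => 2 * exp (2 * x)) x).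
{ intros x; split; [unfold g; auto_derive; auto; ring|].
  apply (ex_derive_continuous (fun x => 2 * exp (2 * x))). auto_derive; auto. }
assert (Hrc : rc (fun v => RtoC 2 * gam s v)%C).
{ apply rc_mult; [apply rc_const|]. apply rc_mult; [apply rc_Cexp_lin|apply rc_RtoC, cont_exp_exp]. }
assert (Ex : forall h : R -> R, (forall t, 0 < t -> continuous h t) -> ex_RInt h a b).
{ intros h Hh. apply (ex_RInt_continuous (V := R_CompleteNormedModule)). intros z Hz. apply Hh.
  pose proof (Rmin_glb_lt _ _ _ Ha Hb). lra. }
rewrite <- CI_scal by (apply rc_mult; [apply rc_Cexp_lin|apply rc_RtoC, cont_exp_exp]).
apply (is_RInt_fct_extend_pair (U := R_NormedModule) (V := R_NormedModule) f).
- rewrite (RInt_ext _ (fun v => scal (2 * exp (2 * v)) (Re (f (g v))))).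
  2:{ intros v _. rewrite <- Ef. unfold scal; simpl; unfold mult; simpl. unfold Re. eqR. ring. }
  rewrite (RInt_comp (fun t => Re (f t)) g (fun v => 2 * exp (2 * v))).
  + rewrite Ega, Egb. apply (RInt_correct (V := R_CompleteNormedModule) (fun t => Re (f t))). apply Ex. intros t Ht; exact (proj1 (Cf t Ht)).
  + intros x _. exact (proj1 (Cf _ (exp_pos _))).
  + intros x _. exact (Dg x).
- rewrite (RInt_ext _ (fun v => scal (2 * exp (2 * v)) (Im (f (g v))))).
  2:{ intros v _. rewrite <- Ef. unfold scal; simpl; unfold mult; simpl. unfold Im. eqR. ring. }
  rewrite (RInt_comp (fun t => Im (f t)) g (fun v => 2 * exp (2 * v))).
  + rewrite Ega, Egb. apply (RInt_correct (V := R_CompleteNormedModule) (fun t => Im (f t))). apply Ex. intros t Ht; exact (proj2 (Cf t Ht)).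
  + intros x _. exact (proj2 (Cf _ (exp_pos _))).
  + intros x _. exact (Dg x).
Qed.

(** Under [t = exp (2 v)] the one-sided limits at 0 and at infinity in [Gamma] become the two ends
    of the line. *)
Lemma Gamma_half s : 0 < Re s -> Gamma (s / RtoC 2) = (RtoC 2 * J (gam s))%C.
Proof.
intros Hs. unfold Gamma. apply (is_RInt_gen_unique (V := C_R_CompleteNormedModule)).
intros P [eps HP].
destruct (J_spec _ (tame_gam s Hs) (eps / 2)) as [M [HM0 HM]]; [destruct eps; simpl; lra|].
assert (E1 : 0 < exp (- (2 * M))) by apply exp_pos.
apply (Filter_prod _ _ _ (fun a => 0 < a < exp (- (2 * M))) (fun b => exp (2 * M) < b)).
- exists (mkposreal _ E1). intros a Ha1 Ha2. split; auto. change (Rabs (a - 0) < exp (- (2 * M))) in Ha1.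
  rewrite Rminus_0_r, Rabs_pos_eq in Ha1; lra.
- exists (exp (2 * M)). auto.
- intros a b [Ha0 Ha] Hb. pose proof (exp_pos (2 * M)) as E2.
  exists (RtoC 2 * CI (gam s) (ln a / 2) (ln b / 2))%C. split; [apply gamma_change_var; simpl; lra|].
  apply HP.
  assert (La : ln a / 2 <= - M).
  { assert (ln a <= - (2 * M)); [|lra]. rewrite <- (ln_exp (- (2 * M))). apply ln_le; lra. }
  assert (Lb : M <= ln b / 2).
  { assert (2 * M <= ln b); [|lra]. rewrite <- (ln_exp (2 * M)). apply ln_le; lra. }
  specialize (HM _ _ La Lb).
  assert (HM2 : Cmod (RtoC 2 * CI (gam s) (ln a / 2) (ln b / 2) - RtoC 2 * J (gam s))%C < eps).
  { replace (RtoC 2 * CI (gam s) (ln a / 2) (ln b / 2) - RtoC 2 * J (gam s))%C with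
      (RtoC 2 * (CI (gam s) (ln a / 2) (ln b / 2) - J (gam s)))%C by ring.
    rewrite Cmod_mult, Cmod_R, Rabs_pos_eq by lra. lra. }
  split.
  + eapply Rle_lt_trans; [|apply HM2]. apply (re_le_Cmod (RtoC 2 * CI (gam s) (ln a / 2) (ln b / 2) - RtoC 2 * J (gam s))%C).
  + eapply Rle_lt_trans; [|apply HM2]. apply (im_le_Cmod (RtoC 2 * CI (gam s) (ln a / 2) (ln b / 2) - RtoC 2 * J (gam s))%C).
Qed.

Definition mell (s : C) (n : nat) (v : R) : C := (Cexp (s * RtoC v) * RtoC (gterm n v))%C.

Lemma RtoC_exp x : RtoC (exp x) = Cexp (RtoC x).
Proof. unfold Cexp, RtoC; simpl. rewrite cos_0, sin_0. f_equal; ring. Qed.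

(** [gterm n] is the Gamma kernel translated by [c], because [exp (2 c) = PI (n + 1)^2]. The factor
    in front is the general term of zeta times the power of pi. *)
Lemma mell_shift s n v : mell s n v =
  (Cexp (- (s * RtoC (ln (INR (S n)) + ln PI / 2))) * gam s (v + (ln (INR (S n)) + ln PI / 2)))%C.
Proof.
set (c := ln (INR (S n)) + ln PI / 2). unfold mell, gam.
assert (Hn : 0 < INR (S n)) by (apply lt_0_INR; lia).
assert (E : exp (2 * (v + c)) = PI * INR (S n) ^ 2 * exp (2 * v)).
{ rewrite <- (exp_ln PI) by apply PI_RGT_0. rewrite <- (exp_ln (INR (S n))) at 1 by auto.
  rewrite <- Rpower_pow by apply exp_pos. unfold Rpower. rewrite ln_exp, <- !exp_plus. f_equal. unfold c. simpl (INR 2). field. }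
rewrite E. fold (gterm n v). rewrite Cmult_assoc, <- Cexp_plus.
replace (- (s * RtoC c) + s * RtoC (v + c))%C with (s * RtoC v)%C by (rewrite RtoC_plus; ring). reflexivity.
Qed.

Lemma tame_shift g c : tame g -> tame (fun t => g (t + c)).
Proof.
intros [Hg [K [d [Hd HK]]]]. split.
- intros t. destruct (Hg (t + c)) as [H1 H2].
  assert (Hc : continuous (fun t => t + c) t) by (apply (ex_derive_continuous (fun t => t + c)); auto_derive; auto).
  split; [apply (continuous_comp (fun t => t + c) (fun t => Re (g t)))|apply (continuous_comp (fun t => t + c) (fun t => Im (g t)))]; auto.
- exists (K * exp (d * Rabs c)), d. split; auto. intros t. pose proof (decays_nonneg g K d HK).
  eapply Rle_trans; [apply HK|]. rewrite Rmult_assoc, <- exp_plus. apply Rmult_le_compat_l; auto. apply exp_le.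
  assert (Rabs t <= Rabs (t + c) + Rabs c).
  { replace t with ((t + c) + - c) at 1 by ring. eapply Rle_trans; [apply Rabs_triang|]. rewrite Rabs_Ropp. lra. }
  nra.
Qed.

Lemma tame_mell s n : 0 < Re s -> tame (mell s n).
Proof.
intros Hs. eapply tame_ext; [intros v; symmetry; apply mell_shift|].
apply tame_scal. apply (tame_shift (gam s)). now apply tame_gam.
Qed.

Lemma J_mell s n : 0 < Re s ->
  J (mell s n) = (Rpow PI (- (s / RtoC 2)) * Rpow (INR (S n)) (- s) * J (gam s))%C.
Proof.
intros Hs. rewrite (J_ext _ _ (mell_shift s n)).
rewrite J_scal by (apply (tame_shift (gam s)); now apply tame_gam).
rewrite (J_shift (gam s)) by now apply tame_gam. f_equal.
unfold Rpow. rewrite <- Cexp_plus. f_equal. rewrite RtoC_plus, RtoC_div by lra.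
field.
Qed.

Lemma cabs_zeta s : 1 < Re s -> cabs (fun k => Rpow (INR (S k)) (- s)).
Proof.
intros Hs. apply (cabs_dom _ (wt (Re s))); [|now apply ex_series_wt].
intros n. unfold Rpow, wt. rewrite Cmod_Cexp_lin. simpl. apply Req_le. reflexivity.
Qed.

Definition mellPsi (s : C) (v : R) : C := (Cexp (s * RtoC v) * RtoC (Psi v))%C.

(** The weights [b] allow one bound to serve both the whole series and its tails. Of the two
    exponents in [gterm_bound], [(1 + Re s) / 4] is for [v < 0] and [(3 Re s - 1) / 4] for [0 <= v];
    multiplied by [exp (Re s * v)] both leave decay at the same rate [(Re s - 1) / 2]. *)
Lemma mell_tail_decays s b : 1 < Re s -> (forall n, 0 <= b n <= 1) ->
  decays (fun v => Cexp (s * RtoC v) * RtoC (Series (fun n => (b n * gterm n v)%R)))%C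
    ((kap ((1 + Re s) / 4) + kap ((3 * Re s - 1) / 4)) * Series (fun n => b n * wt ((1 + Re s) / 2) n)) ((Re s - 1) / 2).
Proof.
intros Hs Hb v. set (P := (1 + Re s) / 2). set (K1 := kap ((1 + Re s) / 4)). set (K2 := kap ((3 * Re s - 1) / 4)).
assert (HK1 : 0 < K1) by apply exp_pos. assert (HK2 : 0 < K2) by apply exp_pos.
assert (Es : ex_series (fun n => b n * wt P n)).
{ apply (ex_series_dom _ (wt P)); [|apply ex_series_wt; unfold P; lra].
  intros n. pose proof (wt_pos P n). destruct (Hb n). rewrite Rabs_pos_eq; nra. }
assert (B : Series (fun n => b n * gterm n v) <= (K1 + K2) * Series (fun n => b n * wt P n) * exp (- (Re s * v) - (Re s - 1) / 2 * Rabs v)).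
{ rewrite <- Series_scal_l, <- Series_scal_r. apply Series_le.
  - intros n. destruct (Hb n) as [Hb0 Hb1]. pose proof (gterm_pos n v). pose proof (wt_pos P n) as Hw. split; [nra|].
    assert (G : gterm n v <= (K1 + K2) * wt P n * exp (- (Re s * v) - (Re s - 1) / 2 * Rabs v)).
    { unfold Rabs; destruct Rcase_abs as [Hv|Hv].
      - eapply Rle_trans; [apply (gterm_bound ((1 + Re s) / 4)); lra|].
        replace (2 * ((1 + Re s) / 4)) with P by (unfold P; field). fold K1.
        replace (- (Re s * v) - (Re s - 1) / 2 * - v) with (- P * v) by (unfold P; field).
        apply Rmult_le_compat_r; [apply Rlt_le, exp_pos|]. nra.
      - eapply Rle_trans; [apply (gterm_bound ((3 * Re s - 1) / 4)); lra|].
        fold K2. replace (- (Re s * v) - (Re s - 1) / 2 * v) with (- (2 * ((3 * Re s - 1) / 4)) * v) by field.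
        apply Rmult_le_compat_r; [apply Rlt_le, exp_pos|].
        assert (wt (2 * ((3 * Re s - 1) / 4)) n <= wt P n).
        { unfold wt. apply exp_le. pose proof (ln_S_pos n). unfold P. nra. }
        pose proof (wt_pos (2 * ((3 * Re s - 1) / 4)) n). nra. }
    apply Rle_trans with (b n * ((K1 + K2) * wt P n * exp (- (Re s * v) - (Re s - 1) / 2 * Rabs v))).
    + now apply Rmult_le_compat_l.
    + apply Req_le; ring.
  - apply ex_series_scal_r. now apply ex_series_scalR. }
assert (B0 : 0 <= Series (fun n => b n * gterm n v)).
{ apply Series_nonneg.
  - intros n. destruct (Hb n). pose proof (gterm_pos n v). nra.
  - apply (ex_series_dom _ (fun n => gterm n v)); [|apply gterm_summable].
    intros n. pose proof (gterm_pos n v). destruct (Hb n). rewrite Rabs_pos_eq; nra. }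
rewrite Cmod_mult, Cmod_Cexp_lin, Cmod_R, Rabs_pos_eq by auto.
apply Rle_trans with (exp (Re s * v) * ((K1 + K2) * Series (fun n => b n * wt P n) * exp (- (Re s * v) - (Re s - 1) / 2 * Rabs v))).
- apply Rmult_le_compat_l; auto. apply Rlt_le, exp_pos.
- apply Req_le. replace (- (Re s * v) - (Re s - 1) / 2 * Rabs v) with (- (Re s * v) + - ((Re s - 1) / 2) * Rabs v) by ring.
  rewrite exp_plus, exp_Ropp. field. apply Rgt_not_eq, exp_pos.
Qed.

Lemma tame_mellPsi s : 1 < Re s -> tame (mellPsi s).
Proof.
intros Hs. split.
- apply rc_mult; [apply rc_Cexp_lin|apply rc_RtoC, Psi_continuous].
- pose proof (mell_tail_decays s (fun _ => 1) Hs ltac:(intros; lra)) as H. eexists; eexists; split; [|].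
  2:{ intros v. specialize (H v). cbv beta in H. rewrite (Series_ext (fun n => 1 * gterm n v) (fun n => gterm n v)) in H by (intros; ring). exact H. }
  lra.
Qed.

(** Sum and integral are exchanged: the error after [N] terms is the integral of the weighted tail,
    which [mell_tail_decays] bounds by a tail of [wt P]. *)
Theorem mellin_zeta s : 1 < Re s ->
  (Rpow PI (- (s / RtoC 2)) * Gamma (s / RtoC 2) * zeta s)%C = (RtoC 2 * J (mellPsi s))%C.
Proof.
intros Hs. rewrite Gamma_half by lra.
change (zeta s) with (CSeries (fun k => Rpow (INR (S k)) (- s))).
set (X := (Rpow PI (- (s / RtoC 2)) * J (gam s))%C).
assert (Em : J (mellPsi s) = (X * CSeries (fun k => Rpow (INR (S k)) (- s)))%C).
{ apply C_eq_of_small. intros eps He.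
  assert (HC := cabs_zeta s Hs). pose proof (Cmod_ge_0 X) as HX.
  destruct (Csum_lim _ (eps / (2 * (Cmod X + 1))) HC) as [N0 HN0]; [apply Rdiv_lt_0_compat; lra|].
  set (P := (1 + Re s) / 2). set (K := kap ((1 + Re s) / 4) + kap ((3 * Re s - 1) / 4)).
  assert (HK : 0 < K) by (apply Rplus_lt_0_compat; apply exp_pos).
  assert (Ew : ex_series (wt P)) by (apply ex_series_wt; unfold P; lra).
  set (q := eps * ((Re s - 1) / 2) / (4 * K)).
  assert (Hq : 0 < q) by (apply Rdiv_lt_0_compat; nra).
  assert (Lw : is_lim_seq (sum_n (wt P)) (Series (wt P))) by exact (Series_correct _ Ew).
  apply is_lim_seq_spec in Lw. destruct (Lw (mkposreal _ Hq)) as [N1 HN1].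
  set (N := max N0 N1). specialize (HN0 N ltac:(unfold N; lia)). specialize (HN1 N ltac:(unfold N; lia)).
  simpl in HN1. rewrite sum_n_Reals in HN1.
  destruct (Csum_J (fun n => mell s n) N) as [T1 T2]; [intros; apply tame_mell; lra|].
  assert (E1 : J (fun v => Csum (fun n => mell s n v) N) = (X * Csum (fun k => Rpow (INR (S k)) (- s)) N)%C).
  { rewrite T2, <- Csum_scal. apply Csum_ext. intros n _. rewrite J_mell by lra. unfold X. ring. }
  (* Weights that select the terms beyond [N]. *)
  set (b := fun n => if Compare_dec.le_dec n N then 0 else 1).
  assert (Hb : forall n, 0 <= b n <= 1) by (intros n; unfold b; destruct Compare_dec.le_dec; lra).
  assert (Sb : forall a : nat -> R, ex_series a -> Series (fun n => b n * a n) = Series a - sum_f_R0 a N).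
  { intros a Ha. rewrite (Series_incr_n a (S N)) by (auto; lia). simpl pred.
    assert (Hba : ex_series (fun n => b n * a n)).
    { apply (ex_series_incr_n _ (S N)). apply (ex_series_ext (fun k => a (S N + k)%nat)).
      - intros k. unfold b. destruct Compare_dec.le_dec; [lia|]. now rewrite Rmult_1_l.
      - now apply (ex_series_incr_n a (S N)). }
    rewrite (Series_incr_n (fun n => b n * a n) (S N)) by (auto; lia). simpl pred.
    rewrite (sum_eq (fun n => b n * a n) (fun _ => 0)).
    - rewrite sum_cte. rewrite (Series_ext (fun k => b (S N + k)%nat * a (S N + k)%nat) (fun k => a (S N + k)%nat)).
      + ring.
      + intros k. unfold b. destruct Compare_dec.le_dec; [lia|]. now rewrite Rmult_1_l.
    - intros i Hi. unfold b. destruct Compare_dec.le_dec; [ring|lia]. }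
  pose proof (mell_tail_decays s b Hs Hb) as D. fold P K in D. rewrite Sb in D by auto.
  assert (D2 : decays (fun v => mellPsi s v - Csum (fun n => mell s n v) N)%C (K * (Series (wt P) - sum_f_R0 (wt P) N)) ((Re s - 1) / 2)).
  { intros v. eapply Rle_trans; [|apply D]. apply Req_le. f_equal. rewrite Sb by apply gterm_summable.
    unfold mellPsi, mell. rewrite Csum_scal, RtoC_minus. fold (Psi v).
    replace (Csum (fun n => RtoC (gterm n v)) N) with (RtoC (sum_f_R0 (fun n => gterm n v) N)).
    - ring.
    - clear. induction N as [|N IH]; [now rewrite Csum_0|]. rewrite Csum_S, <- IH, tech5, RtoC_plus. reflexivity. }
  assert (Bd := J_dist _ _ _ ((Re s - 1) / 2) (tame_mellPsi s Hs) T1 ltac:(lra) D2). rewrite E1 in Bd.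
  set (Z := CSeries _) in *. set (ZN := Csum (fun k => Rpow (INR (S k)) (- s)) N) in *.
  replace (J (mellPsi s) - X * Z)%C with ((J (mellPsi s) - X * ZN) + - (X * (Z - ZN)))%C by ring.
  eapply Rle_lt_trans; [apply Cmod_triangle|]. rewrite Cmod_opp, Cmod_mult.
  assert (B1 : Cmod X * Cmod (Z - ZN) <= eps / 2).
  { apply Rle_trans with ((Cmod X + 1) * (eps / (2 * (Cmod X + 1)))).
    - apply Rmult_le_compat; try lra. apply Cmod_ge_0.
    - apply Req_le; field; lra. }
  assert (B2 : 2 * (K * (Series (wt P) - sum_f_R0 (wt P) N)) / ((Re s - 1) / 2) < eps / 2).
  { apply Rabs_def2 in HN1. apply Rmult_lt_reg_r with ((Re s - 1) / 2); [lra|].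
    unfold Rdiv at 1. rewrite Rmult_assoc, Rinv_l by lra.
    assert (K * (Series (wt P) - sum_f_R0 (wt P) N) < K * q) by (apply Rmult_lt_compat_l; lra).
    assert (Eq : K * q = eps * ((Re s - 1) / 2) / 4) by (unfold q; field; lra). lra. }
  lra. }
rewrite Em. unfold X. ring.
Qed.

(** The discrepancy between [om] and its even version [Om], times [exp (x v)]. It lives on [v <= 0];
    [Rmin v 0] gives a single formula that is zero for [0 <= v]. *)
Definition negpart (x : C) (v : R) : C :=
  (Cexp (x * RtoC (Rmin v 0)) * RtoC ((exp (- Rmin v 0 / 2) - exp (Rmin v 0 / 2)) / 2))%C.

Lemma om_minus_Om x v : (Cexp (x * RtoC v) * RtoC (om v))%C =
  (RtoC (Om v) * Cexp (x * RtoC v) + negpart x v)%C.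
Proof.
unfold negpart, Om. unfold Rmin; destruct Rle_dec as [H|H].
- rewrite <- (Rabs_Ropp v), Rabs_pos_eq by lra. rewrite <- om_refl, RtoC_minus. ring.
- rewrite Rabs_pos_eq by lra. replace (- 0 / 2) with (0 / 2) by field.
  replace ((exp (0 / 2) - exp (0 / 2)) / 2) with 0 by field. ring.
Qed.

(** On [v <= 0] the integrand is half the difference of two exponentials, integrable since
    [Re x > 1/2]. With [x = s - 1/2] the result is [1 / (s (s - 1))], the polar part that the factor
    [s (s - 1)] of xi turns into the constant 1. *)
Lemma J_negpart x : / 2 < Re x -> tame (negpart x) ->
  (RtoC 2 * J (negpart x))%C = (/ (x * x - / RtoC 4))%C.
Proof.
intros Hx HT.
assert (N2 : RtoC 2 <> RtoC 0) by (intros E; apply RtoC_inj in E; lra).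
assert (Nm : (x - RtoC (/ 2))%C <> RtoC 0).
{ intros E. assert (Re (x - RtoC (/ 2))%C = 0) by (rewrite E; reflexivity). simpl in H. unfold Re in Hx. lra. }
assert (Np : (x + RtoC (/ 2))%C <> RtoC 0).
{ intros E. assert (Re (x + RtoC (/ 2))%C = 0) by (rewrite E; reflexivity). simpl in H. unfold Re in Hx. lra. }
set (l := (/ RtoC 2 * (/ (x - RtoC (/ 2)) - / (x + RtoC (/ 2))))%C).
assert (E : J (negpart x) = l).
{ apply J_unique. intros eps He.
  assert (Ea : forall a, a <= 0 -> CI (negpart x) a 0 =
    (/ RtoC 2 * ((Cexp 0 - Cexp ((x - RtoC (/ 2)) * RtoC a)) / (x - RtoC (/ 2)) + - ((Cexp 0 - Cexp ((x + RtoC (/ 2)) * RtoC a)) / (x + RtoC (/ 2)))))%C).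
  { intros a Ha.
    rewrite (CI_ext _ (fun v => / RtoC 2 * (Cexp ((x - RtoC (/ 2)) * RtoC v) + - (1) * Cexp ((x + RtoC (/ 2)) * RtoC v)))%C).
    - rewrite CI_scal, CI_plus, CI_scal, !CI_Cexp; auto using rc_Cexp_lin.
      + rewrite !Cmult_0_r. ring.
      + apply rc_mult; auto using rc_const, rc_Cexp_lin.
      + apply rc_plus; [apply rc_Cexp_lin|]. apply rc_mult; auto using rc_const, rc_Cexp_lin.
    - intros v Hv. rewrite Rmin_left, Rmax_right in Hv by auto. unfold negpart. rewrite (Rmin_left v 0) by lra.
      replace ((exp (- v / 2) - exp (v / 2)) / 2) with (/ 2 * (exp (- v / 2) - exp (v / 2))) by field. rewrite RtoC_mult, RtoC_minus, !RtoC_exp, <- RtoC_inv by lra.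
      replace ((x - RtoC (/ 2)) * RtoC v)%C with (x * RtoC v + RtoC (- v / 2))%C by (unfold Rdiv; rewrite RtoC_mult, RtoC_opp; ring).
      replace ((x + RtoC (/ 2)) * RtoC v)%C with (x * RtoC v + RtoC (v / 2))%C by (unfold Rdiv; rewrite RtoC_mult; ring).
      rewrite !Cexp_plus. ring. }
  set (A := Cmod (/ (x - RtoC (/ 2)))%C + Cmod (/ (x + RtoC (/ 2)))%C).
  destruct (exp_decay_small (Re x - / 2) eps A ltac:(lra) He) as [n Hn].
  exists (INR n). split; [apply pos_INR|]. intros a b Ha Hb. pose proof (pos_INR n).
  rewrite <- (CI_Chasles _ a 0 b) by apply HT.
  rewrite (CI_ext (negpart x) (fun _ => 0%C) 0 b).
  2:{ intros v Hv. rewrite Rmin_left, Rmax_right in Hv by lra. unfold negpart. rewrite Rmin_right by lra.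
    replace (- 0 / 2) with (0 / 2) by field. replace ((exp (0 / 2) - exp (0 / 2)) / 2) with 0 by field. ring. }
  rewrite CI_const, Ea by lra. rewrite Cexp_0.
  replace (/ RtoC 2 * ((1 - Cexp ((x - RtoC (/ 2)) * RtoC a)) / (x - RtoC (/ 2)) + - ((1 - Cexp ((x + RtoC (/ 2)) * RtoC a)) / (x + RtoC (/ 2)))) + RtoC (b - 0) * 0 - l)%C
   with (/ RtoC 2 * (- (Cexp ((x - RtoC (/ 2)) * RtoC a) * / (x - RtoC (/ 2))) + Cexp ((x + RtoC (/ 2)) * RtoC a) * / (x + RtoC (/ 2))))%C
   by (unfold l; field; auto).
  eapply Rle_lt_trans; [|apply (Hn (- a)); lra].
  rewrite Cmod_mult, Cmod_inv, Cmod_R, Rabs_pos_eq by (auto; lra).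
  assert (T : Cmod (- (Cexp ((x - RtoC (/ 2)) * RtoC a) * / (x - RtoC (/ 2))) + Cexp ((x + RtoC (/ 2)) * RtoC a) * / (x + RtoC (/ 2)))%C
    <= A * exp (- (Re x - / 2) * - a)).
  { eapply Rle_trans; [apply Cmod_triangle|]. rewrite Cmod_opp, !Cmod_mult, !Cmod_Cexp_lin. unfold A.
    rewrite Rmult_plus_distr_r. apply Rplus_le_compat; rewrite Rmult_comm; apply Rmult_le_compat_l; try apply Cmod_ge_0;
    apply exp_le; unfold Re in *; simpl; nra. }
  pose proof (Cmod_ge_0 (- (Cexp ((x - RtoC (/ 2)) * RtoC a) * / (x - RtoC (/ 2))) + Cexp ((x + RtoC (/ 2)) * RtoC a) * / (x + RtoC (/ 2)))%C).
  lra. }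
rewrite E. unfold l.
assert (E4 : (x * x - / RtoC 4)%C = ((x - RtoC (/ 2)) * (x + RtoC (/ 2)))%C).
{ replace (/ RtoC 4)%C with (RtoC (/ 2) * RtoC (/ 2))%C; [ring|].
  rewrite <- RtoC_mult, <- RtoC_inv by lra. f_equal. field. }
rewrite E4.
assert (E1 : (RtoC (/ 2) + RtoC (/ 2))%C = RtoC 1) by (rewrite <- RtoC_plus; f_equal; field).
replace (/ (x - RtoC (/ 2)) - / (x + RtoC (/ 2)))%C with ((RtoC (/ 2) + RtoC (/ 2)) * / ((x - RtoC (/ 2)) * (x + RtoC (/ 2))))%C by (field; auto).
rewrite E1. field. repeat split; auto.
Qed.

Definition xiE (s : C) : C := CP ecoef (s - RtoC (/ 2)).

Lemma holo_CP_ecoef : holo (CP ecoef).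
Proof.
intros z. exists (CP (PS_derive ecoef) z). apply (cdiff_CP ecoef z (Cmod z + 1)); [|lra].
apply absconv_ecoef. pose proof (Cmod_ge_0 z); lra.
Qed.

Lemma holo_xiE : holo xiE.
Proof.
apply (holo_comp (CP ecoef) (fun s => s - RtoC (/ 2))%C); [apply holo_CP_ecoef|].
apply (holo_plus (fun s => s) (fun _ => - RtoC (/ 2))%C); [apply holo_id|apply holo_const].
Qed.

(** The Mellin integral splits into the transform of the even kernel [Om], which is entire in [x],
    and the elementary polar part. *)
Theorem is_xi_xiE : is_xi xiE.
Proof.
split.
- intros z. apply cdiff_ex_derive, holo_xiE.
- intros s Hs. set (x := (s - RtoC (/ 2))%C).
  assert (Hx : / 2 < Re x) by (unfold x; unfold Re in *; simpl; lra).
  transitivity (s * (s - RtoC 1) * (Rpow PI (- (s / RtoC 2)) * Gamma (s / RtoC 2) * zeta s))%C; [|ring].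
  rewrite mellin_zeta by auto.
  assert (Ev : forall v, mellPsi s v = (Cexp (x * RtoC v) * RtoC (om v))%C).
  { intros v. unfold mellPsi, om. rewrite RtoC_mult, RtoC_exp.
    replace (Cexp (x * RtoC v) * (Cexp (RtoC (v / 2)) * RtoC (Psi v)))%C with ((Cexp (x * RtoC v) * Cexp (RtoC (v / 2))) * RtoC (Psi v))%C by ring.
    rewrite <- Cexp_plus. f_equal. f_equal. unfold x, Rdiv. rewrite RtoC_mult. ring. }
  assert (TO := tame_OmCexp x).
  assert (TN : tame (negpart x)).
  { apply (tame_ext (fun v => mellPsi s v + - (1) * (RtoC (Om v) * Cexp (x * RtoC v)))%C).
    - intros v. rewrite Ev, om_minus_Om. ring.
    - auto using tame_plus, tame_scal, tame_mellPsi. }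
  assert (EJ : J (mellPsi s) = (J (fun v => RtoC (Om v) * Cexp (x * RtoC v)) + J (negpart x))%C).
  { rewrite <- J_plus by auto. apply J_ext. intros v. now rewrite Ev, om_minus_Om. }
  rewrite EJ. unfold xiE. fold x. rewrite CP_ecoef, mu_generating.
  assert (JN := J_negpart x Hx TN).
  rewrite Cmult_plus_distr_l, JN.
  assert (Es : (s * (s - RtoC 1))%C = (x * x - / RtoC 4)%C).
  { unfold x. rewrite <- RtoC_inv by lra. replace (/ 4) with (/ 2 * / 2) by field. rewrite RtoC_mult.
    replace (RtoC 1) with (RtoC (/ 2) + RtoC (/ 2))%C by (rewrite <- RtoC_plus; f_equal; field). ring. }
  assert (Nz : (x * x - / RtoC 4)%C <> RtoC 0).
  { rewrite <- Es. apply Cmult_neq_0; intros E.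
    - rewrite E in Hs. simpl in Hs. lra.
    - assert (Re (s - RtoC 1)%C = 0) by (rewrite E; reflexivity). unfold Re in *. simpl in H. lra. }
  rewrite Es, Cmult_plus_distr_l, Cinv_r by auto. ring.
Qed.

(** [is_xi_xiE] shows that the choice made by [epsilon] satisfies [is_xi]; the difference of two
    such functions vanishes on a half-plane. *)
Theorem xi_eq z : xi z = xiE z.
Proof.
assert (H : is_xi xi) by (unfold xi; apply epsilon_spec; exists xiE; apply is_xi_xiE).
destruct H as [H1 H2]. destruct is_xi_xiE as [G1 G2].
assert (Hh : holo (fun z => xi z + - (1) * xiE z)%C).
{ apply holo_plus; [intros w; apply cdiff_ex_derive, H1|].
  apply holo_mult; [apply holo_const|apply holo_xiE]. }
assert (E := holo_zero_half_plane _ 1 Hh). cbv beta in E.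
assert (E0 : (xi z + - (1) * xiE z)%C = 0%C).
{ apply E. intros w Hw. rewrite H2, G2 by auto. ring. }
replace (xi z) with ((xi z + - (1) * xiE z) + xiE z)%C by ring. rewrite E0. ring.
Qed.

Theorem xiR_eq x : xiR x = PSeries ecoef (x - / 2).
Proof.
unfold xiR. rewrite xi_eq. unfold xiE. rewrite <- RtoC_minus, CP_real. reflexivity.
Qed.

(** * Smooth functions *)

(** Recursion on the derivative as a global function lets products, inverses and logarithms be
    treated by induction on the order. *)
Fixpoint Cn (n : nat) (f : R -> R) : Prop :=
  match n with
  | O => True
  | S n => (forall x, ex_derive f x) /\ Cn n (Derive f)
  end.

Definition smooth (f : R -> R) : Prop := forall n, Cn n f.

Lemma smooth_ex_derive f : smooth f -> forall x, ex_derive f x.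
Proof. intros H. apply (H 1%nat). Qed.

Lemma smooth_Derive f : smooth f -> smooth (Derive f).
Proof. intros H n. apply (H (S n)). Qed.

Lemma smooth_Derive_n f n : smooth f -> smooth (Derive_n f n).
Proof. intros H. induction n as [|n IH]; simpl; auto. now apply smooth_Derive. Qed.

Lemma Cn_le n : forall f, Cn (S n) f -> Cn n f.
Proof.
induction n as [|n IH]; intros f [H1 H2]; simpl; auto.
Qed.

Lemma Cn_plus n : forall f g, Cn n f -> Cn n g -> Cn n (fun x => f x + g x).
Proof.
induction n as [|n IH]; intros f g Hf Hg; simpl; auto. destruct Hf as [Hf1 Hf2], Hg as [Hg1 Hg2].
split; [intros; now apply (ex_derive_plus (K := R_AbsRing) (V := R_NormedModule))|].
replace (Derive (fun x => f x + g x)) with (fun x => Derive f x + Derive g x); auto.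
apply functional_extensionality; intros x. symmetry; now apply Derive_plus.
Qed.

Lemma Cn_mult n : forall f g, Cn n f -> Cn n g -> Cn n (fun x => f x * g x).
Proof.
induction n as [|n IH]; intros f g Hf Hg; [simpl; auto|].
pose proof (Cn_le n f Hf). pose proof (Cn_le n g Hg).
destruct Hf as [Hf1 Hf2], Hg as [Hg1 Hg2].
split; [intros; now apply ex_derive_mult|].
replace (Derive (fun x => f x * g x)) with (fun x => Derive f x * g x + f x * Derive g x).
- apply Cn_plus; auto.
- apply functional_extensionality; intros x. symmetry; now apply Derive_mult.
Qed.

Lemma Cn_const n : forall c, Cn n (fun _ => c).
Proof.
induction n as [|n IH]; intros c; simpl; auto. split; [intros; apply ex_derive_const|].
replace (Derive (fun _ => c)) with (fun _ : R => 0); auto.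
apply functional_extensionality; intros x. now rewrite Derive_const.
Qed.

Lemma Cn_inv n : forall f, (forall x, f x <> 0) -> Cn n f -> Cn n (fun x => / f x).
Proof.
induction n as [|n IH]; intros f H0 Hf; [simpl; auto|].
pose proof (Cn_le n f Hf). destruct Hf as [Hf1 Hf2].
split; [intros; now apply ex_derive_inv|].
replace (Derive (fun x => / f x)) with (fun x => (-1 * Derive f x) * (/ f x * / f x)).
- apply Cn_mult; [apply Cn_mult; auto using Cn_const|]. apply Cn_mult; auto.
- apply functional_extensionality; intros x. rewrite Derive_inv by auto. field. auto.
Qed.

Lemma smooth_mult f g : smooth f -> smooth g -> smooth (fun x => f x * g x).
Proof. intros Hf Hg n; now apply Cn_mult. Qed.

Lemma smooth_const c : smooth (fun _ => c).
Proof. intros n; apply Cn_const. Qed.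

Lemma smooth_inv f : (forall x, f x <> 0) -> smooth f -> smooth (fun x => / f x).
Proof. intros H Hf n; now apply Cn_inv. Qed.

Lemma smooth_of_Derive f : (forall x, ex_derive f x) -> smooth (Derive f) -> smooth f.
Proof. intros H1 H2 [|n]; simpl; auto. Qed.

Lemma smooth_id : smooth (fun x => x).
Proof.
apply smooth_of_Derive; [intros; apply ex_derive_id|].
replace (Derive (fun x => x)) with (fun _ : R => 1); [apply smooth_const|].
apply functional_extensionality; intros x. now rewrite Derive_id.
Qed.

Lemma smooth_pow m : smooth (fun x => x ^ m).
Proof.
induction m as [|m IH]; simpl; [apply smooth_const|]. apply smooth_mult; auto using smooth_id.
Qed.

Lemma smooth_ln f : (forall x, 0 < f x) -> smooth f -> smooth (fun x => ln (f x)).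
Proof.
intros H0 Hf.
assert (D : forall x, is_derive (fun x => ln (f x)) x (Derive f x * / f x)).
{ intros x. apply (is_derive_comp ln f); [now apply is_derive_ln|].
  apply Derive_correct, smooth_ex_derive; auto. }
apply smooth_of_Derive; [intros x; eexists; apply D|].
replace (Derive (fun x => ln (f x))) with (fun x => Derive f x * / f x).
- apply smooth_mult; [now apply smooth_Derive|]. apply smooth_inv; auto.
  intros x; specialize (H0 x); lra.
- apply functional_extensionality; intros x. symmetry; apply is_derive_unique, D.
Qed.

Lemma is_derive_sum_f (u du : nat -> R -> R) N x : (forall k, (k <= N)%nat -> is_derive (u k) x (du k x)) ->
  is_derive (fun x => sum_f_R0 (fun k => u k x) N) x (sum_f_R0 (fun k => du k x) N).
Proof.
induction N as [|N IH]; intros H; simpl; [apply H; lia|].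
apply (is_derive_plus (K := R_AbsRing) (V := R_NormedModule)); [apply IH; intros; apply H; lia|apply H; lia].
Qed.

Lemma Derive_n_id_mult h k x : smooth h ->
  Derive_n (fun s => s * h s) (S k) x = x * Derive_n h (S k) x + INR (S k) * Derive_n h k x.
Proof.
intros Hh. revert x. induction k as [|k IH]; intros x.
- change (Derive (fun s => s * h s) x = x * Derive h x + 1 * h x). rewrite Derive_mult; [|apply ex_derive_id|now apply smooth_ex_derive]. rewrite Derive_id. ring.
- change (Derive_n (fun s => s * h s) (S (S k)) x) with (Derive (Derive_n (fun s => s * h s) (S k)) x).
  rewrite (Derive_ext _ _ x IH).
  assert (S1 := smooth_Derive_n h (S k) Hh). assert (S0 := smooth_Derive_n h k Hh).
  assert (D1 := Derive_correct _ x (smooth_ex_derive _ S1 x)).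
  assert (D0 := Derive_correct _ x (smooth_ex_derive _ S0 x)).
  change (Derive (Derive_n h (S k)) x) with (Derive_n h (S (S k)) x) in D1.
  change (Derive (Derive_n h k) x) with (Derive_n h (S k) x) in D0.
  apply is_derive_unique.
  replace (x * Derive_n h (S (S k)) x + INR (S (S k)) * Derive_n h (S k) x) with
    ((1 * Derive_n h (S k) x + x * Derive_n h (S (S k)) x) + INR (S k) * Derive_n h (S k) x)
    by (rewrite (S_INR (S k)); ring).
  apply (is_derive_plus (K := R_AbsRing) (V := R_NormedModule) (fun s => s * Derive_n h (S k) s)).
  + apply (is_derive_mult (fun s => s) (Derive_n h (S k))); auto; [apply (is_derive_id (K := R_AbsRing))|].
    intros; apply Rmult_comm.
  + apply (is_derive_scal (Derive_n h k)). exact D0.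
Qed.

(** * The xi function on the real axis *)

Lemma absconv_radius a r : 0 <= r -> absconv a r -> Rbar_le r (CV_radius a).
Proof.
intros Hr H. destruct (CV_radius_bounded a) as [Hub _]. apply Hub.
exists (Series (fun n => Rabs (a n) * r ^ n)). intros n.
assert (Hp : forall k, 0 <= Rabs (a k) * r ^ k) by (intros; apply Rmult_le_pos; [apply Rabs_pos|now apply pow_le]).
rewrite Rabs_mult, (Rabs_pos_eq (r ^ n)) by now apply pow_le.
rewrite (Series_incr_n _ (S n)) by (auto; lia). simpl pred.
assert (0 <= Series (fun k => Rabs (a (S n + k)%nat) * r ^ (S n + k))).
{ apply Series_nonneg; auto. now apply (ex_series_incr_n (fun k => Rabs (a k) * r ^ k) (S n)). }
assert (Rabs (a n) * r ^ n <= sum_f_R0 (fun k => Rabs (a k) * r ^ k) n); [|lra].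
destruct n as [|n]; [simpl; lra|]. rewrite tech5.
pose proof (cond_pos_sum (fun k => Rabs (a k) * r ^ k) n Hp). lra.
Qed.

Lemma CV_ecoef : CV_radius ecoef = p_infty.
Proof.
assert (H : forall r, 0 <= r -> Rbar_le r (CV_radius ecoef)) by (intros; apply absconv_radius; auto using absconv_ecoef).
destruct (CV_radius ecoef) as [c| |]; auto.
- specialize (H (Rabs c + 1) ltac:(pose proof (Rabs_pos c); lra)). simpl in H. pose proof (Rle_abs c). lra.
- specialize (H 0 (Rle_refl 0)). contradiction.
Qed.

Lemma smooth_PSeries a : CV_radius a = p_infty -> smooth (PSeries a).
Proof.
intros Ha n. revert a Ha. induction n as [|n IH]; intros a Ha; simpl; auto. split.
- intros x. apply ex_derive_PSeries. rewrite Ha. exact I.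
- replace (Derive (PSeries a)) with (PSeries (PS_derive a)).
  + apply IH. now rewrite CV_radius_derive.
  + apply functional_extensionality; intros x. symmetry; apply Derive_PSeries. rewrite Ha. exact I.
Qed.

Lemma smooth_shift f c : smooth f -> smooth (fun x => f (x - c)).
Proof.
intros Hf n. specialize (Hf n). revert f Hf. induction n as [|n IH]; intros f Hf; simpl; auto.
destruct Hf as [H1 H2].
assert (D : forall x, is_derive (fun x => f (x - c)) x (Derive f (x - c))).
{ intros x. replace (Derive f (x - c)) with (scal 1 (Derive f (x - c))) by (apply Rmult_1_l).
  apply (is_derive_comp f (fun x => x - c)); [now apply Derive_correct|]. auto_derive; auto. }
split; [intros x; eexists; apply D|].
replace (Derive (fun x => f (x - c))) with (fun x => Derive f (x - c)).
- now apply IH.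
- apply functional_extensionality; intros x. symmetry; apply is_derive_unique, D.
Qed.

Lemma xiR_fun : xiR = fun x => PSeries ecoef (x - / 2).
Proof. apply functional_extensionality, xiR_eq. Qed.

Lemma smooth_xiR : smooth xiR.
Proof. rewrite xiR_fun. apply smooth_shift, smooth_PSeries, CV_ecoef. Qed.

Lemma PSeries_ecoef_even y : PSeries ecoef (- y) = PSeries ecoef y.
Proof.
unfold PSeries. apply Series_ext. intros n. destruct (even_odd_nat n) as [k [->| ->]].
- now rewrite pow_opp_even.
- rewrite ecoef_odd. ring.
Qed.

Lemma ex_series_ecoef y : ex_series (fun n => ecoef n * y ^ n).
Proof.
apply (ex_series_dom _ (fun n => Rabs (ecoef n) * Rabs y ^ n)).
- intros n. rewrite Rabs_mult, RPow_abs. lra.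
- exact (absconv_ecoef (Rabs y) (Rabs_pos y)).
Qed.

Lemma ecoef_term_nonneg n y : 0 <= ecoef n * y ^ n.
Proof.
destruct (even_odd_nat n) as [k [->| ->]].
- apply Rmult_le_pos; [apply ecoef_nonneg|]. rewrite pow_mult. apply pow_le, pow2_ge_0.
- rewrite ecoef_odd. lra.
Qed.

Lemma PSeries_ecoef_ge y : ecoef 0 <= PSeries ecoef y.
Proof.
unfold PSeries. rewrite Series_incr_1 by apply ex_series_ecoef.
assert (0 <= Series (fun k => ecoef (S k) * y ^ S k)).
{ apply Series_nonneg; [intros; apply ecoef_term_nonneg|].
  apply (ex_series_incr_1 (fun n => ecoef n * y ^ n)), ex_series_ecoef. }
simpl (y ^ 0). lra.
Qed.

Lemma xiR_pos x : 0 < xiR x.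
Proof. rewrite xiR_eq. pose proof (PSeries_ecoef_ge (x - / 2)). pose proof ecoef_0_pos. lra. Qed.

Lemma Derive_ecoef_pos y : 0 < y -> 0 < Derive (PSeries ecoef) y.
Proof.
intros Hy. rewrite Derive_PSeries by (rewrite CV_ecoef; exact I).
assert (Ex : ex_series (fun n => PS_derive ecoef n * y ^ n)).
{ apply (ex_series_dom _ (fun n => Rabs (PS_derive ecoef n) * y ^ n)).
  - intros n. rewrite Rabs_mult, (Rabs_pos_eq (y ^ n)); [lra|apply pow_le; lra].
  - apply (absconv_derive ecoef y (y + 1)); [lra|]. apply absconv_ecoef; lra. }
assert (Hp : forall n, 0 <= PS_derive ecoef n * y ^ n).
{ intros n. apply Rmult_le_pos; [|apply pow_le; lra]. apply Rmult_le_pos; [apply pos_INR|apply ecoef_nonneg]. }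
unfold PSeries. rewrite (Series_incr_n _ 2) by (auto; lia). simpl pred.
assert (0 <= Series (fun k => PS_derive ecoef (2 + k) * y ^ (2 + k))).
{ apply Series_nonneg; auto. now apply (ex_series_incr_n (fun n => PS_derive ecoef n * y ^ n) 2). }
rewrite tech5. cbn [sum_f_R0]. pose proof (Hp O).
assert (0 < PS_derive ecoef 1 * y ^ 1); [|lra].
unfold PS_derive. pose proof ecoef_2_pos. simpl (y ^ 1). rewrite Rmult_1_r.
repeat apply Rmult_lt_0_compat; auto. apply lt_0_INR; lia.
Qed.

Lemma Derive_xiR x : Derive xiR x = Derive (PSeries ecoef) (x - / 2).
Proof.
rewrite xiR_fun. apply is_derive_unique.
replace (Derive (PSeries ecoef) (x - / 2)) with (scal 1 (Derive (PSeries ecoef) (x - / 2))) by (apply Rmult_1_l).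
apply (is_derive_comp (PSeries ecoef) (fun x => x - / 2)).
- apply Derive_correct, smooth_ex_derive, smooth_PSeries, CV_ecoef.
- auto_derive; auto.
Qed.

Lemma Derive_ecoef_odd y : Derive (PSeries ecoef) (- y) = - Derive (PSeries ecoef) y.
Proof.
assert (S0 := smooth_ex_derive _ (smooth_PSeries _ CV_ecoef)).
assert (D : is_derive (fun t => PSeries ecoef (- t)) y (scal (- 1) (Derive (PSeries ecoef) (- y)))).
{ apply (is_derive_comp (PSeries ecoef) Ropp); [now apply Derive_correct|]. auto_derive; auto. }
assert (D2 : is_derive (fun t => PSeries ecoef (- t)) y (Derive (PSeries ecoef) y)).
{ apply (is_derive_ext (PSeries ecoef)); [intros; symmetry; apply PSeries_ecoef_even|]. now apply Derive_correct. }
apply is_derive_unique in D. apply is_derive_unique in D2. rewrite D in D2.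
change (-1 * Derive (PSeries ecoef) (- y) = Derive (PSeries ecoef) y) in D2. lra.
Qed.

Definition logxi (s : R) : R := ln (xiR s).

Lemma smooth_logxi : smooth logxi.
Proof. apply smooth_ln; [apply xiR_pos|apply smooth_xiR]. Qed.

Lemma Derive_logxi s : Derive logxi s = Derive xiR s / xiR s.
Proof.
apply is_derive_unique. apply (is_derive_comp ln xiR); [apply is_derive_ln, xiR_pos|].
apply Derive_correct, smooth_ex_derive, smooth_xiR.
Qed.

(** The expansion of xi around 1/2 is even with nonnegative coefficients and [ecoef 2 > 0], so its
    derivative is odd about that point and positive to the right of it. *)
Lemma Derive_logxi_sign s : (s < 1 / 2 -> Derive logxi s < 0) /\ (s = 1 / 2 -> Derive logxi s = 0) /\ (1 / 2 < s -> 0 < Derive logxi s).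
Proof.
rewrite Derive_logxi, Derive_xiR. pose proof (xiR_pos s) as Hp. repeat split; intros H.
- replace (s - / 2) with (- (/ 2 - s)) by ring. rewrite Derive_ecoef_odd.
  pose proof (Derive_ecoef_pos (/ 2 - s) ltac:(lra)).
  unfold Rdiv. pose proof (Rinv_0_lt_compat _ Hp). nra.
- subst s. pose proof (Derive_ecoef_odd 0) as H0. rewrite Ropp_0 in H0.
  replace (1 / 2 - / 2) with 0 by field. replace (Derive (PSeries ecoef) 0) with 0 by lra. unfold Rdiv; ring.
- apply Rdiv_lt_0_compat; auto. apply Derive_ecoef_pos. lra.
Qed.

(** * The functions [alpha n] *)

Definition powlog (m : nat) (s : R) : R := s ^ m * logxi s.

Lemma smooth_powlog m : smooth (powlog m).
Proof. apply smooth_mult; [apply smooth_pow|apply smooth_logxi]. Qed.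

Lemma alpha_S m tau : alpha (S m) tau = / INR (fact m) * Derive_n (powlog m) (S m) tau.
Proof. unfold alpha. replace (S m - 1)%nat with m by lia. reflexivity. Qed.

Lemma smooth_alpha n : (1 <= n)%nat -> smooth (alpha n).
Proof.
intros Hn. destruct n as [|m]; [lia|].
replace (alpha (S m)) with (fun tau => / INR (fact m) * Derive_n (powlog m) (S m) tau).
- apply smooth_mult; [apply smooth_const|]. apply smooth_Derive_n, smooth_powlog.
- apply functional_extensionality; intros x. now rewrite alpha_S.
Qed.

(** [s^n log xi] is [s] times [s^(n-1) log xi], and the Leibniz rule with a linear factor has only
    two terms. *)
Lemma alpha_rec n tau : (1 <= n)%nat ->
  INR n * alpha (S n) tau = tau * Derive (alpha n) tau + (INR n + 1) * alpha n tau.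
Proof.
intros Hn. destruct n as [|m]; [lia|].
assert (E : Derive (alpha (S m)) tau = / INR (fact m) * Derive_n (powlog m) (S (S m)) tau).
{ rewrite (Derive_ext _ _ tau (alpha_S m)). rewrite Derive_scal. reflexivity. }
rewrite E, (alpha_S (S m)), (alpha_S m).
rewrite (Derive_n_ext (powlog (S m)) (fun s => s * powlog m s)).
2:{ intros t. unfold powlog. simpl. ring. }
rewrite Derive_n_id_mult by apply smooth_powlog.
rewrite fact_simpl, mult_INR, !S_INR. field.
split; [apply INR_fact_neq_0|pose proof (pos_INR m); lra].
Qed.

Lemma is_derive_pow_alpha n s : (1 <= n)%nat ->
  is_derive (fun s => s ^ (S n) * alpha n s) s (INR n * s ^ n * alpha (S n) s).
Proof.
intros Hn.
replace (INR n * s ^ n * alpha (S n) s) with (INR (S n) * s ^ n * alpha n s + s ^ (S n) * Derive (alpha n) s).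
- apply (is_derive_mult (fun s => s ^ (S n)) (alpha n)).
  + apply is_derive_Reals, (derivable_pt_lim_pow s (S n)).
  + apply Derive_correct, smooth_ex_derive, smooth_alpha; auto.
  + intros; apply Rmult_comm.
- rewrite S_INR. simpl pow.
  replace (INR n * s ^ n * alpha (S n) s) with (s ^ n * (INR n * alpha (S n) s)) by ring.
  rewrite alpha_rec by auto. ring.
Qed.

Lemma rolle_alpha n x y : (1 <= n)%nat -> 0 <= x < y -> (x = 0 \/ alpha n x = 0) -> alpha n y = 0 ->
  exists z, x < z < y /\ alpha (S n) z = 0.
Proof.
intros Hn Hxy Hx Hy.
destruct (MVT_cor2 (fun s => s ^ (S n) * alpha n s) (fun s => INR n * s ^ n * alpha (S n) s) x y) as [z [E Hz]]; [lra| |].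
- intros c _. apply is_derive_Reals, is_derive_pow_alpha; auto.
- exists z; split; auto. rewrite Hy in E.
  assert (E0 : x ^ S n * alpha n x = 0) by (destruct Hx as [-> | ->]; [simpl; ring|ring]).
  rewrite E0, Rmult_0_r, Rminus_0_r in E.
  assert (Hzn : 0 < z ^ n) by (apply pow_lt; lra). assert (HnR : 0 < INR n) by (apply lt_0_INR; lia).
  symmetry in E. apply Rmult_integral in E. destruct E as [E|E]; [|lra].
  apply Rmult_integral in E. destruct E as [E|E]; [nra|auto].
Qed.

Lemma alpha_continuity n x : (1 <= n)%nat -> continuity_pt (alpha n) x.
Proof.
intros Hn. apply derivable_continuous_pt. exists (Derive (alpha n) x).
apply is_derive_Reals, Derive_correct, smooth_ex_derive, smooth_alpha; auto.
Qed.

Lemma alpha_1 tau : alpha 1 tau = Derive logxi tau.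
Proof.
rewrite alpha_S. simpl. rewrite Rinv_1, Rmult_1_l. apply Derive_ext. intros t. unfold powlog. simpl. ring.
Qed.

(** At 0 the recurrence reduces to [n alpha_(n+1) = (n + 1) alpha_n]. *)
Lemma alpha_0 n : (1 <= n)%nat -> alpha n 0 = INR n * (Derive xiR 0 / xiR 0).
Proof.
induction 1 as [|n Hn IH].
- rewrite alpha_1, Derive_logxi. simpl. ring.
- pose proof (alpha_rec n 0 Hn) as E. rewrite IH in E.
  apply Rmult_eq_reg_l with (INR n); [|apply not_0_INR; lia]. rewrite E, S_INR. ring.
Qed.

Lemma alpha_0_neg n : (1 <= n)%nat -> alpha n 0 < 0.
Proof.
intros Hn. rewrite alpha_0, <- Derive_logxi by auto.
assert (0 < INR n) by (apply lt_0_INR; lia).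
pose proof (proj1 (Derive_logxi_sign 0) ltac:(lra)). nra.
Qed.

Lemma continuity_pt_near f x e : continuity_pt f x -> 0 < e ->
  exists d, 0 < d /\ forall y, Rabs (y - x) < d -> Rabs (f y - f x) < e.
Proof.
intros H He. destruct (H e He) as [d [Hd H1]]. exists d; split; auto. intros y Hy.
destruct (Req_dec x y) as [->|N].
- rewrite Rminus_diag, Rabs_R0; auto.
- apply (H1 y). split; [split; [exact I|auto]|exact Hy].
Qed.

Lemma first_zero h c : (forall x, continuity_pt h x) -> h 0 < 0 -> 0 < c -> h c = 0 ->
  exists a, 0 < a <= c /\ h a = 0 /\ forall t, 0 <= t < a -> h t < 0.
Proof.
intros Hc H0 Hcp Hz.
set (E := fun t => 0 <= t <= c /\ forall u, 0 <= u <= t -> h u < 0).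
destruct (completeness E) as [a [Ha1 Ha2]].
- exists c. intros t [Ht _]. lra.
- exists 0. split; [lra|]. intros u Hu. replace u with 0 by lra. auto.
- assert (Ha0 : 0 <= a).
  { apply Ha1. split; [lra|]. intros u Hu. replace u with 0 by lra. auto. }
  assert (Hac : a <= c) by (apply Ha2; intros t [Ht _]; lra).
  assert (Hbelow : forall t, 0 <= t < a -> h t < 0).
  { intros t Ht. destruct (classic (exists e, E e /\ t < e)) as [[e [[He1 He2] He3]]|N].
    - apply He2; lra.
    - exfalso. assert (a <= t); [|lra]. apply Ha2. intros e He. apply Rnot_lt_le. intros X. apply N. now exists e. }
  assert (Hna : ~ h a < 0).
  { intros Hn. destruct (continuity_pt_near h a (- h a) (Hc a)) as [d [Hd H1]]; [lra|].
    assert (Hlt : a < c).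
    { destruct (Rle_lt_or_eq_dec a c Hac) as [|E']; auto. subst a. lra. }
    set (b := Rmin (a + d / 2) c).
    assert (Hb : a < b <= c) by (unfold b; split; [apply Rmin_glb_lt; lra|apply Rmin_r]).
    assert (Hbd : b <= a + d / 2) by apply Rmin_l.
    assert (b <= a); [|lra]. apply Ha1. split; [lra|]. intros u Hu.
    destruct (Rlt_dec u a); [apply Hbelow; lra|].
    specialize (H1 u). rewrite Rabs_pos_eq in H1 by lra. specialize (H1 ltac:(lra)). apply Rabs_def2 in H1. lra. }
  assert (Hnp : ~ 0 < h a).
  { intros Hp. assert (a <> 0) by (intros ->; lra).
    destruct (continuity_pt_near h a (h a) (Hc a) Hp) as [d [Hd H1]].
    set (t := Rmax 0 (a - d / 2)).
    assert (Ht : 0 <= t < a) by (unfold t; split; [apply Rmax_l|apply Rmax_lub_lt; lra]).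
    assert (a - d / 2 <= t) by apply Rmax_r.
    specialize (Hbelow t Ht). specialize (H1 t). rewrite Rabs_left in H1 by lra.
    specialize (H1 ltac:(lra)). apply Rabs_def2 in H1. lra. }
  exists a. repeat split; auto; [|lra].
  destruct (Rle_lt_or_eq_dec 0 a Ha0); auto. subst a. lra.
Qed.

Definition is_first_zero (n : nat) (a : R) : Prop :=
  0 < a < 2 /\ alpha n a = 0 /\ forall t, 0 <= t < a -> alpha n t < 0.

Lemma first_zero_unique n a b : is_first_zero n a -> is_first_zero n b -> a = b.
Proof.
intros [A1 [A2 A3]] [B1 [B2 B3]].
destruct (Rtotal_order a b) as [H|[H|H]]; auto.
- specialize (B3 a ltac:(lra)). lra.
- specialize (A3 b ltac:(lra)). lra.
Qed.

Lemma first_zero_1 : is_first_zero 1 (1 / 2).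
Proof.
split; [lra|]. split.
- rewrite alpha_1. now apply Derive_logxi_sign.
- intros t Ht. rewrite alpha_1. apply Derive_logxi_sign. lra.
Qed.

(** Rolle's theorem between 0 and [a] places a zero of the next function below [a], and its first
    zero is no larger. *)
Lemma first_zero_S n a : (1 <= n)%nat -> is_first_zero n a -> exists b, b < a /\ is_first_zero (S n) b.
Proof.
intros Hn [A1 [A2 A3]].
destruct (rolle_alpha n 0 a Hn) as [z [Hz1 Hz2]]; auto; [lra|].
destruct (first_zero (alpha (S n)) z) as [b [B1 [B2 B3]]]; auto.
- intros x. apply alpha_continuity. lia.
- apply alpha_0_neg. lia.
- lra.
- exists b. split; [lra|]. split; [lra|auto].
Qed.

Definition azero (n : nat) : R := epsilon (inhabits 0) (is_first_zero n).

Lemma azero_spec n : (1 <= n)%nat -> is_first_zero n (azero n).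
Proof.
intros Hn. unfold azero. apply epsilon_spec. induction Hn as [|n Hn [a IH]].
- exists (1 / 2). apply first_zero_1.
- destruct (first_zero_S n a Hn IH) as [b [_ Hb]]. now exists b.
Qed.

Lemma azero_1 : azero 1 = 1 / 2.
Proof. apply (first_zero_unique 1); [apply azero_spec; auto|apply first_zero_1]. Qed.

Lemma azero_decr n : (1 <= n)%nat -> azero (S n) < azero n.
Proof.
intros Hn. destruct (first_zero_S n _ Hn (azero_spec n Hn)) as [b [H1 H2]].
rewrite (first_zero_unique (S n) (azero (S n)) b); auto. apply azero_spec; lia.
Qed.

(** * Counting zeros *)

(** The point [x 0 = 0] is not a zero of [alpha n] but the additional end point that Rolle's theorem
    accepts here; the zeros are [x 1, ..., x k]. *)
Definition zero_seq (n k : nat) (x : nat -> R) : Prop :=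
  x O = 0 /\ forall i, (i < k)%nat -> x i < x (S i) /\ alpha n (x (S i)) = 0.

Definition has_zeros (n k : nat) (tau : R) : Prop := exists x, zero_seq n k x /\ x k <= tau.

Lemma zero_seq_incr n k x i j : zero_seq n k x -> (i < j)%nat -> (j <= k)%nat -> x i < x j.
Proof.
intros [H0 H] Hij. induction Hij as [|j Hij IH]; intros Hk.
- apply H; lia.
- specialize (IH ltac:(lia)). pose proof (proj1 (H j ltac:(lia))). lra.
Qed.

Lemma zero_seq_nonneg n k x i : zero_seq n k x -> (i <= k)%nat -> 0 <= x i.
Proof.
intros H Hi. destruct i as [|i]; [rewrite (proj1 H); lra|].
pose proof (zero_seq_incr n k x 0 (S i) H ltac:(lia) Hi). rewrite (proj1 H) in H0. lra.
Qed.

Lemma zero_seq_last n k x : zero_seq n k x -> x k = 0 \/ alpha n (x k) = 0.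
Proof.
intros [H0 H]. destruct k as [|k]; [now left|]. right. apply H; lia.
Qed.

(** Rolle's theorem on the [k] gaps, the leftmost starting at 0, loses no zero. Hence the number of
    zeros in [(0, tau]] never decreases with [n]. *)
Lemma zero_seq_interlace n k x : (1 <= n)%nat -> zero_seq n k x ->
  exists y, zero_seq (S n) k y /\ y k <= x k.
Proof.
intros Hn Hx.
assert (G : forall i, exists z, (i < k)%nat -> x i < z < x (S i) /\ alpha (S n) z = 0).
{ intros i. destruct (Compare_dec.le_lt_dec k i) as [Hi|Hi]; [exists 0; lia|].
  destruct (rolle_alpha n (x i) (x (S i))) as [z Hz]; auto.
  - split; [apply (zero_seq_nonneg n k); auto; lia|]. apply Hx; auto.
  - destruct i as [|i]; [left; apply Hx|]. right. apply Hx. lia.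
  - now apply Hx.
  - now exists z. }
set (y := fun j => match j with O => 0 | S i => epsilon (inhabits 0) (fun z => (i < k)%nat -> x i < z < x (S i) /\ alpha (S n) z = 0) end).
assert (Hy : forall i, (i < k)%nat -> x i < y (S i) < x (S i) /\ alpha (S n) (y (S i)) = 0).
{ intros i Hi. exact (epsilon_spec (inhabits 0) _ (G i) Hi). }
exists y. split; [split; [reflexivity|]|].
- intros i Hi. split; [|apply Hy; auto]. destruct i as [|i].
  + change (y O) with 0. rewrite <- (proj1 Hx). apply Hy; auto.
  + pose proof (proj1 (Hy i ltac:(lia))). pose proof (proj1 (Hy (S i) Hi)). lra.
- destruct k as [|k]; [rewrite (proj1 Hx); apply Rle_refl|]. pose proof (proj1 (Hy k ltac:(lia))). lra.
Qed.

Lemma has_zeros_mono n k tau tau' : tau <= tau' -> has_zeros n k tau -> has_zeros n k tau'.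
Proof. intros H [x [Hx Hk]]. exists x. split; auto. lra. Qed.

Lemma has_zeros_le n m k tau : (1 <= n)%nat -> (n <= m)%nat -> has_zeros n k tau -> has_zeros m k tau.
Proof.
intros Hn Hm H. induction Hm as [|m Hm IH]; auto. destruct IH as [x [Hx Hk]].
destruct (zero_seq_interlace m k x ltac:(lia) Hx) as [y [Hy1 Hy2]]. exists y. split; auto. lra.
Qed.

Lemma zero_seq_extend n k x z tau : zero_seq n k x -> x k < z <= tau -> alpha n z = 0 -> has_zeros n (S k) tau.
Proof.
intros [H0 H] Hz Az.
exists (fun i => if Compare_dec.le_dec i k then x i else z). split; [split|].
- simpl. exact H0.
- intros i Hi. destruct (Compare_dec.le_dec i k) as [L|L]; [|lia]. destruct (Compare_dec.le_dec (S i) k) as [L'|L'].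
  + apply H; lia.
  + assert (i = k) by lia. subst i. split; [lra|auto].
- destruct (Compare_dec.le_dec (S k) k); [lia|lra].
Qed.

Lemma sign_cases a : a <> 0 -> exists sg, (sg = 1 \/ sg = -1) /\ 0 < sg * a.
Proof.
intros H. destruct (Rtotal_order a 0) as [L|[L|L]]; [exists (-1)|contradiction|exists 1]; split; auto; lra.
Qed.

(** The primitive [s^(n+1) alpha_n] runs from 0 at the last zero to a value of sign [sg] at [tau],
    so [alpha (S n)] takes the sign [sg] in between. The opposite sign at [tau] would force a zero
    of [alpha (S n)] beyond its [k] interlacing ones, which is excluded. *)
Lemma sign_persists n k x tau sg : (1 <= n)%nat -> (sg = 1 \/ sg = -1) -> zero_seq n k x -> x k < tau ->
  ~ has_zeros (S n) (S k) tau -> 0 < sg * alpha n tau -> 0 < sg * alpha (S n) tau.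
Proof.
intros Hn Hs Hx Hk HN Hpos.
destruct (zero_seq_interlace n k x Hn Hx) as [y [Hy1 Hy2]].
assert (NZ : forall z, x k < z <= tau -> alpha (S n) z <> 0).
{ intros z Hz E. apply HN. apply (zero_seq_extend (S n) k y z); auto. lra. }
apply Rnot_le_lt. intros Hneg.
pose proof (NZ tau ltac:(lra)) as NT.
assert (Hneg' : sg * alpha (S n) tau < 0) by (destruct Hs; subst sg; lra).
pose proof (zero_seq_nonneg n k x k Hx (Nat.le_refl k)) as Hx0.
destruct (MVT_cor2 (fun s => s ^ (S n) * alpha n s) (fun s => INR n * s ^ n * alpha (S n) s) (x k) tau Hk) as [c [E Hc]].
{ intros c _. apply is_derive_Reals, is_derive_pow_alpha; auto. }
assert (E0 : x k ^ S n * alpha n (x k) = 0).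
{ destruct (zero_seq_last n k x Hx) as [-> | ->]; [simpl; ring|ring]. }
rewrite E0, Rminus_0_r in E.
assert (Hcn : 0 < INR n * c ^ n) by (apply Rmult_lt_0_compat; [apply lt_0_INR; lia|apply pow_lt; lra]).
assert (Htn : 0 < tau ^ S n) by (apply pow_lt; lra).
assert (Hcpos : 0 < sg * alpha (S n) c).
{ apply Rnot_le_lt. intros Hle.
  assert (A : 0 < tau ^ S n * (sg * alpha n tau)) by (apply Rmult_lt_0_compat; auto).
  assert (B : tau ^ S n * (sg * alpha n tau) = (INR n * c ^ n) * (tau - x k) * (sg * alpha (S n) c)).
  { transitivity (sg * (tau ^ S n * alpha n tau)); [ring|]. rewrite E. ring. }
  assert (0 < INR n * c ^ n * (tau - x k)) by (apply Rmult_lt_0_compat; lra). nra. }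
destruct (IVT (fun s => - (sg * alpha (S n) s)) c tau) as [z [Hz1 Hz2]].
- intros t. apply continuity_pt_opp, continuity_pt_mult; [apply continuity_const; intros ? ?; reflexivity|].
  apply alpha_continuity. lia.
- lra.
- lra.
- lra.
- apply (NZ z); [lra|]. destruct Hs; subst sg; lra.
Qed.

Lemma least_nat (P : nat -> Prop) : (exists n, P n) -> exists n, P n /\ forall m, (m < n)%nat -> ~ P m.
Proof.
intros [n Hn]. induction n as [n IH] using lt_wf_ind.
destruct (classic (exists m, (m < n)%nat /\ P m)) as [[m [H1 H2]]|N].
- exact (IH m H1 H2).
- exists n. split; auto. intros m Hm HP. apply N. now exists m.
Qed.

(** [k] is minimal such that for some [tau < 1] no [alpha n] has more than [k] zeros in [(0, tau]].
    By minimality some [alpha n1] has [k] zeros already in [(0, tau / 2]], and so have all later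
    ones. As a further zero up to [tau] is excluded, the sign at [tau] is nonzero and can no longer
    change. *)
Theorem bounded_zeros_constant_sign N : (forall n, (1 <= n)%nat -> ~ has_zeros n N 1) ->
  exists tau n0 sg, 0 < tau < 1 /\ (sg = 1 \/ sg = -1) /\ (1 <= n0)%nat /\
    forall n, (n0 <= n)%nat -> 0 < sg * alpha n tau.
Proof.
intros HN.
assert (H0 : forall n tau, 0 <= tau -> has_zeros n 0 tau).
{ intros n tau Ht. exists (fun _ => 0). split; [split; [auto|intros; lia]|auto]. }
destruct (least_nat (fun k => exists tau, 0 < tau < 1 /\ forall n, (1 <= n)%nat -> ~ has_zeros n (S k) tau)) as [k [[tau [Ht Hk]] Hmin]].
{ destruct N as [|N]; [exfalso; apply (HN 1%nat); auto; apply H0; lra|].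
  exists N, (1 / 2). split; [lra|]. intros n Hn H. apply (HN n Hn). revert H. apply has_zeros_mono. lra. }
assert (Hex : exists n1, (1 <= n1)%nat /\ has_zeros n1 k (tau / 2)).
{ destruct k as [|k]; [exists 1%nat; split; auto; apply H0; lra|].
  apply NNPP. intros C. apply (Hmin k ltac:(lia)). exists (tau / 2). split; [lra|].
  intros n Hn H. apply C. now exists n. }
destruct Hex as [n1 [Hn1 Hz1]].
assert (Hseq : forall n, (n1 <= n)%nat -> exists x, zero_seq n k x /\ x k < tau).
{ intros n Hn. destruct (has_zeros_le n1 n k _ Hn1 Hn Hz1) as [x [Hx1 Hx2]]. exists x. split; auto. lra. }
assert (Hnz : alpha n1 tau <> 0).
{ intros E. destruct (Hseq n1 (Nat.le_refl _)) as [x [Hx1 Hx2]]. apply (Hk n1 Hn1).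
  apply (zero_seq_extend n1 k x tau); auto. lra. }
destruct (sign_cases _ Hnz) as [sg [Hs Hp]].
exists tau, n1, sg. repeat split; auto; try lra.
intros n Hn. induction Hn as [|n Hn IH]; auto.
destruct (Hseq n Hn) as [x [Hx1 Hx2]].
apply (sign_persists n k x); auto; [lia|]. apply Hk. lia.
Qed.

Lemma has_zeros_list n N : has_zeros n N 1 ->
  exists l : list R, NoDup l /\ length l = N /\ (forall x, In x l -> 0 < x < 2 /\ alpha n x = 0).
Proof.
intros [x [Hx HN]]. exists (map (fun i => x (S i)) (seq 0 N)). repeat split.
- apply NoDup_map_NoDup_ForallPairs.
  + intros i j Hi Hj E. apply in_seq in Hi, Hj.
    destruct (Nat.lt_trichotomy i j) as [L|[L|L]]; auto.
    * pose proof (zero_seq_incr n N x (S i) (S j) Hx ltac:(lia) ltac:(lia)). lra.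
    * pose proof (zero_seq_incr n N x (S j) (S i) Hx ltac:(lia) ltac:(lia)). lra.
  + apply seq_NoDup.
- now rewrite length_map, length_seq.
- apply in_map_iff in H. destruct H as [i [<- Hi]]. apply in_seq in Hi.
  pose proof (zero_seq_incr n N x 0 (S i) Hx ltac:(lia) ltac:(lia)). rewrite (proj1 Hx) in H. auto.
- apply in_map_iff in H. destruct H as [i [<- Hi]]. apply in_seq in Hi.
  destruct (Nat.eq_dec (S i) N) as [<-|E]; [lra|].
  pose proof (zero_seq_incr n N x (S i) N Hx ltac:(lia) ltac:(lia)). lra.
- apply in_map_iff in H. destruct H as [i [<- Hi]]. apply in_seq in Hi. apply Hx. lia.
Qed.

(** * The Taylor coefficients of [xi (tau / (1 - z))] *)

(** Tannery's theorem applied to the partial sums over [n], dominated by [b k]. *)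
Theorem double_series (x : nat -> nat -> R) (b : nat -> R) :
  (forall k, ex_series (fun n => Rabs (x k n))) ->
  (forall k, Series (fun n => Rabs (x k n)) <= b k) -> ex_series b ->
  ex_series (fun n => Rabs (Series (fun k => x k n))) /\
  Series (fun k => Series (fun n => x k n)) = Series (fun n => Series (fun k => x k n)).
Proof.
intros Hx Hb Eb.
assert (Hbound : forall k n, sum_f_R0 (fun n => Rabs (x k n)) n <= b k).
{ intros k n. eapply Rle_trans; [|apply Hb]. rewrite (Series_incr_n _ (S n)) by (auto; lia). simpl pred.
  assert (0 <= Series (fun m => Rabs (x k (S n + m)%nat))); [|lra].
  apply Series_nonneg; [intros; apply Rabs_pos|]. now apply (ex_series_incr_n (fun n => Rabs (x k n)) (S n)). }
assert (Hterm : forall k n, Rabs (x k n) <= b k).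
{ intros k n. eapply Rle_trans; [|apply (Hbound k n)]. destruct n as [|n]; [simpl; lra|]. rewrite tech5.
  pose proof (cond_pos_sum (fun n => Rabs (x k n)) n (fun _ => Rabs_pos _)). lra. }
assert (Ek : forall n, ex_series (fun k => x k n)) by (intros n; apply (ex_series_dom _ b); auto).
assert (Eka : forall n, ex_series (fun k => Rabs (x k n))).
{ intros n. apply (ex_series_dom _ b); auto. intros k. rewrite Rabs_Rabsolu. auto. }
assert (Fsum : forall (y : nat -> nat -> R) N, (forall n, ex_series (fun k => y k n)) ->
   ex_series (fun k => sum_f_R0 (fun n => y k n) N) /\
   Series (fun k => sum_f_R0 (fun n => y k n) N) = sum_f_R0 (fun n => Series (fun k => y k n)) N).
{ intros y N Hy. induction N as [|N [IH1 IH2]]; simpl; [split; auto|]. split.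
  - now apply (ex_series_plus (fun k => sum_f_R0 (fun n => y k n) N)).
  - rewrite Series_plus by auto. now rewrite IH2. }
split.
- destruct (ex_finite_lim_seq_incr (sum_n (fun n => Rabs (Series (fun k => x k n)))) (Series b)) as [l Hl].
  + intros n. rewrite sum_Sn. unfold plus; simpl. pose proof (Rabs_pos (Series (fun k => x k (S n)))). lra.
  + intros n. rewrite sum_n_Reals.
    apply Rle_trans with (sum_f_R0 (fun n => Series (fun k => Rabs (x k n))) n).
    * apply sum_Rle. intros m _. now apply Series_Rabs.
    * rewrite <- (proj2 (Fsum (fun k n => Rabs (x k n)) n Eka)). apply Series_le; auto.
      intros k. split; auto. apply cond_pos_sum. intros; apply Rabs_pos.
  + exists l. exact Hl.
- assert (L : is_lim_seq (fun N => Series (fun k => sum_f_R0 (fun n => x k n) N)) (Series (fun k => Series (fun n => x k n)))).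
  { apply (tannery (fun N k => sum_f_R0 (fun n => x k n) N) _ b); auto.
    - intros k. assert (Exk : ex_series (fun n => x k n)) by now apply ex_series_Rabs.
      apply (is_lim_seq_ext (sum_n (fun n => x k n))); [intros; apply sum_n_Reals|]. exact (Series_correct _ Exk).
    - exists O. intros N _ k. eapply Rle_trans; [|apply (Hbound k N)]. apply Rsum_abs. }
  symmetry. apply is_series_unique.
  apply (is_lim_seq_ext _ (sum_n (fun n => Series (fun k => x k n)))) in L; [exact L|].
  intros N. rewrite sum_n_Reals. apply Fsum, Ek.
Qed.

Section Composition.

Variables (e c : nat -> R) (r : R).
Hypothesis Hr : 0 <= r.
Hypothesis Hc : absconv c r.
Hypothesis He : forall T, 0 <= T -> absconv e T.

Fixpoint ps_pow (c : nat -> R) (k : nat) : nat -> R :=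
  match k with
  | O => fun n => match n with O => 1 | S _ => 0 end
  | S k => PS_mult c (ps_pow c k)
  end.

(** The inner series may have a constant term because the outer one converges everywhere; each
    coefficient is then itself an infinite series. *)
Definition ps_comp (n : nat) : R := Series (fun k => e k * ps_pow c k n).

Let T := Series (fun n => Rabs (c n) * r ^ n).

Let T_nonneg : 0 <= T.
Proof.
apply Series_nonneg; auto. intros n. apply Rmult_le_pos; [apply Rabs_pos|now apply pow_le].
Qed.

Lemma ps_pow_0_abs s : is_series (fun n => Rabs (ps_pow c 0 n) * s ^ n) 1.
Proof.
replace 1 with (sum_f_R0 (fun n => Rabs (ps_pow c 0 n) * s ^ n) 0) by (simpl; rewrite Rabs_R1; ring).
apply is_series_finite. intros [|n] Hn; [lia|]. simpl. rewrite Rabs_R0. ring.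
Qed.

(** The sum of absolute values weighted by [r ^ n] is submultiplicative under the Cauchy product. *)
Lemma ps_pow_abs k : absconv (ps_pow c k) r /\ Series (fun n => Rabs (ps_pow c k n) * r ^ n) <= T ^ k.
Proof.
induction k as [|k [IH1 IH2]].
- pose proof (ps_pow_0_abs r) as H. split; [now exists 1|]. rewrite (is_series_unique _ _ H). simpl; lra.
- split; [now apply absconv_mult|]. simpl pow.
  pose proof (is_series_mult _ _ _ _ (Series_correct _ Hc) (Series_correct _ IH1)) as M.
  assert (A : forall a, absconv a r -> ex_series (fun n => Rabs (Rabs (a n) * r ^ n))).
  { intros a Ha. eapply ex_series_ext; [|exact Ha]. intros n; simpl. rewrite (Rabs_pos_eq (_ * _)); auto.
    apply Rmult_le_pos; [apply Rabs_pos|now apply pow_le]. }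
  specialize (M (A _ Hc) (A _ IH1)).
  apply Rle_trans with (T * Series (fun n => Rabs (ps_pow c k n) * r ^ n)); [|now apply Rmult_le_compat_l].
  unfold T. rewrite <- (is_series_unique _ _ M). apply Series_le; [|eexists; apply M].
  intros n. split; [apply Rmult_le_pos; [apply Rabs_pos|now apply pow_le]|].
  cbn [ps_pow]. unfold PS_mult.
  apply Rle_trans with (sum_f_R0 (fun k0 => Rabs (c k0 * ps_pow c k (n - k0)%nat)) n * r ^ n).
  + apply Rmult_le_compat_r; [now apply pow_le|]. apply Rsum_abs.
  + rewrite Rmult_comm, scal_sum. apply Req_le, sum_eq. intros i Hi. rewrite Rabs_mult.
    replace (r ^ n) with (r ^ i * r ^ (n - i)); [ring|]. rewrite <- pow_add. f_equal. lia.
Qed.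

Let bnd (k : nat) := Rabs (e k) * T ^ k.
Let bnd_sum : ex_series bnd.
Proof. apply He, T_nonneg. Qed.

Lemma ps_comp_abs : absconv ps_comp r.
Proof.
destruct (double_series (fun k n => e k * ps_pow c k n * r ^ n) bnd) as [H _].
- intros k. destruct (ps_pow_abs k) as [H1 _].
  apply (ex_series_ext (fun n => Rabs (e k) * (Rabs (ps_pow c k n) * r ^ n))).
  + intros n. rewrite !Rabs_mult, (Rabs_pos_eq (r ^ n)) by now apply pow_le. eqR; ring.
  + now apply ex_series_scalR.
- intros k. destruct (ps_pow_abs k) as [H1 H2].
  rewrite (Series_ext _ (fun n => Rabs (e k) * (Rabs (ps_pow c k n) * r ^ n))).
  + rewrite Series_scal_l. apply Rmult_le_compat_l; [apply Rabs_pos|auto].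
  + intros n. rewrite !Rabs_mult, (Rabs_pos_eq (r ^ n)) by now apply pow_le. ring.
- apply bnd_sum.
- eapply ex_series_ext; [|exact H]. intros n; simpl. rewrite Series_scal_r, Rabs_mult, (Rabs_pos_eq (r ^ n)); auto.
  now apply pow_le.
Qed.

Lemma CP_ps_pow k z : Cmod z <= r -> CP (ps_pow c k) z = (CP c z ^ k)%C.
Proof.
intros Hz. induction k as [|k IH].
- transitivity (Csum (fun n => RtoC (ps_pow c 0 n) * z ^ n)%C 0); [|rewrite Csum_0; simpl; ring].
  unfold CP, CSeries, Csum. f_equal; apply Series_finite; intros [|n] Hn; try lia; simpl; ring.
- simpl. rewrite (CP_mult c (ps_pow c k) z r); auto; [now rewrite IH|]. apply ps_pow_abs.
Qed.

(** Expanding the powers of the inner series gives a double series whose rows are dominated by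
    [|e k| T^k], so the order of summation may be reversed. *)
Theorem CP_comp z : Cmod z <= r -> CP ps_comp z = CP e (CP c z).
Proof.
intros Hz.
assert (Hzp : forall n, Cmod z ^ n <= r ^ n) by (intros n; apply pow_incr; split; [apply Cmod_ge_0|auto]).
set (f := fun k n => (RtoC (e k) * (RtoC (ps_pow c k n) * z ^ n))%C).
assert (Hf : forall k n, Cmod (f k n) <= Rabs (e k) * (Rabs (ps_pow c k n) * r ^ n)).
{ intros k n. unfold f. rewrite Cmod_mult, Cmod_R, Cmod_term. apply Rmult_le_compat_l; [apply Rabs_pos|].
  apply Rmult_le_compat_l; [apply Rabs_pos|auto]. }
assert (Hs : forall k, ex_series (fun n => Rabs (e k) * (Rabs (ps_pow c k n) * r ^ n))).
{ intros k. apply ex_series_scalR, ps_pow_abs. }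
assert (Hb : forall k, Series (fun n => Rabs (e k) * (Rabs (ps_pow c k n) * r ^ n)) <= bnd k).
{ intros k. rewrite Series_scal_l. apply Rmult_le_compat_l; [apply Rabs_pos|]. apply ps_pow_abs. }
assert (G : forall p : C -> R, (forall w, Rabs (p w) <= Cmod w) ->
  Series (fun k => Series (fun n => p (f k n))) = Series (fun n => Series (fun k => p (f k n)))).
{ intros p Hp. apply (double_series (fun k n => p (f k n)) bnd); [| |apply bnd_sum].
  - intros k. apply (ex_series_dom _ (fun n => Rabs (e k) * (Rabs (ps_pow c k n) * r ^ n))); auto.
    intros n. rewrite Rabs_Rabsolu. eapply Rle_trans; [apply Hp|apply Hf].
  - intros k. eapply Rle_trans; [|apply Hb]. apply Series_le; auto.
    intros n. split; [apply Rabs_pos|]. eapply Rle_trans; [apply Hp|apply Hf]. }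
assert (HC : cabs (fun k => RtoC (e k) * CP c z ^ k)%C).
{ apply (cabs_CP e _ (Cmod (CP c z))); [|lra]. apply He, Cmod_ge_0. }
assert (Ek : forall k, (RtoC (e k) * CP c z ^ k)%C = CSeries (fun n => f k n)).
{ intros k. rewrite <- CP_ps_pow by auto. unfold CP. rewrite <- CSeries_scal; [reflexivity|].
  apply (cabs_CP _ z r); auto. apply ps_pow_abs. }
assert (En : forall n, (RtoC (ps_comp n) * z ^ n)%C = CSeries (fun k => f k n)).
{ intros n. unfold ps_comp, f, CSeries. apply injective_projections; simpl.
  - rewrite Rmult_0_l, Rminus_0_r, <- Series_scal_r. apply Series_ext. intros k. ring.
  - rewrite Rmult_0_l, Rplus_0_r, <- Series_scal_r. apply Series_ext. intros k. ring. }
unfold CP at 1 2. rewrite (CSeries_ext _ _ En), (CSeries_ext _ _ Ek).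
unfold CSeries. apply injective_projections; simpl.
- symmetry. apply (G Re), re_le_Cmod.
- symmetry. apply (G Im), im_le_Cmod.
Qed.

End Composition.

(** * Normalized Taylor coefficients: products, quotients and Pringsheim's argument *)

(** Each function is the derivative of its predecessor divided by the index, as for Taylor
    coefficients at a moving point; with this normalization the Leibniz rule has no binomial
    coefficients. Differentiating the formula of order [n] gives [n + 1] times the next one. *)
Theorem leibniz_seq (lo hi : R) (u v w : nat -> R -> R) :
  (forall k x, lo < x < hi -> is_derive (u k) x (INR (S k) * u (S k) x)) ->
  (forall k x, lo < x < hi -> is_derive (v k) x (INR (S k) * v (S k) x)) ->
  (forall k x, lo < x < hi -> is_derive (w k) x (INR (S k) * w (S k) x)) ->
  (forall x, lo < x < hi -> w O x = u O x * v O x) ->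
  forall n x, lo < x < hi -> w n x = sum_f_R0 (fun k => u k x * v (n - k)%nat x) n.
Proof.
intros Hu Hv Hw H0 n. induction n as [|n IH]; intros x Hx; [now apply H0|].
assert (D1 := Hw n x Hx).
assert (D2 : is_derive (w n) x
  (sum_f_R0 (fun k => INR (S k) * u (S k) x * v (n - k)%nat x + u k x * (INR (S (n - k)) * v (S (n - k)) x)) n)).
{ apply (is_derive_ext_loc (fun x => sum_f_R0 (fun k => u k x * v (n - k)%nat x) n)).
  - assert (Hd : 0 < Rmin (x - lo) (hi - x)) by (apply Rmin_pos; lra).
    exists (mkposreal _ Hd). intros y Hy. change (Rabs (y - x) < Rmin (x - lo) (hi - x)) in Hy. symmetry. apply IH.
    pose proof (Rmin_l (x - lo) (hi - x)). pose proof (Rmin_r (x - lo) (hi - x)). apply Rabs_def2 in Hy. lra.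
  - apply (is_derive_sum_f (fun k x => u k x * v (n - k)%nat x)
     (fun k x => INR (S k) * u (S k) x * v (n - k)%nat x + u k x * (INR (S (n - k)) * v (S (n - k)) x))).
    intros k _. apply (is_derive_mult (u k) (v (n - k)%nat)); auto. intros; apply Rmult_comm. }
assert (E := is_derive_unique _ _ _ D1). rewrite (is_derive_unique _ _ _ D2) in E. clear D1 D2.
apply Rmult_eq_reg_l with (INR (S n)); [|apply not_0_INR; lia]. rewrite <- E. clear E.
rewrite scal_sum.
transitivity (sum_f_R0 (fun k => INR (S k) * (u (S k) x * v (n - k)%nat x)) n
  + sum_f_R0 (fun k => INR (S n - k) * (u k x * v (S n - k)%nat x)) n).
{ rewrite <- plus_sum. apply sum_eq. intros k Hk. replace (S (n - k)) with (S n - k)%nat by lia. ring. }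
transitivity (sum_f_R0 (fun k => INR k * (u k x * v (S n - k)%nat x)) (S n)
  + sum_f_R0 (fun k => INR (S n - k) * (u k x * v (S n - k)%nat x)) (S n)).
2:{ rewrite <- plus_sum. apply sum_eq. intros k Hk. rewrite minus_INR by auto. ring. }
f_equal.
- rewrite (decomp_sum _ (S n)) by lia. simpl pred. simpl (INR 0). rewrite Rmult_0_l, Rplus_0_l.
  apply sum_eq. intros k Hk. reflexivity.
- rewrite tech5. rewrite Nat.sub_diag. simpl (INR 0). ring.
Qed.

Lemma PS_derive_n_nonneg a m : (forall n, 0 <= a n) -> forall n, 0 <= PS_derive_n m a n.
Proof.
intros H n. unfold PS_derive_n. apply Rmult_le_pos; auto.
apply Rdiv_le_0_compat; [apply pos_INR|apply INR_fact_lt_0].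
Qed.

Lemma PSeries_nonneg a x : (forall n, 0 <= a n) -> 0 <= x -> Rbar_lt (Rabs x) (CV_radius a) -> 0 <= PSeries a x.
Proof.
intros H Hx Hr. apply Series_nonneg.
- intros n. apply Rmult_le_pos; auto. now apply pow_le.
- apply ex_series_Rabs. eapply ex_series_ext; [|exact (CV_disk_inside a x Hr)]. intros; reflexivity.
Qed.

Lemma PSeries_dom a b x : (forall n, Rabs (a n) <= b n) -> 0 <= x -> Rbar_lt (Rabs x) (CV_radius b) ->
  Rabs (PSeries a x) <= PSeries b x.
Proof.
intros H Hx Hr. apply Series_abs_le.
- intros n. rewrite Rabs_mult, (Rabs_pos_eq (x ^ n)) by now apply pow_le.
  apply Rmult_le_compat_r; [now apply pow_le|auto].
- apply ex_series_Rabs. eapply ex_series_ext; [|exact (CV_disk_inside b x Hr)]. intros; reflexivity.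
Qed.

Lemma Rbar_lt_R_trans x y c : x < y -> Rbar_le y c -> Rbar_lt x c.
Proof. intros H1 H2. apply Rbar_lt_le_trans with y; auto. Qed.

(** With nonnegative coefficients all derivatives on [[x, r]] are nonnegative, hence so is the
    Lagrange remainder, and a single Taylor term cannot exceed the value at [r]. *)
Lemma taylor_term_bound a x r m : (forall n, 0 <= a n) -> 0 <= x < r -> Rbar_lt r (CV_radius a) ->
  PSeries (PS_derive_n m a) x / INR (fact m) * (r - x) ^ m <= PSeries a r.
Proof.
intros Ha Hx Hr.
assert (Hin : forall t, x <= t <= r -> Rbar_lt (Rabs t) (CV_radius a)).
{ intros t Ht. rewrite Rabs_pos_eq by lra. apply Rbar_le_lt_trans with r; auto. simpl; lra. }
destruct (Taylor_Lagrange (PSeries a) m x r) as [z [Hz E]]; [lra| |].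
- intros t Ht k _. apply ex_derive_n_PSeries. now apply Hin.
- rewrite E.
  assert (P : forall k t, x <= t <= r -> 0 <= Derive_n (PSeries a) k t).
  { intros k t Ht. rewrite Derive_n_PSeries by now apply Hin. apply PSeries_nonneg; [now apply PS_derive_n_nonneg|lra|].
    rewrite CV_radius_derive_n. now apply Hin. }
  assert (F : forall k, 0 < INR (fact k)) by (intros; apply INR_fact_lt_0).
  assert (Hrem : 0 <= (r - x) ^ S m / INR (fact (S m)) * Derive_n (PSeries a) (S m) z).
  { apply Rmult_le_pos; [apply Rdiv_le_0_compat; auto; apply pow_le; lra|]. apply P; lra. }
  assert (Hs : PSeries (PS_derive_n m a) x / INR (fact m) * (r - x) ^ m <=
     sum_f_R0 (fun k => (r - x) ^ k / INR (fact k) * Derive_n (PSeries a) k x) m).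
  { assert (Hk : forall k, 0 <= (r - x) ^ k / INR (fact k) * Derive_n (PSeries a) k x).
    { intros k. apply Rmult_le_pos; [apply Rdiv_le_0_compat; auto; apply pow_le; lra|]. apply P; lra. }
    rewrite <- Derive_n_PSeries by (apply Hin; lra).
    replace (Derive_n (PSeries a) m x / INR (fact m) * (r - x) ^ m) with
      ((r - x) ^ m / INR (fact m) * Derive_n (PSeries a) m x) by (field; specialize (F m); lra).
    destruct m as [|m]; [simpl; lra|]. rewrite tech5.
    pose proof (cond_pos_sum _ m Hk). lra. }
  lra.
Qed.

(** The counterpart of Cauchy's estimate, obtained by replacing the coefficients by their absolute
    values. *)
Lemma tc_bound a r x m : absconv a r -> 0 <= x < r ->
  Rbar_lt r (CV_radius (fun n => Rabs (a n))) ->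
  Rabs (PSeries (PS_derive_n m a) x) / INR (fact m) <= PSeries (fun n => Rabs (a n)) r * (/ (r - x)) ^ m.
Proof.
intros Ha Hx Hr.
pose proof (taylor_term_bound (fun n => Rabs (a n)) x r m (fun n => Rabs_pos _) Hx Hr) as T.
assert (D : Rabs (PSeries (PS_derive_n m a) x) <= PSeries (PS_derive_n m (fun n => Rabs (a n))) x).
{ apply PSeries_dom; [|lra|].
  - intros n. unfold PS_derive_n. rewrite Rabs_mult, Rabs_pos_eq; [lra|].
    apply Rdiv_le_0_compat; [apply pos_INR|apply INR_fact_lt_0].
  - rewrite CV_radius_derive_n, Rabs_pos_eq by lra. apply Rbar_le_lt_trans with r; auto. simpl; lra. }
assert (F := INR_fact_lt_0 m). assert (Hp : 0 < (r - x) ^ m) by (apply pow_lt; lra).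
rewrite pow_inv. apply Rmult_le_reg_r with ((r - x) ^ m); auto.
rewrite (Rmult_assoc (PSeries _ r)), Rinv_l, Rmult_1_r by lra.
eapply Rle_trans; [|apply T]. apply Rmult_le_compat_r; [lra|].
unfold Rdiv. apply Rmult_le_compat_r; auto. apply Rlt_le, Rinv_0_lt_compat; auto.
Qed.

Lemma absconv_Rabs a r : absconv a r -> absconv (fun n => Rabs (a n)) r.
Proof. intros H. eapply ex_series_ext; [|exact H]. intros n; simpl. now rewrite Rabs_Rabsolu. Qed.

(* The recurrence says [A' = A * q] for the generating functions. *)
Lemma quotient_bound (A q : nat -> R) (C M b : R) : 0 < b -> 0 < C -> 1 <= M -> b <= A O ->
  (forall k, Rabs (A k) <= C * M ^ k) ->
  (forall m, INR (S m) * A (S m) = sum_f_R0 (fun k => A k * q (m - k)%nat) m) ->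
  forall m, Rabs (q m) <= (2 * C * M / b) * (M * (4 * C / b + 2)) ^ m.
Proof.
intros Hb HC HM Hb0 HA HR.
(* [L] makes [C / (L - 1) <= b / 2], so the convolution with [A 1, A 2, ...] contributes at most
   half of the claimed bound. [C2] and [L > 2] fit the term with the factor [INR (S m)] into the
   other half, since [m + 1 <= 2 ^ m]. *)
set (L := 4 * C / b + 2). set (C2 := 2 * C * M / b). set (M2 := M * L).
assert (HL : 2 < L) by (unfold L; assert (0 < 4 * C / b) by (apply Rdiv_lt_0_compat; lra); lra).
assert (HC2 : 0 < C2) by (unfold C2; apply Rdiv_lt_0_compat; nra).
assert (HM2 : 1 < M2) by (unfold M2; nra).
assert (P2 : forall k, INR (S k) <= 2 ^ k).
{ induction k as [|k IH]; [simpl; lra|]. rewrite S_INR. change (2 ^ S k) with (2 * 2 ^ k).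
  assert (1 <= 2 ^ k) by (apply pow_R1_Rle; lra). lra. }
assert (first : forall m, INR (S m) * (C * M ^ S m) <= b / 2 * C2 * M2 ^ m).
{ intros m. replace (b / 2 * C2) with (C * M) by (unfold C2; field; lra).
  unfold M2. rewrite Rpow_mult_distr. change (M ^ S m) with (M * M ^ m).
  assert (INR (S m) <= L ^ m) by (eapply Rle_trans; [apply P2|apply pow_incr; lra]).
  assert (0 < M ^ m) by (apply pow_lt; lra).
  assert (0 <= C * M * M ^ m) by (repeat apply Rmult_le_pos; lra). nra. }
intros m. induction m as [m IH] using Wf_nat.lt_wf_ind.
assert (Hq : b * Rabs (q m) <= b * (C2 * M2 ^ m)).
{ specialize (HR m).
  assert (Hsecond : Rabs (A O * q m) <= INR (S m) * (C * M ^ S m) + b / 2 * C2 * M2 ^ m).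
  { destruct m as [|p].
    - simpl in HR. rewrite <- HR. simpl INR. simpl in HA. rewrite Rmult_1_l.
      pose proof (HA 1%nat). simpl in *. assert (0 <= b / 2 * C2) by nra. lra.
    - rewrite (decomp_sum _ (S p)) in HR by lia. simpl pred in HR. rewrite Nat.sub_0_r in HR.
      assert (E : A O * q (S p) = INR (S (S p)) * A (S (S p)) - sum_f_R0 (fun i => A (S i) * q (S p - S i)%nat) p) by lra.
      rewrite E. unfold Rminus. eapply Rle_trans; [apply Rabs_triang|]. rewrite Rabs_Ropp. apply Rplus_le_compat.
      + rewrite Rabs_mult, (Rabs_pos_eq (INR _)) by apply pos_INR. apply Rmult_le_compat_l; [apply pos_INR|apply HA].
      + apply Rle_trans with (sum_f_R0 (fun i => (/ L) ^ S i * (C * C2 * M2 ^ S p)) p).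
        * eapply Rle_trans; [apply Rsum_abs|]. apply sum_Rle. intros i Hi. rewrite Rabs_mult.
          apply Rle_trans with (C * M ^ S i * (C2 * M2 ^ (S p - S i))).
          -- apply Rmult_le_compat; try apply Rabs_pos; [apply HA|]. apply IH. lia.
          -- apply Req_le. replace (M2 ^ S p) with (M2 ^ S i * M2 ^ (S p - S i)) by (rewrite <- pow_add; f_equal; lia).
             unfold M2 at 2. rewrite Rpow_mult_distr, pow_inv. field. apply pow_nonzero. lra.
        * rewrite <- scal_sum.
          assert (G : sum_f_R0 (fun i => (/ L) ^ S i) p <= / (L - 1)).
          { assert (Hg : forall n, sum_f_R0 (fun i => (/ L) ^ S i) n = (1 - (/ L) ^ S n) / (L - 1)).
            { induction n as [|n IHn]; [simpl; field; lra|]. rewrite tech5, IHn.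
              change ((/ L) ^ S (S n)) with (/ L * (/ L) ^ S n). field. lra. }
            rewrite Hg. unfold Rdiv. rewrite <- (Rmult_1_l (/ (L - 1))) at 2.
            apply Rmult_le_compat_r; [apply Rlt_le, Rinv_0_lt_compat; lra|].
            assert (0 < (/ L) ^ S p) by (apply pow_lt, Rinv_0_lt_compat; lra). lra. }
          assert (HMp : 0 < M2 ^ S p) by (apply pow_lt; lra).
          apply Rle_trans with (C * C2 * M2 ^ S p * / (L - 1)).
          -- apply Rmult_le_compat_l; auto. apply Rmult_le_pos; [apply Rmult_le_pos; lra|lra].
          -- assert (X : C * / (L - 1) <= b / 2).
             { apply Rmult_le_reg_r with (L - 1); [lra|]. rewrite Rmult_assoc, Rinv_l, Rmult_1_r by lra.
               unfold L. replace (b / 2 * (4 * C / b + 2 - 1)) with (2 * C + b / 2) by (field; lra). lra. }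
             replace (C * C2 * M2 ^ S p * / (L - 1)) with (C * / (L - 1) * (C2 * M2 ^ S p)) by ring.
             apply Rle_trans with (b / 2 * (C2 * M2 ^ S p)); [|apply Req_le; ring]. apply Rmult_le_compat_r; auto. apply Rmult_le_pos; lra. }
  rewrite Rabs_mult in Hsecond. rewrite (Rabs_pos_eq (A O)) in Hsecond by lra.
  specialize (first m). pose proof (Rabs_pos (q m)). nra. }
apply Rmult_le_reg_l with b; auto.
Qed.

(* The step of Pringsheim's theorem: the nonnegative coefficients [d] of the expansion at [0]
   are controlled by the re-expansion at [x], which converges beyond [x + h]. *)
Lemma pringsheim_step (d : nat -> R) (x C M : R) : 0 <= x -> (forall n, 0 <= d n) -> 0 < M -> 0 <= C ->
  Rbar_lt x (CV_radius d) ->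
  (forall m, PSeries (PS_derive_n m d) x / INR (fact m) <= C * M ^ m) ->
  absconv d (x + / (2 * M)).
Proof.
intros Hx Hd HM HC Hr HB.
set (h := / (2 * M)). assert (Hh : 0 < h) by (apply Rinv_0_lt_compat; lra).
assert (Hbound : forall N, sum_f_R0 (fun n => d n * (x + h) ^ n) N <= 2 * C).
(* [t] cuts [d] off after [N], so its Taylor expansion at [x] is finite and exact. The choice of [h]
   turns it into a geometric sum of ratio 1/2, bounded independently of [N]. *)
{ intros N. set (t := fun n => if Compare_dec.le_dec n N then d n else 0).
  assert (Ht0 : forall n, (N < n)%nat -> t n = 0) by (intros n Hn; unfold t; destruct Compare_dec.le_dec; [lia|auto]).
  assert (CVt : forall y, Rbar_lt (Rabs y) (CV_radius t)).
  { intros y. apply Rbar_lt_R_trans with (Rabs y + 1); [lra|]. apply absconv_radius; [pose proof (Rabs_pos y); lra|].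
    eexists. apply (is_series_finite _ N). intros n Hn. rewrite Ht0, Rabs_R0 by auto. ring. }
  assert (E1 : PSeries t (x + h) = sum_f_R0 (fun n => d n * (x + h) ^ n) N).
  { unfold PSeries. rewrite (Series_finite _ N).
    - apply sum_eq. intros i Hi. unfold t. destruct Compare_dec.le_dec; [auto|lia].
    - intros n Hn. rewrite Ht0 by auto. ring. }
  rewrite <- E1.
  destruct (Taylor_Lagrange (PSeries t) N x (x + h)) as [z [Hz E]]; [lra| |].
  - intros y _ k _. apply ex_derive_n_PSeries, CVt.
  - rewrite E. rewrite (Derive_n_PSeries (S N)) by apply CVt.
    replace (PSeries (PS_derive_n (S N) t) z) with 0.
    2:{ unfold PSeries. rewrite (Series_ext _ (fun n => 0 * 0)); [rewrite Series_scal_l; ring|].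
      intros n. unfold PS_derive_n. rewrite Ht0 by lia. ring. }
    rewrite Rmult_0_r, Rplus_0_r.
    apply Rle_trans with (sum_f_R0 (fun m => (/ 2) ^ m * C) N).
    + apply sum_Rle. intros m _. rewrite Derive_n_PSeries by apply CVt.
      replace (x + h - x) with h by ring.
      assert (D : PSeries (PS_derive_n m t) x <= PSeries (PS_derive_n m d) x).
      { eapply Rle_trans; [apply Rle_abs|]. apply PSeries_dom; auto.
        - intros n. unfold PS_derive_n. rewrite Rabs_mult, Rabs_pos_eq by (apply Rdiv_le_0_compat; [apply pos_INR|apply INR_fact_lt_0]).
          apply Rmult_le_compat_l; [apply Rdiv_le_0_compat; [apply pos_INR|apply INR_fact_lt_0]|].
          unfold t. specialize (Hd (n + m)%nat). destruct Compare_dec.le_dec; [rewrite Rabs_pos_eq; lra|rewrite Rabs_R0; auto].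
        - rewrite CV_radius_derive_n, Rabs_pos_eq by auto. exact Hr. }
      specialize (HB m). pose proof (INR_fact_lt_0 m). assert (0 < h ^ m) by now apply pow_lt.
      apply Rle_trans with (h ^ m * (C * M ^ m)).
      * unfold Rdiv in *. rewrite Rmult_assoc. apply Rmult_le_compat_l; [lra|].
        eapply Rle_trans; [|apply HB]. rewrite Rmult_comm. apply Rmult_le_compat_r; auto.
        apply Rlt_le, Rinv_0_lt_compat; auto.
      * apply Req_le. unfold h. rewrite Rinv_mult, Rpow_mult_distr.
        replace ((/ M) ^ m) with (/ M ^ m) by (symmetry; apply pow_inv). field. apply pow_nonzero; lra.
    + rewrite <- scal_sum.
      assert (G : sum_f_R0 (fun i => (/ 2) ^ i) N <= 2).
      { assert (Hg : forall n, sum_f_R0 (fun i => (/ 2) ^ i) n = 2 - (/ 2) ^ n).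
        { induction n as [|n IHn]; [simpl; lra|]. rewrite tech5, IHn. simpl. lra. }
        rewrite Hg. assert (0 < (/ 2) ^ N) by (apply pow_lt; lra). lra. }
      apply Rle_trans with (C * 2); [apply Rmult_le_compat_l; auto|lra]. }
destruct (ex_finite_lim_seq_incr (sum_n (fun n => Rabs (d n) * (x + h) ^ n)) (2 * C)) as [l Hl].
- intros n. rewrite sum_Sn. unfold plus; simpl. pose proof (Rabs_pos (d (S n))).
  assert (0 <= (x + h) * (x + h) ^ n) by (apply Rmult_le_pos; [lra|apply pow_le; lra]). nra.
- intros n. rewrite sum_n_Reals. eapply Rle_trans; [|apply (Hbound n)]. apply Req_le, sum_eq. intros i _.
  now rewrite Rabs_pos_eq.
- exists l. exact Hl.
Qed.

(** * From a constant sign of [alpha n tau] to the absence of zeros of xi *)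

Section ZeroFree.

Variable tau : R.
Hypothesis Htau : 0 < tau < 1.

(* The expansion of [tau / (1 - z) - 1 / 2]. *)
Definition mob (n : nat) : R := match n with O => tau - / 2 | S _ => tau end.
Definition acoef : nat -> R := ps_comp ecoef mob.

Lemma absconv_mob r : 0 <= r < 1 -> absconv mob r.
Proof.
intros Hr. apply ex_series_incr_1. apply (ex_series_ext (fun n => tau * r * r ^ n)).
- intros n. simpl. rewrite Rabs_pos_eq by lra. eqR; ring.
- apply ex_series_scalR, ex_series_geom. rewrite Rabs_pos_eq; lra.
Qed.

Lemma Cminus_neq_0 z : Cmod z < 1 -> (1 - z)%C <> RtoC 0.
Proof.
intros Hz E. assert (z = RtoC 1) by (replace z with (1 - (1 - z))%C by ring; rewrite E; ring).
rewrite H, Cmod_1 in Hz. lra.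
Qed.

Lemma CP_mob z : Cmod z < 1 -> CP mob z = (RtoC tau / (1 - z) - RtoC (/ 2))%C.
Proof.
intros Hz. pose proof (Cmod_ge_0 z).
assert (Ha : absconv (fun _ => 1) (Cmod z)).
{ apply (ex_series_ext (fun n => Cmod z ^ n)); [intros; rewrite Rabs_R1; eqR; ring|].
  apply ex_series_geom. rewrite Rabs_pos_eq; lra. }
assert (H1 := cabs_CP _ z _ Ha (Rle_refl _)).
assert (Hm := cabs_CP _ z _ (absconv_mob (Cmod z) ltac:(lra)) (Rle_refl _)).
assert (X1 : CSeries (fun n => RtoC 1 * z ^ S n)%C = CSeries (fun n => z * (RtoC 1 * z ^ n))%C) by (apply CSeries_ext; intros; simpl; ring).
assert (Xm : CSeries (fun n => RtoC (mob (S n)) * z ^ S n)%C = CSeries (fun n => (RtoC tau * z) * (RtoC 1 * z ^ n))%C) by (apply CSeries_ext; intros; simpl; ring).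
rewrite (CSeries_scal z (fun n => RtoC 1 * z ^ n)%C H1) in X1. rewrite (CSeries_scal (RtoC tau * z)%C (fun n => RtoC 1 * z ^ n)%C H1) in Xm. pose proof (eq_trans (CSeries_tail _ 0 H1) X1) as T1. pose proof (eq_trans (CSeries_tail _ 0 Hm) Xm) as Tm.
rewrite Csum_0 in T1, Tm. unfold CP.
set (A := CSeries (fun n => RtoC 1 * z ^ n)%C) in *. set (B := CSeries (fun n => RtoC (mob n) * z ^ n)%C) in *.
assert (Nz := Cminus_neq_0 z Hz).
assert (EA : A = (/ (1 - z))%C).
{ assert (E : (A * (1 - z))%C = 1%C).
  { replace (A * (1 - z))%C with ((A - RtoC 1 * z ^ 0) - z * A + 1)%C by (simpl; ring). rewrite T1. ring. }
  replace A with (A * (1 - z) / (1 - z))%C by (field; auto). rewrite E. field; auto. }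
replace B with ((B - RtoC (mob 0) * z ^ 0) + RtoC (mob 0))%C by (simpl; ring).
rewrite Tm, EA. simpl mob. rewrite RtoC_minus. field; auto.
Qed.

Lemma absconv_acoef r : 0 <= r < 1 -> absconv acoef r.
Proof.
intros Hr. apply ps_comp_abs; [lra|now apply absconv_mob|apply absconv_ecoef].
Qed.

Lemma CP_acoef z : Cmod z < 1 -> CP acoef z = xiE (RtoC tau / (1 - z))%C.
Proof.
intros Hz. unfold acoef, xiE. pose proof (Cmod_ge_0 z).
rewrite (CP_comp ecoef mob (Cmod z)), CP_mob; auto; try lra.
- apply absconv_mob; lra.
- apply absconv_ecoef.
Qed.

Lemma CV_acoef x : Rabs x < 1 -> Rbar_lt (Rabs x) (CV_radius acoef) /\ Rbar_lt (Rabs x) (CV_radius (fun n => Rabs (acoef n))).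
Proof.
intros Hx. pose proof (Rabs_pos x).
split; (apply Rbar_lt_R_trans with ((Rabs x + 1) / 2); [lra|]; apply absconv_radius; [lra|]).
- apply absconv_acoef; lra.
- apply absconv_Rabs, absconv_acoef; lra.
Qed.

Lemma PSeries_acoef x : -1 < x < 1 -> PSeries acoef x = xiR (tau / (1 - x)).
Proof.
intros Hx. apply RtoC_inj. rewrite <- CP_real, CP_acoef by (rewrite Cmod_R; apply Rabs_def1; lra).
rewrite <- RtoC_minus, <- RtoC_div by lra. unfold xiE. rewrite <- RtoC_minus, CP_real, xiR_eq. reflexivity.
Qed.

(* The Taylor coefficients at [x] of [A = xi (tau / (1 - x))] and of [A' / A]. *)
Definition tcA (j : nat) (x : R) : R := Derive_n (PSeries acoef) j x / INR (fact j).
Definition tcD (m : nat) (x : R) : R :=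
  / tau ^ (S m) * ((tau / (1 - x)) ^ (S (S m)) * alpha (S m) (tau / (1 - x))).

Lemma is_derive_tcA j x : -1 < x < 1 -> is_derive (tcA j) x (INR (S j) * tcA (S j) x).
Proof.
intros Hx. assert (Hr : Rabs x < 1) by (apply Rabs_def1; lra). unfold tcA.
replace (INR (S j) * (Derive_n (PSeries acoef) (S j) x / INR (fact (S j)))) with
  (/ INR (fact j) * Derive_n (PSeries acoef) (S j) x).
- apply (is_derive_ext (fun x => / INR (fact j) * Derive_n (PSeries acoef) j x)).
  + intros t. eqR. unfold Rdiv. ring.
  + apply (is_derive_scal (Derive_n (PSeries acoef) j)). apply Derive_correct.
    apply (ex_derive_n_PSeries (S j) acoef x). apply CV_acoef; auto.
- rewrite fact_simpl, mult_INR. field. split; [apply INR_fact_neq_0|apply not_0_INR; lia].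
Qed.

Lemma is_derive_frac x : x < 1 -> is_derive (fun x => tau / (1 - x)) x (tau / (1 - x) ^ 2).
Proof. intros Hx. auto_derive; [lra|]. field. lra. Qed.

(** With [s = tau / (1 - x)] one has [ds/dx = s^2 / tau], and [s^(m+2) alpha_(m+1)] has derivative
    [(m + 1) s^(m+1) alpha_(m+2)]. The recurrence for [alpha] is thus the passage to the next Taylor
    coefficient. *)
Lemma is_derive_tcD m x : -1 < x < 1 -> is_derive (tcD m) x (INR (S m) * tcD (S m) x).
Proof.
intros Hx. unfold tcD. set (s := tau / (1 - x)).
assert (Hs : 0 < s) by (apply Rdiv_lt_0_compat; lra).
replace (INR (S m) * (/ tau ^ S (S m) * (s ^ S (S (S m)) * alpha (S (S m)) s))) with
  (/ tau ^ S m * ((tau / (1 - x) ^ 2) * (INR (S m) * s ^ (S m) * alpha (S (S m)) s))).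
- apply (is_derive_scal (fun x => (tau / (1 - x)) ^ (S (S m)) * alpha (S m) (tau / (1 - x)))).
  apply (is_derive_comp (fun s => s ^ (S (S m)) * alpha (S m) s) (fun x => tau / (1 - x))).
  + apply is_derive_pow_alpha. lia.
  + apply is_derive_frac. lra.
- replace (tau / (1 - x) ^ 2) with (s * s / tau) by (unfold s; field; lra).
  simpl pow. field. split; [apply pow_nonzero; lra|lra].
Qed.

Lemma tcA_0 x : -1 < x < 1 -> tcA 0 x = xiR (tau / (1 - x)).
Proof. intros Hx. unfold tcA. simpl. rewrite PSeries_acoef by auto. field. Qed.

Lemma tcA_1 x : -1 < x < 1 -> tcA 1 x = tcA 0 x * tcD 0 x.
Proof.
intros Hx. rewrite tcA_0 by auto.
assert (D : is_derive (PSeries acoef) x (tau / (1 - x) ^ 2 * Derive xiR (tau / (1 - x)))).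
{ apply (is_derive_ext_loc (fun x => xiR (tau / (1 - x)))).
  - assert (Hd : 0 < Rmin (x + 1) (1 - x)) by (apply Rmin_pos; lra).
    exists (mkposreal _ Hd). intros y Hy. change (Rabs (y - x) < Rmin (x + 1) (1 - x)) in Hy.
    pose proof (Rmin_l (x + 1) (1 - x)). pose proof (Rmin_r (x + 1) (1 - x)). apply Rabs_def2 in Hy.
    symmetry. apply PSeries_acoef. lra.
  - apply (is_derive_comp xiR (fun x => tau / (1 - x))).
    + apply Derive_correct, smooth_ex_derive, smooth_xiR.
    + apply is_derive_frac. lra. }
unfold tcA, tcD. rewrite (is_derive_unique _ _ _ D : Derive_n (PSeries acoef) 1 x = _).
rewrite alpha_1, Derive_logxi. pose proof (xiR_pos (tau / (1 - x))). simpl. field. split; lra.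
Qed.

(** The Leibniz rule for [A' = A * (A' / A)]; the left-hand side is the coefficient sequence of
    [A']. *)
Lemma tc_relation m x : -1 < x < 1 ->
  INR (S m) * tcA (S m) x = sum_f_R0 (fun k => tcA k x * tcD (m - k) x) m.
Proof.
revert m x.
apply (leibniz_seq (-1) 1 tcA tcD (fun m x => INR (S m) * tcA (S m) x)).
- intros; now apply is_derive_tcA.
- intros; now apply is_derive_tcD.
- intros k x Hx. apply (is_derive_scal (tcA (S k))). now apply is_derive_tcA.
- intros x Hx. rewrite tcA_1 by auto. simpl. ring.
Qed.

Definition dcoef (n : nat) : R := tcD n 0.

Lemma dcoef_alpha n : dcoef n = tau * alpha (S n) tau.
Proof.
unfold dcoef, tcD. replace (tau / (1 - 0)) with tau by field. simpl pow. field.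
split; [apply pow_nonzero|]; lra.
Qed.

Lemma tcA_at_0 k : tcA k 0 = acoef k.
Proof.
unfold tcA. rewrite Derive_n_coef.
- field. apply INR_fact_neq_0.
- rewrite <- Rabs_R0. apply CV_acoef. rewrite Rabs_R0; lra.
Qed.

(** At [x = 0] the relation is an identity of coefficients, which carries the equation [A' = A * D]
    over to complex arguments. *)
Lemma PS_derive_acoef : PS_derive acoef = PS_mult acoef dcoef.
Proof.
apply functional_extensionality; intros n. unfold PS_derive, PS_mult.
rewrite <- tcA_at_0, tc_relation by lra. apply sum_eq. intros k _. now rewrite tcA_at_0.
Qed.

(** On the real axis xi is at least [ecoef 0], and absolute convergence at the larger radius
    [(1 + R0) / 2] controls its Taylor coefficients, so [quotient_bound] applies at every [x]. The
    constants are uniform in [x], which gives the later continuation a fixed step length. *)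
Lemma tcD_bound R0 : 0 <= R0 < 1 -> exists C M, 0 < C /\ 1 <= M /\
  forall m x, 0 <= x <= R0 -> Rabs (tcD m x) <= C * M ^ m.
Proof.
intros HR. set (r := (1 + R0) / 2). set (M := 2 / (1 - R0)). set (C := PSeries (fun n => Rabs (acoef n)) r + 1).
assert (Hrr : Rabs r < 1) by (unfold r; rewrite Rabs_pos_eq; lra).
destruct (CV_acoef r Hrr) as [V1 V2].
assert (HC : 0 < C).
{ unfold C. assert (0 <= PSeries (fun n => Rabs (acoef n)) r); [|lra].
  apply PSeries_nonneg; auto; [intros; apply Rabs_pos|unfold r; lra]. }
assert (HM : 1 <= M).
{ unfold M. apply Rmult_le_reg_r with (1 - R0); [lra|]. replace (2 / (1 - R0) * (1 - R0)) with 2 by (field; lra). lra. }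
pose proof ecoef_0_pos as Hb.
exists (2 * C * M / ecoef 0), (M * (4 * C / ecoef 0 + 2)).
assert (0 < 4 * C / ecoef 0) by (apply Rdiv_lt_0_compat; lra).
split; [apply Rdiv_lt_0_compat; nra|]. split; [nra|].
intros m x Hx.
apply (quotient_bound (fun k => tcA k x) (fun k => tcD k x) C M (ecoef 0)); auto.
- rewrite tcA_0, xiR_eq by lra. apply PSeries_ecoef_ge.
- intros k. unfold tcA. rewrite Derive_n_PSeries by (apply CV_acoef; rewrite Rabs_pos_eq; lra).
  unfold Rdiv. rewrite Rabs_mult, (Rabs_pos_eq (/ _)) by (apply Rlt_le, Rinv_0_lt_compat, INR_fact_lt_0).
  eapply Rle_trans; [apply (tc_bound acoef r x k)|].
  + apply absconv_acoef. unfold r; lra.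
  + unfold r; lra.
  + rewrite Rabs_pos_eq in V2 by (unfold r; lra). exact V2.
  + apply Rmult_le_compat; [|apply pow_le, Rlt_le, Rinv_0_lt_compat; unfold r; lra|unfold C; lra|].
    * unfold C in HC. apply PSeries_nonneg; auto; [intros; apply Rabs_pos|unfold r; lra].
    * apply pow_incr. split; [apply Rlt_le, Rinv_0_lt_compat; unfold r; lra|].
      unfold M. replace (2 / (1 - R0)) with (/ (r - R0)) by (unfold r; field; lra).
      apply Rinv_le_contravar; unfold r; lra.
- intros k. apply tc_relation. lra.
Qed.

Lemma PSeries_dcoef x' y : 0 < x' -> absconv dcoef x' -> Rabs y < x' -> -1 < y < 1 -> PSeries dcoef y = tcD 0 y.
Proof.
intros Hx' Hd Hy Hy1.
assert (V : Rbar_lt (Rabs y) (CV_radius dcoef)) by (apply Rbar_lt_R_trans with x'; auto; apply absconv_radius; auto; lra).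
assert (Va : Rbar_lt (Rabs y) (CV_radius acoef)) by (apply CV_acoef, Rabs_def1; lra).
assert (E := PSeries_mult acoef dcoef y Va V).
rewrite <- PS_derive_acoef, <- Derive_PSeries, PSeries_acoef in E by auto.
assert (E1 := tcA_1 y Hy1). rewrite tcA_0 in E1 by auto.
replace (tcA 1 y) with (Derive (PSeries acoef) y) in E1 by (unfold tcA, Rdiv; simpl; rewrite Rinv_1; change (Derive (PSeries acoef) y = Derive (PSeries acoef) y * 1); ring).
pose proof (xiR_pos (tau / (1 - y))).
apply Rmult_eq_reg_l with (xiR (tau / (1 - y))); [|lra]. rewrite <- E, <- E1. reflexivity.
Qed.

(** Inside a disc where the series of [dcoef] is already known to converge, its re-expansion at [y]
    has the coefficients [tcD m y], whose bounds do not depend on that disc. *)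
Lemma Derive_n_dcoef x' m : 0 < x' -> absconv dcoef x' -> forall y, Rabs y < x' -> -1 < y < 1 ->
  Derive_n (PSeries dcoef) m y = INR (fact m) * tcD m y.
Proof.
intros Hx' Hd. induction m as [|m IH]; intros y Hy Hy1.
- simpl. rewrite (PSeries_dcoef x') by auto. ring.
- change (Derive (Derive_n (PSeries dcoef) m) y = INR (fact (S m)) * tcD (S m) y).
  apply is_derive_unique.
  apply (is_derive_ext_loc (fun y => INR (fact m) * tcD m y)).
  + assert (Hd2 : 0 < Rmin (x' - Rabs y) (Rmin (y + 1) (1 - y))) by (repeat apply Rmin_pos; lra).
    exists (mkposreal _ Hd2). intros t Ht. change (Rabs (t - y) < Rmin (x' - Rabs y) (Rmin (y + 1) (1 - y))) in Ht.
    pose proof (Rmin_l (x' - Rabs y) (Rmin (y + 1) (1 - y))). pose proof (Rmin_r (x' - Rabs y) (Rmin (y + 1) (1 - y))).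
    pose proof (Rmin_l (y + 1) (1 - y)). pose proof (Rmin_r (y + 1) (1 - y)).
    symmetry. apply IH.
    * replace t with ((t - y) + y) by ring. eapply Rle_lt_trans; [apply Rabs_triang|]. lra.
    * apply Rabs_def2 in Ht. lra.
  + rewrite fact_simpl, mult_INR. replace (INR (S m) * INR (fact m) * tcD (S m) y) with (INR (fact m) * (INR (S m) * tcD (S m) y)) by ring.
    apply (is_derive_scal (tcD m)). now apply is_derive_tcD.
Qed.

Variables (sg : R) (n0 : nat).
Hypothesis Hsg : sg = 1 \/ sg = -1.
Hypothesis Hsign : forall n, (n0 <= n)%nat -> 0 < sg * alpha n tau.

(* The coefficients of unknown sign form the polynomial [dfin]. *)
Let dpos (n : nat) : R := if Compare_dec.le_dec n0 n then sg * dcoef n else 0.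
Let dfin (n : nat) : R := if Compare_dec.le_dec n0 n then 0 else sg * dcoef n.

Let dpos_eq n : dpos n = sg * dcoef n - dfin n.
Proof. unfold dpos, dfin. destruct Compare_dec.le_dec; ring. Qed.

Let dpos_nonneg n : 0 <= dpos n.
Proof.
unfold dpos. destruct Compare_dec.le_dec as [H|H]; [|lra]. rewrite dcoef_alpha.
pose proof (Hsign (S n) ltac:(lia)). replace (sg * (tau * alpha (S n) tau)) with (tau * (sg * alpha (S n) tau)) by ring.
apply Rmult_le_pos; lra.
Qed.

Let dfin_0 n : (n0 < n)%nat -> dfin n = 0.
Proof. intros H. unfold dfin. destruct Compare_dec.le_dec; [auto|lia]. Qed.

Let absconv_dfin r : absconv dfin r.
Proof. eexists. apply (is_series_finite _ n0). intros n Hn. rewrite dfin_0, Rabs_R0 by auto. ring. Qed.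

Let absconv_dpos r : 0 <= r -> absconv dpos r <-> absconv dcoef r.
Proof.
intros Hr.
assert (Ha : Rabs sg = 1) by (destruct Hsg; subst sg; [apply Rabs_R1|rewrite Rabs_left; lra]).
assert (Hp : forall n, 0 <= r ^ n) by (intros; now apply pow_le).
split; intros H.
- apply (ex_series_dom _ (fun n => Rabs (dpos n) * r ^ n + Rabs (dfin n) * r ^ n)).
  + intros n. rewrite Rabs_mult, Rabs_Rabsolu, (Rabs_pos_eq (r ^ n)) by auto. rewrite <- Rmult_plus_distr_r.
    apply Rmult_le_compat_r; auto. rewrite <- (Rmult_1_l (Rabs (dcoef n))), <- Ha, <- Rabs_mult.
    replace (sg * dcoef n) with (dpos n + dfin n) by (rewrite dpos_eq; ring). apply Rabs_triang.
  + apply (ex_series_plus (fun n => Rabs (dpos n) * r ^ n)); [exact H|apply absconv_dfin].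
- apply (ex_series_dom _ (fun n => Rabs (dcoef n) * r ^ n)); auto.
  intros n. rewrite Rabs_mult, Rabs_Rabsolu, (Rabs_pos_eq (r ^ n)) by auto. apply Rmult_le_compat_r; auto.
  unfold dpos. destruct Compare_dec.le_dec; [rewrite Rabs_mult, Ha; lra|rewrite Rabs_R0; apply Rabs_pos].
Qed.

Lemma CV_of_absconv a x x' : 0 <= x < x' -> absconv a x' -> Rbar_lt x (CV_radius a).
Proof. intros H Ha. apply Rbar_lt_R_trans with x'; [lra|]. apply absconv_radius; auto; lra. Qed.

Lemma ex_series_PS_derive_n a m x : 0 <= x -> Rbar_lt x (CV_radius a) -> ex_series (fun n => PS_derive_n m a n * x ^ n).
Proof.
intros Hx H. apply ex_series_Rabs. apply (CV_disk_inside (PS_derive_n m a) x). rewrite CV_radius_derive_n, Rabs_pos_eq; auto.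
Qed.

(** Convergence starts from the direct bound at 0 and is pushed outwards by Pringsheim steps whose
    length depends only on the uniform constant [M]. *)
Theorem absconv_dcoef R0 : 0 <= R0 < 1 -> absconv dcoef R0.
Proof.
intros HR. destruct (tcD_bound R0 HR) as [C [M [HC [HM HB]]]].
set (Pb := PSeries (fun n => Rabs (dfin n)) 2).
assert (HPb : 0 <= Pb).
{ apply PSeries_nonneg; [intros; apply Rabs_pos|lra|]. rewrite Rabs_pos_eq by lra.
  apply (CV_of_absconv _ 2 3); [lra|]. apply absconv_Rabs, absconv_dfin. }
set (h := / (2 * M)). assert (Hh : 0 < h) by (apply Rinv_0_lt_compat; lra).
assert (Hbase : absconv dcoef h).
{ apply (ex_series_dom _ (fun n => C * (/ 2) ^ n)).
  - intros n. rewrite Rabs_mult, Rabs_Rabsolu, (Rabs_pos_eq (h ^ n)) by (apply pow_le; lra).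
    unfold dcoef. apply Rle_trans with (C * M ^ n * h ^ n).
    + apply Rmult_le_compat_r; [apply pow_le; lra|]. apply HB; lra.
    + apply Req_le. unfold h. rewrite Rmult_assoc, <- Rpow_mult_distr. do 2 f_equal. field. lra.
  - apply ex_series_scalR, ex_series_geom. rewrite Rabs_pos_eq; lra. }
assert (Hstep : forall x x', 0 <= x < x' -> x <= R0 -> absconv dcoef x' -> absconv dcoef (x + h)).
{ intros x x' Hx HxR Hd. apply absconv_dpos; [lra|]. unfold h.
  assert (Vd : Rbar_lt x (CV_radius dcoef)) by (now apply (CV_of_absconv _ x x')).
  assert (Vp : Rbar_lt x (CV_radius dpos)) by (apply (CV_of_absconv _ x x'); auto; apply absconv_dpos; auto; lra).
  assert (Vf : Rbar_lt x (CV_radius dfin)) by (apply (CV_of_absconv _ x x'); auto; apply absconv_dfin).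
  apply (pringsheim_step dpos x (C + Pb) M); auto; try lra.
  intros m.
  assert (E : PSeries (PS_derive_n m dpos) x = sg * PSeries (PS_derive_n m dcoef) x - PSeries (PS_derive_n m dfin) x).
  { unfold PSeries. rewrite <- Series_scal_l, <- Series_minus.
    - apply Series_ext. intros n. unfold PS_derive_n. rewrite dpos_eq. ring.
    - apply ex_series_scalR, ex_series_PS_derive_n; auto; lra.
    - apply ex_series_PS_derive_n; auto; lra. }
  assert (E2 : PSeries (PS_derive_n m dcoef) x = INR (fact m) * tcD m x).
  { rewrite <- Derive_n_PSeries by (rewrite Rabs_pos_eq; auto; lra).
    apply (Derive_n_dcoef x'); auto; try lra. rewrite Rabs_pos_eq; lra. }
  assert (F := INR_fact_lt_0 m).
  assert (T : Rabs (PSeries (PS_derive_n m dfin) x) / INR (fact m) <= Pb * (/ (2 - x)) ^ m).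
  { apply tc_bound; [apply absconv_dfin|lra|]. apply (CV_of_absconv _ 2 3); [lra|]. apply absconv_Rabs, absconv_dfin. }
  assert (HM1 : 1 <= M ^ m) by (apply pow_R1_Rle; lra).
  assert (T2 : Pb * (/ (2 - x)) ^ m <= Pb * M ^ m).
  { apply Rmult_le_compat_l; auto. apply Rle_trans with (1 ^ m); [|rewrite pow1; auto].
    apply pow_incr. split; [apply Rlt_le, Rinv_0_lt_compat; lra|]. rewrite <- Rinv_1. apply Rinv_le_contravar; lra. }
  rewrite E, E2. replace ((sg * (INR (fact m) * tcD m x) - PSeries (PS_derive_n m dfin) x) / INR (fact m)) with
    (sg * tcD m x - PSeries (PS_derive_n m dfin) x / INR (fact m)) by (field; lra).
  assert (B1 : sg * tcD m x <= C * M ^ m).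
  { eapply Rle_trans; [|apply (HB m x); lra]. unfold Rabs; destruct Hsg; subst sg; destruct Rcase_abs; lra. }
  assert (B2 : - (PSeries (PS_derive_n m dfin) x / INR (fact m)) <= Rabs (PSeries (PS_derive_n m dfin) x) / INR (fact m)).
  { unfold Rdiv. rewrite Ropp_mult_distr_l. apply Rmult_le_compat_r; [apply Rlt_le, Rinv_0_lt_compat; auto|].
    rewrite <- Rabs_Ropp. apply Rle_abs. }
  lra. }
(* The re-expansion point lies [h / 4] inside the radius already reached; adding [h] then gains more
   than the [h / 2] claimed. *)
assert (Hiter : forall j, INR (S j) * (h / 2) <= R0 + h / 2 -> absconv dcoef (INR (S j) * (h / 2))).
{ induction j as [|j IH]; intros Hj.
  - apply (absconv_le _ h); auto. simpl. lra.
  - rewrite S_INR in Hj. pose proof (pos_INR j) as Hj0. rewrite (S_INR j) in *.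
    specialize (IH ltac:(lra)).
    apply (absconv_le _ ((INR j + 1) * (h / 2) - h / 4 + h)).
    + rewrite !S_INR. split; [|lra]. apply Rmult_le_pos; lra.
    + apply (Hstep _ ((INR j + 1) * (h / 2))); auto; [|lra]. split; [|lra]. nra. }
destruct (nfloor_ex (R0 / (h / 2))) as [j [Hj1 Hj2]]; [apply Rdiv_le_0_compat; lra|].
assert (K : R0 / (h / 2) * (h / 2) = R0) by (field; lra).
apply (absconv_le _ (INR (S j) * (h / 2))).
- rewrite S_INR. split; [lra|]. rewrite <- K. apply Rmult_le_compat_r; lra.
- apply Hiter. rewrite S_INR.
  assert (INR j * (h / 2) <= R0 / (h / 2) * (h / 2)) by (apply Rmult_le_compat_r; lra). lra.
Qed.

Lemma is_derive_ray0 f w l t : cdiff f (RtoC t * w)%C l ->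
  is_derive (fun t => Re (f (RtoC t * w)%C)) t (Re (l * w)%C) /\
  is_derive (fun t => Im (f (RtoC t * w)%C)) t (Im (l * w)%C).
Proof.
intros H. destruct (is_derive_ray f 0 w l t) as [H1 H2].
- now rewrite Cplus_0_l.
- split; [eapply is_derive_ext; [|exact H1]|eapply is_derive_ext; [|exact H2]]; intros; simpl; now rewrite Cplus_0_l.
Qed.

(* Along a ray [A' = A * D] with [D] bounded, so [|A|^2 exp (2 M t)] cannot decrease. *)
Theorem CP_acoef_neq_0 z : Cmod z < 1 -> CP acoef z <> RtoC 0.
Proof.
intros Hz Hzero. pose proof (Cmod_ge_0 z) as Hz0.
assert (Hd := absconv_dcoef (Cmod z) ltac:(lra)).
set (M := Series (fun n => Rabs (dcoef n) * Cmod z ^ n)).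
set (u := fun t => Re (CP acoef (RtoC t * z)%C)). set (v := fun t => Im (CP acoef (RtoC t * z)%C)).
set (D := fun t => (CP dcoef (RtoC t * z) * z)%C).
assert (Hm : forall t, 0 <= t <= 1 -> Cmod (RtoC t * z) <= Cmod z).
{ intros t Ht. rewrite Cmod_mult, Cmod_R, Rabs_pos_eq by lra. nra. }
assert (HD : forall t, 0 <= t <= 1 -> - M <= Re (D t)).
{ intros t Ht. assert (B : Cmod (CP dcoef (RtoC t * z)%C) <= M).
  { apply Cmod_CSeries_le; auto. intros n. rewrite Cmod_term. apply Rmult_le_compat_l; [apply Rabs_pos|].
    apply pow_incr. split; [apply Cmod_ge_0|]. now apply Hm. }
  assert (B2 : Cmod (D t) <= M).
  { unfold D. rewrite Cmod_mult. pose proof (Cmod_ge_0 (CP dcoef (RtoC t * z)%C)). nra. }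
  pose proof (re_le_Cmod (D t)) as B3. revert B3. unfold Rabs; destruct Rcase_abs; lra. }
assert (Huv : forall t, 0 <= t <= 1 -> is_derive u t (u t * Re (D t) - v t * Im (D t)) /\ is_derive v t (u t * Im (D t) + v t * Re (D t))).
{ intros t Ht. set (r := (1 + Cmod z) / 2).
  assert (C1 : cdiff (CP acoef) (RtoC t * z)%C (CP (PS_derive acoef) (RtoC t * z)%C)).
  { apply (cdiff_CP acoef _ r); [apply absconv_acoef; unfold r; lra|]. specialize (Hm t Ht). unfold r; lra. }
  rewrite PS_derive_acoef in C1.
  rewrite (CP_mult acoef dcoef _ (Cmod z)) in C1; auto; [|apply absconv_acoef; lra].
  apply is_derive_ray0 in C1. rewrite <- Cmult_assoc in C1. exact C1. }
set (N := fun t => (u t * u t + v t * v t) * exp (2 * M * t)).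
assert (HN : forall t, 0 <= t <= 1 -> is_derive N t ((2 * (u t * u t + v t * v t) * Re (D t) + 2 * M * (u t * u t + v t * v t)) * exp (2 * M * t))).
{ intros t Ht. destruct (Huv t Ht) as [Hu Hv]. unfold N. auto_derive.
  - repeat split; eexists; eauto.
  - rewrite (is_derive_unique _ _ _ Hu : Derive (fun x => u x) t = _), (is_derive_unique _ _ _ Hv : Derive (fun x => v x) t = _). ring. }
destruct (MVT_cor2 N (fun t => (2 * (u t * u t + v t * v t) * Re (D t) + 2 * M * (u t * u t + v t * v t)) * exp (2 * M * t)) 0 1) as [c [E Hc]]; [lra| |].
{ intros t Ht. apply is_derive_Reals. now apply HN. }
assert (E1 : N 1 = 0).
{ unfold N, u, v. rewrite Cmult_1_l, Hzero. simpl. ring. }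
assert (E0 : N 0 = xiR tau * xiR tau).
{ unfold N, u, v. rewrite Cmult_0_l, CP_real, PSeries_acoef by lra. replace (tau / (1 - 0)) with tau by field.
  replace (2 * M * 0) with 0 by ring. rewrite exp_0. simpl. ring. }
assert (P : 0 <= (2 * (u c * u c + v c * v c) * Re (D c) + 2 * M * (u c * u c + v c * v c)) * exp (2 * M * c)).
{ apply Rmult_le_pos; [|apply Rlt_le, exp_pos]. pose proof (HD c ltac:(lra)).
  assert (0 <= u c * u c + v c * v c) by nra. nra. }
pose proof (xiR_pos tau). nra.
Qed.

(** [z = 1 - tau / s] lies in the unit disc exactly when [|s - tau| < |s|], that is, when
    [Re s > tau / 2]; here [Re s >= 1/2] and [tau < 1]. *)
Theorem CP_ecoef_neq_0_right x : 0 <= Re x -> CP ecoef x <> RtoC 0.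
Proof.
intros Hx. set (s := (x + RtoC (/ 2))%C).
assert (Hs : / 2 <= Re s) by (unfold s; unfold Re in *; simpl; lra).
assert (Ns : s <> RtoC 0).
{ intros E. rewrite E in Hs. simpl in Hs. lra. }
assert (Ps : 0 < Cmod s) by (apply (proj1 (Cmod_gt_0 s)); auto).
set (z := (1 - RtoC tau / s)%C).
assert (Hz : Cmod z < 1).
{ replace z with ((s - RtoC tau) / s)%C by (unfold z; field; auto). rewrite Cmod_div by auto.
  apply Rmult_lt_reg_r with (Cmod s); auto. unfold Rdiv. rewrite Rmult_assoc, Rinv_l by lra. rewrite Rmult_1_r, Rmult_1_l.
  apply Rsqr_incrst_0; try apply Cmod_ge_0.
  unfold Rsqr. pose proof (Cmod2_alt (s - RtoC tau)%C) as A1. pose proof (Cmod2_alt s) as A2.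
  assert (R1 : Re (s - RtoC tau)%C = Re s - tau) by reflexivity.
  assert (R2 : Im (s - RtoC tau)%C = Im s) by (unfold Im; simpl; ring). rewrite R1, R2 in A1. nra. }
assert (E := CP_acoef z Hz). unfold xiE in E.
replace (RtoC tau / (1 - z) - RtoC (/ 2))%C with x in E.
- rewrite <- E. now apply CP_acoef_neq_0.
- unfold z. replace (1 - (1 - RtoC tau / s))%C with (RtoC tau / s)%C by ring.
  replace (RtoC tau / (RtoC tau / s))%C with s.
  + unfold s. ring.
  + field. split; auto. intros E0. apply RtoC_inj in E0. lra.
Qed.

End ZeroFree.

Lemma CP_ecoef_even x : CP ecoef (- x) = CP ecoef x.
Proof.
unfold CP. apply CSeries_ext. intros n. destruct (even_odd_nat n) as [k [->| ->]].
- f_equal. rewrite !Cpow_mult_r. f_equal. simpl. ring.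
- rewrite ecoef_odd. ring.
Qed.

Theorem constant_sign_zero_free tau sg n0 : 0 < tau < 1 -> (sg = 1 \/ sg = -1) ->
  (forall n, (n0 <= n)%nat -> 0 < sg * alpha n tau) -> forall x, CP ecoef x <> RtoC 0.
Proof.
intros Ht Hs Hn x. destruct (Rle_dec 0 (Re x)) as [H|H].
- now apply (CP_ecoef_neq_0_right tau Ht sg n0).
- rewrite <- CP_ecoef_even. apply (CP_ecoef_neq_0_right tau Ht sg n0); auto.
  unfold Re in *; simpl. lra.
Qed.

(** * Growth of xi against a weighted circle mean of its logarithm *)

Lemma ln_le_id x : 0 < x -> ln x <= x - 1.
Proof. intros H. pose proof (exp_ineq1_le (ln x)) as E. rewrite exp_ln in E; lra. Qed.

(** The radius [r = k^2 - 3/4] is tuned so that [2 r + 1 + 1/2 = 2 k^2]. Then [Dc (2 r + 1)]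
    contains [kap (k^2) = exp (2 k^2 ln k - k^2)], and [ln k <= k - 1] bounds this by [exp (2 k^3)].
    In terms of [r] the exponent has order [r^(3/2)]. *)
Lemma ecoef_growth : exists c, 0 < c /\ forall k, 2 <= k -> 1 + PSeries ecoef (k * k - 3 / 4) <= exp (c * (k * k * k)).
Proof.
set (A := Series (wt 2)).
assert (HA : 0 <= A) by (apply Series_nonneg; [intros; apply Rlt_le, wt_pos|apply ex_series_wt; lra]).
exists (8 + 8 * A). split; [lra|]. intros k Hk.
set (r := k * k - 3 / 4). assert (Hr : 1 <= r) by (unfold r; nra).
assert (E : PSeries ecoef r = 1 + (r * r - / 4) * PSeries mu r).
{ pose proof (CP_ecoef (RtoC r)) as E. rewrite !CP_real in E.
  apply (f_equal Re) in E. simpl in E. rewrite E. unfold Re. simpl. eqR; field. }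
assert (B1 : PSeries mu r <= 8 * Dc (2 * r + 1)).
{ replace (8 * Dc (2 * r + 1)) with (Series (fun n => 4 * Dc (2 * r + 1) * (/ 2) ^ n)).
  - eapply Rle_trans; [apply Rle_abs|]. apply Series_abs_le.
    + intros n. rewrite Rabs_mult. eapply Rle_trans.
      * apply Rmult_le_compat_r; [apply Rabs_pos|]. apply (mu_bound (2 * r)); lra.
      * rewrite Rabs_pos_eq by (apply pow_le; lra). rewrite Rmult_assoc, <- Rpow_mult_distr.
        replace (/ (2 * r) * r) with (/ 2) by (field; lra). lra.
    + apply ex_series_scalR, ex_series_geom. rewrite Rabs_pos_eq; lra.
  - rewrite Series_scal_l, Series_geom by (rewrite Rabs_pos_eq; lra). field. }
assert (B2 : Dc (2 * r + 1) <= exp (2 * (k * k * k)) * A).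
{ unfold Dc. replace (2 * r + 1 + / 2) with (2 * (k * k)) by (unfold r; field).
  replace (2 * (k * k) / 2) with (k * k) by field.
  apply Rmult_le_compat.
  - apply Rlt_le, exp_pos.
  - apply Series_nonneg; [intros; apply Rlt_le, wt_pos|apply ex_series_wt; nra].
  - unfold kap. apply exp_le. rewrite ln_mult by lra. pose proof (ln_le_id k ltac:(lra)). nra.
  - apply Series_le; [|apply ex_series_wt; lra]. intros n. split; [apply Rlt_le, wt_pos|].
    unfold wt. apply exp_le. assert (0 <= ln (INR (S n))).
    { rewrite <- ln_1. apply ln_le; [lra|]. rewrite S_INR. pose proof (pos_INR n). lra. }
    assert (1 <= k * k) by nra. assert (0 <= (k * k - 1) * ln (INR (S n))) by (apply Rmult_le_pos; lra). lra. }
assert (P : PSeries mu r <= 8 * A * exp (2 * (k * k * k))) by lra.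
set (X := exp (2 * (k * k * k))) in *.
assert (HX : 1 <= X) by (rewrite <- exp_0; apply exp_le; nra).
assert (B3 : (r * r - / 4) * PSeries mu r <= (k * k) * (k * k) * (8 * A * X)).
{ assert (HAX : 0 <= A * X) by (apply Rmult_le_pos; lra).
  assert (Hq : 1 * 1 <= r * r) by (apply Rmult_le_compat; lra).
  apply Rle_trans with ((r * r - / 4) * (8 * A * X)); [apply Rmult_le_compat_l; lra|].
  apply Rmult_le_compat_r; [lra|]. assert (r * r <= (k * k) * (k * k)) by (apply Rmult_le_compat; unfold r in *; lra). lra. }
assert (B4 : (k * k) * (k * k) <= exp (4 * k)).
{ replace (4 * k) with (k + k + (k + k)) by ring. rewrite !exp_plus. pose proof (exp_ineq1_le k).
  assert (k * k <= exp k * exp k) by nra. assert (0 <= k * k) by nra. apply Rmult_le_compat; auto. }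
assert (B5 : 2 + 8 * A <= exp (2 + 8 * A)) by (pose proof (exp_ineq1_le (2 + 8 * A)); lra).
apply Rle_trans with (exp (2 + 8 * A) * exp (4 * k) * X).
- rewrite E. assert (2 * 2 <= k * k) by (apply Rmult_le_compat; lra).
  assert (H1 : 1 * 1 <= (k * k) * (k * k)) by (apply Rmult_le_compat; lra).
  apply Rle_trans with ((2 + 8 * A) * ((k * k) * (k * k)) * X).
  + assert (1 * 1 <= k * k * (k * k) * X) by (apply Rmult_le_compat; lra). lra.
  + apply Rmult_le_compat_r; [lra|]. apply Rmult_le_compat; lra.
- unfold X. rewrite <- !exp_plus. apply exp_le.
  assert (2 * 2 <= k * k) by (apply Rmult_le_compat; lra).
  assert (4 * k <= k * k * k) by nra. nra.
Qed.

(** Joint continuity in radius and angle, as required for differentiation under the integral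
    sign. *)
Lemma ccont_2d f : (forall z, ccont f z) -> forall x y,
  continuity_2d_pt (fun u t => Re (f (RtoC u * cis t)%C)) x y /\
  continuity_2d_pt (fun u t => Im (f (RtoC u * cis t)%C)) x y.
Proof.
intros Hf x y.
assert (K : forall eps : posreal, locally_2d (fun u t => Cmod (f (RtoC u * cis t) - f (RtoC x * cis y))%C < eps) x y).
{ intros eps. destruct (Hf (RtoC x * cis y)%C eps (cond_pos eps)) as [d [Hd H]].
  assert (Hd2 : 0 < d / 2) by lra.
  assert (C1 : continuity_2d_pt (fun u t => u * cos t) x y).
  { apply (continuity_2d_pt_mult (fun u _ => u) (fun _ t => cos t)); [apply continuity_2d_pt_id1|].
    apply (continuity_1d_2d_pt_comp cos (fun _ t => t)); [apply continuity_cos|apply continuity_2d_pt_id2]. }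
  assert (C2 : continuity_2d_pt (fun u t => u * sin t) x y).
  { apply (continuity_2d_pt_mult (fun u _ => u) (fun _ t => sin t)); [apply continuity_2d_pt_id1|].
    apply (continuity_1d_2d_pt_comp sin (fun _ t => t)); [apply continuity_sin|apply continuity_2d_pt_id2]. }
  specialize (C1 (mkposreal _ Hd2)). specialize (C2 (mkposreal _ Hd2)).
  generalize (locally_2d_and _ _ _ _ C1 C2). apply locally_2d_impl. apply locally_2d_forall.
  intros u t [D1 D2]. simpl in D1, D2. specialize (H (RtoC u * cis t - RtoC x * cis y)%C).
  replace (RtoC x * cis y + (RtoC u * cis t - RtoC x * cis y))%C with (RtoC u * cis t)%C in H by ring.
  apply H. eapply Rle_lt_trans; [apply Cmod_le_abs|].
  replace (Re (RtoC u * cis t - RtoC x * cis y)%C) with (u * cos t - x * cos y) by (unfold Re; simpl; ring).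
  replace (Im (RtoC u * cis t - RtoC x * cis y)%C) with (u * sin t - x * sin y) by (unfold Im; simpl; ring).
  lra. }
split; intros eps; generalize (K eps); apply locally_2d_impl; apply locally_2d_forall; intros u t Hs.
- eapply Rle_lt_trans; [|apply Hs]. apply (re_le_Cmod (f (RtoC u * cis t) - f (RtoC x * cis y))%C).
- eapply Rle_lt_trans; [|apply Hs]. apply (im_le_Cmod (f (RtoC u * cis t) - f (RtoC x * cis y))%C).
Qed.

Section Jensen.

Hypothesis Hnz : forall x, CP ecoef x <> RtoC 0.

(** The logarithmic derivative; the absence of zeros makes it entire. *)
Let G (z : C) : C := (CP (PS_derive ecoef) z / CP ecoef z)%C.
(* As [ecoef 1 = 0], the derivative of [CP ecoef] is [z * CP bcoef z]. *)
Definition bcoef (n : nat) : R := INR (S (S n)) * ecoef (S (S n)).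
Let Q1 (z : C) : C := (CP bcoef z / CP ecoef z)%C.

Lemma absconv_PS_derive_ecoef r : 0 <= r -> absconv (PS_derive ecoef) r.
Proof. intros Hr. apply (absconv_derive _ _ (r + 1)); [lra|]. apply absconv_ecoef. lra. Qed.

Lemma absconv_bcoef r : 0 <= r -> absconv bcoef r.
Proof.
intros Hr.
apply (absconv_le _ (r + 1)); [lra|].
apply (ex_series_dom _ (fun n => Rabs (PS_derive ecoef (S n)) * (r + 1) ^ S n)).
- intros n. rewrite Rabs_mult, Rabs_Rabsolu, (Rabs_pos_eq ((r + 1) ^ n)) by (apply pow_le; lra).
  apply Rmult_le_compat_l; [apply Rabs_pos|]. simpl. assert (0 <= (r + 1) ^ n) by (apply pow_le; lra). nra.
- apply (ex_series_incr_1 (fun n => Rabs (PS_derive ecoef n) * (r + 1) ^ n)). apply absconv_PS_derive_ecoef. lra.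
Qed.

Lemma holo_CP a : (forall r, 0 <= r -> absconv a r) -> holo (CP a).
Proof.
intros Ha z. eexists. apply (cdiff_CP a z (Cmod z + 1)); [apply Ha|]; pose proof (Cmod_ge_0 z); lra.
Qed.

Lemma holo_div f g : holo f -> holo g -> (forall z, g z <> RtoC 0) -> holo (fun z => f z / g z)%C.
Proof. intros Hf Hg N z. destruct (Hf z) as [l Hl], (Hg z) as [m Hm]. eexists. apply cdiff_div; eauto. Qed.

Let holo_G : holo G.
Proof. apply holo_div; auto; apply holo_CP; [apply absconv_PS_derive_ecoef|apply absconv_ecoef]. Qed.

Let holo_Q1 : holo Q1.
Proof. apply holo_div; auto; apply holo_CP; [apply absconv_bcoef|apply absconv_ecoef]. Qed.

Let G_Q1 z : G z = (z * Q1 z)%C.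
Proof.
unfold G, Q1. replace (CP (PS_derive ecoef) z) with (z * CP bcoef z)%C; [unfold Cdiv; ring|].
pose proof (Cmod_ge_0 z) as Hz.
assert (H1 := cabs_CP _ z _ (absconv_PS_derive_ecoef _ Hz) (Rle_refl _)).
assert (Hb := cabs_CP _ z _ (absconv_bcoef _ Hz) (Rle_refl _)).
pose proof (CSeries_tail _ 0 H1) as T. rewrite Csum_0 in T.
pose proof (ecoef_odd 0) as E1. simpl in E1.
unfold CP. rewrite <- (CSeries_scal _ _ Hb).
replace (CSeries (fun n => RtoC (PS_derive ecoef n) * z ^ n)%C) with
  (CSeries (fun n => RtoC (PS_derive ecoef n) * z ^ n) - RtoC (PS_derive ecoef 0) * z ^ 0)%C.
- rewrite T. apply CSeries_ext. intros n. unfold bcoef, PS_derive. simpl plus. rewrite !RtoC_mult. simpl. ring.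
- unfold PS_derive at 2. change (ecoef 1) with (ecoef (2 * 0 + 1)). rewrite ecoef_odd, Rmult_0_r. ring.
Qed.

(** [log |xi|] at distance [u] from 1/2, written through the squared modulus to stay smooth, times a
    nonnegative weight that selects the quadratic Taylor coefficient. *)
Definition logdens (u t : R) : R :=
  / 2 * ln (Re (CP ecoef (RtoC u * cis t)%C) * Re (CP ecoef (RtoC u * cis t)%C) +
            Im (CP ecoef (RtoC u * cis t)%C) * Im (CP ecoef (RtoC u * cis t)%C)) * (1 + cos (2 * t)).

Let norm_pos z : 0 < Re (CP ecoef z) * Re (CP ecoef z) + Im (CP ecoef z) * Im (CP ecoef z).
Proof.
pose proof (Cmod2_alt (CP ecoef z)) as E. assert (P := proj1 (Cmod_gt_0 _) (Hnz z)).
unfold Rsqr in E. nra.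
Qed.

Let is_derive_logdens u t : is_derive (fun u => logdens u t) u (Re (cis t * G (RtoC u * cis t))%C * (1 + cos (2 * t))).
Proof.
assert (C1 : cdiff (CP ecoef) (RtoC u * cis t)%C (CP (PS_derive ecoef) (RtoC u * cis t)%C)).
{ apply (cdiff_CP ecoef _ (Cmod (RtoC u * cis t)%C + 1)); [apply absconv_ecoef|]; pose proof (Cmod_ge_0 (RtoC u * cis t)%C); lra. }
apply is_derive_ray0 in C1. destruct C1 as [DU DV].
set (U := fun u => Re (CP ecoef (RtoC u * cis t)%C)) in *. set (V := fun u => Im (CP ecoef (RtoC u * cis t)%C)) in *.
assert (N : 0 < U u * U u + V u * V u) by apply norm_pos.
assert (E : (CP (PS_derive ecoef) (RtoC u * cis t) * cis t)%C = ((cis t * G (RtoC u * cis t)) * CP ecoef (RtoC u * cis t))%C)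
  by (unfold G; field; auto).
rewrite E in DU, DV. set (g := (cis t * G (RtoC u * cis t))%C) in *.
unfold logdens. change (is_derive (fun u => / 2 * ln (U u * U u + V u * V u) * (1 + cos (2 * t))) u (Re g * (1 + cos (2 * t)))).
auto_derive.
- repeat split; try (eexists; eauto). exact N.
- rewrite (is_derive_unique _ _ _ DU : Derive (fun x => U x) u = _), (is_derive_unique _ _ _ DV : Derive (fun x => V x) u = _).
  change (Re (g * CP ecoef (RtoC u * cis t))%C) with (Re g * U u - Im g * V u).
  change (Im (g * CP ecoef (RtoC u * cis t))%C) with (Re g * V u + Im g * U u). field. lra.
Qed.

Let G_cont : forall z, ccont (fun z => G z) z.
Proof. now apply holo_ccont. Qed.

Let logdens_cont u t : continuous (logdens u) t.
Proof.
unfold logdens.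
assert (R : rc (fun t => CP ecoef (RtoC u * cis t)%C)).
{ apply ccont_rc; [intros; apply holo_ccont, holo_CP, absconv_ecoef|apply rc_cis]. }
destruct (R t) as [R1 R2].
apply (continuous_mult (K := R_AbsRing)); [apply (continuous_mult (K := R_AbsRing)); [apply continuous_const|]|].
- apply (continuous_comp _ ln).
  + apply (continuous_plus (V := R_NormedModule)); now apply (continuous_mult (K := R_AbsRing)).
  + apply (ex_derive_continuous ln). eexists. apply is_derive_Reals, derivable_pt_lim_ln, norm_pos.
- apply (ex_derive_continuous (fun t => 1 + cos (2 * t))). auto_derive; auto.
Qed.

Definition circle_mean (u : R) : R := RInt (logdens u) 0 (2 * PI).

Let is_derive_circle_mean u : is_derive circle_mean u (RInt (fun t => Re (cis t * G (RtoC u * cis t))%C * (1 + cos (2 * t))) 0 (2 * PI)).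
Proof.
unfold circle_mean.
replace (RInt (fun t => Re (cis t * G (RtoC u * cis t))%C * (1 + cos (2 * t))) 0 (2 * PI)) with
  (RInt (fun t => Derive (fun u => logdens u t) u) 0 (2 * PI)).
- apply (is_derive_RInt_param logdens 0 (2 * PI) u).
  + apply filter_forall. intros v t _. eexists. apply is_derive_logdens.
  + intros t _.
    apply (continuity_2d_pt_ext (fun u t => (cos t * Re (G (RtoC u * cis t)%C) - sin t * Im (G (RtoC u * cis t)%C)) * (1 + cos (2 * t)))).
    * intros v s. symmetry. apply is_derive_unique, is_derive_logdens.
    * destruct (ccont_2d G G_cont u t) as [K1 K2].
      apply (continuity_2d_pt_mult (fun u t => cos t * Re (G (RtoC u * cis t)%C) - sin t * Im (G (RtoC u * cis t)%C)) (fun _ t => 1 + cos (2 * t))).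
      -- apply (continuity_2d_pt_minus (fun u t => cos t * Re (G (RtoC u * cis t)%C)) (fun u t => sin t * Im (G (RtoC u * cis t)%C))).
         ++ apply (continuity_2d_pt_mult (fun _ t => cos t)); auto.
            apply (continuity_1d_2d_pt_comp cos (fun _ t => t)); [apply continuity_cos|apply continuity_2d_pt_id2].
         ++ apply (continuity_2d_pt_mult (fun _ t => sin t)); auto.
            apply (continuity_1d_2d_pt_comp sin (fun _ t => t)); [apply continuity_sin|apply continuity_2d_pt_id2].
      -- apply (continuity_1d_2d_pt_comp (fun t => 1 + cos (2 * t)) (fun _ t => t)); [|apply continuity_2d_pt_id2].
         apply derivable_continuous_pt. apply ex_derive_Reals_0. auto_derive; auto.
  + apply filter_forall. intros v. apply (ex_RInt_continuous (V := R_CompleteNormedModule)). intros; apply logdens_cont.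
- apply RInt_ext. intros t _. apply is_derive_unique, is_derive_logdens.
Qed.

Let q : R := 2 * ecoef 2 / ecoef 0.

Let Q1_0 : Q1 0 = RtoC q.
Proof.
unfold Q1. rewrite !CP_real, <- RtoC_div.
- f_equal. rewrite !PSeries_0. reflexivity.
- rewrite PSeries_0. pose proof ecoef_0_pos; lra.
Qed.

(* On the circle [|z| = u], [Re (cis t * G) * (1 + cos (2 t))] is the real part of the
   holomorphic function [K], and [2 PI * Re (K 0) = PI * q * u]. *)
Let circle_mean_derive u : 0 < u -> is_derive circle_mean u (PI * q * u).
Proof.
intros Hu. pose proof (is_derive_circle_mean u) as D.
replace (PI * q * u) with (RInt (fun t => Re (cis t * G (RtoC u * cis t))%C * (1 + cos (2 * t))) 0 (2 * PI)); auto.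
(* With [w = cis t] and [z = u w], the weight is [1 + (w^2 + w^(-2)) / 2] and
   [w * G z = z^2 Q1 z / u]. Substituting [w^2 = z^2 / u^2] gives the three terms; the last one,
   [u / 2], comes from [w^(-2)] and is the only one that survives at the centre. *)
set (K := fun z => (Q1 z * (RtoC (/ u) * (z * z) + (RtoC (/ (2 * u * u * u)) * (z * z) * (z * z) + RtoC (u / 2))))%C).
assert (HK : holo K).
{ unfold K. apply holo_mult; auto. repeat first [apply holo_plus | apply holo_mult | apply holo_const | apply holo_id]. }
assert (M := mean_value K u HK Hu).
apply (f_equal Re) in M. change (RInt (fun t => Re (K (RtoC u * cis t)%C)) 0 (2 * PI) = Re (RtoC (2 * PI) * K 0)%C) in M.
transitivity (RInt (fun t => Re (K (RtoC u * cis t)%C)) 0 (2 * PI)).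
- apply RInt_ext. intros t _. rewrite G_Q1. unfold K. set (Z := Q1 (RtoC u * cis t)%C).
  assert (Ew : (cis t * cis t)%C = (cos (2 * t), sin (2 * t))).
  { unfold cis. apply injective_projections; simpl; [rewrite cos_2a|rewrite sin_2a]; ring. }
  pose proof (sin2_cos2 (2 * t)) as SC. unfold Rsqr in SC.
  set (a := cos (2 * t)) in *. set (b := sin (2 * t)) in *.
  assert (Ez : (cis t * (RtoC u * cis t * Z))%C = (RtoC u * (a, b) * Z)%C) by (rewrite <- Ew; ring).
  assert (Em : (RtoC (/ u) * (RtoC u * cis t * (RtoC u * cis t)) + (RtoC (/ (2 * u * u * u)) * (RtoC u * cis t * (RtoC u * cis t)) * (RtoC u * cis t * (RtoC u * cis t)) + RtoC (u / 2)))%C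
     = (RtoC (u * (1 + a)) * (a, b))%C).
  { replace (RtoC u * cis t * (RtoC u * cis t))%C with (RtoC (u * u) * (a, b))%C by (rewrite <- Ew, RtoC_mult; ring).
    apply injective_projections; simpl.
    - replace (b * b) with (1 - a * a) by lra. field_simplify; [|lra..]. replace (b ^ 2) with (1 - a * a) by (simpl; lra). field.
    - field. lra. }
  rewrite Ez, Em. unfold Re. simpl. ring.
- rewrite M. unfold K. rewrite Q1_0. unfold Re. simpl. field. lra.
Qed.

Theorem entire_zero_free_absurd : False.
Proof.
destruct ecoef_growth as [c [Hc Hg]]. pose proof PI_RGT_0 as Hpi.
assert (Hq : 0 < q).
{ unfold q. pose proof ecoef_0_pos. pose proof ecoef_2_pos. apply Rdiv_lt_0_compat; lra. }
(* Integrated from radius 1, because the radial derivative was computed for positive radii. *)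
assert (E : forall r, 1 < r -> circle_mean r = circle_mean 1 + PI * q * (r * r - 1) / 2).
{ intros r Hr. set (F := fun u => circle_mean u - PI * q * (u * u) / 2).
  destruct (MVT_cor2 F (fun _ => 0) 1 r Hr) as [d [Hd _]].
  - intros u Hu. apply is_derive_Reals. unfold F.
    pose proof (circle_mean_derive u ltac:(lra)) as D. auto_derive; [eexists; eauto|].
    rewrite (is_derive_unique _ _ _ D : Derive (fun x => circle_mean x) u = _). field.
  - unfold F in Hd. lra. }
(* The weight lies between 0 and 2, so an upper bound for [log |xi|] on the circle is enough. *)
assert (U : forall k, 2 <= k -> circle_mean (k * k - 3 / 4) <= 2 * c * (k * k * k) * (2 * PI - 0)).
{ intros k Hk. unfold circle_mean. set (r := k * k - 3 / 4). assert (Hr : 0 <= r) by (unfold r; nra).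
  apply RInt_le_const; [lra| |].
  { apply (ex_RInt_continuous (V := R_CompleteNormedModule)). intros; apply logdens_cont. }
  intros t _. unfold logdens. set (z := (RtoC r * cis t)%C).
  assert (Ez : Cmod z = r) by (unfold z; rewrite Cmod_mult, Cmod_cis, Cmod_R, Rabs_pos_eq by lra; ring).
  assert (B : Cmod (CP ecoef z) <= PSeries ecoef r).
  { apply Cmod_CSeries_le; [|apply ex_series_ecoef]. intros n. rewrite Cmod_term, Ez, Rabs_pos_eq by apply ecoef_nonneg. lra. }
  specialize (Hg k Hk). fold r in Hg. pose proof (PSeries_ecoef_ge r). pose proof ecoef_0_pos.
  assert (L : ln (Re (CP ecoef z) * Re (CP ecoef z) + Im (CP ecoef z) * Im (CP ecoef z)) <= 2 * (c * (k * k * k))).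
  { rewrite <- (ln_exp (2 * (c * (k * k * k)))). apply ln_le; [apply norm_pos|].
    pose proof (Cmod2_alt (CP ecoef z)) as M. pose proof (Cmod_ge_0 (CP ecoef z)).
    replace (2 * (c * (k * k * k))) with (c * (k * k * k) + c * (k * k * k)) by ring. rewrite exp_plus.
    apply Rle_trans with (Cmod (CP ecoef z) * Cmod (CP ecoef z)); [apply Req_le; transitivity (Re (CP ecoef z) ^ 2 + Im (CP ecoef z) ^ 2); [ring|rewrite <- M; ring]|].
    apply Rmult_le_compat; lra. }
  pose proof (COS_bound (2 * t)). assert (0 <= k * k * k) by (repeat apply Rmult_le_pos; lra).
  assert (0 <= c * (k * k * k)) by (apply Rmult_le_pos; lra).
  apply Rle_trans with (c * (k * k * k) * (1 + cos (2 * t))).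
  - apply Rmult_le_compat_r; lra.
  - replace (2 * c * (k * k * k)) with (c * (k * k * k) * 2) by ring. apply Rmult_le_compat_l; lra. }
set (m := Rabs (circle_mean 1)).
(* At [r = k^2 - 3/4] the mean grows like [k^4] while its bound grows like [k^3]; [B] collects the
   coefficients of the smaller terms, and this [k] makes the quartic term exceed them. *)
set (B := 4 * PI * c + m + PI * q). set (k := 2 + 8 * B / (PI * q)).
assert (Hpq : 0 < PI * q) by (apply Rmult_lt_0_compat; auto).
assert (Hm : 0 <= m) by apply Rabs_pos.
assert (HB : 0 < B) by (unfold B; pose proof (Rmult_lt_0_compat _ _ Hpi Hc); lra).
assert (HBq : 0 < 8 * B / (PI * q)) by (apply Rdiv_lt_0_compat; lra).
assert (Hk : 2 <= k) by (unfold k; lra).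
assert (Hkk : PI * q * k = 2 * (PI * q) + 8 * B) by (unfold k; field; split; lra).
assert (Hk2 : 2 * 2 <= k * k) by (apply Rmult_le_compat; lra).
pose proof (U k Hk) as U1. rewrite E in U1 by lra.
assert (Hm1 : - m <= circle_mean 1) by (unfold m, Rabs; destruct Rcase_abs; lra).
set (K3 := k * k * k) in *. assert (HK3 : 2 * 2 * 2 <= K3) by (unfold K3; apply Rmult_le_compat; lra).
assert (Hsq : k * k * (k * k) / 4 <= (k * k - 3 / 4) * (k * k - 3 / 4)).
{ assert (k * k / 2 * (k * k / 2) <= (k * k - 3 / 4) * (k * k - 3 / 4)) by (apply Rmult_le_compat; lra). lra. }
assert (H4 : PI * q * (k * k * (k * k)) = (2 * (PI * q) + 8 * B) * K3) by (rewrite <- Hkk; unfold K3; ring).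
assert (H5 : PI * q * (k * k * (k * k) / 4) <= PI * q * ((k * k - 3 / 4) * (k * k - 3 / 4))) by (apply Rmult_le_compat_l; lra).
assert (H6 : B * 8 <= B * K3) by (apply Rmult_le_compat_l; lra).
assert (H7 : 0 <= PI * q * K3) by (apply Rmult_le_pos; lra).
assert (H8 : 4 * PI * c * K3 + m + PI * q <= B * K3).
{ unfold B. assert (m * 1 <= m * K3) by (apply Rmult_le_compat_l; lra).
  assert (PI * q * 1 <= PI * q * K3) by (apply Rmult_le_compat_l; lra). lra. }
lra.
Qed.

End Jensen.

Theorem theorem2 :
  (forall n : nat, (1 <= n)%nat ->
     alpha n 0 = INR n * (Derive xiR 0 / xiR 0) /\ alpha n 0 < 0) /\
  (exists a : nat -> R,
     a 1%nat = 1 / 2 /\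
     (forall n : nat, (1 <= n)%nat -> a (S n) < a n) /\
     (forall n : nat, (1 <= n)%nat ->
        0 <= a n < 2 /\
        alpha n (a n) = 0 /\
        (forall tau : R, 0 <= tau < a n -> alpha n tau < 0))) /\
  (forall n : nat, (1 <= n)%nat ->
     forall x y : R, 0 <= x -> x < y -> y < 2 ->
       alpha n x = 0 -> alpha n y = 0 ->
       exists z : R, x < z < y /\ alpha (S n) z = 0) /\
  (forall N : nat, (1 <= N)%nat ->
     exists n0 : nat, (1 <= n0)%nat /\
       forall n : nat, (n0 < n)%nat ->
         exists l : list R,
           NoDup l /\ length l = N /\
           (forall x : R, In x l -> 0 < x < 2 /\ alpha n x = 0)).
Proof.
repeat split.
- now apply alpha_0.
- now apply alpha_0_neg.
- exists azero. split; [apply azero_1|split; [apply azero_decr|]].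
  intros n Hn. destruct (azero_spec n Hn) as [H1 [H2 H3]]. repeat split; auto; lra.
- intros n Hn x y Hx Hxy _ Ex Ey. apply rolle_alpha; auto.
- intros N HN.
  (* The number of zeros in [(0, 1]] never decreases with [n], so either it reaches [N] once and for
     all or it stays below [N] for every [n]. *)
  destruct (classic (exists n, (1 <= n)%nat /\ has_zeros n N 1)) as [[n0 [Hn0 Hz]]|H].
  + exists n0. split; auto. intros n Hn. apply has_zeros_list. apply (has_zeros_le n0); auto. lia.
  + exfalso. destruct (bounded_zeros_constant_sign N) as [tau [n0 [sg [Ht [Hs [_ Hn]]]]]].
    * intros n Hn Hz. apply H. now exists n.
    * apply entire_zero_free_absurd. apply (constant_sign_zero_free tau sg n0); auto.
Qed.
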